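(* Let $1 \leq p < \infty$, let $\phi$ be analytic on the open unit disk $\mathbb{D}$ and let $\varphi$ be an analytic self-map of $\mathbb{D}$. If the weighted composition operator $W_{\phi,\varphi}\colon S^p \to S^p$ is bounded but not compact, then $W_{\phi,\varphi}$ fixes an isomorphic copy of $\ell^p$ in $S^p$. In particular, $W_{\phi,\varphi}$ is not strictly singular; that is, for a bounded operator $W_{\phi,\varphi}$ on $S^p$, strict singularity coincides with compactness.
   Context: $\mathbb{D}$ is the open unit disk, $m$ the normalized Lebesgue measure on $\partial\mathbb{D}$. For $0<p<\infty$, the Hardy space $H^p$ consists of analytic $f$ on $\mathbb{D}$ with $\|f\|_{H^p}=\sup_{0\le r<1}\left(\int_{\partial\mathbb{D}}|f(r\xi)|^p\,dm(\xi)\right)^{1/p}<\infty$; $H^\infty$ is the space of bounded analytic functions with the sup norm. The derivative Hardy space is $S^p=\{f \text{ analytic on } \mathbb{D}: \|f\|_{S^p}:=|f(0)|+\|f'\|_{H^p}<\infty\}$. The weighted composition operator is $W_{\phi,\varphi}f(z)=\phi(z)f(\varphi(z))$. A bounded operator $T\colon X\to Y$ between Banach spaces fixes a copy of a Banach space $E$ if there is a closed subspace $M\subset X$ linearly isomorphic to $E$ such that $T|_M$ is an isomorphism from $M$ onto $T(M)$. $T$ is strictly singular if its restriction to any infinite-dimensional closed subspace is not an isomorphism onto its image. *)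

(* Defs.v *)
From Stdlib Require Import Reals.
From Coquelicot Require Import Coquelicot.
Open Scope R_scope.

Definition inD (z : C) : Prop := Cmod z < 1.

Definition rpow (x p : R) : R :=
  if Req_EM_T x 0 then 0 else Rpower x p.

Definition analytic_on_D (f : C -> C) : Prop :=
  forall z : C, inD z -> @ex_derive C_AbsRing C_NormedModule f z.

Definition deriv (f : C -> C) : C -> C := C_derive f.

Definition circ (r th : R) : C := (r * cos th, r * sin th).

Definition Mp (p : R) (f : C -> C) (r : R) : R :=
  / (2 * PI) * RInt (fun th => rpow (Cmod (f (circ r th))) p) 0 (2 * PI).

Definition in_Hp (p : R) (f : C -> C) : Prop :=
  analytic_on_D f /\
  exists M : R, forall r : R, 0 <= r < 1 -> Mp p f r <= M.

Definition Hp_norm (p : R) (f : C -> C) : R :=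
  real (Lub_Rbar (fun y => exists r : R, 0 <= r < 1 /\ y = rpow (Mp p f r) (/ p))).

Definition in_Sp (p : R) (f : C -> C) : Prop :=
  analytic_on_D f /\ in_Hp p (deriv f).

Definition Sp_norm (p : R) (f : C -> C) : R :=
  Cmod (f 0) + Hp_norm p (deriv f).

Definition W (phi vphi : C -> C) (f : C -> C) : C -> C :=
  fun z => (phi z * f (vphi z))%C.

Definition analytic_selfmap (vphi : C -> C) : Prop :=
  analytic_on_D vphi /\ forall z, inD z -> inD (vphi z).

Definition bounded_on_Sp (p : R) (T : (C -> C) -> (C -> C)) : Prop :=
  (forall f, in_Sp p f -> in_Sp p (T f)) /\
  exists K : R, forall f, in_Sp p f -> Sp_norm p (T f) <= K * Sp_norm p f.

Definition compact_on_Sp (p : R) (T : (C -> C) -> (C -> C)) : Prop :=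
  forall f : nat -> C -> C,
    (forall n, in_Sp p (f n)) ->
    (exists B : R, forall n, Sp_norm p (f n) <= B) ->
    exists (sg : nat -> nat) (g : C -> C),
      (forall n, (sg n < sg (S n))%nat) /\ in_Sp p g /\
      is_lim_seq (fun n => Sp_norm p (fun z => (T (f (sg n)) z - g z)%C)) 0.

Definition in_lp (p : R) (x : nat -> C) : Prop :=
  ex_series (fun n => rpow (Cmod (x n)) p).

Definition lp_norm (p : R) (x : nat -> C) : R :=
  rpow (Series (fun n => rpow (Cmod (x n)) p)) (/ p).

(* T fixes a copy of l^p in S^p: there is a linear isomorphic embedding
   E : l^p -> S^p (onto the closed subspace M = E(l^p)) such that T
   restricted to M is an isomorphism onto T(M), i.e. T o E is bounded below. *)
Definition fixes_lp_copy (p : R) (T : (C -> C) -> (C -> C)) : Prop :=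
  exists (E : (nat -> C) -> (C -> C)) (c1 c2 d : R),
    0 < c1 /\ 0 < d /\
    (forall x, in_lp p x -> in_Sp p (E x)) /\
    (forall (a : C) x y, in_lp p x -> in_lp p y ->
       forall z, inD z ->
         E (fun n => (a * x n + y n)%C) z = (a * E x z + E y z)%C) /\
    (forall x, in_lp p x ->
       c1 * lp_norm p x <= Sp_norm p (E x) <= c2 * lp_norm p x) /\
    (forall x, in_lp p x -> d * lp_norm p x <= Sp_norm p (T (E x))).

Definition closed_inf_dim_subspace (p : R) (M : (C -> C) -> Prop) : Prop :=
  (forall f, M f -> in_Sp p f) /\
  M (fun _ => 0%C) /\
  (forall (a : C) f g, M f -> M g -> M (fun z => (a * f z + g z)%C)) /\
  (forall (g : nat -> C -> C) h, (forall n, M (g n)) -> in_Sp p h ->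
     is_lim_seq (fun n => Sp_norm p (fun z => (g n z - h z)%C)) 0 -> M h) /\
  (exists e : nat -> C -> C, (forall n, M (e n)) /\
     forall (n : nat) (a : nat -> C),
       (forall z, inD z -> @sum_n C_AbelianMonoid (fun i => (a i * e i z)%C) n = RtoC 0) ->
       forall i, (i <= n)%nat -> a i = 0%C).

(* T is strictly singular: no restriction of T to an infinite-dimensional
   closed subspace is an isomorphism onto its image (= bounded below) *)
Definition strictly_singular_on_Sp (p : R) (T : (C -> C) -> (C -> C)) : Prop :=
  forall M, closed_inf_dim_subspace p M ->
    ~ (exists d : R, 0 < d /\ forall f, M f -> d * Sp_norm p f <= Sp_norm p (T f)).

(* Main.v *)
Require Import Defs.
From Stdlib Require Import Reals.
From Coquelicot Require Import Coquelicot.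
From Stdlib Require Import Lra Lia Classical ClassicalEpsilon FunctionalExtensionality.
Open Scope R_scope.

(* Write u = phi vphi', so that (W f)' = phi' f(vphi) + u f'(vphi). The test functions
   f_a(z) = (1-|a|^2)^(2-1/p) z / (1 - conj a z) are bounded in S^p, and |f_a'|^p is the
   kernel (1-|a|^2)^(2p-1) / |1 - conj a z|^(2p). The term phi' f(vphi) is always compact
   (uniform integrability of phi'). If the integrals of |u|^p |f_a'(vphi)|^p tend to 0 as |a| -> 1,
   then the pull-back measure is vanishing Carleson and W is compact. So for W non-compact there
   are points a_n -> zeta, |zeta| = 1, with ||W f_{a_n}|| bounded below. The mass of (W f_{a_n})'
   leaves every set |vphi - zeta| >= delta as n grows, while for fixed n the set
   |vphi - zeta| < delta carries little mass when delta is small. A subsequence therefore consists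
   of almost disjoint humps, both before and after applying W, and x |-> sum x_k f_{a_{n_k}}
   embeds l^p isomorphically with W bounded below on its range. All estimates are made on circles
   of radius r < 1, uniformly in r, which avoids boundary values; the cutoffs are continuous
   functions of |vphi - zeta|, and |x+y|^p <= 2^p (|x|^p + |y|^p) replaces Minkowski's inequality. *)

(** * Real powers, continuity and circle averages *)

(** The exponent 2 - 1/p is forced: it turns |f_a'|^p into a kernel whose circle means stay bounded,
    while f_a itself tends to 0 on compact sets as |a| -> 1. The argument uses neither factorization
    nor boundary functions; everything rests on the subharmonicity of |f|^q. It puts |f|^(p/2) below
    a kernel integral in L^2, and the Carleson embedding becomes a T T-star argument driven by the
    quasi-metric |1 - conj z w|. The kernel there has exponent 2 + 2p instead of 2p, because the
    Poisson kernel gets multiplied by the (p/2)-th power of a fourth power. Uniform integrability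
    stands in for the boundary function: no mass of |g|^p concentrates on small sets as r -> 1.
    Doing without Minkowski costs a factor 2^p per summand, hence about 2^(kp) at the k-th one, so
    the humps must be separated at a geometric rate. The lower bound for W f_a holds only for radii
    beyond one that depends on a; the lower l^p estimate is therefore proved for finitely many humps
    at a time. *)

Lemma rpow_pos x p : 0 < x -> rpow x p = Rpower x p.
Proof. intros H; unfold rpow; destruct (Req_EM_T x 0); lra. Qed.

Lemma rpow_0 p : rpow 0 p = 0.
Proof. unfold rpow; destruct (Req_EM_T 0 0); lra. Qed.

Lemma Rpower_gt0 x p : 0 < Rpower x p.
Proof. apply exp_pos. Qed.

Lemma rpow_ge0 x p : 0 <= rpow x p.
Proof.
  unfold rpow; destruct (Req_EM_T x 0); [lra|]. left; apply Rpower_gt0.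
Qed.

Lemma rpow_gt0 x p : 0 < x -> 0 < rpow x p.
Proof. intros H; rewrite rpow_pos by lra. apply Rpower_gt0. Qed.

Lemma rpow_1 p : rpow 1 p = 1.
Proof. rewrite rpow_pos by lra. unfold Rpower. rewrite ln_1, Rmult_0_r. apply exp_0. Qed.

Lemma rpow_le x y p : 0 <= p -> 0 <= x <= y -> rpow x p <= rpow y p.
Proof.
  intros Hp [Hx Hxy]. destruct (Req_dec x 0) as [->|Hx0].
  - rewrite rpow_0; apply rpow_ge0.
  - rewrite !rpow_pos by lra. apply Rle_Rpower_l; lra.
Qed.

Lemma rpow_lt x y p : 0 < p -> 0 <= x < y -> rpow x p < rpow y p.
Proof.
  intros Hp [Hx Hxy]. destruct (Req_dec x 0) as [->|Hx0].
  - rewrite rpow_0; apply rpow_gt0; lra.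
  - rewrite !rpow_pos by lra. apply Rlt_Rpower_l; lra.
Qed.

Lemma rpow_mult x y p : 0 <= x -> 0 <= y -> rpow (x * y) p = rpow x p * rpow y p.
Proof.
  intros Hx Hy. destruct (Req_dec x 0) as [->|Hx0].
  - rewrite Rmult_0_l, rpow_0; ring.
  - destruct (Req_dec y 0) as [->|Hy0].
    + rewrite Rmult_0_r, rpow_0; ring.
    + rewrite !rpow_pos by nra. symmetry; apply Rpower_mult_distr; lra.
Qed.

Lemma rpow_rpow x p q : 0 <= x -> rpow (rpow x p) q = rpow x (p * q).
Proof.
  intros Hx. destruct (Req_dec x 0) as [->|Hx0].
  - now rewrite !rpow_0.
  - rewrite (rpow_pos x) by lra. rewrite !rpow_pos by (try apply Rpower_gt0; lra).
    apply Rpower_mult.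
Qed.

Lemma rpow_exp1 x : 0 <= x -> rpow x 1 = x.
Proof.
  intros Hx. destruct (Req_dec x 0) as [->|Hx0].
  - apply rpow_0.
  - rewrite rpow_pos by lra. apply Rpower_1; lra.
Qed.

Lemma rpow_inv_l x p : 0 < p -> 0 <= x -> rpow (rpow x p) (/ p) = x.
Proof. intros Hp Hx. rewrite rpow_rpow, Rinv_r, rpow_exp1; lra. Qed.

Lemma rpow_inv_r x p : 0 < p -> 0 <= x -> rpow (rpow x (/ p)) p = x.
Proof. intros Hp Hx. rewrite rpow_rpow, Rinv_l, rpow_exp1; lra. Qed.

Lemma rpow_2 x : 0 <= x -> rpow x 2 = x ^ 2.
Proof.
  intros Hx. destruct (Req_dec x 0) as [->|Hx0].
  - rewrite rpow_0; ring.
  - rewrite rpow_pos by lra. replace 2 with (INR 2) by (simpl; lra). apply Rpower_pow; lra.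
Qed.

Lemma rpow_plus_exp x a b : 0 <= x -> rpow x (a + b) = rpow x a * rpow x b.
Proof.
  intros Hx. destruct (Req_dec x 0) as [->|Hx0].
  - rewrite !rpow_0; ring.
  - rewrite !rpow_pos by lra. apply Rpower_plus.
Qed.

(** Turns p-th means into squares, so that L^2 arguments apply to |f|^(p/2) for every p. *)
Lemma rpow_half_sqr x p : 0 <= x -> (rpow x (p / 2)) ^ 2 = rpow x p.
Proof.
  intros Hx. replace p with (p / 2 + p / 2) at 2 by lra.
  rewrite rpow_plus_exp by lra; ring.
Qed.

Lemma rpow_ge1 x p : 0 <= p -> 1 <= x -> 1 <= rpow x p.
Proof. intros. rewrite <- (rpow_1 p). apply rpow_le; lra. Qed.

Lemma rpow_le1 x p : 0 <= p -> 0 <= x <= 1 -> rpow x p <= 1.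
Proof. intros. rewrite <- (rpow_1 p). apply rpow_le; lra. Qed.

Lemma rpow_anti_exp x a b : 0 <= x <= 1 -> a <= b -> rpow x b <= rpow x a.
Proof.
  intros Hx Hab. replace b with (a + (b - a)) by ring.
  rewrite rpow_plus_exp by lra.
  pose proof (rpow_le1 x (b - a) ltac:(lra) Hx). pose proof (rpow_ge0 x a). nra.
Qed.

Lemma rpow_mono_exp x a b : 1 <= x -> a <= b -> rpow x a <= rpow x b.
Proof.
  intros Hx Hab. replace b with (a + (b - a)) by ring.
  rewrite rpow_plus_exp by lra.
  pose proof (rpow_ge1 x (b - a) ltac:(lra) Hx). pose proof (rpow_ge0 x a). nra.
Qed.

Lemma rpow_add_le x y p : 0 <= p -> 0 <= x -> 0 <= y ->
  rpow (x + y) p <= rpow 2 p * (rpow x p + rpow y p).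
Proof.
  intros Hp Hx Hy.
  pose proof (rpow_ge0 x p). pose proof (rpow_ge0 y p). pose proof (rpow_ge0 2 p).
  destruct (Rle_dec x y).
  - apply Rle_trans with (rpow (2 * y) p). { apply rpow_le; lra. }
    rewrite rpow_mult by lra. nra.
  - apply Rle_trans with (rpow (2 * x) p). { apply rpow_le; lra. }
    rewrite rpow_mult by lra. nra.
Qed.

Lemma le_1_rpow x p : 1 <= p -> 0 <= x -> x <= 1 + rpow x p.
Proof.
  intros Hp Hx. pose proof (rpow_ge0 x p). destruct (Rle_dec x 1); [lra|].
  pose proof (rpow_mono_exp x 1 p ltac:(lra) Hp). rewrite rpow_exp1 in H0; lra.
Qed.

(* At 0 only continuity along nonnegative values holds, since Rpower takes the junk value 1 on
   negative bases. *)
Lemma continuous_rpow_comp {T : UniformSpace} (F : T -> R) p x :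
  0 < p -> (forall y, 0 <= F y) -> continuous F x -> continuous (fun y => rpow (F y) p) x.
Proof.
  intros Hp Hpos HF. destruct (Req_dec (F x) 0) as [H0|H0].
  - apply filterlim_locally. intros eps. rewrite H0, rpow_0.
    assert (He : 0 < rpow eps (/ p)) by (apply rpow_gt0, cond_pos).
    assert (HF' := proj1 (filterlim_locally F (F x)) HF (mkposreal _ He)).
    revert HF'. apply filter_imp. intros y Hy.
    change (Rabs (F y - F x) < rpow eps (/ p)) in Hy. change (Rabs (rpow (F y) p - 0) < eps).
    rewrite H0, Rminus_0_r, Rabs_pos_eq in Hy by apply Hpos.
    rewrite Rminus_0_r, Rabs_pos_eq by apply rpow_ge0.
    rewrite <- (rpow_inv_r eps p) by (try left; try apply cond_pos; lra).
    apply rpow_lt; auto.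
  - assert (Hx : 0 < F x) by (specialize (Hpos x); lra).
    apply continuous_ext_loc with (fun y => exp (p * ln (F y))).
    + assert (HF' := proj1 (filterlim_locally F (F x)) HF (mkposreal _ Hx)).
      revert HF'. apply filter_imp. intros y Hy.
      change (Rabs (F y - F x) < F x) in Hy. apply Rabs_def2 in Hy.
      rewrite rpow_pos by lra. reflexivity.
    + apply (continuous_comp (fun y => p * ln (F y)) exp).
      * apply (continuous_mult (fun _ => p) (fun y => ln (F y))). apply continuous_const.
        apply (continuous_comp F ln); auto. apply continuous_ln; auto.
      * apply continuous_exp.
Qed.

(** * Continuity of real-valued functions *)

Lemma ct_plus {T : UniformSpace} (F G : T -> R) x :
  continuous F x -> continuous G x -> continuous (fun t => F t + G t) x.
Proof. apply (continuous_plus F G). Qed.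
Lemma ct_opp {T : UniformSpace} (F : T -> R) x : continuous F x -> continuous (fun t => - F t) x.
Proof. apply (continuous_opp F). Qed.
Lemma ct_minus {T : UniformSpace} (F G : T -> R) x :
  continuous F x -> continuous G x -> continuous (fun t => F t - G t) x.
Proof. apply (continuous_minus F G). Qed.
Lemma ct_mult {T : UniformSpace} (F G : T -> R) x :
  continuous F x -> continuous G x -> continuous (fun t => F t * G t) x.
Proof. apply (continuous_mult F G). Qed.
Lemma ct_pow {T : UniformSpace} (F : T -> R) n x : continuous F x -> continuous (fun t => F t ^ n) x.
Proof.
  intros H; induction n; simpl. apply continuous_const. apply ct_mult; auto.
Qed.
Lemma ct_inv {T : UniformSpace} (F : T -> R) x : continuous F x -> F x <> 0 -> continuous (fun t => / F t) x.
Proof. intros H Hn. apply (continuous_comp F Rinv); auto. apply continuous_Rinv; auto. Qed.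

Definition Cts {T : UniformSpace} (F : T -> R) := forall x, continuous F x.

Lemma Cts_const {T : UniformSpace} (c : R) : Cts (fun _ : T => c).
Proof. intros x; apply continuous_const. Qed.
Lemma Cts_plus {T : UniformSpace} (F G : T -> R) : Cts F -> Cts G -> Cts (fun x => F x + G x).
Proof. intros HF HG x; apply (continuous_plus F G); auto. Qed.
Lemma Cts_opp {T : UniformSpace} (F : T -> R) : Cts F -> Cts (fun x => - F x).
Proof. intros HF x; apply (continuous_opp F); auto. Qed.
Lemma Cts_minus {T : UniformSpace} (F G : T -> R) : Cts F -> Cts G -> Cts (fun x => F x - G x).
Proof. intros HF HG x; apply (continuous_minus F G); auto. Qed.
Lemma Cts_mult {T : UniformSpace} (F G : T -> R) : Cts F -> Cts G -> Cts (fun x => F x * G x).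
Proof. intros HF HG x; apply (continuous_mult F G); auto. Qed.
Lemma Cts_pow {T : UniformSpace} (F : T -> R) n : Cts F -> Cts (fun x => F x ^ n).
Proof.
  intros HF; induction n; simpl. apply Cts_const. apply Cts_mult; auto.
Qed.
Lemma Cts_inv {T : UniformSpace} (F : T -> R) : Cts F -> (forall x, F x <> 0) -> Cts (fun x => / F x).
Proof.
  intros HF Hn x. apply (continuous_comp F Rinv); auto. apply continuous_Rinv; auto.
Qed.
Lemma Cts_div {T : UniformSpace} (F G : T -> R) :
  Cts F -> Cts G -> (forall x, G x <> 0) -> Cts (fun x => F x / G x).
Proof. intros. apply Cts_mult; auto. apply Cts_inv; auto. Qed.
Lemma Cts_comp {T U : UniformSpace} (G : T -> U) (F : U -> R) :
  Cts F -> (forall x, continuous G x) -> Cts (fun x => F (G x)).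
Proof. intros HF HG x. apply (continuous_comp G F); auto. Qed.
Lemma Cts_rpow {T : UniformSpace} (F : T -> R) p :
  0 < p -> (forall x, 0 <= F x) -> Cts F -> Cts (fun x => rpow (F x) p).
Proof. intros Hp H0 HF x. apply continuous_rpow_comp; auto. Qed.
Lemma Cts_abs {T : UniformSpace} (F : T -> R) : Cts F -> Cts (fun x => Rabs (F x)).
Proof. intros HF x. apply (continuous_comp F Rabs); auto. apply continuous_Rabs. Qed.
Lemma Cts_sqrt {T : UniformSpace} (F : T -> R) : Cts F -> Cts (fun x => sqrt (F x)).
Proof. intros HF x. apply (continuous_comp F sqrt); auto. apply continuous_sqrt. Qed.
Lemma Cts_cos {T : UniformSpace} (F : T -> R) : Cts F -> Cts (fun x => cos (F x)).
Proof. intros HF x. apply (continuous_comp F cos); auto. apply continuous_cos. Qed.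
Lemma Cts_id : Cts (fun x : R => x).
Proof. intros x; apply continuous_id. Qed.
Lemma Cts_ext {T : UniformSpace} (F G : T -> R) : (forall x, F x = G x) -> Cts F -> Cts G.
Proof. intros H HF x. apply (continuous_ext F G); auto. Qed.

Lemma continuous_fst_comp {T U V : UniformSpace} (F : T -> U * V) x :
  continuous F x -> continuous (fun t => fst (F t)) x.
Proof.
  intros H. apply (continuous_comp F fst); auto. destruct (F x); apply continuous_fst.
Qed.
Lemma continuous_snd_comp {T U V : UniformSpace} (F : T -> U * V) x :
  continuous F x -> continuous (fun t => snd (F t)) x.
Proof.
  intros H. apply (continuous_comp F snd); auto. destruct (F x); apply continuous_snd.
Qed.
Lemma continuous_pair {T U V : UniformSpace} (F : T -> U) (G : T -> V) x :
  continuous F x -> continuous G x -> continuous (fun t => (F t, G t)) x.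
Proof.
  intros HF HG. apply filterlim_locally. intros eps.
  assert (H1 := proj1 (filterlim_locally F _) HF eps).
  assert (H2 := proj1 (filterlim_locally G _) HG eps).
  generalize (filter_and _ _ H1 H2). apply filter_imp. intros y [? ?]; split; auto.
Qed.

(** * Circle averages and integrals depending on a parameter *)

Definition avg (F : R -> R) : R := / (2 * PI) * RInt F 0 (2 * PI).

Lemma PI2_pos : 0 < 2 * PI.
Proof. pose proof PI_RGT_0; lra. Qed.

Lemma Cts_ex_RInt F a b : Cts F -> ex_RInt F a b.
Proof. intros H. apply (ex_RInt_continuous (V := R_CompleteNormedModule)). intros; apply H. Qed.

Lemma avg_ext F G : (forall t, F t = G t) -> avg F = avg G.
Proof. intros H. unfold avg. f_equal. apply RInt_ext; auto. Qed.

Lemma avg_le F G : Cts F -> Cts G -> (forall t, F t <= G t) -> avg F <= avg G.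
Proof.
  intros HF HG H. unfold avg. apply Rmult_le_compat_l.
  - left; apply Rinv_0_lt_compat, PI2_pos.
  - apply RInt_le; auto using Cts_ex_RInt. left; apply PI2_pos.
Qed.

Lemma avg_const c : avg (fun _ => c) = c.
Proof.
  unfold avg. rewrite RInt_const. change (/ (2 * PI) * ((2 * PI - 0) * c) = c).
  field. pose proof PI_RGT_0; lra.
Qed.

Lemma avg_nonneg F : Cts F -> (forall t, 0 <= F t) -> 0 <= avg F.
Proof. intros. rewrite <- (avg_const 0). apply avg_le; auto using Cts_const. Qed.

Lemma avg_plus F G : Cts F -> Cts G -> avg (fun t => F t + G t) = avg F + avg G.
Proof.
  intros HF HG. unfold avg. rewrite <- Rmult_plus_distr_l. f_equal.
  apply (RInt_plus F G); auto using Cts_ex_RInt.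
Qed.

Lemma RInt_scal_R c F a b : Cts F -> RInt (fun t => c * F t) a b = c * RInt F a b.
Proof. intros HF. apply (RInt_scal F a b c (Cts_ex_RInt F _ _ HF)). Qed.

Lemma avg_scal c F : Cts F -> avg (fun t => c * F t) = c * avg F.
Proof. intros HF. unfold avg. rewrite RInt_scal_R; auto. ring. Qed.

Lemma avg_scal_r c F : Cts F -> avg (fun t => F t * c) = avg F * c.
Proof. intros HF. rewrite (avg_ext _ (fun t => c * F t)) by (intros; ring). rewrite avg_scal; auto; ring. Qed.

Lemma avg_minus F G : Cts F -> Cts G -> avg (fun t => F t - G t) = avg F - avg G.
Proof.
  intros HF HG. rewrite (avg_ext _ (fun t => F t + (-1) * G t)) by (intros; ring).
  rewrite avg_plus, avg_scal; auto. ring. apply Cts_mult; auto using Cts_const.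
Qed.

Lemma avg_le_const F c : Cts F -> (forall t, F t <= c) -> avg F <= c.
Proof. intros. rewrite <- (avg_const c). apply avg_le; auto using Cts_const. Qed.

(** The quadratic polynomial x -> avg ((x F + G)^2) is nonnegative, so its discriminant is not
    positive. If the leading coefficient vanishes but b does not, the polynomial is affine and takes
    the value -1 at -(c + 1) / (2b). *)
Lemma avg_CS F G : Cts F -> Cts G ->
  (avg (fun t => F t * G t)) ^ 2 <= avg (fun t => F t ^ 2) * avg (fun t => G t ^ 2).
Proof.
  intros HF HG.
  set (a := avg (fun t => F t ^ 2)). set (b := avg (fun t => F t * G t)).
  set (c := avg (fun t => G t ^ 2)).
  assert (Hq : forall x, 0 <= a * x ^ 2 + 2 * b * x + c).
  { intros x. replace (a * x ^ 2 + 2 * b * x + c) with (avg (fun t => (x * F t + G t) ^ 2)).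
    - apply avg_nonneg. apply Cts_pow, Cts_plus; auto. apply Cts_mult; auto using Cts_const.
      intros; apply pow2_ge_0.
    - unfold a, b, c. rewrite (avg_ext _ (fun t => (x ^ 2 * F t ^ 2 + 2 * x * (F t * G t)) + G t ^ 2))
        by (intros; ring).
      assert (Cts (fun t : R => F t ^ 2)) by (apply Cts_pow; auto).
      assert (Cts (fun t : R => F t * G t)) by (apply Cts_mult; auto).
      assert (Cts (fun t : R => G t ^ 2)) by (apply Cts_pow; auto).
      rewrite avg_plus; [|apply Cts_plus; apply Cts_mult; auto using Cts_const|auto].
      rewrite avg_plus; [|apply Cts_mult; auto using Cts_const|apply Cts_mult; auto using Cts_const].
      rewrite (avg_scal _ (fun t : R => F t ^ 2)), (avg_scal _ (fun t : R => F t * G t)); auto. ring. }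
  assert (Ha : 0 <= a) by (apply avg_nonneg; [apply Cts_pow; auto | intros; apply pow2_ge_0]).
  assert (Hc : 0 <= c) by (apply avg_nonneg; [apply Cts_pow; auto | intros; apply pow2_ge_0]).
  destruct (Req_dec a 0) as [Ha0|Ha0].
  - rewrite Ha0 in *. destruct (Req_dec b 0) as [Hb|Hb]; [rewrite Hb; lra|].
    specialize (Hq (- (c + 1) / (2 * b))).
    replace (0 * (- (c + 1) / (2 * b)) ^ 2 + 2 * b * (- (c + 1) / (2 * b)) + c) with (-1) in Hq
      by (field; auto). lra.
  - specialize (Hq (- b / a)).
    replace (a * (- b / a) ^ 2 + 2 * b * (- b / a) + c) with ((a * c - b ^ 2) / a) in Hq by (field; auto).
    assert (0 < a) by lra. assert (0 <= a * c - b ^ 2); [|lra].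
    replace (a * c - b ^ 2) with ((a * c - b ^ 2) / a * a) by (field; auto). nra.
Qed.

(** Joint continuity at each point of the segment gives a radius there, and compactness of the
    segment extracts one radius that serves all of it. The [+ 1] in the tolerance covers the case a
    = b. *)
Lemma RInt_param_continuous {T : UniformSpace} (F : T -> R -> R) (a b : R) (x : T) :
  a <= b ->
  (forall t, a <= t <= b -> continuous (fun p : T * R => F (fst p) (snd p)) (x, t)) ->
  locally x (fun y => ex_RInt (F y) a b) ->
  continuous (fun y => RInt (F y) a b) x.
Proof.
  intros Hab Hc Hex. apply filterlim_locally. intros eps.
  assert (He : 0 < eps / (2 * (b - a + 1))).
  { apply Rdiv_lt_0_compat. apply cond_pos. lra. }
  set (e := mkposreal _ He).
  assert (Hd : forall t, exists d : posreal, a <= t <= b ->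
     forall y s, ball x d y -> Rabs (s - t) < d -> Rabs (F y s - F x t) < e).
  { intros t. destruct (classic (a <= t <= b)) as [Ht|Ht].
    - assert (H := proj1 (filterlim_locally _ _) (Hc t Ht) e). destruct H as [d Hd].
      exists d. intros _ y s Hy Hs. apply (Hd (y, s)). split; auto.
    - exists (mkposreal 1 Rlt_0_1). intros; tauto. }
  set (dl := fun t => proj1_sig (constructive_indefinite_description _ (Hd t))).
  assert (Hdl : forall t, a <= t <= b -> forall y s, ball x (dl t) y -> Rabs (s - t) < dl t ->
     Rabs (F y s - F x t) < e).
  { intros t. unfold dl. destruct (constructive_indefinite_description _ (Hd t)); auto. }
  destruct (compactness_value_1d a b dl) as [d Hdd].
  assert (Hx : ex_RInt (F x) a b) by (apply (locally_singleton x _ Hex)).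
  assert (Hloc : locally x (ball x d)) by (exists d; auto).
  generalize (filter_and _ _ Hex Hloc). apply filter_imp. intros y [Hy Hyd].
  change (Rabs (RInt (F y) a b - RInt (F x) a b) < eps).
  rewrite <- (RInt_minus (F y) (F x)) by auto.
  apply Rle_lt_trans with ((b - a) * (2 * e)).
  - apply abs_RInt_le_const; auto. apply @ex_RInt_minus; auto.
    intros s Hs. destruct (Rle_lt_dec (Rabs (minus (F y s) (F x s))) (2 * e)) as [|Hl]; auto.
    (* The covering property comes under a double negation, so the goal is first decided and then
       refuted. *)
    exfalso. apply (Hdd s Hs). intros [t [Ht [Hst Hdt]]].
    pose proof (Hdl t Ht y s (ball_le x d (dl t) Hdt y Hyd) Hst).
    pose proof (Hdl t Ht x s (ball_center x (dl t)) Hst).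
    change (minus (F y s) (F x s)) with (F y s - F x s) in Hl.
    apply Rabs_def2 in H. apply Rabs_def2 in H0.
    assert (Rabs (F y s - F x s) < 2 * e); [|lra]. apply Rabs_def1; lra.
  - unfold e; simpl. replace ((b - a) * (2 * (eps / (2 * (b - a + 1))))) with (eps * ((b - a) / (b - a + 1)))
      by (field; lra).
    assert ((b - a) / (b - a + 1) < 1). { apply Rmult_lt_reg_r with (b - a + 1). lra. unfold Rdiv.
      rewrite Rmult_assoc, Rinv_l; lra. }
    pose proof (cond_pos eps). nra.
Qed.

Lemma Cts_section {T : UniformSpace} (F : T -> R -> R) x :
  Cts (fun p : T * R => F (fst p) (snd p)) -> Cts (F x).
Proof.
  intros H t. apply (continuous_comp (fun t => (x, t)) (fun p : T * R => F (fst p) (snd p))).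
  - apply continuous_pair. apply continuous_const. apply continuous_id.
  - apply H.
Qed.

Lemma Cts_RInt {T : UniformSpace} (F : T -> R -> R) a b : a <= b ->
  Cts (fun p : T * R => F (fst p) (snd p)) -> Cts (fun x => RInt (F x) a b).
Proof.
  intros Hab H x. apply RInt_param_continuous; auto.
  apply filter_forall. intros y. apply Cts_ex_RInt. apply Cts_section; auto.
Qed.

Lemma Cts_avg {T : UniformSpace} (F : T -> R -> R) :
  Cts (fun p : T * R => F (fst p) (snd p)) -> Cts (fun x => avg (F x)).
Proof.
  intros H. unfold avg. apply Cts_mult. apply Cts_const. apply Cts_RInt; auto.
  left; apply PI2_pos.
Qed.

Lemma is_derive_RInt_upper (F : R -> R) a x : Cts F -> is_derive (RInt F a) x (F x).
Proof.
  intros H. apply (is_derive_RInt F (RInt F a) a x).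
  - apply filter_forall. intros y. apply (RInt_correct F). apply Cts_ex_RInt; auto.
  - apply H.
Qed.

(** Regard the upper limit b as a variable u: the difference [G] of the two iterated integrals has
    derivative 0 and vanishes at u = a. *)
Lemma RInt_Fubini (F : R -> R -> R) a b c d : a <= b -> c <= d ->
  Cts (fun p : R * R => F (fst p) (snd p)) ->
  RInt (fun x => RInt (F x) c d) a b = RInt (fun y => RInt (fun x => F x y) a b) c d.
Proof.
  intros Hab Hcd H.
  assert (H' : Cts (fun p : R * R => F (snd p) (fst p))).
  { apply (Cts_comp (fun p : R * R => (snd p, fst p)) (fun p : R * R => F (fst p) (snd p))); auto.
    intros x. apply continuous_pair. apply continuous_snd_comp, continuous_id.
    apply continuous_fst_comp, continuous_id. }
  assert (Hin : forall y, Cts (fun x => F x y)).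
  { intros y. apply (Cts_section (fun y x => F x y)); auto. }
  set (G := fun u => RInt (fun x => RInt (F x) c d) a u - RInt (fun y => RInt (fun x => F x y) a u) c d).
  assert (HG : forall u, is_derive G u 0).
  { intros u. unfold G. replace 0 with (RInt (F u) c d - RInt (F u) c d) by ring.
    apply @is_derive_minus.
    - apply (is_derive_RInt_upper (fun x => RInt (F x) c d)). apply Cts_RInt; auto.
    - assert (Hd : forall u y, is_derive (fun u => RInt (fun x => F x y) a u) u (F u y)).
      { intros v y. apply (is_derive_RInt_upper (fun x => F x y)); auto. }
      rewrite (RInt_ext (F u) (fun y => Derive (fun u => RInt (fun x => F x y) a u) u)).
      2:{ intros y _. symmetry. apply is_derive_unique, Hd. }
      apply (is_derive_RInt_param (fun u y => RInt (fun x => F x y) a u) c d u).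
      + apply filter_forall. intros v t _. eexists; apply Hd.
      + intros t _. apply continuity_2d_pt_ext with F.
        * intros x y. symmetry. apply is_derive_unique, Hd.
        * apply continuity_2d_pt_filterlim. apply H.
      (* Differentiating in u looks at both sides of it, so upper limits v < a occur as well; there
         the bounds are swapped. *)
      + apply filter_forall. intros v. apply Cts_ex_RInt.
        destruct (Rle_dec a v).
        * apply (Cts_RInt (fun y x => F x y)); auto.
        * apply (Cts_ext (fun y => - RInt (fun x => F x y) v a)).
          -- intros y. apply (opp_RInt_swap (fun x => F x y)). apply Cts_ex_RInt; auto.
          -- apply Cts_opp. apply (Cts_RInt (fun y x => F x y)); auto; lra. }
  assert (HGab : G a = G b).
  { destruct Hab as [Hab| ->]; auto. apply (eq_is_derive G a b); auto. }
  assert (Ha : G a = 0).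
  { unfold G. rewrite RInt_point. rewrite (RInt_ext _ (fun _ => 0)).
    rewrite RInt_const. unfold scal, zero; simpl. unfold mult; simpl. ring.
    intros y _. rewrite RInt_point; reflexivity. }
  rewrite Ha in HGab. unfold G in HGab. lra.
Qed.

Lemma avg_Fubini (F : R -> R -> R) : Cts (fun p : R * R => F (fst p) (snd p)) ->
  avg (fun x => avg (F x)) = avg (fun y => avg (fun x => F x y)).
Proof.
  intros H. pose proof PI2_pos.
  assert (H' : Cts (fun p : R * R => F (snd p) (fst p))).
  { apply (Cts_comp (fun p : R * R => (snd p, fst p)) (fun p : R * R => F (fst p) (snd p))); auto.
    intros x. apply continuous_pair. apply continuous_snd_comp, continuous_id.
    apply continuous_fst_comp, continuous_id. }
  unfold avg. rewrite !RInt_scal_R.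
  - do 2 f_equal. apply RInt_Fubini; auto; lra.
  - apply (Cts_RInt (fun y x => F x y)); auto; lra.
  - apply Cts_RInt; auto; lra.
Qed.

(** * Green's theorem on rectangles *)

Lemma dependent_choice {T : Type} (P : nat -> T -> Prop) (Q : nat -> T -> T -> Prop) (t0 : T) :
  P O t0 -> (forall n t, P n t -> exists t', P (S n) t' /\ Q n t t') ->
  exists s : nat -> T, s O = t0 /\ (forall n, P n (s n)) /\ (forall n, Q n (s n) (s (S n))).
Proof.
  intros H0 Hs.
  set (step := fun n (u : {t | P n t}) =>
    let (t', Ht') := constructive_indefinite_description _ (Hs n (proj1_sig u) (proj2_sig u)) in
    exist (P (S n)) t' (proj1 Ht')).
  set (f := nat_rect (fun n => {t | P n t}) (exist (P O) t0 H0) step).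
  exists (fun n => proj1_sig (f n)). split; [reflexivity|]. split.
  - intros n. exact (proj2_sig (f n)).
  - intros n. simpl. unfold step at 1.
    destruct (constructive_indefinite_description _ (Hs n (proj1_sig (f n)) (proj2_sig (f n)))) as [t' [Ht1 Ht2]].
    exact Ht2.
Qed.

(** The integral of the form A dy + B dx over the positively oriented boundary of the rectangle. *)
Definition oscill (A B : R -> R -> R) a b c d :=
  RInt (fun y => A b y - A a y) c d - RInt (fun x => B x d - B x c) a b.

Lemma differentiable_pt_lim_continuous_y A x y lx ly :
  differentiable_pt_lim A x y lx ly -> continuous (fun v => A x v) y.
Proof.
  intros H. assert (Hc : continuity_2d_pt A x y).
  { apply differentiable_continuity_pt. exists lx, ly; auto. }
  apply continuity_2d_pt_filterlim in Hc.
  apply (continuous_comp (fun v => (x, v)) (fun p : R * R => A (fst p) (snd p))); auto.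
  apply continuous_pair. apply continuous_const. apply continuous_id.
Qed.

Lemma differentiable_pt_lim_continuous_x A x y lx ly :
  differentiable_pt_lim A x y lx ly -> continuous (fun u => A u y) x.
Proof.
  intros H. assert (Hc : continuity_2d_pt A x y).
  { apply differentiable_continuity_pt. exists lx, ly; auto. }
  apply continuity_2d_pt_filterlim in Hc.
  apply (continuous_comp (fun u => (u, y)) (fun p : R * R => A (fst p) (snd p))); auto.
  apply continuous_pair. apply continuous_id. apply continuous_const.
Qed.

Lemma ex_RInt_cont_on (F : R -> R) a b : a <= b ->
  (forall x, a <= x <= b -> continuous F x) -> ex_RInt F a b.
Proof.
  intros Hab H. apply (ex_RInt_continuous (V := R_CompleteNormedModule)).
  rewrite Rmin_left, Rmax_right; auto.
Qed.

Lemma RInt_minus_R (F G : R -> R) a b : ex_RInt F a b -> ex_RInt G a b ->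
  RInt (fun x => F x - G x) a b = RInt F a b - RInt G a b.
Proof. intros; apply (RInt_minus F G); auto. Qed.

Lemma RInt_Chasles_R (F : R -> R) a b c : ex_RInt F a b -> ex_RInt F b c ->
  RInt F a b + RInt F b c = RInt F a c.
Proof. intros; apply (RInt_Chasles F); auto. Qed.

Lemma RInt_zero (F : R -> R) a b : (forall x, F x = 0) -> RInt F a b = 0.
Proof.
  intros H. rewrite (RInt_ext _ (fun _ => 0)) by (intros; apply H).
  rewrite RInt_const. unfold scal; simpl; unfold mult; simpl; ring.
Qed.

(* Goursat's bisection argument for the real and imaginary parts separately. *)
Lemma green_goursat (A B : R -> R -> R) a b c d : a <= b -> c <= d ->
  (forall x y, a <= x <= b -> c <= y <= d -> exists l m n,
     differentiable_pt_lim A x y l m /\ differentiable_pt_lim B x y n l) ->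
  RInt (fun y => A b y - A a y) c d = RInt (fun x => B x d - B x c) a b.
Proof.
  intros Hab Hcd Hd.
  assert (CA : forall x y, a <= x <= b -> c <= y <= d -> continuous (fun v => A x v) y).
  { intros x y Hx Hy. destruct (Hd x y Hx Hy) as [l [m [n [H _]]]].
    eapply differentiable_pt_lim_continuous_y; eauto. }
  assert (CB : forall x y, a <= x <= b -> c <= y <= d -> continuous (fun u => B u y) x).
  { intros x y Hx Hy. destruct (Hd x y Hx Hy) as [l [m [n [_ H]]]].
    eapply differentiable_pt_lim_continuous_x; eauto. }
  assert (IA : forall x y1 y2, a <= x <= b -> c <= y1 -> y1 <= y2 -> y2 <= d ->
     ex_RInt (A x) y1 y2).
  { intros. apply ex_RInt_cont_on; auto. intros; apply CA; lra. }
  assert (IB : forall y x1 x2, c <= y <= d -> a <= x1 -> x1 <= x2 -> x2 <= b ->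
     ex_RInt (fun x => B x y) x1 x2).
  { intros. apply ex_RInt_cont_on; auto. intros; apply CB; lra. }
  assert (OE : forall x1 x2 y1 y2, a <= x1 -> x1 <= x2 -> x2 <= b -> c <= y1 -> y1 <= y2 -> y2 <= d ->
     oscill A B x1 x2 y1 y2 = (RInt (A x2) y1 y2 - RInt (A x1) y1 y2) -
       (RInt (fun x => B x y2) x1 x2 - RInt (fun x => B x y1) x1 x2)).
  { intros. unfold oscill.
    rewrite (RInt_minus_R (A x2) (A x1)) by (apply IA; lra).
    rewrite (RInt_minus_R (fun x => B x y2) (fun x => B x y1)) by (apply IB; lra). reflexivity. }
  assert (Lx : forall x1 x2 x3 y1 y2, a <= x1 -> x1 <= x2 -> x2 <= x3 -> x3 <= b ->
     c <= y1 -> y1 <= y2 -> y2 <= d ->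
     oscill A B x1 x3 y1 y2 = oscill A B x1 x2 y1 y2 + oscill A B x2 x3 y1 y2).
  { intros. rewrite !OE by lra.
    rewrite <- (RInt_Chasles_R (fun x => B x y2) x1 x2 x3) by (apply IB; lra).
    rewrite <- (RInt_Chasles_R (fun x => B x y1) x1 x2 x3) by (apply IB; lra). ring. }
  assert (Ly : forall x1 x2 y1 y2 y3, a <= x1 -> x1 <= x2 -> x2 <= b ->
     c <= y1 -> y1 <= y2 -> y2 <= y3 -> y3 <= d ->
     oscill A B x1 x2 y1 y3 = oscill A B x1 x2 y1 y2 + oscill A B x1 x2 y2 y3).
  { intros. rewrite !OE by lra.
    rewrite <- (RInt_Chasles_R (A x2) y1 y2 y3) by (apply IA; lra).
    rewrite <- (RInt_Chasles_R (A x1) y1 y2 y3) by (apply IA; lra). ring. }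
  set (w := fun n => (b - a) * (/ 2) ^ n). set (h := fun n => (d - c) * (/ 2) ^ n).
  assert (pw : forall n, 0 < (/ 2) ^ n) by (intros; apply pow_lt; lra).
  assert (w0 : forall n, 0 <= w n) by (intros n; unfold w; specialize (pw n); nra).
  assert (h0 : forall n, 0 <= h n) by (intros n; unfold h; specialize (pw n); nra).
  assert (wS : forall n, w n = w (S n) + w (S n)) by (intros; unfold w; simpl; field).
  assert (hS : forall n, h n = h (S n) + h (S n)) by (intros; unfold h; simpl; field).
  set (L0 := Rabs (oscill A B a b c d)).
  (* One of the four quarters carries at least a quarter of [oscill]; the lower left corners of the
     successive choices form the sequence. *)
  destruct (dependent_choice (T := R * R)
    (fun n p => a <= fst p /\ fst p + w n <= b /\ c <= snd p /\ snd p + h n <= d /\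
        L0 * (/ 4) ^ n <= Rabs (oscill A B (fst p) (fst p + w n) (snd p) (snd p + h n)))
    (fun n p q => fst p <= fst q <= fst p + w (S n) /\ snd p <= snd q <= snd p + h (S n)) (a, c))
    as [s [s0 [sP sQ]]].
  - simpl. unfold w, h; simpl.
    replace (a + (b - a) * 1) with b by ring. replace (c + (d - c) * 1) with d by ring.
    repeat split; try lra. fold L0. lra.
  - intros n [x y]; simpl fst; simpl snd. intros [H1 [H2 [H3 [H4 H5]]]].
    pose proof (w0 (S n)). pose proof (h0 (S n)). rewrite wS in H2. rewrite hS in H4.
    rewrite wS, hS, <- !Rplus_assoc in H5.
    rewrite (Lx x (x + w (S n)) (x + w (S n) + w (S n))) in H5 by lra.
    rewrite (Ly x (x + w (S n)) y (y + h (S n)) (y + h (S n) + h (S n))) in H5 by lra.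
    rewrite (Ly (x + w (S n)) (x + w (S n) + w (S n)) y (y + h (S n)) (y + h (S n) + h (S n))) in H5 by lra.
    revert H5.
    set (q1 := oscill A B x _ y (y + h (S n))). set (q2 := oscill A B x _ (y + h (S n)) _).
    set (q3 := oscill A B (x + w (S n)) _ y (y + h (S n))). set (q4 := oscill A B (x + w (S n)) _ (y + h (S n)) _).
    intros H5. set (T := L0 * (/ 4) ^ n) in *.
    assert (HT : L0 * (/ 4) ^ (S n) = T / 4) by (unfold T; simpl; field). rewrite HT.
    assert (Hor : T / 4 <= Rabs q1 \/ T / 4 <= Rabs q2 \/ T / 4 <= Rabs q3 \/ T / 4 <= Rabs q4).
    { pose proof (Rabs_triang (q1 + q2) (q3 + q4)). pose proof (Rabs_triang q1 q2).
      pose proof (Rabs_triang q3 q4). destruct (Rle_dec (T / 4) (Rabs q1)); auto.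
      destruct (Rle_dec (T / 4) (Rabs q2)); auto. destruct (Rle_dec (T / 4) (Rabs q3)); auto.
      right; right; right. lra. }
    destruct Hor as [Ho|[Ho|[Ho|Ho]]].
    + exists (x, y); simpl; repeat split; try lra. exact Ho.
    + exists (x, y + h (S n)); simpl; repeat split; try lra. exact Ho.
    + exists (x + w (S n), y); simpl; repeat split; try lra. exact Ho.
    + exists (x + w (S n), y + h (S n)); simpl; repeat split; try lra. exact Ho.
  - set (X := fun n => fst (s n)). set (Y := fun n => snd (s n)).
    assert (nest : forall n k, X n <= X (n + k)%nat /\ X (n + k)%nat + w (n + k)%nat <= X n + w n /\
       Y n <= Y (n + k)%nat /\ Y (n + k)%nat + h (n + k)%nat <= Y n + h n).
    { intros n k. induction k.
      - rewrite Nat.add_0_r. lra.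
      - replace (n + S k)%nat with (S (n + k)) by lia. destruct (sQ (n + k)%nat) as [q1 q2].
        fold (X (n + k)%nat) (X (S (n + k))) in q1. fold (Y (n + k)%nat) (Y (S (n + k))) in q2.
        pose proof (wS (n + k)%nat). pose proof (hS (n + k)%nat). lra. }
    assert (sup : forall (Z v : nat -> R), (forall n, 0 <= v n) ->
       (forall n k, Z n <= Z (n + k)%nat /\ Z (n + k)%nat + v (n + k)%nat <= Z n + v n) ->
       exists z, forall n, Z n <= z <= Z n + v n).
    { intros Z v Hv HZ.
      assert (Hle : forall n m, Z m <= Z n + v n).
      { intros n m. destruct (Nat.le_ge_cases n m) as [Hnm|Hnm].
        - replace m with (n + (m - n))%nat by lia. pose proof (HZ n (m - n)%nat).
          specialize (Hv (n + (m - n))%nat). lra.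
        - pose proof (HZ m (n - m)%nat). replace (m + (n - m))%nat with n in H by lia.
          specialize (Hv n). lra. }
      destruct (completeness (fun x => exists n, x = Z n)) as [z [Hz1 Hz2]].
      - exists (Z O + v O). intros x [n ->]. apply Hle.
      - exists (Z O); exists O; auto.
      - exists z. intros n; split. apply Hz1; exists n; auto.
        apply Hz2. intros x [m ->]. apply Hle. }
    destruct (sup X w w0) as [x0 Hx0]. { intros n k; specialize (nest n k); lra. }
    destruct (sup Y h h0) as [y0 Hy0]. { intros n k; specialize (nest n k); lra. }
    assert (Bx : a <= x0 <= b). { specialize (sP O). specialize (Hx0 O). unfold X in Hx0. lra. }
    assert (By : c <= y0 <= d). { specialize (sP O). specialize (Hy0 O). unfold Y in Hy0. lra. }
    destruct (Hd x0 y0 Bx By) as [l [m [k [HA HB]]]].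
    (* The [+ 1] keeps the size positive for a degenerate rectangle. *)
    set (S := Rmax (b - a) (d - c) + 1).
    assert (HS : 0 < S /\ b - a <= S /\ d - c <= S).
    { unfold S. pose proof (Rmax_l (b - a) (d - c)). pose proof (Rmax_r (b - a) (d - c)). lra. }
    (* Near the common point both functions are affine up to eps times the distance. The affine
       parts cancel because the x-derivative of A and the y-derivative of B are the same l, and the
       errors are of the order of the squared side, which shrinks like 4^(-n) just as the lower
       bound for [oscill] does. *)
    assert (Hsmall : forall eps, 0 < eps -> L0 <= 4 * eps * S ^ 2).
    { intros eps He. destruct (HA (mkposreal _ He)) as [d1 Hd1]. destruct (HB (mkposreal _ He)) as [d2 Hd2].
      simpl in Hd1, Hd2.
      assert (Hn : exists n, S * (/ 2) ^ n < Rmin d1 d2).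
      { assert (Hm : 0 < Rmin d1 d2) by (apply Rmin_pos; apply cond_pos).
        destruct (pow_lt_1_zero (/ 2)) with (y := Rmin d1 d2 / S) as [n Hn].
        rewrite Rabs_pos_eq; lra. apply Rdiv_lt_0_compat; lra.
        exists n. specialize (Hn n (le_n n)). rewrite Rabs_pos_eq in Hn by (left; apply pw).
        apply (Rmult_lt_compat_l S) in Hn; [|lra].
        replace (S * (Rmin d1 d2 / S)) with (Rmin d1 d2) in Hn by (field; lra). auto. }
      destruct Hn as [n Hn]. set (sn := S * (/ 2) ^ n) in *.
      pose proof (Rmin_l d1 d2). pose proof (Rmin_r d1 d2).
      specialize (Hx0 n). specialize (Hy0 n). specialize (sP n).
      change (fst (s n)) with (X n) in sP. change (snd (s n)) with (Y n) in sP.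
      destruct sP as [P1 [P2 [P3 [P4 P5]]]].
      assert (wn : w n <= sn). { unfold w, sn. specialize (pw n). nra. }
      assert (hn : h n <= sn). { unfold h, sn. specialize (pw n). nra. }
      specialize (w0 n). specialize (h0 n).
      assert (sn0 : 0 < sn). { unfold sn. specialize (pw n). nra. }
      assert (EA : forall u v, X n <= u <= X n + w n -> Y n <= v <= Y n + h n ->
         Rabs (A u v - A x0 y0 - (l * (u - x0) + m * (v - y0))) <= eps * sn /\
         Rabs (B u v - B x0 y0 - (k * (u - x0) + l * (v - y0))) <= eps * sn).
      { intros u v Hu Hv.
        assert (Rabs (u - x0) <= sn) by (apply Rabs_le; lra).
        assert (Rabs (v - y0) <= sn) by (apply Rabs_le; lra).
        assert (Rmax (Rabs (u - x0)) (Rabs (v - y0)) <= sn) by (apply Rmax_lub; auto).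
        split; (eapply Rle_trans; [first [apply Hd1 | apply Hd2]; lra|]);
        apply Rmult_le_compat_l; lra. }
      assert (E : Rabs (oscill A B (X n) (X n + w n) (Y n) (Y n + h n)) <= 4 * eps * sn ^ 2).
      { unfold oscill.
        replace (RInt (fun y => A (X n + w n) y - A (X n) y) (Y n) (Y n + h n))
          with (RInt (fun y => (A (X n + w n) y - A (X n) y) - l * w n) (Y n) (Y n + h n) + h n * (l * w n)).
        2:{ rewrite (RInt_minus_R (fun y => A (X n + w n) y - A (X n) y) (fun _ => l * w n)).
            rewrite RInt_const. unfold scal; simpl; unfold mult; simpl. ring.
            apply @ex_RInt_minus; apply IA; lra. apply ex_RInt_const. }
        replace (RInt (fun x => B x (Y n + h n) - B x (Y n)) (X n) (X n + w n))
          with (RInt (fun x => (B x (Y n + h n) - B x (Y n)) - l * h n) (X n) (X n + w n) + w n * (l * h n)).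
        2:{ rewrite (RInt_minus_R (fun x => B x (Y n + h n) - B x (Y n)) (fun _ => l * h n)).
            rewrite RInt_const. unfold scal; simpl; unfold mult; simpl. ring.
            apply @ex_RInt_minus; apply IB; lra. apply ex_RInt_const. }
        assert (I1 : Rabs (RInt (fun y => (A (X n + w n) y - A (X n) y) - l * w n) (Y n) (Y n + h n))
             <= (Y n + h n - Y n) * (2 * eps * sn)).
        { apply abs_RInt_le_const. lra.
          apply @ex_RInt_minus. apply @ex_RInt_minus; apply IA; lra. apply ex_RInt_const.
          intros v Hv. destruct (EA (X n + w n) v) as [e1 _]; try lra.
          destruct (EA (X n) v) as [e2 _]; try lra.
          apply Rabs_le. apply Rabs_le_between in e1. apply Rabs_le_between in e2. split; nra. }
        assert (I2 : Rabs (RInt (fun x => (B x (Y n + h n) - B x (Y n)) - l * h n) (X n) (X n + w n))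
             <= (X n + w n - X n) * (2 * eps * sn)).
        { apply abs_RInt_le_const. lra.
          apply @ex_RInt_minus. apply @ex_RInt_minus; apply IB; lra. apply ex_RInt_const.
          intros v Hv. destruct (EA v (Y n + h n)) as [_ e1]; try lra.
          destruct (EA v (Y n)) as [_ e2]; try lra.
          apply Rabs_le. apply Rabs_le_between in e1. apply Rabs_le_between in e2. split; nra. }
        apply Rabs_le_between in I1. apply Rabs_le_between in I2.
        assert (J1 : (Y n + h n - Y n) * (2 * eps * sn) <= 2 * eps * sn ^ 2).
        { replace (2 * eps * sn ^ 2) with (sn * (2 * eps * sn)) by ring.
          apply Rmult_le_compat_r; [|lra]. apply Rmult_le_pos; lra. }
        assert (J2 : (X n + w n - X n) * (2 * eps * sn) <= 2 * eps * sn ^ 2).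
        { replace (2 * eps * sn ^ 2) with (sn * (2 * eps * sn)) by ring.
          apply Rmult_le_compat_r; [|lra]. apply Rmult_le_pos; lra. }
        apply Rabs_le. lra. }
      assert (Hf : L0 * (/ 4) ^ n <= 4 * eps * S ^ 2 * (/ 4) ^ n).
      { eapply Rle_trans; [exact P5|]. eapply Rle_trans; [exact E|].
        unfold sn. replace ((/ 4) ^ n) with ((/ 2) ^ n * (/ 2) ^ n) by (rewrite <- Rpow_mult_distr; f_equal; lra).
        right; ring. }
      apply Rmult_le_reg_r with ((/ 4) ^ n); auto. apply pow_lt; lra. }
    assert (HL0 : L0 <= 0).
    { apply Rle_plus_epsilon. intros e He.
      replace (0 + e) with (4 * (e / (4 * S ^ 2)) * S ^ 2) by (field; lra).
      apply Hsmall. apply Rdiv_lt_0_compat; auto. nra. }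
    unfold L0, oscill in HL0. pose proof (Rabs_pos (oscill A B a b c d)). unfold oscill in H.
    apply Rminus_diag_uniq. apply Rabs_eq_0. lra.
Qed.

(** * Complex differentiability *)

Lemma C_eq (a b : C) : fst a = fst b -> snd a = snd b -> a = b.
Proof. destruct a, b; simpl; intros; subst; auto. Qed.

(** Fixes the uniform structure on C to be that of the product, so that continuity can be checked on
    the two coordinates. *)
Definition CCt {T : UniformSpace} (F : T -> C) (x : T) : Prop := @continuous T C_UniformSpace F x.

Lemma CCt_intro {T : UniformSpace} (F : T -> C) x :
  continuous (fun t => fst (F t)) x -> continuous (fun t => snd (F t)) x -> CCt F x.
Proof.
  intros H1 H2. unfold CCt.
  apply (continuous_ext (T := T) (U := C_UniformSpace) (fun t => (fst (F t), snd (F t)))).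
  - intros t; destruct (F t); auto.
  - apply (continuous_pair (U := R_UniformSpace) (V := R_UniformSpace)); auto.
Qed.

Lemma CCt_fst {T : UniformSpace} (F : T -> C) x : CCt F x -> continuous (fun t => fst (F t)) x.
Proof. apply (continuous_fst_comp (U := R_UniformSpace) (V := R_UniformSpace)). Qed.
Lemma CCt_snd {T : UniformSpace} (F : T -> C) x : CCt F x -> continuous (fun t => snd (F t)) x.
Proof. apply (continuous_snd_comp (U := R_UniformSpace) (V := R_UniformSpace)). Qed.

Lemma CCt_const {T : UniformSpace} (c : C) (x : T) : CCt (fun _ => c) x.
Proof. apply (continuous_const (V := C_UniformSpace)). Qed.
Lemma CCt_id (x : C) : CCt (T := C_UniformSpace) (fun z => z) x.
Proof. apply continuous_id. Qed.
Lemma CCt_plus {T : UniformSpace} (F G : T -> C) x : CCt F x -> CCt G x -> CCt (fun t => (F t + G t)%C) x.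
Proof.
  intros HF HG. apply CCt_intro; simpl; apply ct_plus; auto using CCt_fst, CCt_snd.
Qed.
Lemma CCt_opp {T : UniformSpace} (F : T -> C) x : CCt F x -> CCt (fun t => (- F t)%C) x.
Proof.
  intros HF. apply CCt_intro; simpl; apply ct_opp; auto using CCt_fst, CCt_snd.
Qed.
Lemma CCt_minus {T : UniformSpace} (F G : T -> C) x : CCt F x -> CCt G x -> CCt (fun t => (F t - G t)%C) x.
Proof. intros HF HG. apply CCt_plus; auto. apply CCt_opp; auto. Qed.
Lemma CCt_mult {T : UniformSpace} (F G : T -> C) x : CCt F x -> CCt G x -> CCt (fun t => (F t * G t)%C) x.
Proof.
  intros HF HG. apply CCt_intro; simpl.
  - apply ct_minus; apply ct_mult; auto using CCt_fst, CCt_snd.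
  - apply ct_plus; apply ct_mult; auto using CCt_fst, CCt_snd.
Qed.
Lemma CCt_pow {T : UniformSpace} (F : T -> C) n x : CCt F x -> CCt (fun t => (F t ^ n)%C) x.
Proof. intros HF. induction n; simpl. apply CCt_const. apply CCt_mult; auto. Qed.

Lemma Csqr_neq0 (z : C) : z <> 0%C -> fst z ^ 2 + snd z ^ 2 <> 0.
Proof.
  intros Hz H. apply Hz. apply C_eq; simpl; nra.
Qed.

Lemma CCt_inv {T : UniformSpace} (F : T -> C) x : CCt F x -> F x <> 0%C -> CCt (fun t => (/ F t)%C) x.
Proof.
  intros HF Hn. pose proof (Csqr_neq0 _ Hn) as Hn'.
  assert (HI : continuous (fun t => / (fst (F t) ^ 2 + snd (F t) ^ 2)) x).
  { apply ct_inv; auto. apply ct_plus; apply ct_pow; auto using CCt_fst, CCt_snd. }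
  apply CCt_intro; unfold Cinv, fst at 1, snd at 1.
  - apply ct_mult; auto using CCt_fst.
  - apply ct_mult; auto. apply ct_opp; auto using CCt_snd.
Qed.
Lemma CCt_comp {T : UniformSpace} (G : T -> C) (F : C -> C) x :
  CCt G x -> CCt (T := C_UniformSpace) F (G x) -> CCt (fun t => F (G t)) x.
Proof. intros HG HF. apply (continuous_comp (V := C_UniformSpace) G F); auto. Qed.

(** Balls of the product structure are squares; the factors sqrt 2 compare them with discs. *)
Lemma CCt_eps (F : C -> C) (z : C) :
  CCt (T := C_UniformSpace) F z <->
  forall eps, 0 < eps -> exists d, 0 < d /\ forall w, Cmod (w - z) < d -> Cmod (F w - F z) < eps.
Proof.
  split.
  - intros H eps He.
    assert (He2 : 0 < eps / sqrt 2) by (apply Rdiv_lt_0_compat; auto; apply sqrt_lt_R0; lra).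
    destruct (proj1 (filterlim_locally (U := C_UniformSpace) F _) H (mkposreal _ He2)) as [d Hd].
    exists d. split. apply cond_pos. intros w Hw.
    assert (Hw' : @ball C_UniformSpace z d w) by (apply C_NormedModule_mixin_compat1; auto).
    apply Hd in Hw'. apply C_NormedModule_mixin_compat2 in Hw'. simpl in Hw'.
    replace (sqrt 2 * (eps / sqrt 2)) with eps in Hw' by (field; apply Rgt_not_eq, sqrt_lt_R0; lra). auto.
  - intros H. apply (filterlim_locally (U := C_UniformSpace)). intros eps.
    destruct (H eps (cond_pos eps)) as [d [Hd H']].
    assert (Hd2 : 0 < d / sqrt 2) by (apply Rdiv_lt_0_compat; auto; apply sqrt_lt_R0; lra).
    exists (mkposreal _ Hd2). intros w Hw. apply C_NormedModule_mixin_compat1. apply H'.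
    apply C_NormedModule_mixin_compat2 in Hw. simpl in Hw.
    replace (sqrt 2 * (d / sqrt 2)) with d in Hw by (field; apply Rgt_not_eq, sqrt_lt_R0; lra). auto.
Qed.

Lemma CCt_Cmod {T : UniformSpace} (F : T -> C) x : CCt F x -> continuous (fun t => Cmod (F t)) x.
Proof.
  intros HF. unfold Cmod. apply (continuous_comp _ sqrt); [|apply continuous_sqrt].
  apply ct_plus; apply ct_pow; auto using CCt_fst, CCt_snd.
Qed.

(* Caratheodory's form of complex differentiability. *)
Definition Cdiff (f : C -> C) (z l : C) : Prop :=
  exists q : C -> C, CCt (T := C_UniformSpace) q z /\ q z = l /\
    forall w, f w = (f z + (w - z) * q w)%C.

Lemma Cdiff_eps f z l : Cdiff f z l <->
  forall eps, 0 < eps -> exists d, 0 < d /\ forall w, Cmod (w - z) < d ->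
    Cmod (f w - f z - (w - z) * l) <= eps * Cmod (w - z).
Proof.
  split.
  - intros [q [Hq [Hl Hf]]] eps He. destruct (proj1 (CCt_eps q z) Hq eps He) as [d [Hd H]].
    exists d; split; auto. intros w Hw. rewrite (Hf w).
    replace (f z + (w - z) * q w - f z - (w - z) * l)%C with ((w - z) * (q w - q z))%C
      by (rewrite Hl; ring).
    rewrite Cmod_mult. specialize (H w Hw). pose proof (Cmod_ge_0 (w - z)). nra.
  - intros H. exists (fun w => if excluded_middle_informative (w = z) then l else ((f w - f z) / (w - z))%C).
    split; [|split].
    + apply CCt_eps. intros eps He. destruct (H (eps / 2)) as [d [Hd H']]; [lra|].
      exists d; split; auto. intros w Hw. destruct (excluded_middle_informative (z = z)) as [_|]; [|tauto].
      destruct (excluded_middle_informative (w = z)) as [->|Hn].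
      * replace (l - l)%C with (RtoC 0) by ring. rewrite Cmod_0; auto.
      * assert (Hwz : (w - z)%C <> 0%C) by (intros E; apply Hn; replace w with (w - z + z)%C by ring; rewrite E; ring).
        replace ((f w - f z) / (w - z) - l)%C with ((f w - f z - (w - z) * l) / (w - z))%C by (field; auto).
        rewrite Cmod_div; auto. specialize (H' w Hw). apply Cmod_gt_0 in Hwz.
        apply Rle_lt_trans with (eps / 2); [|lra].
        apply Rmult_le_reg_r with (Cmod (w - z)); auto. unfold Rdiv. rewrite Rmult_assoc, Rinv_l; lra.
    + destruct (excluded_middle_informative (z = z)); tauto.
    + intros w. destruct (excluded_middle_informative (w = z)) as [->|Hn]. ring.
      assert (Hwz : (w - z)%C <> 0%C) by (intros E; apply Hn; replace w with (w - z + z)%C by ring; rewrite E; ring).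
      field; auto.
Qed.

Lemma Cdiff_is_derive (f : C -> C) (z l : C) :
  Cdiff f z l <-> @is_derive C_AbsRing C_NormedModule f z l.
Proof.
  rewrite Cdiff_eps. split.
  - intros H. split.
    + apply (is_linear_scal_l (K := C_AbsRing) (V := C_NormedModule) l).
    + intros x Hx. apply (@is_filter_lim_locally_unique _ (AbsRing_NormedModule C_AbsRing)) in Hx.
      simpl in Hx. subst x. intros eps. destruct (H eps (cond_pos eps)) as [d [Hd H']].
      exists (mkposreal _ Hd). intros w Hw. apply (H' w). exact Hw.
  - intros [_ H] eps He. specialize (H z (fun P HP => HP) (mkposreal _ He)).
    destruct H as [d Hd]. exists d; split. apply cond_pos. intros w Hw. apply (Hd w). exact Hw.
Qed.

Lemma Cdiff_cont f z l : Cdiff f z l -> CCt (T := C_UniformSpace) f z.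
Proof.
  intros [q [Hq [_ Hf]]]. apply (continuous_ext (T := C_UniformSpace) (U := C_UniformSpace) (fun w => (f z + (w - z) * q w)%C)).
  intros; symmetry; auto.
  apply CCt_plus. apply CCt_const. apply CCt_mult; auto. apply CCt_minus. apply CCt_id. apply CCt_const.
Qed.

Lemma Cdiff_const c z : Cdiff (fun _ => c) z 0%C.
Proof. exists (fun _ => 0%C). split; [apply CCt_const|split; auto]. intros; ring. Qed.
Lemma Cdiff_id z : Cdiff (fun w => w) z 1%C.
Proof. exists (fun _ => 1%C). split; [apply CCt_const|split; auto]. intros; ring. Qed.
Lemma Cdiff_plus f g z l m : Cdiff f z l -> Cdiff g z m -> Cdiff (fun w => (f w + g w)%C) z (l + m)%C.
Proof.
  intros [q [Hq [<- Hf]]] [q' [Hq' [<- Hg]]]. exists (fun w => (q w + q' w)%C).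
  split; [apply CCt_plus; auto|split; auto]. intros w. rewrite (Hf w), (Hg w). ring.
Qed.
Lemma Cdiff_mult f g z l m : Cdiff f z l -> Cdiff g z m ->
  Cdiff (fun w => (f w * g w)%C) z (l * g z + f z * m)%C.
Proof.
  intros Hf' [q' [Hq' [<- Hg]]]. pose proof (Cdiff_cont _ _ _ Hf') as Hc. destruct Hf' as [q [Hq [<- Hf]]].
  exists (fun w => (q w * g z + f w * q' w)%C).
  split; [|split; auto].
  - apply CCt_plus; apply CCt_mult; auto. apply CCt_const.
  - intros w. rewrite (Hg w), (Hf w). ring.
Qed.
Lemma Cdiff_opp f z l : Cdiff f z l -> Cdiff (fun w => (- f w)%C) z (- l)%C.
Proof.
  intros [q [Hq [<- Hf]]]. exists (fun w => (- q w)%C).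
  split; [apply CCt_opp; auto|split; auto]. intros w. rewrite (Hf w). ring.
Qed.
Lemma Cdiff_minus f g z l m : Cdiff f z l -> Cdiff g z m -> Cdiff (fun w => (f w - g w)%C) z (l - m)%C.
Proof. intros; apply Cdiff_plus; auto. apply Cdiff_opp; auto. Qed.
Lemma Cdiff_scal c f z l : Cdiff f z l -> Cdiff (fun w => (c * f w)%C) z (c * l)%C.
Proof.
  intros [q [Hq [<- Hf]]]. exists (fun w => (c * q w)%C).
  split; [apply CCt_mult; auto; apply CCt_const|split; auto]. intros w. rewrite (Hf w). ring.
Qed.
Lemma Cdiff_comp f g z l m : Cdiff g z m -> Cdiff f (g z) l -> Cdiff (fun w => f (g w)) z (l * m)%C.
Proof.
  intros Hg' [q [Hq [<- Hf]]]. pose proof (Cdiff_cont _ _ _ Hg') as Hc. destruct Hg' as [q' [Hq' [<- Hg]]].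
  exists (fun w => (q (g w) * q' w)%C).
  split; [|split; auto].
  - apply CCt_mult; auto. apply CCt_comp; auto.
  - intros w. rewrite (Hf (g w)). rewrite (Hg w) at 1. ring.
Qed.
Lemma Cdiff_ext_loc f g z l r : 0 < r -> (forall w, Cmod (w - z) < r -> f w = g w) -> Cdiff f z l -> Cdiff g z l.
Proof.
  intros Hr H Hf. apply Cdiff_eps. intros eps He. destruct (proj1 (Cdiff_eps f z l) Hf eps He) as [d [Hd H']].
  exists (Rmin d r). split. apply Rmin_pos; auto. intros w Hw.
  pose proof (Rmin_l d r). pose proof (Rmin_r d r). rewrite <- !H. apply H'; lra.
  replace (z - z)%C with (RtoC 0) by ring. rewrite Cmod_0; auto. lra.
Qed.
Lemma Cminus_neq0 (w z : C) : w <> z -> (w - z)%C <> 0%C.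
Proof. intros Hn E; apply Hn; replace w with (w - z + z)%C by ring; rewrite E; ring. Qed.
Lemma Cdiff_inv (z : C) : z <> 0%C -> Cdiff (fun w => (/ w)%C) z (- / (z * z))%C.
Proof.
  intros Hz. pose proof (proj1 (Cmod_gt_0 z) Hz) as Hm.
  apply (Cdiff_ext_loc (fun w => (/ z + (w - z) * (- / (z * w)))%C)) with (r := Cmod z); auto.
  - intros w Hw. assert (w <> 0%C).
    { intros ->. replace (0 - z)%C with (- z)%C in Hw by ring. rewrite Cmod_opp in Hw; lra. }
    field; auto.
  - exists (fun w => (- / (z * w))%C). split; [|split].
    + apply CCt_opp, CCt_inv. apply CCt_mult. apply CCt_const. apply CCt_id.
      apply Cmult_neq_0; auto.
    + auto.
    + intros w. replace (z - z)%C with (RtoC 0) by ring. ring.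
Qed.
Lemma Cdiff_inv_comp f z l : Cdiff f z l -> f z <> 0%C ->
  Cdiff (fun w => (/ f w)%C) z (- / (f z * f z) * l)%C.
Proof. intros Hf Hz. apply (Cdiff_comp (fun w => (/ w)%C)); auto. apply Cdiff_inv; auto. Qed.
Lemma Cdiff_pow f z l n : Cdiff f z l ->
  Cdiff (fun w => (f w ^ n)%C) z (INR n * f z ^ (n - 1) * l)%C.
Proof.
  intros Hf. induction n.
  - simpl. replace (0 * 1 * l)%C with (RtoC 0) by ring. apply Cdiff_const.
  - pose proof (Cdiff_mult _ _ _ _ _ Hf IHn) as H. simpl Cpow at 1.
    replace (INR (S n) * f z ^ (S n - 1) * l)%C with (l * f z ^ n + f z * (INR n * f z ^ (n - 1) * l))%C; auto.
    rewrite S_INR, RtoC_plus. replace (S n - 1)%nat with n by lia. destruct n; simpl. simpl; ring.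
    rewrite Nat.sub_0_r. ring.
Qed.
Lemma Cdiff_deriv f z l : Cdiff f z l -> deriv f z = l.
Proof. intros H. apply Cdiff_is_derive in H. apply is_C_derive_unique; auto. Qed.

Definition hol (rho : R) (f : C -> C) : Prop := forall z, Cmod z < rho -> exists l, Cdiff f z l.

Lemma hol_deriv rho f z : hol rho f -> Cmod z < rho -> Cdiff f z (deriv f z).
Proof. intros H Hz. destruct (H z Hz) as [l Hl]. rewrite (Cdiff_deriv _ _ _ Hl); auto. Qed.

Lemma analytic_hol f : analytic_on_D f <-> hol 1 f.
Proof.
  split; intros H z Hz; destruct (H z Hz) as [l Hl]; exists l; apply Cdiff_is_derive; auto.
Qed.

Lemma Cmod_circ r t : Cmod (circ r t) = Rabs r.
Proof.
  unfold Cmod, circ; simpl. replace (_ + _) with (r ^ 2 * (Rsqr (sin t) + Rsqr (cos t))) by (unfold Rsqr; ring).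
  rewrite sin2_cos2, Rmult_1_r. replace (r ^ 2) with (Rsqr r) by (unfold Rsqr; ring). apply sqrt_Rsqr_abs.
Qed.

(** The Cauchy-Riemann equations: multiplication by l, written as a real 2 by 2 matrix. *)
Lemma Cdiff_fst_2d f z l : Cdiff f z l ->
  differentiable_pt_lim (fun u v => fst (f (u, v))) (fst z) (snd z) (fst l) (- snd l) /\
  differentiable_pt_lim (fun u v => snd (f (u, v))) (fst z) (snd z) (snd l) (fst l).
Proof.
  intros H. rewrite Cdiff_eps in H.
  assert (H2 : 0 < sqrt 2) by (apply sqrt_lt_R0; lra).
  assert (K : forall eps : posreal, exists d : posreal, forall u v, Rabs (u - fst z) < d -> Rabs (v - snd z) < d ->
     Cmod (f (u, v) - f z - ((u, v) - z) * l) <= eps * Rmax (Rabs (u - fst z)) (Rabs (v - snd z))).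
  { intros eps. destruct (H (eps / sqrt 2)) as [d [Hd H']].
    { apply Rdiv_lt_0_compat; auto. apply cond_pos. }
    assert (Hd2 : 0 < d / sqrt 2) by (apply Rdiv_lt_0_compat; auto).
    exists (mkposreal _ Hd2). intros u v Hu Hv. simpl in Hu, Hv.
    pose proof (Cmod_2Rmax ((u, v) - z)%C) as HM. simpl in HM.
    change (u + - fst z) with (u - fst z) in HM. change (v + - snd z) with (v - snd z) in HM.
    eapply Rle_trans. apply H'.
    - eapply Rle_lt_trans. apply HM. replace d with (sqrt 2 * (d / sqrt 2)) by (field; lra).
      apply Rmult_lt_compat_l; auto. apply Rmax_lub_lt; auto.
    - replace (eps * Rmax (Rabs (u - fst z)) (Rabs (v - snd z))) with
        (eps / sqrt 2 * (sqrt 2 * Rmax (Rabs (u - fst z)) (Rabs (v - snd z)))) by (field; lra).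
      apply Rmult_le_compat_l; auto. left. apply Rdiv_lt_0_compat; auto. apply cond_pos. }
  split; intros eps; destruct (K eps) as [d Hd]; exists d; intros u v Hu Hv; specialize (Hd u v Hu Hv);
  eapply Rle_trans; try exact Hd; destruct z as [x y]; simpl in *;
  (eapply Rle_trans; [|apply Rmax_Cmod]).
  - eapply Rle_trans; [|apply Rmax_l]. right. f_equal. simpl. ring.
  - eapply Rle_trans; [|apply Rmax_r]. right. f_equal. simpl. ring.
Qed.

(** * Cauchy's formula *)

Definition cavg (F : R -> C) : C := (avg (fun t => fst (F t)), avg (fun t => snd (F t))).

Definition CC (F : R -> C) : Prop := forall t : R, CCt (T := R_UniformSpace) F t.

Lemma CC_fst F : CC F -> Cts (fun t : R => fst (F t)).
Proof. intros H t; apply CCt_fst; auto. Qed.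
Lemma CC_snd F : CC F -> Cts (fun t : R => snd (F t)).
Proof. intros H t; apply CCt_snd; auto. Qed.
Lemma CC_Cmod F : CC F -> Cts (fun t : R => Cmod (F t)).
Proof. intros H t; apply CCt_Cmod; auto. Qed.
Lemma CC_const c : CC (fun _ => c).
Proof. intros t; apply CCt_const. Qed.
Lemma CC_plus F G : CC F -> CC G -> CC (fun t => (F t + G t)%C).
Proof. intros HF HG t; apply CCt_plus; auto. Qed.
Lemma CC_mult F G : CC F -> CC G -> CC (fun t => (F t * G t)%C).
Proof. intros HF HG t; apply CCt_mult; auto. Qed.
Lemma CC_minus F G : CC F -> CC G -> CC (fun t => (F t - G t)%C).
Proof. intros HF HG t; apply CCt_minus; auto. Qed.
Lemma CC_inv F : CC F -> (forall t, F t <> 0%C) -> CC (fun t => (/ F t)%C).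
Proof. intros HF HG t; apply CCt_inv; auto. Qed.
Lemma CC_pow F n : CC F -> CC (fun t => (F t ^ n)%C).
Proof. intros HF t; apply CCt_pow; auto. Qed.

Lemma cavg_ext F G : (forall t, F t = G t) -> cavg F = cavg G.
Proof. intros H. unfold cavg. f_equal; apply avg_ext; intros; rewrite H; auto. Qed.
Lemma cavg_plus F G : CC F -> CC G -> cavg (fun t => (F t + G t)%C) = (cavg F + cavg G)%C.
Proof.
  intros HF HG. apply C_eq; simpl.
  - apply (avg_plus (fun t => fst (F t)) (fun t => fst (G t))); apply CC_fst; auto.
  - apply (avg_plus (fun t => snd (F t)) (fun t => snd (G t))); apply CC_snd; auto.
Qed.
Lemma cavg_scal c F : CC F -> cavg (fun t => (c * F t)%C) = (c * cavg F)%C.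
Proof.
  intros HF. pose proof (CC_fst _ HF) as H1. pose proof (CC_snd _ HF) as H2.
  apply C_eq; simpl.
  - rewrite <- !avg_scal by auto. apply avg_minus; apply Cts_mult; auto using Cts_const.
  - rewrite <- !avg_scal by auto. apply avg_plus; apply Cts_mult; auto using Cts_const.
Qed.
Lemma cavg_const c : cavg (fun _ => c) = c.
Proof. apply C_eq; simpl; apply avg_const. Qed.
Lemma cavg_minus F G : CC F -> CC G -> cavg (fun t => (F t - G t)%C) = (cavg F - cavg G)%C.
Proof.
  intros HF HG. rewrite (cavg_ext _ (fun t => (F t + (-(1)) * G t)%C)) by (intros; ring).
  rewrite cavg_plus, cavg_scal; auto. ring. apply CC_mult; auto. apply CC_const.
Qed.

Lemma Cmod_sqr z : Cmod z ^ 2 = fst z ^ 2 + snd z ^ 2.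
Proof. unfold Cmod. rewrite pow2_sqrt; auto. nra. Qed.

Lemma fst_le_Cmod z : fst z <= Cmod z.
Proof. eapply Rle_trans; [apply Rle_abs | apply (re_le_Cmod z)]. Qed.

(** With c the average, |c|^2 is the mean of the real part of conj c * F, hence at most |c| times
    the mean of |F|. Only real integrals are compared. *)
Lemma Cmod_cavg F : CC F -> Cmod (cavg F) <= avg (fun t => Cmod (F t)).
Proof.
  intros HF. set (c := cavg F). set (m := avg (fun t => Cmod (F t))).
  assert (Hm : Cmod c ^ 2 <= Cmod c * m).
  { replace (Cmod c ^ 2) with (fst (Cconj c * c)%C) by (rewrite Cmod_sqr; unfold Cconj; simpl; ring).
    unfold c at 2. rewrite <- cavg_scal by auto. simpl.
    unfold m. rewrite <- avg_scal by (apply CC_Cmod; auto).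
    apply avg_le.
    - apply (CC_fst (fun t => (Cconj c * F t)%C)). apply CC_mult; auto. apply CC_const.
    - apply Cts_mult. apply Cts_const. apply CC_Cmod; auto.
    - intros t. rewrite <- (Cmod_conj c), <- Cmod_mult. apply (fst_le_Cmod (Cconj c * F t)%C). }
  assert (0 <= m) by (apply avg_nonneg; [apply CC_Cmod; auto | intros; apply Cmod_ge_0]).
  pose proof (Cmod_ge_0 c). nra.
Qed.

Lemma Cmod_cavg_sub F c e : CC F -> (forall t, Cmod (F t - c) <= e) -> Cmod (cavg F - c) <= e.
Proof.
  intros HF He. rewrite <- (cavg_const c) at 1. rewrite <- cavg_minus by auto using CC_const.
  eapply Rle_trans. apply Cmod_cavg. apply CC_minus; auto using CC_const.
  apply avg_le_const; auto. apply CC_Cmod. apply CC_minus; auto using CC_const.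
Qed.

Lemma CCt_circ {T : UniformSpace} (r th : T -> R) x :
  continuous r x -> continuous th x -> CCt (fun t => circ (r t) (th t)) x.
Proof.
  intros Hr Hth. apply CCt_intro; unfold circ; simpl; apply ct_mult; auto.
  - apply (continuous_comp th cos); auto. apply continuous_cos.
  - apply (continuous_comp th sin); auto. apply continuous_sin.
Qed.

Lemma CC_circ r : CC (circ r).
Proof. intros t. apply (CCt_circ (fun _ => r) (fun t => t)). apply continuous_const. apply continuous_id. Qed.

Lemma CC_comp_circ f r : (forall w, Cmod w = Rabs r -> CCt (T := C_UniformSpace) f w) -> CC (fun t => f (circ r t)).
Proof.
  intros H t. apply CCt_comp. apply CC_circ. apply H. apply Cmod_circ.
Qed.

Lemma hol_cont rho f z : hol rho f -> Cmod z < rho -> CCt (T := C_UniformSpace) f z.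
Proof. intros H Hz. destruct (H z Hz) as [l Hl]. eapply Cdiff_cont; eauto. Qed.

Lemma CC_hol rho f r : hol rho f -> 0 <= r < rho -> CC (fun t => f (circ r t)).
Proof.
  intros H Hr. apply CC_comp_circ. intros w Hw. eapply hol_cont; eauto.
  rewrite Hw, Rabs_pos_eq; lra.
Qed.

Lemma differentiable_pt_lim_mult2 x y : differentiable_pt_lim (fun u v => u * v) x y y x.
Proof.
  intros eps. exists eps. intros u v Hu Hv.
  replace (u * v - x * y - (y * (u - x) + x * (v - y))) with ((u - x) * (v - y)) by ring.
  rewrite Rabs_mult. pose proof (Rabs_pos (u - x)). pose proof (Rabs_pos (v - y)).
  pose proof (Rmax_r (Rabs (u - x)) (Rabs (v - y))). nra.
Qed.

Lemma differentiable_pt_lim_of_y f x y l : derivable_pt_lim f y l ->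
  differentiable_pt_lim (fun _ v => f v) x y 0 l.
Proof.
  intros H. apply (differentiable_pt_lim_proj1_0 f y y l) in H.
  intros eps. destruct (H eps) as [d Hd]. exists d. intros u v Hu Hv.
  assert (H0 : Rabs (y - y) < d) by (rewrite Rminus_diag, Rabs_R0; apply cond_pos).
  specialize (Hd v y Hv H0). rewrite Rminus_diag, Rabs_R0 in Hd.
  rewrite Rmax_left in Hd by apply Rabs_pos.
  replace (f v - f y - (0 * (u - x) + l * (v - y))) with (f v - f y - (l * (v - y) + 0 * 0)) by ring.
  eapply Rle_trans; [exact Hd|]. apply Rmult_le_compat_l. left; apply cond_pos. apply Rmax_r.
Qed.

Lemma differentiable_pt_lim_of_x f x y l : derivable_pt_lim f x l ->
  differentiable_pt_lim (fun u _ => f u) x y l 0.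
Proof. apply (differentiable_pt_lim_proj1_0 f x y l). Qed.

Lemma differentiable_pt_lim_mult f g x y a b c d :
  differentiable_pt_lim f x y a b -> differentiable_pt_lim g x y c d ->
  differentiable_pt_lim (fun u v => f u v * g u v) x y (g x y * a + f x y * c) (g x y * b + f x y * d).
Proof.
  intros Hf Hg.
  apply (differentiable_pt_lim_comp (fun u v => u * v) f g x y (g x y) (f x y)); auto.
  apply differentiable_pt_lim_mult2.
Qed.

Lemma differentiable_pt_lim_eq f x y a b a' b' :
  differentiable_pt_lim f x y a b -> a = a' -> b = b' -> differentiable_pt_lim f x y a' b'.
Proof. intros; subst; auto. Qed.

Lemma differentiable_rcos r t : differentiable_pt_lim (fun r t => r * cos t) r t (cos t) (- r * sin t).
Proof.
  eapply differentiable_pt_lim_eq.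
  - apply (differentiable_pt_lim_mult (fun r _ => r) (fun _ t => cos t)).
    + apply (differentiable_pt_lim_of_x (fun r => r)). apply derivable_pt_lim_id.
    + apply (differentiable_pt_lim_of_y cos). apply derivable_pt_lim_cos.
  - simpl; ring.
  - simpl; ring.
Qed.
Lemma differentiable_rsin r t : differentiable_pt_lim (fun r t => r * sin t) r t (sin t) (r * cos t).
Proof.
  eapply differentiable_pt_lim_eq.
  - apply (differentiable_pt_lim_mult (fun r _ => r) (fun _ t => sin t)).
    + apply (differentiable_pt_lim_of_x (fun r => r)). apply derivable_pt_lim_id.
    + apply (differentiable_pt_lim_of_y sin). apply derivable_pt_lim_sin.
  - simpl; ring.
  - simpl; ring.
Qed.

Lemma circ_2PI r : circ r (2 * PI) = circ r 0.
Proof. unfold circ. rewrite cos_2PI, sin_2PI, cos_0, sin_0; auto. Qed.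

Lemma Cdiff_polar G r t l : Cdiff G (circ r t) l ->
  differentiable_pt_lim (fun r t => fst (G (circ r t))) r t
    (fst l * cos t - snd l * sin t) (- r * (fst l * sin t + snd l * cos t)) /\
  differentiable_pt_lim (fun r t => snd (G (circ r t))) r t
    (fst l * sin t + snd l * cos t) (r * (fst l * cos t - snd l * sin t)).
Proof.
  intros H. destruct (Cdiff_fst_2d _ _ _ H) as [H1 H2].
  change (fst (circ r t)) with ((fun r t => r * cos t) r t) in H1, H2.
  change (snd (circ r t)) with ((fun r t => r * sin t) r t) in H1, H2.
  split.
  - eapply differentiable_pt_lim_eq.
    + apply (differentiable_pt_lim_comp _ _ _ _ _ _ _ _ _ _ _ H1 (differentiable_rcos r t) (differentiable_rsin r t)).
    + ring.
    + ring.
  - eapply differentiable_pt_lim_eq.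
    + apply (differentiable_pt_lim_comp _ _ _ _ _ _ _ _ _ _ _ H2 (differentiable_rcos r t) (differentiable_rsin r t)).
    + ring.
    + ring.
Qed.

Lemma avg_eq_of_RInt_sub F G : Cts F -> Cts G ->
  RInt (fun t => F t - G t) 0 (2 * PI) = 0 -> avg F = avg G.
Proof.
  intros HF HG H. rewrite RInt_minus_R in H by auto using Cts_ex_RInt.
  unfold avg. f_equal. lra.
Qed.

(** [green_goursat] in polar coordinates: with A = Re G and B = Im G / r the polar Cauchy-Riemann
    equations give the required equality of the r-derivative of A and the angular derivative of B.
    The two radial sides, at angles 0 and 2 pi, cancel by periodicity. The imaginary part uses B = -
    Re G / r. *)
Lemma annulus_const G r1 r2 s t : 0 <= r1 -> r1 < s <= t -> t < r2 ->
  (forall w, r1 < Cmod w < r2 -> exists l, Cdiff G w l) ->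
  cavg (fun th => G (circ s th)) = cavg (fun th => G (circ t th)).
Proof.
  intros Hr1 Hs Ht HG.
  assert (HC : forall r, r1 < r < r2 -> CC (fun th => G (circ r th))).
  { intros r Hr. apply CC_comp_circ. intros w Hw. rewrite Rabs_pos_eq in Hw by lra.
    destruct (HG w) as [l Hl]. lra. eapply Cdiff_cont; eauto. }
  pose proof PI_RGT_0.
  assert (Hinv : forall x y, 0 < x -> differentiable_pt_lim (fun x _ => / x) x y (- / x ^ 2) 0).
  { intros x y Hx. apply (differentiable_pt_lim_of_x Rinv). apply is_derive_Reals.
    replace (- / x ^ 2) with (- (1) * / (x * x)) by (field; lra). auto_derive; [lra | reflexivity]. }
  assert (Hinv2 : forall x y, 0 < x -> differentiable_pt_lim (fun x _ => - / x) x y (/ x ^ 2) 0).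
  { intros x y Hx. apply (differentiable_pt_lim_of_x (fun x => - / x)). apply is_derive_Reals.
    replace (/ x ^ 2) with (- (- (1) * / (x * x))) by (field; lra). auto_derive; [lra | reflexivity]. }
  symmetry. apply C_eq; simpl; apply avg_eq_of_RInt_sub;
    try (first [apply CC_fst | apply CC_snd]; apply HC; lra).
  - rewrite (green_goursat (fun r th => fst (G (circ r th))) (fun r th => / r * snd (G (circ r th)))); try lra.
    + apply RInt_zero.
      intros x. rewrite circ_2PI. ring.
    + intros x y Hx Hy. destruct (HG (circ x y)) as [l Hl].
      { rewrite Cmod_circ, Rabs_pos_eq; lra. }
      destruct (Cdiff_polar _ _ _ _ Hl) as [D1 D2].
      do 3 eexists. split. exact D1.
      eapply differentiable_pt_lim_eq.
      * apply (differentiable_pt_lim_mult (fun x _ => / x) _ _ _ _ _ _ _ (Hinv x y ltac:(lra)) D2).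
      * reflexivity.
      * simpl. field. lra.
  - rewrite (green_goursat (fun r th => snd (G (circ r th))) (fun r th => - / r * fst (G (circ r th)))); try lra.
    + apply RInt_zero.
      intros x. rewrite circ_2PI. ring.
    + intros x y Hx Hy. destruct (HG (circ x y)) as [l Hl].
      { rewrite Cmod_circ, Rabs_pos_eq; lra. }
      destruct (Cdiff_polar _ _ _ _ Hl) as [D1 D2].
      do 3 eexists. split. exact D2.
      eapply differentiable_pt_lim_eq.
      * apply (differentiable_pt_lim_mult (fun x _ => - / x) _ _ _ _ _ _ _ (Hinv2 x y ltac:(lra)) D1).
      * simpl. reflexivity.
      * simpl. field. lra.
Qed.

Lemma Cmod_eq_of_small (a b : C) : (forall e, 0 < e -> Cmod (a - b) <= e) -> a = b.
Proof.
  intros H. assert (Cmod (a - b) = 0).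
  { apply Rle_antisym; [|apply Cmod_ge_0]. apply Rle_plus_epsilon. intros e He.
    rewrite Rplus_0_l; auto. }
  apply Cmod_eq_0 in H0. replace a with (a - b + b)%C by ring. rewrite H0; ring.
Qed.

Lemma circ_0 t : circ 0 t = 0%C.
Proof. apply C_eq; unfold circ; simpl; ring. Qed.

(** The average may be moved to a circle so small that G differs there from its value at 0 by less
    than e. *)
Lemma mean_value G rho r : hol rho G -> 0 <= r < rho -> cavg (fun t => G (circ r t)) = G 0%C.
Proof.
  intros HG Hr. destruct (Req_dec r 0) as [->|Hr0].
  - rewrite (cavg_ext _ (fun _ => G 0%C)). apply cavg_const. intros; rewrite circ_0; auto.
  - apply Cmod_eq_of_small. intros e He.
    assert (H0 : Cmod 0 < rho) by (rewrite Cmod_0; lra).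
    destruct (proj1 (CCt_eps G 0%C) (hol_cont _ _ _ HG H0) e He) as [d [Hd H]].
    set (s := Rmin r (d / 2)).
    assert (Hs : 0 < s <= r /\ s < d).
    { unfold s. pose proof (Rmin_l r (d / 2)). pose proof (Rmin_r r (d / 2)).
      pose proof (Rmin_pos r (d / 2) ltac:(lra) ltac:(lra)). lra. }
    rewrite <- (annulus_const G 0 rho s r); try lra; [|intros w Hw; apply HG; lra].
    apply Cmod_cavg_sub. apply (CC_hol rho); auto; lra.
    intros t. left. apply H. replace (circ s t - 0)%C with (circ s t) by ring.
    rewrite Cmod_circ, Rabs_pos_eq; lra.
Qed.

(** Serves to cross, in Cauchy's formula, the one circle on which the integrand is merely
    continuous. *)
Lemma cavg_circ_continuous F r0 : 0 < r0 ->
  (exists e, 0 < e /\ forall w, Rabs (Cmod w - r0) < e -> CCt (T := C_UniformSpace) F w) ->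
  forall e, 0 < e -> exists d, 0 < d /\ forall r, Rabs (r - r0) < d ->
    Cmod (cavg (fun t => F (circ r t)) - cavg (fun t => F (circ r0 t))) <= e.
Proof.
  intros Hr0 [e0 [He0 HF]] e He.
  assert (Hloc : forall r, Rabs (r - r0) < Rmin e0 r0 -> CC (fun t => F (circ r t))).
  { intros r Hr. pose proof (Rmin_l e0 r0). pose proof (Rmin_r e0 r0).
    assert (0 < r) by (apply Rabs_def2 in Hr; lra).
    apply CC_comp_circ. intros w Hw. apply HF. rewrite Hw, (Rabs_pos_eq r) by lra. lra. }
  assert (Hm : 0 < Rmin e0 r0) by (apply Rmin_pos; lra).
  assert (Hc0 : forall t, CCt (T := prod_UniformSpace R_UniformSpace R_UniformSpace)
             (fun p : R * R => F (circ (fst p) (snd p))) (r0, t)).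
  { intros t. apply CCt_comp.
    - apply CCt_circ. apply continuous_fst_comp, continuous_id. apply continuous_snd_comp, continuous_id.
    - apply HF. simpl. rewrite Cmod_circ, (Rabs_pos_eq r0), Rminus_diag, Rabs_R0 by lra. lra. }
  assert (K : forall pr : C -> R, (pr = fst \/ pr = snd) ->
     continuous (fun r => RInt (fun t => pr (F (circ r t))) 0 (2 * PI)) r0).
  { intros pr Hpr. apply (RInt_param_continuous (T := R_UniformSpace)).
    - left; apply PI2_pos.
    - intros t _. destruct Hpr as [-> | ->]; [apply (CCt_fst _ _ (Hc0 t)) | apply (CCt_snd _ _ (Hc0 t))].
    - exists (mkposreal _ Hm). intros r Hr. apply Cts_ex_RInt.
      destruct Hpr as [-> | ->]; [apply CC_fst | apply CC_snd]; apply Hloc; exact Hr. }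
  assert (K2 : CCt (T := R_UniformSpace) (fun r => cavg (fun t => F (circ r t))) r0).
  { apply CCt_intro; unfold cavg, avg; simpl; apply ct_mult; try apply continuous_const; apply K; auto. }
  pose proof (CCt_Cmod _ _ (CCt_minus _ _ _ K2 (CCt_const (cavg (fun t => F (circ r0 t))) r0))) as K3.
  cbv beta in K3.
  destruct (proj1 (filterlim_locally _ _) K3 (mkposreal _ He)) as [d Hd].
  exists d. split. apply cond_pos. intros r Hr. specialize (Hd r Hr).
  change (Rabs (Cmod (cavg (fun t => F (circ r t)) - cavg (fun t => F (circ r0 t))) -
     Cmod (cavg (fun t => F (circ r0 t)) - cavg (fun t => F (circ r0 t)))) < e) in Hd.
  replace (cavg (fun t => F (circ r0 t)) - cavg (fun t => F (circ r0 t)))%C with (RtoC 0) in Hd by ring.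
  rewrite Cmod_0, Rminus_0_r in Hd. apply Rabs_def2 in Hd. lra.
Qed.

Lemma Cmod_minus_ge (w z : C) : Cmod w - Cmod z <= Cmod (w - z).
Proof.
  pose proof (Cmod_triangle (w - z) z). replace (w - z + z)%C with w in H by ring. lra.
Qed.

Lemma Cmod_gt_neq (w z : C) : Cmod z < Cmod w -> (w - z)%C <> 0%C.
Proof. intros H. apply Cmod_gt_0. pose proof (Cmod_minus_ge w z). lra. Qed.

Lemma Cmod_minus_sym (w z : C) : Cmod (w - z) = Cmod (z - w).
Proof. rewrite <- Cmod_opp. f_equal. ring. Qed.

(** The circle is blown up to a radius [R] with |z| / (R - |z|) <= e, where w / (w - z) is within e
    of 1. *)
Lemma cauchy_kernel z r : Cmod z < r -> cavg (fun t => (circ r t * / (circ r t - z))%C) = 1%C.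
Proof.
  intros Hz. pose proof (Cmod_ge_0 z).
  set (G := fun w : C => (w * / (w - z))%C).
  assert (HG : forall w, Cmod z < Cmod w -> exists l, Cdiff G w l).
  { intros w Hw. eexists. apply Cdiff_mult. apply Cdiff_id.
    apply (Cdiff_inv_comp (fun w => (w - z)%C)). apply Cdiff_minus. apply Cdiff_id. apply Cdiff_const.
    apply Cmod_gt_neq; auto. }
  apply Cmod_eq_of_small. intros e He.
  set (R := r + (Cmod z + 1) / e + Cmod z).
  assert (HR : 0 < (Cmod z + 1) / e) by (apply Rdiv_lt_0_compat; lra).
  change (Cmod (cavg (fun t => G (circ r t)) - 1) <= e).
  rewrite (annulus_const G (Cmod z) (R + 1) r R); try (unfold R; lra).
  2:{ intros w Hw; apply HG; lra. }
  apply Cmod_cavg_sub.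
  - apply CC_comp_circ. intros w Hw. rewrite Rabs_pos_eq in Hw by (unfold R; lra).
    destruct (HG w) as [l Hl]. rewrite Hw; unfold R; lra. eapply Cdiff_cont; eauto.
  - intros t. unfold G. set (w := circ R t).
    assert (Hw : Cmod w = R) by (unfold w; rewrite Cmod_circ, Rabs_pos_eq; unfold R; lra).
    assert (Hn : (w - z)%C <> 0%C) by (apply Cmod_gt_neq; rewrite Hw; unfold R; lra).
    replace (w * / (w - z) - 1)%C with (z / (w - z))%C by (field; auto).
    rewrite Cmod_div by auto. pose proof (Cmod_minus_ge w z) as Hge. rewrite Hw in Hge.
    apply Cmod_gt_0 in Hn. apply Rmult_le_reg_r with (Cmod (w - z)); auto.
    unfold Rdiv; rewrite Rmult_assoc, Rinv_l, Rmult_1_r by lra.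
    assert (e * (R - Cmod z) <= e * Cmod (w - z)) by (apply Rmult_le_compat_l; lra).
    assert (e * ((Cmod z + 1) / e) = Cmod z + 1) by (field; lra).
    unfold R in H0. nra.
Qed.

(** With q the slope function of f at z, F w = w * q w is analytic off z and continuous at z. Its
    averages are F 0 = 0 on circles inside |w| = |z|, constant on circles outside, and both agree by
    continuity in the radius. So the average of F vanishes, and what remains is f z times the
    average of the kernel. *)
Lemma cauchy_formula f rho z r : hol rho f -> Cmod z < r < rho ->
  cavg (fun t => (f (circ r t) * (circ r t * / (circ r t - z)))%C) = f z.
Proof.
  intros Hf Hr. pose proof (Cmod_ge_0 z) as Hz0.
  destruct (Hf z) as [l [q [Hq [_ Hfq]]]]; [lra|].
  set (F := fun w => (w * q w)%C).
  assert (HFd : forall w, w <> z -> Cmod w < rho -> exists l, Cdiff F w l).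
  { intros w Hw Hwr. destruct (Hf w Hwr) as [m Hm]. pose proof (Cminus_neq0 _ _ Hw) as Hn.
    eexists. apply Cdiff_mult. apply Cdiff_id.
    apply (Cdiff_ext_loc (fun w => ((f w - f z) * / (w - z))%C)) with (r := Cmod (w - z)).
    - apply Cmod_gt_0; auto.
    - intros v Hv. assert (Hv' : (v - z)%C <> 0%C).
      { intros E. replace (w - z)%C with ((v - z) - (v - w))%C in Hv by ring. rewrite E in Hv.
        replace (0 - (v - w))%C with (- (v - w))%C in Hv by ring. rewrite Cmod_opp in Hv. lra. }
      rewrite (Hfq v). field; auto.
    - apply Cdiff_mult. apply Cdiff_minus. exact Hm. apply Cdiff_const.
      apply (Cdiff_inv_comp (fun w => (w - z)%C)). apply Cdiff_minus. apply Cdiff_id. apply Cdiff_const. auto. }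
  assert (HFc : forall w, Cmod w < rho -> CCt (T := C_UniformSpace) F w).
  { intros w Hw. destruct (excluded_middle_informative (w = z)) as [->|Hn].
    - apply CCt_mult; auto. apply CCt_id.
    - destruct (HFd w Hn Hw) as [m Hm]. eapply Cdiff_cont; eauto. }
  assert (HFC : forall s, 0 <= s < rho -> CC (fun t => F (circ s t))).
  { intros s Hs. apply CC_comp_circ. intros w Hw. apply HFc. rewrite Hw, Rabs_pos_eq; lra. }
  assert (HF0 : F 0%C = 0%C) by (unfold F; ring).
  assert (HI : cavg (fun t => F (circ r t)) = 0%C).
  { destruct (Req_dec (Cmod z) 0) as [Hz|Hz].
    (* For z = 0 there are no circles inside; here F = f - f 0 and the mean value property
       suffices. *)
    - apply Cmod_eq_0 in Hz. subst z.
      rewrite (cavg_ext _ (fun t => (f (circ r t) - f 0)%C)).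
      + rewrite (mean_value (fun w => (f w - f 0)%C) rho r); [ring| |lra].
        intros w Hw. destruct (Hf w Hw) as [m Hm]. eexists. apply Cdiff_minus. exact Hm. apply Cdiff_const.
      + intros t. unfold F. rewrite (Hfq (circ r t)). ring.
    - assert (I1 : forall s, 0 < s < Cmod z -> cavg (fun t => F (circ s t)) = 0%C).
      { intros s Hs. rewrite <- HF0. apply (mean_value F (Cmod z)); [|lra].
        intros w Hw. apply HFd; [|lra]. intros ->; lra. }
      assert (I2 : forall s, Cmod z < s < rho -> cavg (fun t => F (circ s t)) = cavg (fun t => F (circ r t))).
      { intros s Hs. assert (HA : forall w, Cmod z < Cmod w < rho -> exists l, Cdiff F w l).
        { intros w Hw. apply HFd; [|lra]. intros ->; lra. }
        destruct (Rle_dec s r); [|symmetry]; apply (annulus_const F (Cmod z) rho); auto; lra. }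
      apply Cmod_eq_of_small. intros e He.
      destruct (cavg_circ_continuous F (Cmod z)) with (e := e / 2) as [d [Hd Hc]]; try lra.
      { exists (rho - Cmod z). split. lra. intros w Hw. apply HFc. apply Rabs_def2 in Hw. lra. }
      (* The circles of radii |z| - d' and |z| + d' lie on either side of z, inside the domain, and
         within reach of the continuity estimate. *)
      set (d' := Rmin (d / 2) (Rmin (Cmod z / 2) ((rho - Cmod z) / 2))).
      assert (Hd' : 0 < d' /\ d' < d /\ d' < Cmod z /\ d' < rho - Cmod z).
      { unfold d'. pose proof (Rmin_l (d / 2) (Rmin (Cmod z / 2) ((rho - Cmod z) / 2))).
        pose proof (Rmin_r (d / 2) (Rmin (Cmod z / 2) ((rho - Cmod z) / 2))).
        pose proof (Rmin_l (Cmod z / 2) ((rho - Cmod z) / 2)).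
        pose proof (Rmin_r (Cmod z / 2) ((rho - Cmod z) / 2)).
        assert (0 < Rmin (d / 2) (Rmin (Cmod z / 2) ((rho - Cmod z) / 2))) by (repeat apply Rmin_pos; lra).
        lra. }
      pose proof (Hc (Cmod z - d')) as H1. pose proof (Hc (Cmod z + d')) as H2.
      rewrite I1 in H1 by lra. rewrite I2 in H2 by lra.
      assert (B1 : Rabs (Cmod z - d' - Cmod z) < d) by (apply Rabs_def1; lra).
      assert (B2 : Rabs (Cmod z + d' - Cmod z) < d) by (apply Rabs_def1; lra).
      specialize (H1 B1). specialize (H2 B2). revert H1 H2.
      set (u := cavg (fun t => F (circ r t))). set (v := cavg (fun t => F (circ (Cmod z) t))).
      intros H1 H2. replace (u - 0)%C with ((u - v) - (0 - v))%C by ring.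
      pose proof (Cmod_triangle (u - v) (- (0 - v))). rewrite Cmod_opp in H.
      change ((u - v) - (0 - v))%C with ((u - v) + - (0 - v))%C. lra. }
  assert (Hn : forall t, (circ r t - z)%C <> 0%C).
  { intros t. apply Cmod_gt_neq. rewrite Cmod_circ, Rabs_pos_eq; lra. }
  assert (HK : CC (fun t => (circ r t * / (circ r t - z))%C)).
  { apply CC_mult. apply CC_circ. apply CC_inv; auto. apply CC_minus; [apply CC_circ | apply CC_const]. }
  rewrite (cavg_ext _ (fun t => (F (circ r t) + f z * (circ r t * / (circ r t - z)))%C)).
  - rewrite (cavg_plus (fun t => F (circ r t)) (fun t => (f z * (circ r t * / (circ r t - z)))%C)).
    + rewrite (cavg_scal (f z) _ HK), HI, cauchy_kernel by lra. ring.
    + apply HFC; lra.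
    + apply CC_mult; [apply CC_const | exact HK].
  - intros t. unfold F. rewrite (Hfq (circ r t)). field. apply Hn.
Qed.

(** * Power series *)

(** Sums of exactly n terms, whereas [sum_n] has n + 1; the empty sum starts the inductions. *)
Fixpoint Csumb (a : nat -> C) (n : nat) : C :=
  match n with O => 0%C | S n => (Csumb a n + a n)%C end.

Fixpoint Rsumb (a : nat -> R) (n : nat) : R :=
  match n with O => 0 | S n => Rsumb a n + a n end.

(** [Series] is real and total, so this value is meaningful when both coordinate series converge;
    [absC] guarantees that. *)
Definition CSer (a : nat -> C) : C := (Series (fun n => fst (a n)), Series (fun n => snd (a n))).

Definition absC (a : nat -> C) : Prop := ex_series (fun n => Cmod (a n)).

Lemma Rabs_fst_le z : Rabs (fst z) <= Cmod z.
Proof. apply (re_le_Cmod z). Qed.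
Lemma Rabs_snd_le z : Rabs (snd z) <= Cmod z.
Proof. eapply Rle_trans; [apply (Rmax_r (Rabs (fst z))) | apply Rmax_Cmod]. Qed.
Lemma Cmod_le_abs z : Cmod z <= Rabs (fst z) + Rabs (snd z).
Proof.
  pose proof (Rabs_pos (fst z)). pose proof (Rabs_pos (snd z)).
  apply Rsqr_incr_0_var; [|lra].
  rewrite !Rsqr_pow2, Cmod_sqr, <- (pow2_abs (fst z)), <- (pow2_abs (snd z)). nra.
Qed.

Lemma absC_fst a : absC a -> ex_series (fun n => fst (a n)).
Proof. intros H. eapply (ex_series_le (K := R_AbsRing) (V := R_CompleteNormedModule)); [|exact H]. intros n; apply Rabs_fst_le. Qed.
Lemma absC_snd a : absC a -> ex_series (fun n => snd (a n)).
Proof. intros H. eapply (ex_series_le (K := R_AbsRing) (V := R_CompleteNormedModule)); [|exact H]. intros n; apply Rabs_snd_le. Qed.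

Lemma ex_series_le_R (a b : nat -> R) : (forall n, 0 <= a n <= b n) -> ex_series b -> ex_series a.
Proof.
  intros H Hb. eapply (ex_series_le (K := R_AbsRing) (V := R_CompleteNormedModule)); [|exact Hb].
  intros n. destruct (H n). change (Rabs (a n) <= b n). rewrite Rabs_pos_eq; auto.
Qed.

Lemma absC_le a b : (forall n, Cmod (a n) <= b n) -> ex_series b -> absC a.
Proof. intros H Hb. eapply ex_series_le_R; [|exact Hb]. intros n; split; auto. apply Cmod_ge_0. Qed.

Lemma absC_plus a b : absC a -> absC b -> absC (fun n => (a n + b n)%C).
Proof.
  intros Ha Hb. eapply absC_le; [intros n; apply Cmod_triangle|].
  apply (ex_series_plus (fun n => Cmod (a n)) (fun n => Cmod (b n))); auto.
Qed.
Lemma ex_series_scal_R c (a : nat -> R) : ex_series a -> ex_series (fun n => c * a n).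
Proof. intros H. apply (ex_series_scal c a); auto. Qed.
Lemma absC_scal c a : absC a -> absC (fun n => (c * a n)%C).
Proof.
  intros Ha. eapply absC_le; [intros n; rewrite Cmod_mult; apply Rle_refl|].
  apply ex_series_scal_R; auto.
Qed.
Lemma CSer_ext a b : (forall n, a n = b n) -> CSer a = CSer b.
Proof. intros H. unfold CSer. f_equal; apply Series_ext; intros; rewrite H; auto. Qed.
Lemma CSer_plus a b : absC a -> absC b -> CSer (fun n => (a n + b n)%C) = (CSer a + CSer b)%C.
Proof.
  intros Ha Hb. apply C_eq; simpl; apply Series_plus; auto using absC_fst, absC_snd.
Qed.
Lemma CSer_scal c a : absC a -> CSer (fun n => (c * a n)%C) = (c * CSer a)%C.
Proof.
  intros Ha. pose proof (absC_fst _ Ha). pose proof (absC_snd _ Ha). apply C_eq; simpl.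
  - rewrite Series_minus by (apply ex_series_scal_R; auto). rewrite !Series_scal_l; auto.
  - rewrite Series_plus by (apply ex_series_scal_R; auto). rewrite !Series_scal_l; auto.
Qed.
Lemma CSer_minus a b : absC a -> absC b -> CSer (fun n => (a n - b n)%C) = (CSer a - CSer b)%C.
Proof.
  intros Ha Hb. rewrite (CSer_ext _ (fun n => (a n + (-(1)) * b n)%C)) by (intros; ring).
  rewrite CSer_plus, CSer_scal; auto. ring. apply absC_scal; auto.
Qed.

Lemma is_series_lim (a : nat -> R) l : is_series a l <-> is_lim_seq (Rsumb a) l.
Proof.
  assert (E : forall n, sum_n a n = Rsumb a (S n)).
  { induction n. rewrite sum_O. simpl; ring. rewrite sum_Sn, IHn. simpl. reflexivity. }
  split.
  - intros H. apply is_lim_seq_incr_1. apply (is_lim_seq_ext (sum_n a)); auto.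
  - intros H. apply is_lim_seq_incr_1 in H. apply (is_lim_seq_ext _ (sum_n a)) in H; auto.
Qed.

Lemma ex_series_lim (a : nat -> R) : ex_series a -> is_lim_seq (Rsumb a) (Series a).
Proof. intros H. apply is_series_lim. apply Series_correct; auto. Qed.

Lemma Rsumb_le a b n : (forall k, (k < n)%nat -> a k <= b k) -> Rsumb a n <= Rsumb b n.
Proof.
  induction n; simpl; intros H. lra. specialize (IHn ltac:(intros; apply H; lia)).
  specialize (H n ltac:(lia)). lra.
Qed.
Lemma Rsumb_ext a b n : (forall k, (k < n)%nat -> a k = b k) -> Rsumb a n = Rsumb b n.
Proof.
  induction n; simpl; intros H; auto. rewrite IHn by (intros; apply H; lia). rewrite H by lia; auto.
Qed.
Lemma Rsumb_ge0 a n : (forall k, 0 <= a k) -> 0 <= Rsumb a n.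
Proof. intros H. induction n; simpl. lra. specialize (H n); lra. Qed.
Lemma Rsumb_plus a b n : Rsumb (fun k => a k + b k) n = Rsumb a n + Rsumb b n.
Proof. induction n; simpl; lra. Qed.
Lemma Rsumb_scal c a n : Rsumb (fun k => c * a k) n = c * Rsumb a n.
Proof. induction n; simpl; lra. Qed.
Lemma Rsumb_mono a n m : (forall k, 0 <= a k) -> (n <= m)%nat -> Rsumb a n <= Rsumb a m.
Proof. intros H Hnm. induction Hnm. lra. simpl. specialize (H m). lra. Qed.

Lemma Rsumb_le_Series a n : (forall k, 0 <= a k) -> ex_series a -> Rsumb a n <= Series a.
Proof.
  intros H Ha. pose proof (ex_series_lim a Ha) as HL.
  apply (is_lim_seq_incr_n _ n) in HL.
  apply (is_lim_seq_le (fun _ => Rsumb a n) (fun k => Rsumb a (k + n)) (Rsumb a n) (Series a)); auto.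
  - intros k. apply Rsumb_mono; auto. lia.
  - apply is_lim_seq_const.
Qed.

Lemma Series_le_bound a M : ex_series a -> (forall n, Rsumb a n <= M) -> Series a <= M.
Proof.
  intros Ha H. apply (is_lim_seq_le (Rsumb a) (fun _ => M) (Series a) M); auto.
  apply ex_series_lim; auto. apply is_lim_seq_const.
Qed.

Lemma Series_ge0 a : (forall n, 0 <= a n) -> ex_series a -> 0 <= Series a.
Proof. intros H Ha. apply (Rsumb_le_Series a 0 H Ha). Qed.

Lemma ex_series_bounded a M : (forall k, 0 <= a k) -> (forall n, Rsumb a n <= M) -> ex_series a.
Proof.
  intros H HM. assert (E : ex_finite_lim_seq (Rsumb a)).
  { apply ex_finite_lim_seq_incr with M; auto. intros n. simpl. specialize (H n); lra. }
  destruct E as [l Hl]. exists l. apply is_series_lim; auto.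
Qed.

Lemma Csumb_fst a n : fst (Csumb a n) = Rsumb (fun k => fst (a k)) n.
Proof. induction n; simpl; auto. rewrite IHn; auto. Qed.
Lemma Csumb_snd a n : snd (Csumb a n) = Rsumb (fun k => snd (a k)) n.
Proof. induction n; simpl; auto. rewrite IHn; auto. Qed.
Lemma Csumb_ext a b n : (forall k, (k < n)%nat -> a k = b k) -> Csumb a n = Csumb b n.
Proof.
  induction n; simpl; intros H; auto. rewrite IHn by (intros; apply H; lia). rewrite H by lia; auto.
Qed.
Lemma Cmod_Csumb a n : Cmod (Csumb a n) <= Rsumb (fun k => Cmod (a k)) n.
Proof.
  induction n; simpl. rewrite Cmod_0; lra. eapply Rle_trans; [apply Cmod_triangle|]. lra.
Qed.

Lemma CSer_lim a : absC a -> forall eps, 0 < eps -> exists N, forall n, (N <= n)%nat ->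
  Cmod (Csumb a n - CSer a) < eps.
Proof.
  intros Ha eps He.
  pose proof (ex_series_lim _ (absC_fst _ Ha)) as H1. pose proof (ex_series_lim _ (absC_snd _ Ha)) as H2.
  apply is_lim_seq_spec in H1. apply is_lim_seq_spec in H2.
  assert (He2 : 0 < eps / 2) by lra.
  destruct (H1 (mkposreal _ He2)) as [N1 HN1]. destruct (H2 (mkposreal _ He2)) as [N2 HN2].
  exists (Nat.max N1 N2). intros n Hn. eapply Rle_lt_trans; [apply Cmod_le_abs|].
  change (Rabs (fst (Csumb a n) - fst (CSer a)) + Rabs (snd (Csumb a n) - snd (CSer a)) < eps).
  rewrite Csumb_fst, Csumb_snd. specialize (HN1 n ltac:(lia)). specialize (HN2 n ltac:(lia)).
  simpl in *. lra.
Qed.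

Lemma CSer_unique a l :
  (forall eps, 0 < eps -> exists N, forall n, (N <= n)%nat -> Cmod (Csumb a n - l) < eps) -> CSer a = l.
Proof.
  intros H. apply C_eq; simpl; apply is_series_unique, is_series_lim, is_lim_seq_spec; intros eps;
  destruct (H eps (cond_pos eps)) as [N HN]; exists N; intros n Hn; specialize (HN n Hn);
  eapply Rle_lt_trans; try exact HN.
  - rewrite <- Csumb_fst. apply (Rabs_fst_le (Csumb a n - l)%C).
  - rewrite <- Csumb_snd. apply (Rabs_snd_le (Csumb a n - l)%C).
Qed.

Lemma Cmod_CSer a : absC a -> Cmod (CSer a) <= Series (fun n => Cmod (a n)).
Proof.
  intros Ha. apply Rle_plus_epsilon. intros e He.
  destruct (CSer_lim a Ha e He) as [N HN]. specialize (HN N (le_n N)).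
  pose proof (Cmod_Csumb a N). pose proof (Rsumb_le_Series _ N (fun k => Cmod_ge_0 (a k)) Ha).
  pose proof (Cmod_minus_ge (CSer a) (Csumb a N)). rewrite Cmod_minus_sym in HN. lra.
Qed.

Lemma Cmod_CSer_le a b : (forall n, Cmod (a n) <= b n) -> ex_series b -> Cmod (CSer a) <= Series b.
Proof.
  intros H Hb. pose proof (absC_le _ _ H Hb). eapply Rle_trans; [apply Cmod_CSer; auto|].
  apply Series_le; auto. intros n; split; auto. apply Cmod_ge_0.
Qed.

(** All second-order remainders share the factor |w - z|^2 with summable constants, so the remainder
    of the sum is again of second order. No uniform convergence of difference quotients is
    involved. *)
Lemma Cdiff_CSer (F : nat -> C -> C) (D : nat -> C) (M : nat -> R) z d :
  0 < d -> ex_series M -> absC D -> (forall w, Cmod (w - z) < d -> absC (fun n => F n w)) ->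
  (forall n w, Cmod (w - z) < d -> Cmod (F n w - F n z - (w - z) * D n) <= M n * Cmod (w - z) ^ 2) ->
  Cdiff (fun w => CSer (fun n => F n w)) z (CSer D).
Proof.
  intros Hd HM HD HF HR. apply Cdiff_eps. intros eps He.
  (* The sign of each M n is read off the remainder bound at w = z + d/2. *)
  assert (M0 : 0 <= Series M).
  { apply Series_ge0; auto. intros n.
    specialize (HR n (z + RtoC (d / 2))%C).
    replace (z + (d / 2)%R - z)%C with (RtoC (d / 2)) in HR by ring.
    rewrite Cmod_R, Rabs_pos_eq in HR by lra. specialize (HR ltac:(lra)).
    assert (0 <= M n * (d / 2) ^ 2) by (eapply Rle_trans; [apply Cmod_ge_0 | exact HR]).
    assert (0 < (d / 2) ^ 2) by (apply pow_lt; lra). nra. }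
  exists (Rmin d (eps / (Series M + 1))). split.
  { apply Rmin_pos; auto. apply Rdiv_lt_0_compat; lra. }
  intros w Hw. pose proof (Rmin_l d (eps / (Series M + 1))). pose proof (Rmin_r d (eps / (Series M + 1))).
  assert (Hz : Cmod (z - z) < d) by (replace (z - z)%C with (RtoC 0) by ring; rewrite Cmod_0; auto).
  pose proof (HF w ltac:(lra)) as Aw. pose proof (HF z Hz) as Az.
  rewrite <- CSer_minus by auto. rewrite <- CSer_scal by auto.
  rewrite <- CSer_minus.
  - pose proof (Cmod_ge_0 (w - z)). eapply Rle_trans.
    + apply (Cmod_CSer_le _ (fun n => Cmod (w - z) ^ 2 * M n)).
      intros n. rewrite Rmult_comm. apply HR; lra. apply ex_series_scal_R; auto.
    + rewrite Series_scal_l.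
      assert (Cmod (w - z) * Series M <= eps).
      { apply Rle_trans with (eps / (Series M + 1) * (Series M + 1)).
        apply Rmult_le_compat; lra. right; field; lra. }
      nra.
  - apply (absC_plus _ (fun n => (- F n z)%C)); auto. eapply absC_le; [|exact Az]. intros; rewrite Cmod_opp; lra.
  - apply absC_scal; auto.
Qed.

(* The binomial remainder, controlled through the same identity for nonnegative reals. *)
Lemma pow_second_order (z h : C) d k : 0 < d -> Cmod h <= d ->
  Cmod ((z + h) ^ k - z ^ k - h * (INR k * z ^ (k - 1))) <=
    (Cmod h / d) ^ 2 * ((Cmod z + d) ^ k - Cmod z ^ k - INR k * d * Cmod z ^ (k - 1)) /\
  INR k * d * Cmod z ^ (k - 1) <= (Cmod z + d) ^ k.
Proof.
  intros Hd Hh. pose proof (Cmod_ge_0 z) as Hz. pose proof (Cmod_ge_0 h) as Hh0.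
  set (E := fun k => (Cmod z + d) ^ k - Cmod z ^ k - INR k * d * Cmod z ^ (k - 1)).
  assert (H : Cmod ((z + h) ^ k - z ^ k - h * (INR k * z ^ (k - 1))) <= (Cmod h / d) ^ 2 * E k /\ 0 <= E k).
  { induction k.
    - unfold E; simpl. split; [|lra].
      replace (1 - 1 - h * (0 * 1))%C with (RtoC 0) by ring. rewrite Cmod_0. nra.
    - destruct IHk as [IH1 IH2].
      assert (Hp : (INR k * z ^ k = z * (INR k * z ^ (k - 1)))%C).
      { destruct k; simpl. ring. rewrite Nat.sub_0_r. ring. }
      assert (HpR : INR k * Cmod z ^ k = Cmod z * (INR k * Cmod z ^ (k - 1))).
      { destruct k; simpl. ring. rewrite Nat.sub_0_r. ring. }
      assert (HE : E (S k) = (Cmod z + d) * E k + INR k * d ^ 2 * Cmod z ^ (k - 1)).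
      { unfold E. replace (S k - 1)%nat with k by lia. rewrite S_INR. simpl pow.
        replace ((INR k + 1) * d * Cmod z ^ k) with (d * (INR k * Cmod z ^ k) + d * Cmod z ^ k) by ring.
        rewrite HpR. ring. }
      assert (P0 : 0 <= INR k * d ^ 2 * Cmod z ^ (k - 1)).
      { apply Rmult_le_pos; [apply Rmult_le_pos|]; [apply pos_INR | nra | apply pow_le; auto]. }
      split; [|rewrite HE; nra].
      replace ((z + h) ^ S k - z ^ S k - h * (INR (S k) * z ^ (S k - 1)))%C
        with ((z + h) * ((z + h) ^ k - z ^ k - h * (INR k * z ^ (k - 1))) + INR k * h ^ 2 * z ^ (k - 1))%C.
      2:{ replace (S k - 1)%nat with k by lia. rewrite S_INR, RtoC_plus. simpl Cpow.
          replace (h * ((INR k + 1) * z ^ k))%C with (h * (INR k * z ^ k) + h * z ^ k)%C by ring.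
          rewrite Hp. ring. }
      eapply Rle_trans; [apply Cmod_triangle|]. rewrite !Cmod_mult, Cmod_R, (Rabs_pos_eq (INR k)) by apply pos_INR.
      rewrite !Cmod_pow, HE.
      pose proof (Cmod_triangle z h). rewrite Rmult_plus_distr_l. apply Rplus_le_compat.
      + apply Rle_trans with ((Cmod z + d) * ((Cmod h / d) ^ 2 * E k)); [|right; ring].
        apply Rmult_le_compat; auto; try apply Cmod_ge_0. lra.
      + right. field. lra. }
  destruct H as [H1 H2]. split; auto. unfold E in H2.
  pose proof (pow_le (Cmod z) k Hz). lra.
Qed.

Definition PS (a : nat -> C) (z : C) : C := CSer (fun k => (a k * z ^ k)%C).

(** Radius of convergence at least 1 in Abel's form: terms bounded at every smaller radius. This is
    what Cauchy's estimates provide directly. *)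
Definition radius1 (a : nat -> C) : Prop :=
  forall rho, 0 < rho < 1 -> exists K, forall k, Cmod (a k) * rho ^ k <= K.

Definition PSd (a : nat -> C) (k : nat) : C := (INR (S k) * a (S k))%C.

Lemma radius1_series a rho : radius1 a -> 0 <= rho < 1 -> ex_series (fun k => Cmod (a k) * rho ^ k).
Proof.
  intros Ha Hr. set (s := (rho + 1) / 2). destruct (Ha s) as [K HK]; [unfold s; lra|].
  assert (Hs : 0 < s < 1) by (unfold s; lra).
  apply ex_series_le_R with (fun k => K * (rho / s) ^ k).
  - intros k. split. apply Rmult_le_pos. apply Cmod_ge_0. apply pow_le; lra.
    replace (rho ^ k) with (s ^ k * (rho / s) ^ k) by (rewrite <- Rpow_mult_distr; f_equal; field; lra).
    rewrite <- Rmult_assoc. apply Rmult_le_compat_r; auto. apply pow_le.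
    apply Rmult_le_pos; [lra|]. left; apply Rinv_0_lt_compat; lra.
  - apply ex_series_scal_R. apply ex_series_geom. rewrite Rabs_pos_eq.
    + apply Rmult_lt_reg_r with s; [lra|]. unfold Rdiv. rewrite Rmult_assoc, Rinv_l by lra. unfold s; lra.
    + apply Rmult_le_pos; [lra|]. left; apply Rinv_0_lt_compat; lra.
Qed.

Lemma radius1_absC a z : radius1 a -> Cmod z < 1 -> absC (fun k => (a k * z ^ k)%C).
Proof.
  intros Ha Hz. eapply absC_le; [|apply (radius1_series a (Cmod z) Ha)].
  - intros n. rewrite Cmod_mult, Cmod_pow. apply Rle_refl.
  - split; auto. apply Cmod_ge_0.
Qed.

Lemma INR_pow_le r d k : 0 <= r -> 0 < d -> INR k * r ^ (k - 1) <= (r + d) ^ k / d.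
Proof.
  intros Hr Hd. destruct (pow_second_order (RtoC r) 0%C d k Hd) as [_ H].
  rewrite Cmod_0; lra. rewrite Cmod_R, Rabs_pos_eq in H by auto.
  apply Rmult_le_reg_r with d; auto. replace ((r + d) ^ k / d * d) with ((r + d) ^ k) by (field; lra). lra.
Qed.

Lemma radius1_PSd a : radius1 a -> radius1 (PSd a).
Proof.
  intros Ha rho Hr. set (d := (1 - rho) / 2). destruct (Ha (rho + d)) as [K HK]; [unfold d; lra|].
  exists (K / d). intros k. unfold PSd. rewrite Cmod_mult, Cmod_R, Rabs_pos_eq by apply pos_INR.
  assert (Hd : 0 < d) by (unfold d; lra).
  pose proof (INR_pow_le rho d (S k) ltac:(lra) Hd) as H. replace (S k - 1)%nat with k in H by lia.
  pose proof (Cmod_ge_0 (a (S k))). specialize (HK (S k)).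
  apply Rle_trans with (Cmod (a (S k)) * ((rho + d) ^ S k / d)).
  - replace (INR (S k) * Cmod (a (S k)) * rho ^ k) with (Cmod (a (S k)) * (INR (S k) * rho ^ k)) by ring.
    apply Rmult_le_compat_l; auto.
  - unfold Rdiv. rewrite <- Rmult_assoc. apply Rmult_le_compat_r; auto. left; apply Rinv_0_lt_compat; auto.
Qed.

Lemma Csumb_shift a n : Csumb a (S n) = (a O + Csumb (fun k => a (S k)) n)%C.
Proof. induction n. simpl; ring. simpl in *. rewrite IHn. ring. Qed.

Lemma CSer_shift a : absC a -> a O = 0%C -> CSer a = CSer (fun k => a (S k)).
Proof.
  intros Ha H0. symmetry. apply CSer_unique. intros eps He.
  destruct (CSer_lim a Ha eps He) as [N HN]. exists N. intros n Hn.
  specialize (HN (S n) ltac:(lia)). rewrite Csumb_shift, H0 in HN.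
  replace (0 + Csumb (fun k : nat => a (S k)) n)%C with (Csumb (fun k : nat => a (S k)) n) in HN by ring. auto.
Qed.

Lemma PS_diff a z : radius1 a -> Cmod z < 1 -> Cdiff (PS a) z (PS (PSd a) z).
Proof.
  intros Ha Hz. pose proof (Cmod_ge_0 z).
  set (d := (1 - Cmod z) / 2). assert (Hd : 0 < d) by (unfold d; lra).
  assert (HA : absC (fun k => a k * (INR k * z ^ (k - 1)))%C).
  { eapply absC_le; [|apply (ex_series_scal_R (/ d)), (radius1_series a (Cmod z + d) Ha); unfold d; lra].
    intros n. rewrite !Cmod_mult, Cmod_R, Cmod_pow, Rabs_pos_eq by apply pos_INR.
    pose proof (INR_pow_le (Cmod z) d n ltac:(lra) Hd). pose proof (Cmod_ge_0 (a n)).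
    replace (/ d * (Cmod (a n) * (Cmod z + d) ^ n)) with (Cmod (a n) * ((Cmod z + d) ^ n / d)) by (field; lra).
    apply Rmult_le_compat_l; auto. }
  replace (PS (PSd a) z) with (CSer (fun k => a k * (INR k * z ^ (k - 1)))%C).
  2:{ rewrite CSer_shift; auto. 2:{ simpl; ring. }
      apply CSer_ext. intros n. unfold PSd. replace (S n - 1)%nat with n by lia. ring. }
  apply (Cdiff_CSer (fun k w => a k * w ^ k)%C _ (fun k => / d ^ 2 * (Cmod (a k) * (Cmod z + d) ^ k)) z d); auto.
  - apply ex_series_scal_R, radius1_series; auto. unfold d; lra.
  - intros w Hw. apply radius1_absC; auto. pose proof (Cmod_minus_ge w z). unfold d in Hw; lra.
  - intros n w Hw. destruct (pow_second_order z (w - z)%C d n Hd ltac:(lra)) as [H1 _].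
    replace (z + (w - z))%C with w in H1 by ring.
    replace (a n * w ^ n - a n * z ^ n - (w - z) * (a n * (INR n * z ^ (n - 1))))%C
      with (a n * (w ^ n - z ^ n - (w - z) * (INR n * z ^ (n - 1))))%C by ring.
    rewrite Cmod_mult. pose proof (Cmod_ge_0 (a n)).
    apply Rle_trans with (Cmod (a n) * ((Cmod (w - z) / d) ^ 2 * (Cmod z + d) ^ n)).
    + apply Rmult_le_compat_l; auto. eapply Rle_trans; [exact H1|]. apply Rmult_le_compat_l. apply pow2_ge_0.
      pose proof (pow_le (Cmod z) n ltac:(lra)).
      assert (0 <= INR n * d * Cmod z ^ (n - 1)).
      { apply Rmult_le_pos; [apply Rmult_le_pos|]; [apply pos_INR | lra | apply pow_le; auto]. }
      lra.
    + right. field. lra.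
Qed.

Lemma PS_hol a : radius1 a -> hol 1 (PS a).
Proof. intros Ha z Hz. eexists. apply PS_diff; auto. Qed.

(** Cauchy's coefficient integral at the arbitrary radius 1/2; [coef_radius] removes the choice. *)
Definition coef (f : C -> C) (k : nat) : C := cavg (fun t => (f (circ (/ 2) t) * (/ circ (/ 2) t) ^ k)%C).

Lemma circ_neq0 r t : 0 < r -> circ r t <> 0%C.
Proof. intros H. apply Cmod_gt_0. rewrite Cmod_circ, Rabs_pos_eq; lra. Qed.

Lemma coef_radius f r k : hol 1 f -> 0 < r < 1 ->
  coef f k = cavg (fun t => (f (circ r t) * (/ circ r t) ^ k)%C).
Proof.
  intros Hf Hr. unfold coef.
  assert (HG : forall w, 0 < Cmod w < 1 -> exists l, Cdiff (fun w => f w * (/ w) ^ k)%C w l).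
  { intros w Hw. destruct (Hf w ltac:(lra)) as [l Hl]. eexists. apply Cdiff_mult. exact Hl.
    apply (Cdiff_pow (fun w => / w)%C). apply Cdiff_inv. apply Cmod_gt_0; lra. }
  destruct (Rle_dec (/ 2) r); [|symmetry];
  apply (annulus_const (fun w => f w * (/ w) ^ k)%C 0 1); auto; lra.
Qed.

Lemma cavg_Csumb (F : nat -> R -> C) n : (forall k, CC (F k)) ->
  cavg (fun t => Csumb (fun k => F k t) n) = Csumb (fun k => cavg (F k)) n /\ CC (fun t => Csumb (fun k => F k t) n).
Proof.
  intros H. induction n; simpl.
  - split. apply cavg_const. apply CC_const.
  - destruct IHn as [I1 I2]. split.
    + rewrite (cavg_plus (fun t => Csumb (fun k => F k t) n)); auto. rewrite I1; auto.
    + apply CC_plus; auto.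
Qed.

(** The maximum over one period is carried to all angles by induction on the number of periods;
    negative angles are first shifted by a multiple of 2 pi. *)
Lemma circle_max f r : hol 1 f -> 0 <= r < 1 -> exists m, forall t, Cmod (f (circ r t)) <= Cmod (f (circ r m)).
Proof.
  intros Hf Hr. pose proof (CC_Cmod _ (CC_hol 1 f r Hf Hr)) as HC.
  destruct (continuity_ab_maj (fun t => Cmod (f (circ r t))) 0 (2 * PI)) as [m [Hm _]].
  - left; apply PI2_pos.
  - intros c _. apply continuity_pt_filterlim. apply HC.
  - exists m.
    assert (HN : forall n t, 0 <= t -> t <= INR (S n) * (2 * PI) -> Cmod (f (circ r t)) <= Cmod (f (circ r m))).
    { induction n; intros t Ht1 Ht2.
      - apply Hm. simpl in Ht2; lra.
      - destruct (Rle_dec t (2 * PI)); [apply Hm; lra|].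
        replace (circ r t) with (circ r (t - 2 * PI)).
        + apply IHn. lra. rewrite S_INR in Ht2. lra.
        + unfold circ. replace t with ((t - 2 * PI) + 2 * INR 1 * PI) at 3 4 by (simpl; ring).
          rewrite cos_period, sin_period. auto. }
    intros t. pose proof PI2_pos as P2.
    destruct (INR_unbounded (Rabs t / (2 * PI))) as [n Hn].
    assert (Ha : Rabs t < INR n * (2 * PI)).
    { apply (Rmult_lt_compat_r (2 * PI)) in Hn; auto. unfold Rdiv in Hn. rewrite Rmult_assoc, Rinv_l in Hn by lra. lra. }
    apply Rabs_def2 in Ha.
    replace (circ r t) with (circ r (t + 2 * INR n * PI)).
    + apply (HN (2 * n)%nat). lra. rewrite S_INR, mult_INR. simpl. pose proof PI_RGT_0. nra.
    + unfold circ. rewrite cos_period, sin_period. auto.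
Qed.

Lemma Cmod_hol_bounded f r : hol 1 f -> 0 <= r < 1 -> exists B, 0 <= B /\ forall t, Cmod (f (circ r t)) <= B.
Proof. intros Hf Hr. destruct (circle_max f r Hf Hr) as [m Hm]. exists (Cmod (f (circ r m))). split; auto. apply Cmod_ge_0. Qed.

Lemma coef_bound f r k B : hol 1 f -> 0 < r < 1 -> (forall t, Cmod (f (circ r t)) <= B) ->
  Cmod (coef f k) * r ^ k <= B.
Proof.
  intros Hf Hr HB. rewrite (coef_radius f r k) by auto.
  assert (P : 0 < r ^ k) by (apply pow_lt; lra).
  assert (HC : CC (fun t => (f (circ r t) * (/ circ r t) ^ k)%C)).
  { apply CC_mult. apply (CC_hol 1); auto; lra. apply CC_pow. apply CC_inv. apply CC_circ.
    intros t; apply circ_neq0; lra. }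
  assert (H : Cmod (cavg (fun t => (f (circ r t) * (/ circ r t) ^ k)%C)) <= B * / r ^ k).
  { eapply Rle_trans; [apply Cmod_cavg; auto|]. apply avg_le_const. apply CC_Cmod; auto.
    intros t. rewrite Cmod_mult, Cmod_pow, Cmod_inv by (apply circ_neq0; lra).
    rewrite Cmod_circ, Rabs_pos_eq, pow_inv by lra. apply Rmult_le_compat_r; auto.
    left; apply Rinv_0_lt_compat; auto. }
  apply (Rmult_le_compat_r (r ^ k)) in H; [|lra]. rewrite Rmult_assoc, Rinv_l in H by lra. lra.
Qed.

Lemma coef_radius1 f : hol 1 f -> radius1 (coef f).
Proof.
  intros Hf rho Hr. destruct (Cmod_hol_bounded f rho Hf ltac:(lra)) as [B [_ HB]].
  exists B. intros k. apply coef_bound; auto.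
Qed.

Lemma geom_C (x : C) n : (1 - x)%C <> 0%C -> (/ (1 - x) = Csumb (fun k => x ^ k) n + x ^ n * / (1 - x))%C.
Proof.
  intros Hx. induction n; simpl. ring. rewrite IHn at 1. field. auto.
Qed.

(** In Cauchy's formula w / (w - z) = 1 / (1 - z/w) is expanded as a finite geometric sum. Its terms
    yield the coefficients, and the remainder carries (|z| / r)^n. *)
Lemma taylor f z : hol 1 f -> Cmod z < 1 -> f z = PS (coef f) z.
Proof.
  intros Hf Hz. pose proof (Cmod_ge_0 z) as Hz0.
  set (r := (Cmod z + 1) / 2). assert (Hr : Cmod z < r < 1) by (unfold r; lra).
  destruct (Cmod_hol_bounded f r Hf ltac:(lra)) as [B [HB0 HB]].
  symmetry. apply CSer_unique. intros eps He.
  assert (Hq : 0 <= Cmod z / r < 1).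
  { split. apply Rmult_le_pos; [lra|]. left; apply Rinv_0_lt_compat; lra.
    apply Rmult_lt_reg_r with r; [lra|]. unfold Rdiv. rewrite Rmult_assoc, Rinv_l by lra. lra. }
  set (A := B * (r / (r - Cmod z)) + 1).
  assert (HA : 0 < A).
  { unfold A. assert (0 <= r / (r - Cmod z)); [|nra]. apply Rmult_le_pos; [lra|]. left; apply Rinv_0_lt_compat; lra. }
  destruct (pow_lt_1_zero (Cmod z / r)) with (y := eps / A) as [N HN].
  { rewrite Rabs_pos_eq; lra. } { apply Rdiv_lt_0_compat; lra. }
  exists N. intros n Hn. specialize (HN n Hn). rewrite Rabs_pos_eq in HN by (apply pow_le; lra).
  assert (Hne : forall t, circ r t <> 0%C) by (intros; apply circ_neq0; lra).
  assert (Hne2 : forall t, (circ r t - z)%C <> 0%C).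
  { intros t. apply Cmod_gt_neq. rewrite Cmod_circ, Rabs_pos_eq; lra. }
  assert (CF : CC (fun t => f (circ r t))) by (apply (CC_hol 1); auto; lra).
  assert (CI : CC (fun t => (/ circ r t)%C)) by (apply CC_inv; auto; apply CC_circ).
  assert (CK : CC (fun t => (circ r t * / (circ r t - z))%C)).
  { apply CC_mult. apply CC_circ. apply CC_inv; auto. apply CC_minus; [apply CC_circ | apply CC_const]. }
  set (Rem := fun t => (f (circ r t) * ((z * / circ r t) ^ n * (circ r t * / (circ r t - z))))%C).
  assert (CR : CC Rem).
  { apply CC_mult; auto. apply CC_mult; auto. apply CC_pow. apply CC_mult; auto. apply CC_const. }
  assert (E : (f z = Csumb (fun k => coef f k * z ^ k) n + cavg Rem)%C).
  { rewrite <- (cauchy_formula f 1 z r Hf) at 1 by lra.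
    rewrite (cavg_ext _ (fun t => Csumb (fun k => z ^ k * (f (circ r t) * (/ circ r t) ^ k)) n + Rem t)%C).
    - destruct (cavg_Csumb (fun k t => z ^ k * (f (circ r t) * (/ circ r t) ^ k))%C n) as [E1 E2].
      { intros k. apply CC_mult. apply CC_const. apply CC_mult; auto. apply CC_pow; auto. }
      rewrite (cavg_plus (fun t => Csumb (fun k => z ^ k * (f (circ r t) * (/ circ r t) ^ k)) n)%C); auto.
      rewrite E1. f_equal. apply Csumb_ext. intros k _.
      rewrite (cavg_scal (z ^ k)%C (fun t => f (circ r t) * (/ circ r t) ^ k)%C).
      + rewrite <- coef_radius by (auto; lra). ring.
      + apply CC_mult; auto. apply CC_pow; auto.
    - intros t. unfold Rem. pose proof (Hne t). pose proof (Hne2 t).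
      assert (H1 : (1 - z * / circ r t)%C <> 0%C).
      { intros E. apply (Hne2 t). replace (circ r t - z)%C with (circ r t * (1 - z * / circ r t))%C by (field; auto).
        rewrite E; ring. }
      assert (H2 : (circ r t * / (circ r t - z) = / (1 - z * / circ r t))%C) by (field; repeat split; auto;
        intros E; apply (Hne2 t); rewrite <- E; ring).
      rewrite !H2. rewrite (geom_C _ n H1) at 1.
      replace (Csumb (fun k => z ^ k * (f (circ r t) * (/ circ r t) ^ k)) n)%C
        with (f (circ r t) * Csumb (fun k => (z * / circ r t) ^ k) n)%C. ring.
      clear. induction n; simpl. ring. rewrite <- IHn. rewrite Cpow_mult_l. ring. }
  rewrite E. replace (Csumb (fun k => coef f k * z ^ k) n - (Csumb (fun k => coef f k * z ^ k) n + cavg Rem))%C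
    with (- cavg Rem)%C by ring.
  rewrite Cmod_opp. eapply Rle_lt_trans; [apply Cmod_cavg; auto|].
  apply Rle_lt_trans with (B * ((Cmod z / r) ^ n * (r / (r - Cmod z)))).
  - apply avg_le_const. apply CC_Cmod; auto. intros t. unfold Rem.
    rewrite !Cmod_mult, Cmod_pow, Cmod_mult, !Cmod_inv, !Cmod_circ, Rabs_pos_eq by (auto; lra).
    assert (Hm : r - Cmod z <= Cmod (circ r t - z)).
    { pose proof (Cmod_minus_ge (circ r t) z). rewrite Cmod_circ, Rabs_pos_eq in H; lra. }
    apply Rmult_le_compat; auto; try apply Cmod_ge_0.
    + apply Rmult_le_pos. apply pow_le; apply Hq. apply Rmult_le_pos; [lra|]. left; apply Rinv_0_lt_compat; lra.
    + apply Rmult_le_compat_l. apply pow_le; apply Hq. apply Rmult_le_compat_l; [lra|].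
      apply Rinv_le_contravar; lra.
  - apply Rle_lt_trans with ((Cmod z / r) ^ n * A).
    + unfold A. assert (0 <= (Cmod z / r) ^ n) by (apply pow_le; lra). nra.
    + replace eps with (eps / A * A) by (field; lra). apply Rmult_lt_compat_r; auto.
Qed.

Lemma hol_ext rho f g : (forall z, Cmod z < rho -> f z = g z) -> hol rho f -> hol rho g.
Proof.
  intros E Hf z Hz. destruct (Hf z Hz) as [l Hl]. exists l.
  apply (Cdiff_ext_loc f g z l (rho - Cmod z)); auto. lra.
  intros w Hw. apply E. pose proof (Cmod_minus_ge w z). lra.
Qed.

Lemma deriv_ext rho f g z : hol rho f -> (forall z, Cmod z < rho -> f z = g z) -> Cmod z < rho ->
  deriv g z = deriv f z.
Proof.
  intros Hf E Hz. apply Cdiff_deriv. apply (Cdiff_ext_loc f g z _ (rho - Cmod z)). lra.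
  - intros w Hw. apply E. pose proof (Cmod_minus_ge w z). lra.
  - apply (hol_deriv rho); auto.
Qed.

Lemma deriv_taylor f z : hol 1 f -> Cmod z < 1 -> deriv f z = PS (PSd (coef f)) z.
Proof.
  intros Hf Hz. apply Cdiff_deriv.
  apply (Cdiff_ext_loc (PS (coef f)) f z _ (1 - Cmod z)). lra.
  - intros w Hw. symmetry; apply taylor; auto. pose proof (Cmod_minus_ge w z). lra.
  - apply PS_diff; auto. apply coef_radius1; auto.
Qed.

Lemma hol_deriv_hol1 f : hol 1 f -> hol 1 (deriv f).
Proof.
  intros Hf. apply (hol_ext 1 (PS (PSd (coef f)))).
  - intros z Hz. symmetry; apply deriv_taylor; auto.
  - apply PS_hol, radius1_PSd, coef_radius1; auto.
Qed.

Lemma hol_scale rho f c : 0 < c -> hol rho f -> hol (rho / c) (fun z => f (RtoC c * z)%C) /\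
  (forall z, Cmod z < rho / c -> Cdiff (fun z => f (RtoC c * z)%C) z (RtoC c * deriv f (RtoC c * z))%C).
Proof.
  intros Hc Hf.
  assert (H : forall z, Cmod z < rho / c -> Cdiff (fun z => f (RtoC c * z)%C) z (RtoC c * deriv f (RtoC c * z))%C).
  { intros z Hz. rewrite Cmult_comm.
    apply (Cdiff_comp f (fun z => RtoC c * z)%C).
    - pose proof (Cdiff_scal (RtoC c) _ z _ (Cdiff_id z)) as Hs. rewrite Cmult_1_r in Hs. exact Hs.
    - apply (hol_deriv rho); auto. rewrite Cmod_mult, Cmod_R, Rabs_pos_eq by lra.
      apply (Rmult_lt_compat_l c) in Hz; auto. replace (c * (rho / c)) with rho in Hz by (field; lra). auto. }
  split; auto. intros z Hz. eexists; apply H; auto.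
Qed.

(** Reduced by dilation to the unit disc, where the derivative is a power series. *)
Lemma hol_deriv_hol rho f : 0 < rho -> hol rho f -> hol rho (deriv f).
Proof.
  intros Hr Hf. destruct (hol_scale rho f rho Hr Hf) as [H1 H2].
  replace (rho / rho) with 1 in H1, H2 by (field; lra).
  apply (hol_ext rho (fun z => RtoC (/ rho) * deriv (fun z => f (RtoC rho * z)%C) (RtoC (/ rho) * z))%C).
  - intros z Hz. rewrite (Cdiff_deriv _ _ (RtoC rho * deriv f (RtoC rho * (RtoC (/ rho) * z)))%C).
    + assert (E : (RtoC rho * RtoC (/ rho))%C = 1%C) by (rewrite <- RtoC_mult, Rinv_r by lra; auto).
      replace (RtoC rho * (RtoC (/ rho) * z))%C with z.
      * replace (RtoC (/ rho) * (RtoC rho * deriv f z))%C with ((RtoC rho * RtoC (/ rho)) * deriv f z)%C by ring.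
        rewrite E; ring.
      * replace (RtoC rho * (RtoC (/ rho) * z))%C with ((RtoC rho * RtoC (/ rho)) * z)%C by ring. rewrite E; ring.
    + apply H2. rewrite Cmod_mult, Cmod_R, Rabs_pos_eq by (left; apply Rinv_0_lt_compat; lra).
      apply Rmult_lt_reg_l with rho; auto. rewrite <- Rmult_assoc, Rinv_r by lra. lra.
  - apply hol_deriv_hol1 in H1. destruct (hol_scale 1 _ (/ rho) ltac:(apply Rinv_0_lt_compat; lra) H1) as [H3 _].
    replace (1 / / rho) with rho in H3 by (field; lra).
    intros z Hz. destruct (H3 z Hz) as [l Hl]. eexists. apply Cdiff_scal. exact Hl.
Qed.

(** * Hardy's convexity theorem *)

Lemma is_derive_avg_param (F F' : R -> R -> R) (s0 : R) (d : R) : 0 < d ->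
  (forall s t, Rabs (s - s0) < d -> is_derive (fun s => F s t) s (F' s t)) ->
  (forall s t, Rabs (s - s0) < d -> continuous (fun p : R * R => F' (fst p) (snd p)) (s, t)) ->
  (forall s, Rabs (s - s0) < d -> Cts (F s)) ->
  is_derive (fun s => avg (F s)) s0 (avg (F' s0)).
Proof.
  intros Hd HF HF' HC.
  assert (H00 : Rabs (s0 - s0) < d) by (rewrite Rminus_diag, Rabs_R0; auto).
  unfold avg. apply (is_derive_scal (fun s => RInt (F s) 0 (2 * PI))).
  rewrite (RInt_ext (F' s0) (fun t => Derive (fun u => F u t) s0)).
  2:{ intros t _. symmetry. apply is_derive_unique, HF; auto. }
  apply (is_derive_RInt_param F).
  - exists (mkposreal _ Hd). intros s Hs t _. eexists. apply HF. exact Hs.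
  - intros t _. apply continuity_2d_pt_ext_loc with F'.
    + exists (mkposreal _ Hd). intros u v Hu _. symmetry. apply is_derive_unique, HF. exact Hu.
    + apply continuity_2d_pt_filterlim. apply HF'; auto.
  - exists (mkposreal _ Hd). intros s Hs. apply Cts_ex_RInt, HC. exact Hs.
Qed.

Lemma rd_eq (F : R -> R) s (l l' : R) : is_derive F s l -> l = l' -> is_derive F s l'.
Proof. intros; subst; auto. Qed.
Lemma rd_plus (F G : R -> R) s (l m : R) : is_derive F s l -> is_derive G s m ->
  is_derive (fun s => F s + G s) s (l + m).
Proof. intros; apply (is_derive_plus F G); auto. Qed.
Lemma rd_minus (F G : R -> R) s (l m : R) : is_derive F s l -> is_derive G s m ->
  is_derive (fun s => F s - G s) s (l - m).
Proof. intros; apply (is_derive_minus F G); auto. Qed.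
Lemma rd_mult (F G : R -> R) s (l m : R) : is_derive F s l -> is_derive G s m ->
  is_derive (fun s => F s * G s) s (l * G s + F s * m).
Proof. intros; apply (is_derive_mult F G); auto. intros; apply Rmult_comm. Qed.
Lemma rd_scal (F : R -> R) s (c l : R) : is_derive F s l -> is_derive (fun s => c * F s) s (c * l).
Proof. intros; apply (is_derive_scal F); auto. Qed.
Lemma rd_sqr (F : R -> R) s (l : R) : is_derive F s l -> is_derive (fun s => F s ^ 2) s (2 * F s * l).
Proof.
  intros H. apply rd_eq with (l * F s + F s * l); [|ring].
  apply (is_derive_ext (fun s => F s * F s)). intros; simpl; ring. apply rd_mult; auto.
Qed.
Lemma rd_const (c : R) s : is_derive (fun _ : R => c) s 0.
Proof. apply (is_derive_const (K := R_AbsRing) (V := R_NormedModule)). Qed.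

(** In logarithmic coordinates z = exp (s + i t) this is the derivative in s, and i times it is the
    derivative in t. Iterating it gives all second derivatives. *)
Definition zderiv (f : C -> C) (z : C) : C := (z * deriv f z)%C.

Lemma zderiv_hol rho f : 0 < rho -> hol rho f -> hol rho (zderiv f).
Proof.
  intros Hr Hf z Hz. destruct (hol_deriv_hol rho f Hr Hf z Hz) as [l Hl].
  eexists. apply Cdiff_mult. apply Cdiff_id. exact Hl.
Qed.

Lemma polar_derivs rho f s t : hol rho f -> exp s < rho ->
  is_derive (fun s => fst (f (circ (exp s) t))) s (fst (zderiv f (circ (exp s) t))) /\
  is_derive (fun s => snd (f (circ (exp s) t))) s (snd (zderiv f (circ (exp s) t))) /\
  is_derive (fun t => fst (f (circ (exp s) t))) t (- snd (zderiv f (circ (exp s) t))) /\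
  is_derive (fun t => snd (f (circ (exp s) t))) t (fst (zderiv f (circ (exp s) t))).
Proof.
  intros Hf Hs. pose proof (exp_pos s).
  assert (Hz : Cmod (circ (exp s) t) < rho) by (rewrite Cmod_circ, Rabs_pos_eq; lra).
  destruct (Cdiff_polar _ _ _ _ (hol_deriv rho f _ Hf Hz)) as [D1 D2].
  unfold zderiv. set (l := deriv f (circ (exp s) t)) in *.
  split; [|split; [|split]]; apply is_derive_Reals.
  - replace (fst (circ (exp s) t * l)%C) with
      ((fst l * cos t - snd l * sin t) * exp s + (- exp s * (fst l * sin t + snd l * cos t)) * 0)
      by (unfold circ; simpl; ring).
    apply (derivable_pt_lim_comp_2d _ exp (fun _ => t) s _ _ _ _ D1).
    apply derivable_pt_lim_exp. apply derivable_pt_lim_const.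
  - replace (snd (circ (exp s) t * l)%C) with
      ((fst l * sin t + snd l * cos t) * exp s + (exp s * (fst l * cos t - snd l * sin t)) * 0)
      by (unfold circ; simpl; ring).
    apply (derivable_pt_lim_comp_2d _ exp (fun _ => t) s _ _ _ _ D2).
    apply derivable_pt_lim_exp. apply derivable_pt_lim_const.
  - replace (- snd (circ (exp s) t * l)%C) with
      ((fst l * cos t - snd l * sin t) * 0 + (- exp s * (fst l * sin t + snd l * cos t)) * 1)
      by (unfold circ; simpl; ring).
    apply (derivable_pt_lim_comp_2d _ (fun _ => exp s) (fun t => t) t _ _ _ _ D1).
    apply derivable_pt_lim_const. apply derivable_pt_lim_id.
  - replace (fst (circ (exp s) t * l)%C) with
      ((fst l * sin t + snd l * cos t) * 0 + (exp s * (fst l * cos t - snd l * sin t)) * 1)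
      by (unfold circ; simpl; ring).
    apply (derivable_pt_lim_comp_2d _ (fun _ => exp s) (fun t => t) t _ _ _ _ D2).
    apply derivable_pt_lim_const. apply derivable_pt_lim_id.
Qed.

Lemma hol_polar_cont rho f s t : hol rho f -> exp s < rho ->
  continuous (fun p : R * R => fst (f (circ (exp (fst p)) (snd p)))) (s, t) /\
  continuous (fun p : R * R => snd (f (circ (exp (fst p)) (snd p)))) (s, t).
Proof.
  intros Hf Hs. pose proof (exp_pos s).
  assert (H0 : CCt (T := prod_UniformSpace R_UniformSpace R_UniformSpace)
             (fun p : R * R => f (circ (exp (fst p)) (snd p))) (s, t)).
  { apply CCt_comp.
    - apply CCt_circ.
      + apply (continuous_comp (fun p : R * R => fst p) exp). apply continuous_fst_comp, continuous_id.
        apply continuous_exp.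
      + apply continuous_snd_comp, continuous_id.
    - apply (hol_cont rho); auto. simpl. rewrite Cmod_circ, Rabs_pos_eq; lra. }
  split; [apply (CCt_fst _ _ H0) | apply (CCt_snd _ _ H0)].
Qed.

Lemma Rpower_derive F s l a : is_derive F s l -> 0 < F s ->
  is_derive (fun s => Rpower (F s) a) s (l * (a * Rpower (F s) (a - 1))).
Proof.
  intros HF Hp. apply (is_derive_comp (fun x => Rpower x a) F); auto.
  apply is_derive_Reals. apply derivable_pt_lim_power; auto.
Qed.

Lemma continuous_Rpower_comp {T : UniformSpace} (F : T -> R) b x : 0 < F x -> continuous F x ->
  continuous (fun y => Rpower (F y) b) x.
Proof.
  intros Hp HF. unfold Rpower. apply (continuous_comp (fun y => b * ln (F y)) exp); [|apply continuous_exp].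
  apply ct_mult. apply continuous_const. apply (continuous_comp F ln); auto. apply continuous_ln; auto.
Qed.

(** With s = ln r, the mean [N] of V = (|f|^2 + e)^a satisfies N'' = mean of V_ss = mean of V_ss +
    V_tt, since V_tt has mean 0 by periodicity. The Laplacian is nonnegative, so N is convex in s.
    As N stays bounded for s -> -infinity, N' >= 0. The term e > 0 keeps the base of the power away
    from 0. *)
Lemma subharmonic_mono_eps rho f a e r1 r2 : hol rho f -> 0 < a -> 0 < e -> 0 < r1 <= r2 -> r2 < rho ->
  avg (fun t => Rpower (Cmod (f (circ r1 t)) ^ 2 + e) a) <= avg (fun t => Rpower (Cmod (f (circ r2 t)) ^ 2 + e) a).
Proof.
  intros Hf Ha He Hr Hr2. assert (Hrho : 0 < rho) by lra.
  pose proof (zderiv_hol rho f Hrho Hf) as Hf1. pose proof (zderiv_hol rho _ Hrho Hf1) as Hf2.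
  set (x := fun s t => fst (f (circ (exp s) t))). set (y := fun s t => snd (f (circ (exp s) t))).
  set (x1 := fun s t => fst (zderiv f (circ (exp s) t))). set (y1 := fun s t => snd (zderiv f (circ (exp s) t))).
  set (x2 := fun s t => fst (zderiv (zderiv f) (circ (exp s) t))).
  set (y2 := fun s t => snd (zderiv (zderiv f) (circ (exp s) t))).
  set (Q := fun s t => x s t ^ 2 + y s t ^ 2 + e).
  assert (HQ : forall s t, 0 < Q s t).
  { intros s t. unfold Q. pose proof (pow2_ge_0 (x s t)). pose proof (pow2_ge_0 (y s t)). lra. }
  set (V := fun s t => Rpower (Q s t) a).
  set (V1 := fun s t => (2 * a) * (x s t * x1 s t + y s t * y1 s t) * Rpower (Q s t) (a - 1)).
  set (V2 := fun s t => (2 * a) * (x1 s t ^ 2 + y1 s t ^ 2 + x s t * x2 s t + y s t * y2 s t) * Rpower (Q s t) (a - 1)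
      + (4 * a * (a - 1)) * (x s t * x1 s t + y s t * y1 s t) ^ 2 * Rpower (Q s t) (a - 1 - 1)).
  (* [V1] and [V2] are the first two s-derivatives of [V]; [U] and [U1] are the first two
     t-derivatives. *)
  set (U := fun s t => (2 * a) * (y s t * x1 s t - x s t * y1 s t) * Rpower (Q s t) (a - 1)).
  set (U1 := fun s t => (2 * a) * (x1 s t ^ 2 + y1 s t ^ 2 - x s t * x2 s t - y s t * y2 s t) * Rpower (Q s t) (a - 1)
      + (4 * a * (a - 1)) * (y s t * x1 s t - x s t * y1 s t) ^ 2 * Rpower (Q s t) (a - 1 - 1)).
  assert (DV : forall s t, exp s < rho -> is_derive (fun s => V s t) s (V1 s t)).
  { intros s t Hs. destruct (polar_derivs rho f s t Hf Hs) as [A1 [A2 _]].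
    fold (x1 s t) (y1 s t) in A1, A2. change (is_derive (fun s => x s t) s (x1 s t)) in A1.
    change (is_derive (fun s => y s t) s (y1 s t)) in A2.
    replace (V1 s t) with ((2 * x s t * x1 s t + 2 * y s t * y1 s t) * (a * Rpower (Q s t) (a - 1)))
      by (unfold V1; ring).
    apply (Rpower_derive (fun s => Q s t)); auto. unfold Q.
    eapply rd_eq.
    { apply (rd_plus (fun s => x s t ^ 2 + y s t ^ 2) (fun _ => e)); [|apply rd_const].
      apply (rd_plus (fun s => x s t ^ 2) (fun s => y s t ^ 2)); [apply (rd_sqr (fun s => x s t)) | apply (rd_sqr (fun s => y s t))]; eassumption. }
    ring. }
  assert (DQ : forall s t, exp s < rho -> is_derive (fun s => Q s t) s (2 * (x s t * x1 s t + y s t * y1 s t)) /\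
       is_derive (fun t => Q s t) t (2 * (y s t * x1 s t - x s t * y1 s t))).
  { intros s t Hs. destruct (polar_derivs rho f s t Hf Hs) as [A1 [A2 [A3 A4]]].
    change (is_derive (fun s => x s t) s (x1 s t)) in A1. change (is_derive (fun s => y s t) s (y1 s t)) in A2.
    change (is_derive (fun t => x s t) t (- y1 s t)) in A3. change (is_derive (fun t => y s t) t (x1 s t)) in A4.
    unfold Q. split.
    - eapply rd_eq.
      { apply (rd_plus (fun s => x s t ^ 2 + y s t ^ 2) (fun _ => e)); [|apply rd_const].
        apply (rd_plus (fun s => x s t ^ 2) (fun s => y s t ^ 2)); [apply (rd_sqr (fun s => x s t)) | apply (rd_sqr (fun s => y s t))]; eassumption. }
      ring.
    - eapply rd_eq.
      { apply (rd_plus (fun t => x s t ^ 2 + y s t ^ 2) (fun _ => e)); [|apply rd_const].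
        apply (rd_plus (fun t => x s t ^ 2) (fun t => y s t ^ 2)); [apply (rd_sqr (fun t => x s t)) | apply (rd_sqr (fun t => y s t))]; eassumption. }
      ring. }
  assert (DV1 : forall s t, exp s < rho -> is_derive (fun s => V1 s t) s (V2 s t)).
  { intros s t Hs. destruct (polar_derivs rho f s t Hf Hs) as [A1 [A2 _]].
    destruct (polar_derivs rho _ s t Hf1 Hs) as [B1 [B2 _]]. destruct (DQ s t Hs) as [C1 _].
    change (is_derive (fun s => x s t) s (x1 s t)) in A1. change (is_derive (fun s => y s t) s (y1 s t)) in A2.
    change (is_derive (fun s => x1 s t) s (x2 s t)) in B1. change (is_derive (fun s => y1 s t) s (y2 s t)) in B2.
    unfold V1. eapply rd_eq.
    { apply (rd_mult (fun s => 2 * a * (x s t * x1 s t + y s t * y1 s t)) (fun s => Rpower (Q s t) (a - 1))).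
      - apply (rd_scal (fun s => x s t * x1 s t + y s t * y1 s t)).
        apply (rd_plus (fun s => x s t * x1 s t) (fun s => y s t * y1 s t)).
        + apply (rd_mult (fun s => x s t) (fun s => x1 s t)); eassumption.
        + apply (rd_mult (fun s => y s t) (fun s => y1 s t)); eassumption.
      - apply (Rpower_derive (fun s => Q s t) s _ (a - 1) C1). apply HQ. }
    unfold V2. ring. }
  assert (DU : forall s t, exp s < rho -> is_derive (fun t => U s t) t (U1 s t)).
  { intros s t Hs. destruct (polar_derivs rho f s t Hf Hs) as [_ [_ [A1 A2]]].
    destruct (polar_derivs rho _ s t Hf1 Hs) as [_ [_ [B1 B2]]]. destruct (DQ s t Hs) as [_ C1].
    change (is_derive (fun t => x s t) t (- y1 s t)) in A1. change (is_derive (fun t => y s t) t (x1 s t)) in A2.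
    change (is_derive (fun t => x1 s t) t (- y2 s t)) in B1. change (is_derive (fun t => y1 s t) t (x2 s t)) in B2.
    unfold U. eapply rd_eq.
    { apply (rd_mult (fun t => 2 * a * (y s t * x1 s t - x s t * y1 s t)) (fun t => Rpower (Q s t) (a - 1))).
      - apply (rd_scal (fun t => y s t * x1 s t - x s t * y1 s t)).
        apply (rd_minus (fun t => y s t * x1 s t) (fun t => x s t * y1 s t)).
        + apply (rd_mult (fun t => y s t) (fun t => x1 s t)); eassumption.
        + apply (rd_mult (fun t => x s t) (fun t => y1 s t)); eassumption.
      - apply (Rpower_derive (fun t => Q s t) t _ (a - 1) C1). apply HQ. }
    unfold U1. ring. }
  assert (HC : forall g, hol rho g -> forall s t, exp s < rho ->
     continuous (fun p : R * R => fst (g (circ (exp (fst p)) (snd p)))) (s, t) /\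
     continuous (fun p : R * R => snd (g (circ (exp (fst p)) (snd p)))) (s, t)).
  { intros; apply (hol_polar_cont rho); auto. }
  assert (CQ : forall b s t, exp s < rho -> continuous (fun p : R * R => Rpower (Q (fst p) (snd p)) b) (s, t)).
  { intros b s t Hs. destruct (HC f Hf s t Hs) as [c1 c2].
    apply (continuous_Rpower_comp (fun p : R * R => Q (fst p) (snd p))). apply HQ. unfold Q, x, y.
    apply ct_plus; [|apply continuous_const]. apply ct_plus; apply ct_pow; auto. }
  assert (CV1 : forall s t, exp s < rho -> continuous (fun p : R * R => V1 (fst p) (snd p)) (s, t)).
  { intros s t Hs. destruct (HC f Hf s t Hs) as [c1 c2]. destruct (HC _ Hf1 s t Hs) as [c3 c4].
    unfold V1. apply ct_mult; auto. apply ct_mult. apply continuous_const. unfold x, y, x1, y1.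
    apply ct_plus; apply ct_mult; auto. }
  assert (CV2 : forall s t, exp s < rho -> continuous (fun p : R * R => V2 (fst p) (snd p)) (s, t)).
  { intros s t Hs. destruct (HC f Hf s t Hs) as [c1 c2]. destruct (HC _ Hf1 s t Hs) as [c3 c4].
    destruct (HC _ Hf2 s t Hs) as [c5 c6].
    unfold V2. apply ct_plus; apply ct_mult; auto; apply ct_mult; try apply continuous_const;
    unfold x, y, x1, y1, x2, y2.
    - apply ct_plus; [apply ct_plus; [apply ct_plus; apply ct_pow; auto|]|]; apply ct_mult; auto.
    - apply ct_pow. apply ct_plus; apply ct_mult; auto. }
  assert (CU1 : forall s t, exp s < rho -> continuous (fun p : R * R => U1 (fst p) (snd p)) (s, t)).
  { intros s t Hs. destruct (HC f Hf s t Hs) as [c1 c2]. destruct (HC _ Hf1 s t Hs) as [c3 c4].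
    destruct (HC _ Hf2 s t Hs) as [c5 c6].
    unfold U1. apply ct_plus; apply ct_mult; auto; apply ct_mult; try apply continuous_const;
    unfold x, y, x1, y1, x2, y2.
    - apply ct_minus; [apply ct_minus; [apply ct_plus; apply ct_pow; auto|]|]; apply ct_mult; auto.
    - apply ct_pow. apply ct_minus; apply ct_mult; auto. }
  assert (Sec : forall (F : R -> R -> R) s, (forall t, continuous (fun p : R * R => F (fst p) (snd p)) (s, t)) -> Cts (F s)).
  { intros F s H t. apply (continuous_comp (fun t => (s, t)) (fun p : R * R => F (fst p) (snd p))); auto.
    apply continuous_pair. apply continuous_const. apply continuous_id. }
  assert (Hloc : forall s, exp s < rho -> exists d, 0 < d /\ forall u, Rabs (u - s) < d -> exp u < rho).
  { intros s Hs. exists (ln rho - s). split.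
    - apply Rlt_Rminus. apply exp_lt_inv. rewrite exp_ln; auto.
    - intros u Hu. rewrite <- (exp_ln rho) by auto. apply exp_increasing. apply Rabs_def2 in Hu. lra. }
  set (N := fun s => avg (V s)). set (N1 := fun s => avg (V1 s)).
  assert (DN : forall s, exp s < rho -> is_derive N s (N1 s)).
  { intros s Hs. destruct (Hloc s Hs) as [d [Hd Hu]]. apply (is_derive_avg_param V V1 s d); auto.
    intros u Hu'. apply Sec. intros t. apply (CQ a); auto. }
  assert (DN1 : forall s, exp s < rho -> is_derive N1 s (avg (V2 s))).
  { intros s Hs. destruct (Hloc s Hs) as [d [Hd Hu]]. apply (is_derive_avg_param V1 V2 s d); auto. }
  assert (HU : forall s, exp s < rho -> avg (U1 s) = 0).
  { intros s Hs. unfold avg.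
    assert (E : RInt (U1 s) 0 (2 * PI) = U s (2 * PI) - U s 0).
    { apply is_RInt_unique. apply (is_RInt_derive (U s) (U1 s)).
      + intros t _. apply DU; auto.
      + intros t _. apply (Sec U1 s). intros t'. apply CU1; auto. }
    rewrite E. unfold U, Q, x, y, x1, y1. rewrite circ_2PI. ring. }
  assert (N2pos : forall s, exp s < rho -> 0 <= avg (V2 s)).
  { intros s Hs. pose proof (HU s Hs) as HU0.
    replace (avg (V2 s)) with (avg (V2 s) + avg (U1 s)) by lra.
    assert (c1 : Cts (V2 s)) by (apply (Sec V2 s); auto). assert (c2 : Cts (U1 s)) by (apply (Sec U1 s); auto).
    rewrite <- avg_plus by auto. apply avg_nonneg. apply Cts_plus; auto.
    intros t. unfold V2, U1. pose proof (Rpower_gt0 (Q s t) (a - 1 - 1)) as HR.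
    replace (Rpower (Q s t) (a - 1)) with (Q s t * Rpower (Q s t) (a - 1 - 1)).
    2:{ rewrite <- (Rpower_1 (Q s t)) at 1 by auto. rewrite <- Rpower_plus. f_equal; ring. }
    (* The Laplacian of (|f|^2 + e)^a in s and t, with |z f'|^2 = x1^2 + y1^2; the terms in the
       second derivatives [x2], [y2] have cancelled. *)
    match goal with |- 0 <= ?E => replace E with
      (4 * a * Rpower (Q s t) (a - 1 - 1) * ((x1 s t ^ 2 + y1 s t ^ 2) * (e + a * (x s t ^ 2 + y s t ^ 2)))) end.
    - pose proof (pow2_ge_0 (x s t)). pose proof (pow2_ge_0 (y s t)). pose proof (pow2_ge_0 (x1 s t)).
      pose proof (pow2_ge_0 (y1 s t)). apply Rmult_le_pos. apply Rmult_le_pos; lra.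
      apply Rmult_le_pos. lra. nra.
    - unfold Q. ring. }
  assert (MV : forall (F F' : R -> R) u v, u < v -> exp v < rho -> (forall s, exp s < rho -> is_derive F s (F' s)) ->
     exists c, u <= c <= v /\ F v - F u = F' c * (v - u)).
  { intros F F' u v Huv Hv HF.
    assert (Hlt : forall c, c <= v -> exp c < rho).
    { intros c Hc. destruct Hc as [Hc| ->]; auto. apply exp_increasing in Hc. lra. }
    destruct (MVT_gen F u v F') as [c [Hc1 Hc2]]; rewrite ?Rmin_left, ?Rmax_right in * by lra.
    - intros c Hc. apply HF, Hlt; lra.
    - intros c Hc. apply continuity_pt_filterlim. apply (ex_derive_continuous F). eexists. apply HF, Hlt; lra.
    - exists c; auto. }
  assert (N1mono : forall u v, u < v -> exp v < rho -> N1 u <= N1 v).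
  { intros u v Huv Hv. destruct (MV N1 (fun s => avg (V2 s)) u v Huv Hv DN1) as [c [Hc E]].
    assert (exp c < rho). { destruct (proj2 Hc) as [Hc'| ->]; auto. apply exp_increasing in Hc'. lra. }
    pose proof (N2pos c H). nra. }
  (* A negative slope at s1 would, by convexity, be at least as negative to the left, so N would
     exceed the bound [Rpower M a], valid near the origin, at the far-left point [s] chosen
     below. *)
  assert (N1pos : forall s, exp s < rho -> 0 <= N1 s).
  { intros s1 Hs1. destruct (Rle_lt_dec 0 (N1 s1)) as [|Hneg]; auto. exfalso.
    assert (H0 : Cmod 0 < rho) by (rewrite Cmod_0; lra).
    destruct (proj1 (CCt_eps f 0%C) (hol_cont _ _ _ Hf H0) 1 Rlt_0_1) as [d [Hd Hfd]].
    set (M := (Cmod (f 0%C) + 1) ^ 2 + e).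
    assert (HNb : forall s, exp s < d -> exp s < rho -> N s <= Rpower M a).
    { intros s Hs Hs'. apply avg_le_const. apply (Sec V s). intros t; apply (CQ a); auto.
      intros t. unfold V. apply Rle_Rpower_l. lra. split; auto. unfold Q, M, x, y. rewrite <- Cmod_sqr.
      apply Rplus_le_compat_r. apply pow_incr. split. apply Cmod_ge_0.
      specialize (Hfd (circ (exp s) t)). replace (circ (exp s) t - 0)%C with (circ (exp s) t) in Hfd by ring.
      rewrite Cmod_circ, Rabs_pos_eq in Hfd by (left; apply exp_pos). specialize (Hfd Hs).
      pose proof (Cmod_minus_ge (f (circ (exp s) t)) (f 0%C)). lra. }
    assert (Kp : 0 <= (Rpower M a + Rabs (N s1) + 1) / - N1 s1).
    { apply Rmult_le_pos. pose proof (Rpower_gt0 M a). pose proof (Rabs_pos (N s1)). lra.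
      left; apply Rinv_0_lt_compat; lra. }
    set (s := Rmin (s1 - 1) (ln d - 1) - (Rpower M a + Rabs (N s1) + 1) / - N1 s1).
    pose proof (Rmin_l (s1 - 1) (ln d - 1)). pose proof (Rmin_r (s1 - 1) (ln d - 1)).
    assert (Hs : s < s1) by (unfold s; lra).
    assert (Hsd : exp s < d). { rewrite <- (exp_ln d) by auto. apply exp_increasing. unfold s. lra. }
    assert (Hsr : exp s < rho). { apply exp_increasing in Hs; lra. }
    destruct (MV N N1 s s1 Hs Hs1 DN) as [c [Hc E]].
    assert (N1 c <= N1 s1). { destruct (proj2 Hc) as [Hc'| ->]; [apply N1mono; auto | lra]. }
    specialize (HNb s Hsd Hsr).
    assert (E2 : Rpower M a + Rabs (N s1) + 1 <= - N1 s1 * (s1 - s)).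
    { apply Rle_trans with (- N1 s1 * ((Rpower M a + Rabs (N s1) + 1) / - N1 s1)).
      right; field; lra. apply Rmult_le_compat_l. lra. unfold s. lra. }
    assert (N1 c * (s1 - s) <= N1 s1 * (s1 - s)) by (apply Rmult_le_compat_r; lra).
    assert (HNa : - N s1 <= Rabs (N s1)) by (rewrite <- Rabs_Ropp; apply Rle_abs). lra. }
  assert (HN : forall r, 0 < r -> avg (fun t => Rpower (Cmod (f (circ r t)) ^ 2 + e) a) = N (ln r)).
  { intros r Hr0. unfold N, V, Q, x, y. apply avg_ext. intros t. rewrite exp_ln, Cmod_sqr; auto. }
  rewrite !HN by lra. destruct (Req_dec r1 r2) as [->|Hne]; [lra|].
  assert (Hln : ln r1 < ln r2) by (apply ln_increasing; lra).
  destruct (MV N N1 (ln r1) (ln r2) Hln) as [c [Hc E]]; auto. rewrite exp_ln; lra.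
  assert (exp c < rho). { apply Rle_lt_trans with (exp (ln r2)). destruct (proj2 Hc) as [Hc'| ->]; [left; apply exp_increasing; auto | lra]. rewrite exp_ln; lra. }
  pose proof (N1pos c H). nra.
Qed.

Lemma avg_param_continuous {T : UniformSpace} (F : T -> R -> R) x :
  (forall t, continuous (fun p : T * R => F (fst p) (snd p)) (x, t)) ->
  locally x (fun y => Cts (F y)) -> continuous (fun y => avg (F y)) x.
Proof.
  intros H1 H2. unfold avg. apply ct_mult. apply continuous_const.
  apply RInt_param_continuous; auto. left; apply PI2_pos.
  revert H2. apply filter_imp. intros y Hy. apply Cts_ex_RInt; auto.
Qed.

(** Lets a regularization parameter e tend to 0 from the right. Two-sided continuity is assumed, so
    its uses extend the parameter evenly through [Rabs e]. *)
Lemma le_of_right_limit (F G : R -> R) : continuous F 0 -> continuous G 0 ->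
  (forall e, 0 < e -> e < 1 -> F e <= G e) -> F 0 <= G 0.
Proof.
  intros HF HG H. apply Rle_plus_epsilon. intros e He.
  assert (He2 : 0 < e / 2) by lra.
  destruct (proj1 (filterlim_locally _ _) HF (mkposreal _ He2)) as [d1 Hd1].
  destruct (proj1 (filterlim_locally _ _) HG (mkposreal _ He2)) as [d2 Hd2].
  set (h := Rmin (Rmin d1 d2) 1 / 2).
  assert (Hm : 0 < Rmin (Rmin d1 d2) 1) by (repeat apply Rmin_pos; try apply cond_pos; lra).
  pose proof (Rmin_l (Rmin d1 d2) 1). pose proof (Rmin_r (Rmin d1 d2) 1). pose proof (Rmin_l d1 d2). pose proof (Rmin_r d1 d2).
  assert (B1 : @ball R_UniformSpace 0 d1 h).
  { change (Rabs (h - 0) < d1). rewrite Rminus_0_r, Rabs_pos_eq; unfold h; lra. }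
  assert (B2 : @ball R_UniformSpace 0 d2 h).
  { change (Rabs (h - 0) < d2). rewrite Rminus_0_r, Rabs_pos_eq; unfold h; lra. }
  specialize (Hd1 h B1). specialize (Hd2 h B2). specialize (H h ltac:(unfold h; lra) ltac:(unfold h; lra)).
  change (Rabs (F h - F 0) < e / 2) in Hd1. change (Rabs (G h - G 0) < e / 2) in Hd2.
  apply Rabs_def2 in Hd1. apply Rabs_def2 in Hd2. lra.
Qed.

(** The regularization |f|^2 + e is removed by letting e -> 0, and the radius r1 = 0, which has no
    logarithm, is reached by continuity of the mean in r. *)
Lemma subharmonic_mono rho f q r1 r2 : hol rho f -> 0 < q -> 0 <= r1 <= r2 -> r2 < rho ->
  avg (fun t => rpow (Cmod (f (circ r1 t))) q) <= avg (fun t => rpow (Cmod (f (circ r2 t))) q).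
Proof.
  intros Hf Hq Hr Hr2.
  assert (Hpos : forall r, 0 < r < rho -> forall e : R,
    Cts (fun t => rpow (Cmod (f (circ r t)) ^ 2 + Rabs e) (q / 2)) /\
    continuous (fun e => avg (fun t => rpow (Cmod (f (circ r t)) ^ 2 + Rabs e) (q / 2))) e).
  { intros r Hr0. pose proof (CC_Cmod _ (CC_hol rho f r Hf ltac:(lra))) as HC.
    assert (H1 : forall e, Cts (fun t => rpow (Cmod (f (circ r t)) ^ 2 + Rabs e) (q / 2))).
    { intros e. apply Cts_rpow. lra. intros x; pose proof (pow2_ge_0 (Cmod (f (circ r x)))); pose proof (Rabs_pos e); lra.
      apply Cts_plus. apply Cts_pow; auto. apply Cts_const. }
    intros e. split; auto.
    apply (avg_param_continuous (fun e t => rpow (Cmod (f (circ r t)) ^ 2 + Rabs e) (q / 2))).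
    - intros t. apply (continuous_rpow_comp (fun p : R * R => Cmod (f (circ r (snd p))) ^ 2 + Rabs (fst p))).
      lra. intros y. apply Rplus_le_le_0_compat; [apply pow2_ge_0 | apply Rabs_pos].
      apply ct_plus. apply ct_pow. apply (continuous_comp (fun p : R * R => snd p) (fun t => Cmod (f (circ r t)))).
      apply continuous_snd_comp, continuous_id. apply HC.
      apply (continuous_comp (fun p : R * R => fst p) Rabs). apply continuous_fst_comp, continuous_id.
      apply continuous_Rabs.
    - apply filter_forall. auto. }
  assert (Hmono : forall r1 r2, 0 < r1 <= r2 -> r2 < rho ->
    avg (fun t => rpow (Cmod (f (circ r1 t))) q) <= avg (fun t => rpow (Cmod (f (circ r2 t))) q)).
  { clear r1 r2 Hr Hr2. intros r1 r2 Hr Hr2.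
    assert (E : forall r, avg (fun t => rpow (Cmod (f (circ r t))) q) =
       (fun e => avg (fun t => rpow (Cmod (f (circ r t)) ^ 2 + Rabs e) (q / 2))) 0).
    { intros r. apply avg_ext. intros t. rewrite Rabs_R0, Rplus_0_r.
      rewrite <- rpow_2 by apply Cmod_ge_0. rewrite rpow_rpow by apply Cmod_ge_0. f_equal. field. }
    rewrite !E.
    apply (le_of_right_limit (fun e => avg (fun t => rpow (Cmod (f (circ r1 t)) ^ 2 + Rabs e) (q / 2)))
      (fun e => avg (fun t => rpow (Cmod (f (circ r2 t)) ^ 2 + Rabs e) (q / 2)))).
    - apply Hpos; lra.
    - apply Hpos; lra.
    - intros e He _.
      assert (E2 : forall r, avg (fun t => rpow (Cmod (f (circ r t)) ^ 2 + Rabs e) (q / 2)) =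
         avg (fun t => Rpower (Cmod (f (circ r t)) ^ 2 + e) (q / 2))).
      { intros r. apply avg_ext. intros t. rewrite Rabs_pos_eq by lra. apply rpow_pos.
        pose proof (pow2_ge_0 (Cmod (f (circ r t)))). lra. }
      rewrite !E2. apply (subharmonic_mono_eps rho); auto. lra. }
  destruct (proj1 Hr) as [Hr0|Hr0].
  - apply Hmono; lra.
  - subst r1. destruct (Req_dec r2 0) as [->|Hr20]; [lra|].
    set (F := fun r => avg (fun t => rpow (Cmod (f (circ r t))) q)).
    change (F 0 <= F r2).
    assert (HF : continuous F 0).
    { apply (avg_param_continuous (fun r t => rpow (Cmod (f (circ r t))) q)).
      - intros t. apply (continuous_rpow_comp (fun p : R * R => Cmod (f (circ (fst p) (snd p))))); auto.
        intros; apply Cmod_ge_0.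
        apply (CCt_Cmod (fun p : R * R => f (circ (fst p) (snd p)))). apply CCt_comp.
        apply CCt_circ. apply continuous_fst_comp, continuous_id. apply continuous_snd_comp, continuous_id.
        apply (hol_cont rho); auto. simpl. rewrite circ_0, Cmod_0. lra.
      - assert (Hp : 0 < rho) by lra. exists (mkposreal _ Hp). intros r Hr0.
        change (Rabs (r - 0) < rho) in Hr0. rewrite Rminus_0_r in Hr0.
        apply Cts_rpow; auto. intros; apply Cmod_ge_0. apply CC_Cmod. apply CC_comp_circ.
        intros w Hw. apply (hol_cont rho); auto. lra. }
    assert (HG : continuous (fun e => F (r2 * e)) 0).
    { apply (continuous_comp (fun e => r2 * e) F). apply ct_mult. apply continuous_const. apply continuous_id.
      replace (r2 * 0) with 0 by ring. exact HF. }
    pose proof (le_of_right_limit (fun e => F (r2 * e)) (fun _ => F r2) HG (continuous_const _ _)) as HL.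
    cbv beta in HL. rewrite Rmult_0_r in HL. apply HL. intros e He He1. apply Hmono; nra.
Qed.

Lemma subharmonic_mean rho f q r : hol rho f -> 0 < q -> 0 <= r < rho ->
  rpow (Cmod (f 0%C)) q <= avg (fun t => rpow (Cmod (f (circ r t))) q).
Proof.
  intros Hf Hq Hr. pose proof (subharmonic_mono rho f q 0 r Hf Hq ltac:(lra) ltac:(lra)) as H.
  rewrite (avg_ext _ (fun _ => rpow (Cmod (f 0%C)) q)), avg_const in H; auto.
  intros t; rewrite circ_0; auto.
Qed.

(** * The Poisson kernel *)

Lemma RInt_periodic (f : R -> R) b : Cts f -> (forall t, f (t + 2 * PI) = f t) ->
  RInt f b (b + 2 * PI) = RInt f 0 (2 * PI).
Proof.
  intros Hf Hp.
  rewrite <- (RInt_Chasles_R f b 0 (b + 2 * PI)) by auto using Cts_ex_RInt.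
  rewrite <- (RInt_Chasles_R f 0 (2 * PI) (b + 2 * PI)) by auto using Cts_ex_RInt.
  replace (RInt f (2 * PI) (b + 2 * PI)) with (RInt f 0 b).
  - pose proof (opp_RInt_swap f b 0 (Cts_ex_RInt f b 0 Hf)) as H.
    change (- RInt f b 0 = RInt f 0 b) in H. lra.
  - pose proof (RInt_comp_lin f 1 (2 * PI) 0 b) as H.
    replace (1 * 0 + 2 * PI) with (2 * PI) in H by ring. replace (1 * b + 2 * PI) with (b + 2 * PI) in H by ring.
    rewrite <- H by auto using Cts_ex_RInt. apply RInt_ext. intros x _.
    change (f x = 1 * f (1 * x + 2 * PI)). rewrite !Rmult_1_l. symmetry; auto.
Qed.

Lemma circle_arg (z : C) : Cmod z = 1 -> exists b, z = circ 1 b.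
Proof.
  intros H. assert (H2 : fst z ^ 2 + snd z ^ 2 = 1) by (rewrite <- Cmod_sqr, H; ring).
  assert (Hf : -1 <= fst z <= 1) by nra.
  destruct (Rle_dec 0 (snd z)).
  - exists (acos (fst z)). apply C_eq; unfold circ; simpl.
    + rewrite cos_acos; auto; lra.
    + rewrite sin_acos by auto. rewrite Rmult_1_l. symmetry. replace (1 - (fst z)²) with ((snd z)²) by (unfold Rsqr; nra).
      apply sqrt_Rsqr; auto.
  - exists (- acos (fst z)). apply C_eq; unfold circ; simpl.
    + rewrite cos_neg, cos_acos; auto; lra.
    + rewrite sin_neg, sin_acos by auto. replace (1 - (fst z)²) with ((- snd z)²) by (unfold Rsqr; nra).
      rewrite sqrt_Rsqr by lra. ring.
Qed.

(** The disc automorphism that takes 0 to z. *)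
Definition sigma (z w : C) : C := ((w + z) * / (1 + Cconj z * w))%C.

Definition Pk (z : C) (al : R) : R := (1 - Cmod z ^ 2) / Cmod (circ 1 al - z) ^ 2.

Lemma sigma_den z w : Cmod z * Cmod w < 1 -> (1 + Cconj z * w)%C <> 0%C.
Proof.
  intros H. replace (1 + Cconj z * w)%C with (1 - (- (Cconj z * w)))%C by ring.
  apply Cmod_gt_neq. rewrite Cmod_opp, Cmod_mult, Cmod_conj, Cmod_1. auto.
Qed.

Lemma Cmod_circ1 t : Cmod (circ 1 t) = 1.
Proof. rewrite Cmod_circ, Rabs_pos_eq; lra. Qed.

Lemma sigma_Cmod_sqr z w : (1 + Cconj z * w)%C <> 0%C ->
  Cmod (sigma z w) ^ 2 = 1 - (1 - Cmod z ^ 2) * (1 - Cmod w ^ 2) / Cmod (1 + Cconj z * w) ^ 2.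
Proof.
  intros H. pose proof (proj1 (Cmod_gt_0 _) H) as Hp. unfold sigma.
  rewrite Cmod_mult, Cmod_inv by auto. rewrite Rpow_mult_distr, pow_inv.
  assert (Hp2 : 0 < Cmod (1 + Cconj z * w) ^ 2) by (apply pow_lt; auto).
  replace (Cmod (w + z) ^ 2) with (Cmod (1 + Cconj z * w) ^ 2 - (1 - Cmod z ^ 2) * (1 - Cmod w ^ 2)).
  - field. lra.
  - rewrite !Cmod_sqr. destruct z, w; unfold Cconj; simpl. ring.
Qed.

Lemma sigma_diff z w : (1 + Cconj z * w)%C <> 0%C ->
  Cdiff (sigma z) w (RtoC (1 - Cmod z ^ 2) * / ((1 + Cconj z * w) * (1 + Cconj z * w)))%C.
Proof.
  intros H. assert (E : RtoC (1 - Cmod z ^ 2) = (1 - Cconj z * z)%C).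
  { rewrite Cmod_sqr. destruct z as [a b]. apply C_eq; unfold Cconj; simpl; ring. }
  rewrite E.
  replace ((1 - Cconj z * z) * / ((1 + Cconj z * w) * (1 + Cconj z * w)))%C with
    ((1 + 0) * / (1 + Cconj z * w) + (w + z) * (- / ((1 + Cconj z * w) * (1 + Cconj z * w)) * (0 + Cconj z * 1)))%C
    by (field; auto).
  apply (Cdiff_mult (fun w => w + z)%C (fun w => / (1 + Cconj z * w))%C).
  - apply Cdiff_plus. apply Cdiff_id. apply Cdiff_const.
  - apply (Cdiff_inv_comp (fun w => 1 + Cconj z * w)%C); auto.
    apply Cdiff_plus. apply Cdiff_const. apply Cdiff_scal, Cdiff_id.
Qed.

(** The angular speed of [sigma z] along the unit circle, which is the Poisson kernel at - z. *)
Definition jac (z : C) (t : R) : R := (1 - Cmod z ^ 2) / Cmod (1 + Cconj z * circ 1 t) ^ 2.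

Lemma sigma_den1 z t : Cmod z < 1 -> (1 + Cconj z * circ 1 t)%C <> 0%C.
Proof. intros H. apply sigma_den. rewrite Cmod_circ1; lra. Qed.

Lemma Cmod_lt1_sqr z : Cmod z < 1 -> 0 < 1 - Cmod z ^ 2.
Proof. intros H. pose proof (Cmod_ge_0 z). nra. Qed.

Lemma jac_cts z : Cmod z < 1 -> Cts (jac z).
Proof.
  intros H. unfold jac. apply Cts_div. apply Cts_const.
  - apply Cts_pow. apply CC_Cmod. apply CC_plus. apply CC_const. apply CC_mult. apply CC_const. apply CC_circ.
  - intros t. apply pow_nonzero. apply Rgt_not_eq. apply Cmod_gt_0. apply sigma_den1; auto.
Qed.

(** Exhibits Poisson-type kernels as real parts of analytic functions, so that their means can be
    read off from the mean value property. *)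
Lemma fst_cayley (u : C) : (1 - u)%C <> 0%C ->
  fst ((1 + u) * / (1 - u))%C = (1 - Cmod u ^ 2) / Cmod (1 - u) ^ 2.
Proof.
  intros H. pose proof (Csqr_neq0 _ H) as H2. rewrite !Cmod_sqr. destruct u as [a b]; simpl in *. field.
  intros E; apply H2. lra.
Qed.

Lemma cayley_hol (c : C) rho : Cmod c * rho <= 1 -> hol rho (fun w => ((1 + c * w) * / (1 - c * w))%C).
Proof.
  intros H w Hw.
  assert (Hn : (1 - c * w)%C <> 0%C).
  { apply Cmod_gt_neq. rewrite Cmod_1, Cmod_mult. pose proof (Cmod_ge_0 c). pose proof (Cmod_ge_0 w).
    destruct (Req_dec (Cmod c) 0) as [E|E]. rewrite E; lra. nra. }
  eexists. apply Cdiff_mult. apply Cdiff_plus. apply Cdiff_const. apply Cdiff_scal, Cdiff_id.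
  apply (Cdiff_inv_comp (fun w => 1 - c * w)%C); auto.
  apply Cdiff_minus. apply Cdiff_const. apply Cdiff_scal, Cdiff_id.
Qed.

Lemma avg_jac z : Cmod z < 1 -> avg (jac z) = 1.
Proof.
  intros H. pose proof (Cmod_ge_0 z).
  set (c := (- Cconj z)%C). assert (Hc : Cmod c = Cmod z) by (unfold c; rewrite Cmod_opp, Cmod_conj; auto).
  (* A radius with 1 < rho and |z| rho <= 1, valid also for z = 0: the Cayley quotient is then
     analytic past the unit circle. *)
  set (rho := 2 / (1 + Cmod z)).
  assert (Hrho : 1 < rho).
  { unfold rho. apply Rmult_lt_reg_r with (1 + Cmod z). lra. unfold Rdiv. rewrite Rmult_assoc, Rinv_l; lra. }
  assert (Hh : hol rho (fun w => ((1 + c * w) * / (1 - c * w))%C)).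
  { apply cayley_hol. rewrite Hc. unfold rho. apply Rmult_le_reg_r with (1 + Cmod z). lra.
    replace (Cmod z * (2 / (1 + Cmod z)) * (1 + Cmod z)) with (2 * Cmod z) by (field; lra). lra. }
  pose proof (mean_value _ rho 1 Hh ltac:(lra)) as HM. apply (f_equal fst) in HM. simpl fst in HM at 1.
  transitivity (fst ((1 + c * 0) * / (1 - c * 0))%C).
  - rewrite <- HM. apply avg_ext. intros t.
    change (jac z t = fst ((1 + c * circ 1 t) * / (1 - c * circ 1 t))%C).
    assert (E : (1 + Cconj z * circ 1 t = 1 - c * circ 1 t)%C) by (unfold c; ring).
    rewrite fst_cayley.
    + unfold jac. rewrite E, Cmod_mult, Hc, Cmod_circ1, Rmult_1_r. auto.
    + rewrite <- E. apply sigma_den1; auto.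
  - replace ((1 + c * 0) * / (1 - c * 0))%C with (RtoC 1). auto.
    replace (1 - c * 0)%C with (RtoC 1) by ring. replace (1 + c * 0)%C with (RtoC 1) by ring.
    apply C_eq; simpl; field.
Qed.

Lemma sigma_circ_derive z t : Cmod z < 1 ->
  is_derive (fun t => fst (sigma z (circ 1 t))) t (- jac z t * snd (sigma z (circ 1 t))) /\
  is_derive (fun t => snd (sigma z (circ 1 t))) t (jac z t * fst (sigma z (circ 1 t))).
Proof.
  intros Hz. pose proof (sigma_den1 z t Hz) as Hn.
  pose proof (sigma_diff z _ Hn) as HD. revert HD.
  set (l := (RtoC (1 - Cmod z ^ 2) * / ((1 + Cconj z * circ 1 t) * (1 + Cconj z * circ 1 t)))%C). intros HD.
  assert (E : (circ 1 t * l = RtoC (jac z t) * sigma z (circ 1 t))%C).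
  { unfold l, jac, sigma.
    assert (Hm : Cmod (1 + Cconj z * circ 1 t) ^ 2 <> 0).
    { apply pow_nonzero, Rgt_not_eq, Cmod_gt_0; auto. }
    assert (E1 : RtoC (Cmod (1 + Cconj z * circ 1 t) ^ 2) = ((1 + Cconj z * circ 1 t) * (1 + z * Cconj (circ 1 t)))%C).
    { rewrite Cmod_sqr. destruct z as [a b]. unfold Cconj, circ. apply C_eq; simpl; ring. }
    assert (E2 : (circ 1 t * Cconj (circ 1 t))%C = 1%C).
    { pose proof (sin2_cos2 t) as Hsc. unfold Rsqr in Hsc. unfold Cconj, circ. apply C_eq; simpl; nra. }
    unfold Rdiv. rewrite RtoC_mult, RtoC_inv by auto.
    assert (Hn2 : (1 + z * Cconj (circ 1 t))%C <> 0%C).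
    { intros E0. apply Hm. apply RtoC_inj. rewrite E1, E0. ring. }
    rewrite E1.
    replace (circ 1 t + z)%C with (circ 1 t * (1 + z * Cconj (circ 1 t)))%C.
    2:{ replace (circ 1 t * (1 + z * Cconj (circ 1 t)))%C with (circ 1 t + z * (circ 1 t * Cconj (circ 1 t)))%C by ring.
        rewrite E2. ring. }
    field. auto. }
  destruct (Cdiff_polar _ 1 t _ HD) as [D1 D2].
  assert (F1 : - jac z t * snd (sigma z (circ 1 t)) = - (fst l * sin t + snd l * cos t)).
  { apply (f_equal snd) in E. unfold circ in E at 1. simpl in E. simpl. lra. }
  assert (F2 : jac z t * fst (sigma z (circ 1 t)) = fst l * cos t - snd l * sin t).
  { apply (f_equal fst) in E. unfold circ in E at 1. simpl in E. simpl. lra. }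
  rewrite F1, F2. split; apply is_derive_Reals.
  - replace (- (fst l * sin t + snd l * cos t)) with
      ((fst l * cos t - snd l * sin t) * 0 + (- (1) * (fst l * sin t + snd l * cos t)) * 1) by ring.
    apply (derivable_pt_lim_comp_2d _ (fun _ => 1) (fun t => t) t _ _ _ _ D1).
    apply derivable_pt_lim_const. apply derivable_pt_lim_id.
  - replace (fst l * cos t - snd l * sin t) with
      ((fst l * sin t + snd l * cos t) * 0 + (1 * (fst l * cos t - snd l * sin t)) * 1) by ring.
    apply (derivable_pt_lim_comp_2d _ (fun _ => 1) (fun t => t) t _ _ _ _ D2).
    apply derivable_pt_lim_const. apply derivable_pt_lim_id.
Qed.

Lemma const_of_derive0 (F : R -> R) : (forall t, is_derive F t 0) -> forall t, F t = F 0.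
Proof.
  intros H t. destruct (Rtotal_order t 0) as [Ht|[->|Ht]]; auto.
  - apply (eq_is_derive F t 0); auto.
  - symmetry. apply (eq_is_derive F 0 t); auto.
Qed.

(** The angle is built as the primitive of [jac z] with the right initial value. The quotient of
    sigma z (circ 1 t) by circ 1 (al t) then has derivative 0 and equals 1; its real and imaginary
    parts are the two constants computed in the proof. The total increase is 2 pi by [avg_jac]. *)
Lemma sigma_lift z : Cmod z < 1 -> exists al : R -> R,
  (forall t, is_derive al t (jac z t)) /\ al (2 * PI) = al 0 + 2 * PI /\
  forall t, sigma z (circ 1 t) = circ 1 (al t).
Proof.
  intros Hz. pose proof (jac_cts z Hz) as HJ.
  assert (HS0 : Cmod (sigma z (circ 1 0)) = 1).
  { pose proof (sigma_Cmod_sqr z (circ 1 0) (sigma_den1 z 0 Hz)) as H. rewrite Cmod_circ1 in H.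
    replace (1 - 1 ^ 2) with 0 in H by ring. unfold Rdiv in H. rewrite Rmult_0_r, Rmult_0_l, Rminus_0_r in H.
    pose proof (Cmod_ge_0 (sigma z (circ 1 0))). nra. }
  destruct (circle_arg _ HS0) as [b Hb].
  set (al := fun t => b + RInt (jac z) 0 t).
  assert (Dal : forall t, is_derive al t (jac z t)).
  { intros t. unfold al. apply rd_eq with (0 + jac z t); [|ring].
    apply (rd_plus (fun _ => b) (RInt (jac z) 0)). apply rd_const. apply is_derive_RInt_upper; auto. }
  assert (al0 : al 0 = b) by (unfold al; rewrite RInt_point; unfold zero; simpl; ring).
  exists al. split; auto. split.
  - rewrite al0. unfold al. f_equal. pose proof (avg_jac z Hz) as H. unfold avg in H.
    pose proof PI_RGT_0. apply Rmult_eq_reg_l with (/ (2 * PI)). rewrite H. field; lra.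
    apply Rinv_neq_0_compat; lra.
  - set (A := fun t => fst (sigma z (circ 1 t))). set (B := fun t => snd (sigma z (circ 1 t))).
    assert (Dc : forall t, is_derive (fun t => cos (al t)) t (jac z t * - sin (al t))).
    { intros t. apply (is_derive_comp cos al). apply is_derive_cos. apply Dal. }
    assert (Ds : forall t, is_derive (fun t => sin (al t)) t (jac z t * cos (al t))).
    { intros t. apply (is_derive_comp sin al). apply is_derive_sin. apply Dal. }
    assert (H1 : forall t, A t * cos (al t) + B t * sin (al t) = A 0 * cos (al 0) + B 0 * sin (al 0)).
    { apply (const_of_derive0 (fun t => A t * cos (al t) + B t * sin (al t))). intros t.
      destruct (sigma_circ_derive z t Hz) as [DA DB].
      eapply rd_eq. apply (rd_plus (fun t => A t * cos (al t)) (fun t => B t * sin (al t))).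
      apply (rd_mult A (fun t => cos (al t))). exact DA. apply Dc.
      apply (rd_mult B (fun t => sin (al t))). exact DB. apply Ds. unfold A, B. ring. }
    assert (H2 : forall t, B t * cos (al t) - A t * sin (al t) = B 0 * cos (al 0) - A 0 * sin (al 0)).
    { apply (const_of_derive0 (fun t => B t * cos (al t) - A t * sin (al t))). intros t.
      destruct (sigma_circ_derive z t Hz) as [DA DB].
      eapply rd_eq. apply (rd_minus (fun t => B t * cos (al t)) (fun t => A t * sin (al t))).
      apply (rd_mult B (fun t => cos (al t))). exact DB. apply Dc.
      apply (rd_mult A (fun t => sin (al t))). exact DA. apply Ds. unfold A, B. ring. }
    intros t. specialize (H1 t). specialize (H2 t).
    assert (EA : A 0 = cos b) by (unfold A; rewrite Hb; unfold circ; simpl; ring).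
    assert (EB : B 0 = sin b) by (unfold B; rewrite Hb; unfold circ; simpl; ring).
    rewrite EA, EB, al0 in H1, H2.
    pose proof (sin2_cos2 (al t)) as S1. pose proof (sin2_cos2 b) as S2. unfold Rsqr in S1, S2.
    replace (cos b * cos b + sin b * sin b) with 1 in H1 by lra.
    replace (sin b * cos b - cos b * sin b) with 0 in H2 by ring.
    apply C_eq; [change (A t = 1 * cos (al t)) | change (B t = 1 * sin (al t))].
    + assert (E : A t = cos (al t) * (A t * cos (al t) + B t * sin (al t)) - sin (al t) * (B t * cos (al t) - A t * sin (al t))).
      { transitivity (A t * (sin (al t) * sin (al t) + cos (al t) * cos (al t))); [rewrite S1; ring | ring]. }
      rewrite H1, H2 in E. rewrite E. ring.
    + assert (E : B t = sin (al t) * (A t * cos (al t) + B t * sin (al t)) + cos (al t) * (B t * cos (al t) - A t * sin (al t))).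
      { transitivity (B t * (sin (al t) * sin (al t) + cos (al t) * cos (al t))); [rewrite S1; ring | ring]. }
      rewrite H1, H2 in E. rewrite E. ring.
Qed.

Lemma Pk_den z al : Cmod z < 1 -> 0 < Cmod (circ 1 al - z) ^ 2.
Proof.
  intros H. apply pow_lt. apply Cmod_gt_0. apply Cmod_gt_neq. rewrite Cmod_circ1; auto.
Qed.

Lemma Pk_cts z : Cmod z < 1 -> Cts (Pk z).
Proof.
  intros H. unfold Pk. apply Cts_div. apply Cts_const.
  - apply Cts_pow, CC_Cmod, CC_minus. apply CC_circ. apply CC_const.
  - intros t. apply Rgt_not_eq. apply Pk_den; auto.
Qed.

Lemma circ_periodic r t : circ r (t + 2 * PI) = circ r t.
Proof.
  unfold circ. replace (t + 2 * PI) with (t + 2 * INR 1 * PI) by (simpl; ring).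
  rewrite cos_period, sin_period; auto.
Qed.

Lemma Pk_periodic z t : Pk z (t + 2 * PI) = Pk z t.
Proof. unfold Pk. rewrite circ_periodic; auto. Qed.

(** Substitution of the lifted angle; along it [jac z] and the Poisson kernel at z are
    reciprocal. *)
Lemma poisson_change z (g : C -> R) : Cmod z < 1 -> Cts (fun al => g (circ 1 al)) ->
  avg (fun t => g (sigma z (circ 1 t))) = avg (fun al => Pk z al * g (circ 1 al)).
Proof.
  intros Hz Hg. destruct (sigma_lift z Hz) as [al [Dal [Hal HS]]].
  pose proof (Pk_cts z Hz) as HP.
  assert (Hf : Cts (fun t : R => Pk z t * g (circ 1 t))) by (apply Cts_mult; auto).
  unfold avg. f_equal.
  rewrite <- (RInt_periodic (fun t => Pk z t * g (circ 1 t)) (al 0)); auto.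
  2:{ intros t. rewrite Pk_periodic, circ_periodic; auto. }
  rewrite <- Hal.
  rewrite <- (RInt_comp (fun t => Pk z t * g (circ 1 t)) al (jac z) 0 (2 * PI)).
  - apply RInt_ext. intros t _. change (g (sigma z (circ 1 t)) = jac z t * (Pk z (al t) * g (circ 1 (al t)))).
    unfold Pk. rewrite <- HS. pose proof (sigma_den1 z t Hz) as Hn. pose proof (proj1 (Cmod_gt_0 _) Hn) as Hm.
    pose proof (Cmod_lt1_sqr z Hz) as H1.
    assert (E : (sigma z (circ 1 t) - z = RtoC (1 - Cmod z ^ 2) * circ 1 t * / (1 + Cconj z * circ 1 t))%C).
    { assert (E : RtoC (1 - Cmod z ^ 2) = (1 - Cconj z * z)%C).
      { rewrite Cmod_sqr. destruct z as [a b]. apply C_eq; unfold Cconj; simpl; ring. }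
      rewrite E. unfold sigma. field. auto. }
    rewrite E, !Cmod_mult, Cmod_R, Rabs_pos_eq, Cmod_circ1, Cmod_inv by (auto; lra).
    unfold jac. field. lra.
  - intros x _. apply Hf.
  - intros x _. split. apply Dal. apply jac_cts; auto.
Qed.

(** Ensures that a function analytic beyond the closed disc stays so after composition with
    [sigma z], so that means may be taken at radius exactly 1. *)
Lemma sigma_hol z : Cmod z < 1 -> forall rho, 1 < rho -> exists r, 1 < r /\
  forall w, Cmod w < r -> (1 + Cconj z * w)%C <> 0%C /\ Cmod (sigma z w) < rho.
Proof.
  intros Hz rho Hrho. pose proof (Cmod_ge_0 z) as Hz0. set (d := 1 - Cmod z).
  assert (Hd : 0 < d <= 1) by (unfold d; lra).
  (* The first bound keeps the denominator of sigma at least d/2. The second makes |w|^2 - 1 <= 3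
     eta at most half of d^2/4 * (rho^2 - 1). *)
  set (eta := Rmin (d / 2) (d ^ 2 * (rho ^ 2 - 1) / 24)).
  assert (Hrr : 0 < rho ^ 2 - 1) by nra.
  assert (Heta : 0 < eta /\ eta <= d / 2 /\ eta <= d ^ 2 * (rho ^ 2 - 1) / 24).
  { unfold eta. split; [apply Rmin_pos; [lra | apply Rdiv_lt_0_compat; [apply Rmult_lt_0_compat; [apply pow_lt; lra | lra] | lra]]|]. split; [apply Rmin_l | apply Rmin_r]. }
  exists (1 + eta). split; [lra|]. intros w Hw. pose proof (Cmod_ge_0 w) as Hw0.
  assert (Hzw : Cmod z * Cmod w <= 1 - d / 2).
  { assert (Hzd : Cmod z = 1 - d) by (unfold d; ring).
    apply Rle_trans with ((1 - d) * (1 + d / 2)); [|nra]. apply Rmult_le_compat; lra. }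
  assert (Hn : (1 + Cconj z * w)%C <> 0%C) by (apply sigma_den; lra).
  split; auto.
  assert (Hden : d / 2 <= Cmod (1 + Cconj z * w)).
  { pose proof (Cmod_triangle (1 + Cconj z * w) (- (Cconj z * w))) as HT.
    replace (1 + Cconj z * w + - (Cconj z * w))%C with (RtoC 1) in HT by ring.
    rewrite Cmod_1, Cmod_opp, Cmod_mult, Cmod_conj in HT. lra. }
  assert (Hs : Cmod (sigma z w) ^ 2 < rho ^ 2).
  { rewrite sigma_Cmod_sqr by auto.
    assert (Hden2 : d ^ 2 / 4 <= Cmod (1 + Cconj z * w) ^ 2) by (replace (d ^ 2 / 4) with ((d / 2) ^ 2) by field; apply pow_incr; lra).
    set (D := Cmod (1 + Cconj z * w) ^ 2) in *.
    assert (HD : 0 < D) by nra.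
    assert (K : (Cmod w ^ 2 - 1) * (1 - Cmod z ^ 2) < D * (rho ^ 2 - 1)).
    { assert (Cmod w ^ 2 - 1 <= 3 * eta) by nra.
      assert (3 * eta <= d ^ 2 / 4 * (rho ^ 2 - 1) / 2) by nra.
      assert (0 < 1 - Cmod z ^ 2 <= 1) by nra.
      assert (d ^ 2 / 4 * (rho ^ 2 - 1) <= D * (rho ^ 2 - 1)) by (apply Rmult_le_compat_r; lra).
      assert (0 < D * (rho ^ 2 - 1)) by (apply Rmult_lt_0_compat; lra).
      destruct (Rle_dec (Cmod w ^ 2 - 1) 0).
      - apply Rle_lt_trans with 0; auto. nra.
      - apply Rle_lt_trans with (Cmod w ^ 2 - 1); [nra|lra]. }
    apply Rmult_lt_reg_r with D; auto.
    replace ((1 - (1 - Cmod z ^ 2) * (1 - Cmod w ^ 2) / D) * D) with (D + (Cmod w ^ 2 - 1) * (1 - Cmod z ^ 2)) by (field; lra).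
    lra. }
  pose proof (Cmod_ge_0 (sigma z w)). nra.
Qed.

Lemma hol_sigma_comp rho f z : 1 < rho -> hol rho f -> Cmod z < 1 -> exists r, 1 < r /\ hol r (fun w => f (sigma z w)).
Proof.
  intros Hrho Hf Hz. destruct (sigma_hol z Hz rho Hrho) as [r [Hr H]]. exists r. split; auto.
  intros w Hw. destruct (H w Hw) as [Hn Hs]. destruct (Hf _ Hs) as [l Hl].
  eexists. apply Cdiff_comp. apply sigma_diff; auto. exact Hl.
Qed.

Lemma sigma_0 z : sigma z 0%C = z.
Proof.
  unfold sigma. replace (1 + Cconj z * 0)%C with (RtoC 1) by ring.
  replace (/ 1)%C with (RtoC 1) by (apply C_eq; simpl; field). ring.
Qed.

Lemma poisson_subharmonic rho f z q : 1 < rho -> hol rho f -> Cmod z < 1 -> 0 < q ->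
  rpow (Cmod (f z)) q <= avg (fun al => Pk z al * rpow (Cmod (f (circ 1 al))) q).
Proof.
  intros Hrho Hf Hz Hq. destruct (hol_sigma_comp rho f z Hrho Hf Hz) as [r [Hr Hh]].
  pose proof (subharmonic_mean r _ q 1 Hh Hq ltac:(lra)) as H. cbv beta in H. rewrite sigma_0 in H.
  rewrite (poisson_change z (fun w => rpow (Cmod (f w)) q)) in H; auto.
  apply Cts_rpow; auto. intros; apply Cmod_ge_0. apply CC_Cmod. apply (CC_hol rho); auto; lra.
Qed.

Lemma poisson_formula rho f z : 1 < rho -> hol rho f -> Cmod z < 1 ->
  avg (fun al => Pk z al * fst (f (circ 1 al))) = fst (f z).
Proof.
  intros Hrho Hf Hz. destruct (hol_sigma_comp rho f z Hrho Hf Hz) as [r [Hr Hh]].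
  pose proof (mean_value _ r 1 Hh ltac:(lra)) as H. cbv beta in H. rewrite sigma_0 in H. rewrite <- H. simpl.
  rewrite (poisson_change z (fun w => fst (f w))); auto.
  apply CC_fst. apply (CC_hol rho); auto; lra.
Qed.

Lemma Pk_ge0 z al : Cmod z < 1 -> 0 <= Pk z al.
Proof.
  intros Hz. pose proof (Cmod_lt1_sqr z Hz). pose proof (Pk_den z al Hz).
  unfold Pk. apply Rmult_le_pos. lra. left; apply Rinv_0_lt_compat; auto.
Qed.

Lemma avg_Pk z : Cmod z < 1 -> avg (Pk z) = 1.
Proof.
  intros Hz. pose proof (poisson_formula 2 (fun _ => 1%C) z ltac:(lra)) as H.
  rewrite (avg_ext _ (Pk z)) in H by (intros; simpl; ring). apply H; auto.
  intros w _. eexists. apply Cdiff_const.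
Qed.

Lemma Pk_le z al : Cmod z < 1 -> Pk z al <= 2 / (1 - Cmod z).
Proof.
  intros Hz. pose proof (Cmod_ge_0 z). pose proof (Pk_den z al Hz) as Hd. unfold Pk.
  assert (Hm : 1 - Cmod z <= Cmod (circ 1 al - z)).
  { pose proof (Cmod_minus_ge (circ 1 al) z). rewrite Cmod_circ1 in H0. auto. }
  apply Rmult_le_reg_r with (Cmod (circ 1 al - z) ^ 2); auto.
  replace ((1 - Cmod z ^ 2) / Cmod (circ 1 al - z) ^ 2 * Cmod (circ 1 al - z) ^ 2) with (1 - Cmod z ^ 2) by (field; lra).
  apply Rle_trans with (2 / (1 - Cmod z) * (1 - Cmod z) ^ 2).
  - replace (2 / (1 - Cmod z) * (1 - Cmod z) ^ 2) with (2 * (1 - Cmod z)) by (field; lra). nra.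
  - apply Rmult_le_compat_l. apply Rmult_le_pos. lra. left; apply Rinv_0_lt_compat; lra. apply pow_incr; lra.
Qed.

Lemma conj_circ1 al : (circ 1 al * Cconj (circ 1 al))%C = 1%C.
Proof.
  pose proof (sin2_cos2 al) as Hsc. unfold Rsqr in Hsc. unfold Cconj, circ. apply C_eq; simpl; nra.
Qed.

Lemma Pk_cayley z al : Cmod z < 1 ->
  Pk z al = fst ((1 + Cconj (circ 1 al) * z) * / (1 - Cconj (circ 1 al) * z))%C.
Proof.
  intros Hz.
  assert (E : (circ 1 al - z = circ 1 al * (1 - Cconj (circ 1 al) * z))%C).
  { replace (circ 1 al * (1 - Cconj (circ 1 al) * z))%C with (circ 1 al - (circ 1 al * Cconj (circ 1 al)) * z)%C by ring.
    rewrite conj_circ1. ring. }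
  rewrite fst_cayley.
  - unfold Pk. rewrite E, !Cmod_mult, Cmod_conj, Cmod_circ1, !Rmult_1_l. auto.
  - apply Cmod_gt_neq. rewrite Cmod_mult, Cmod_conj, Cmod_circ1, Cmod_1; lra.
Qed.

(** For a fixed boundary point the Poisson kernel is the real part of an analytic function of its
    first argument, so composing with vphi preserves the mean value property. This is where the
    constant 2 / (1 - |vphi 0|) of [littlewood] comes from. *)
Lemma avg_Pk_comp (vphi : C -> C) r al : hol 1 vphi -> (forall z, Cmod z < 1 -> Cmod (vphi z) < 1) -> 0 <= r < 1 ->
  avg (fun t => Pk (vphi (circ r t)) al) = Pk (vphi 0%C) al.
Proof.
  intros Hv Hs Hr.
  assert (Hh : hol 1 (fun z => (1 + Cconj (circ 1 al) * vphi z) * / (1 - Cconj (circ 1 al) * vphi z))%C).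
  { intros z Hz. destruct (Hv z Hz) as [l Hl].
    destruct (cayley_hol (Cconj (circ 1 al)) 1) with (z := vphi z) as [m Hm].
    - rewrite Cmod_conj, Cmod_circ1; lra.
    - apply Hs; auto.
    - eexists. apply (Cdiff_comp _ vphi z _ _ Hl Hm). }
  pose proof (mean_value _ 1 r Hh Hr) as H. apply (f_equal fst) in H. simpl fst in H at 1.
  rewrite Pk_cayley by (apply Hs; rewrite Cmod_0; lra).
  rewrite <- H. apply avg_ext. intros t. apply Pk_cayley. apply Hs. rewrite Cmod_circ, Rabs_pos_eq; lra.
Qed.

Definition Kp (r t : R) : R := (1 - r ^ 2) / (1 - 2 * r * cos t + r ^ 2).

Lemma Pk_circ r th al : Pk (circ r th) al = Kp r (th - al).
Proof.
  unfold Pk, Kp. f_equal.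
  - rewrite Cmod_circ, pow2_abs; auto.
  - rewrite Cmod_sqr, cos_minus. unfold circ; simpl.
    pose proof (sin2_cos2 th) as H1. pose proof (sin2_cos2 al) as H2. unfold Rsqr in H1, H2.
    transitivity ((sin al * sin al + cos al * cos al) - 2 * r * (cos th * cos al + sin th * sin al)
      + r ^ 2 * (sin th * sin th + cos th * cos th)); [ring | rewrite H1, H2; ring].
Qed.

Lemma Kp_even r t : Kp r (- t) = Kp r t.
Proof. unfold Kp. rewrite cos_neg; auto. Qed.

(** For fixed al, Kp b (be - al) is the boundary value of the real part of a Cayley quotient
    analytic past the circle; Poisson's formula evaluates that real part at a e^(i th). *)
Lemma Kp_semigroup a b th al : 0 <= a < 1 -> 0 <= b < 1 ->
  avg (fun be => Kp a (th - be) * Kp b (be - al)) = Kp (a * b) (th - al).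
Proof.
  intros Ha Hb. set (c := (RtoC b * Cconj (circ 1 al))%C).
  assert (Hc : Cmod c = b) by (unfold c; rewrite Cmod_mult, Cmod_R, Cmod_conj, Cmod_circ1, Rabs_pos_eq; lra).
  assert (EH : forall r be, 0 <= r <= 1 ->
    fst ((1 + c * circ r be) * / (1 - c * circ r be))%C = Kp (r * b) (be - al)).
  { intros r be Hr.
    assert (E : (c * circ r be = Cconj (circ 1 al) * circ (r * b) be)%C).
    { unfold c. replace (circ (r * b) be) with (RtoC b * circ r be)%C. ring.
      apply C_eq; unfold circ; simpl; ring. }
    rewrite E, <- Pk_cayley. apply Pk_circ. rewrite Cmod_circ, Rabs_pos_eq; nra. }
  set (rho := 2 / (1 + b)).
  assert (Hrho : 1 < rho).
  { unfold rho. apply Rmult_lt_reg_r with (1 + b). lra. unfold Rdiv. rewrite Rmult_assoc, Rinv_l; lra. }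
  assert (Hh : hol rho (fun w => ((1 + c * w) * / (1 - c * w))%C)).
  { apply cayley_hol. rewrite Hc. unfold rho. apply Rmult_le_reg_r with (1 + b). lra.
    replace (b * (2 / (1 + b)) * (1 + b)) with (2 * b) by (field; lra). lra. }
  assert (Hz : Cmod (circ a th) < 1) by (rewrite Cmod_circ, Rabs_pos_eq; lra).
  pose proof (poisson_formula rho _ (circ a th) Hrho Hh Hz) as H.
  cbv beta in H. rewrite EH in H by lra. rewrite <- H. apply avg_ext. intros be.
  rewrite EH, Pk_circ by lra. rewrite Rmult_1_l. auto.
Qed.

Lemma Kp_ge0 r t : 0 <= r < 1 -> 0 <= Kp r t.
Proof.
  intros Hr. replace t with (t - 0) by ring. rewrite <- Pk_circ. apply Pk_ge0.
  rewrite Cmod_circ, Rabs_pos_eq; lra.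
Qed.

Lemma Kp_den r t : 0 <= r < 1 -> 0 < 1 - 2 * r * cos t + r ^ 2.
Proof. intros Hr. pose proof (COS_bound t). nra. Qed.

Lemma Cts_Kp {T : UniformSpace} (F : T -> R) r : 0 <= r < 1 -> Cts F -> Cts (fun x => Kp r (F x)).
Proof.
  intros Hr HF. unfold Kp. apply Cts_div. apply Cts_const.
  - apply Cts_plus; [|apply Cts_const]. apply Cts_minus. apply Cts_const. apply Cts_mult. apply Cts_const. apply Cts_cos; auto.
  - intros x. apply Rgt_not_eq. apply Kp_den; auto.
Qed.

Lemma avg_Kp r th : 0 <= r < 1 -> avg (fun al => Kp r (th - al)) = 1.
Proof.
  intros Hr. rewrite <- (avg_Pk (circ r th)) by (rewrite Cmod_circ, Rabs_pos_eq; lra).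
  apply avg_ext. intros; rewrite Pk_circ; auto.
Qed.

Lemma avg_Kp' r al : 0 <= r < 1 -> avg (fun th => Kp r (th - al)) = 1.
Proof.
  intros Hr. rewrite <- (avg_Kp r al Hr). apply avg_ext. intros t.
  rewrite <- Kp_even. f_equal. ring.
Qed.

Lemma Kp_le r t : 0 <= r < 1 -> Kp r t <= 2 / (1 - r).
Proof.
  intros Hr. replace t with (t - 0) by ring. rewrite <- Pk_circ.
  assert (Cmod (circ r t) = r) by (rewrite Cmod_circ, Rabs_pos_eq; lra).
  rewrite <- H at 2. apply Pk_le. lra.
Qed.

(** * A Carleson embedding for kernel test functions *)

Lemma Cts2_fst (v : R -> R) : Cts v -> Cts (fun p : R * R => v (fst p)).
Proof. intros H. apply (Cts_comp (fun p : R * R => fst p) v); auto. intros x; apply continuous_fst_comp, continuous_id. Qed.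
Lemma Cts2_snd (v : R -> R) : Cts v -> Cts (fun p : R * R => v (snd p)).
Proof. intros H. apply (Cts_comp (fun p : R * R => snd p) v); auto. intros x; apply continuous_snd_comp, continuous_id. Qed.
Lemma Cts2_swap (F : R -> R -> R) : Cts (fun p : R * R => F (fst p) (snd p)) -> Cts (fun p : R * R => F (snd p) (fst p)).
Proof.
  intros H. apply (Cts_comp (fun p : R * R => (snd p, fst p)) (fun p : R * R => F (fst p) (snd p))); auto.
  intros x. apply continuous_pair. apply continuous_snd_comp, continuous_id. apply continuous_fst_comp, continuous_id.
Qed.
Lemma Cts2_sec1 (F : R -> R -> R) x : Cts (fun p : R * R => F (fst p) (snd p)) -> Cts (F x).
Proof. apply Cts_section. Qed.
Lemma Cts2_sec2 (F : R -> R -> R) y : Cts (fun p : R * R => F (fst p) (snd p)) -> Cts (fun x => F x y).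
Proof. intros H. apply (Cts_section (fun y x => F x y)). apply Cts2_swap; auto. Qed.
Lemma Cts2_avg1 (F : R -> R -> R) : Cts (fun p : R * R => F (fst p) (snd p)) -> Cts (fun y => avg (fun x => F x y)).
Proof. intros H. apply (Cts_avg (fun y x => F x y)). apply Cts2_swap; auto. Qed.

(** The squared integral is a double integral of k t x * k t' x. The three-point inequality replaces
    this product by terms linear in k, and then the x-integration only needs the testing bound A.
    The factor h t on both sides of the test restricts it to points with h t > 0. *)
Lemma TT_estimate (k B : R -> R -> R) (om h : R -> R) c A :
  Cts (fun p : R * R => k (fst p) (snd p)) -> Cts (fun p : R * R => B (fst p) (snd p)) -> Cts om -> Cts h ->
  0 <= c -> (forall t x, 0 <= k t x) -> (forall t x, 0 <= B t x) -> (forall x, 0 <= om x) -> (forall t, 0 <= h t) ->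
  (forall t t' x, k t x * k t' x <= c * (B t' t * k t x + B t t' * k t' x)) ->
  (forall t, h t * avg (fun x => om x * k t x) <= h t * A) ->
  avg (fun x => om x * (avg (fun t => h t * k t x)) ^ 2) <= 2 * c * A * avg (fun t => h t * avg (fun t' => h t' * B t' t)).
Proof.
  intros Ck CB Com Ch Hc Hk HB Hom Hh Hq HA.
  set (G := fun t => avg (fun t' => h t' * B t' t)).
  assert (CG : Cts G).
  { apply (Cts2_avg1 (fun t' t => h t' * B t' t)). apply Cts_mult; auto. apply Cts2_fst; auto. }
  assert (HG : forall t, 0 <= G t).
  { intros t. apply avg_nonneg. apply Cts_mult; auto. apply Cts2_sec2; auto. intros; apply Rmult_le_pos; auto. }
  assert (Chk : forall x, Cts (fun t => h t * k t x)).
  { intros x. apply Cts_mult; auto. apply Cts2_sec2; auto. }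
  assert (ChkG : Cts (fun p : R * R => h (fst p) * k (fst p) (snd p) * G (fst p))).
  { apply Cts_mult; [apply Cts_mult|]; auto using Cts2_fst. }
  assert (S1 : forall x, (avg (fun t => h t * k t x)) ^ 2 <= 2 * c * avg (fun t => h t * k t x * G t)).
  { intros x. set (a := avg (fun t => h t * k t x)).
    set (F := fun t t' => h t * h t' * B t' t * k t x).
    assert (CF : Cts (fun p : R * R => F (fst p) (snd p))).
    { unfold F. apply Cts_mult; [apply Cts_mult; [apply Cts_mult|]|]; auto using Cts2_fst, Cts2_snd.
      apply (Cts2_swap B); auto. apply (Cts2_fst (fun t => k t x)). apply Cts2_sec2; auto. }
    assert (E1 : avg (fun t => avg (F t)) = avg (fun t => h t * k t x * G t)).
    { apply avg_ext. intros t. unfold G, F. rewrite <- avg_scal. apply avg_ext; intros; ring.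
      apply Cts_mult; auto. apply Cts2_sec2; auto. }
    assert (E2 : avg (fun t => avg (fun t' => F t' t)) = avg (fun t => h t * k t x * G t)).
    { rewrite <- E1. symmetry. apply avg_Fubini. auto. }
    replace (a ^ 2) with (avg (fun t => avg (fun t' => (h t * k t x) * (h t' * k t' x)))).
    2:{ rewrite (avg_ext _ (fun t => (h t * k t x) * a)).
        rewrite avg_scal_r by auto. fold a. ring.
        intros t. rewrite avg_scal by auto. reflexivity. }
    apply Rle_trans with (avg (fun t => avg (fun t' => c * (F t t' + F t' t)))).
    - assert (C1 : Cts (fun p : R * R => (h (fst p) * k (fst p) x) * (h (snd p) * k (snd p) x))).
      { apply Cts_mult. apply (Cts2_fst (fun t => h t * k t x)); auto. apply (Cts2_snd (fun t => h t * k t x)); auto. }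
      assert (C2 : Cts (fun p : R * R => c * (F (fst p) (snd p) + F (snd p) (fst p)))).
      { apply Cts_mult. apply Cts_const. apply Cts_plus; auto. apply (Cts2_swap F); auto. }
      apply avg_le.
      + apply (Cts_avg (fun t t' => (h t * k t x) * (h t' * k t' x))); auto.
      + apply (Cts_avg (fun t t' => c * (F t t' + F t' t))); auto.
      + intros t. apply avg_le.
        * apply (Cts2_sec1 (fun t t' => (h t * k t x) * (h t' * k t' x))); auto.
        * apply (Cts2_sec1 (fun t t' => c * (F t t' + F t' t))); auto.
        * intros t'. unfold F. specialize (Hq t t' x).
          replace (h t * k t x * (h t' * k t' x)) with (h t * h t' * (k t x * k t' x)) by ring.
          replace (c * (h t * h t' * B t' t * k t x + h t' * h t * B t t' * k t' x)) with
            (h t * h t' * (c * (B t' t * k t x + B t t' * k t' x))) by ring.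
          apply Rmult_le_compat_l; auto. apply Rmult_le_pos; auto.
    - right. rewrite (avg_ext _ (fun t => c * (avg (F t) + avg (fun t' => F t' t)))).
      + rewrite avg_scal, avg_plus, E1, E2; try ring.
        * apply Cts_avg; auto.
        * apply (Cts2_avg1 F); auto.
        * apply Cts_plus. apply Cts_avg; auto. apply (Cts2_avg1 F); auto.
      + intros t. rewrite avg_scal, avg_plus; auto.
        * apply (Cts2_sec1 F); auto.
        * apply (Cts2_sec2 F); auto.
        * apply Cts_plus. apply (Cts2_sec1 F); auto. apply (Cts2_sec2 F); auto. }
  assert (Ca : Cts (fun x => avg (fun t => h t * k t x))).
  { apply (Cts2_avg1 (fun t x => h t * k t x)). apply Cts_mult; auto. apply Cts2_fst; auto. }
  assert (CaG : Cts (fun x => avg (fun t => h t * k t x * G t))).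
  { apply (Cts2_avg1 (fun t x => h t * k t x * G t)); auto. }
  apply Rle_trans with (avg (fun x => om x * (2 * c * avg (fun t => h t * k t x * G t)))).
  { apply avg_le.
    - apply Cts_mult; auto. apply Cts_pow; auto.
    - apply Cts_mult; auto. apply Cts_mult; auto. apply Cts_const.
    - intros x. apply Rmult_le_compat_l; auto. }
  assert (Comk : forall t, Cts (fun x => om x * k t x)).
  { intros t. apply Cts_mult; auto. apply Cts2_sec1; auto. }
  assert (E : avg (fun x => om x * (2 * c * avg (fun t => h t * k t x * G t))) =
     2 * c * avg (fun t => (h t * avg (fun x => om x * k t x)) * G t)).
  { rewrite (avg_ext _ (fun x => 2 * c * avg (fun t => om x * (h t * k t x * G t)))).
    - rewrite avg_scal.
      + f_equal. rewrite (avg_Fubini (fun x t => om x * (h t * k t x * G t))).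
        * apply avg_ext. intros t. rewrite (avg_ext _ (fun x => (h t * G t) * (om x * k t x))) by (intros; ring).
          rewrite avg_scal; auto. ring.
        * apply Cts_mult. apply Cts2_fst; auto. apply (Cts2_swap (fun t x => h t * k t x * G t)); auto.
      + apply (Cts_avg (fun x t => om x * (h t * k t x * G t))). apply Cts_mult. apply Cts2_fst; auto.
        apply (Cts2_swap (fun t x => h t * k t x * G t)); auto.
    - intros x. rewrite avg_scal. ring. apply (Cts2_sec2 (fun t x => h t * k t x * G t)); auto. }
  rewrite E.
  assert (CmA : Cts (fun t => h t * avg (fun x => om x * k t x))).
  { apply Cts_mult; auto. apply (Cts_avg (fun t x => om x * k t x)). apply Cts_mult; auto. apply Cts2_snd; auto. }
  change (2 * c * avg (fun t => h t * avg (fun x => om x * k t x) * G t) <= 2 * c * A * avg (fun t => h t * G t)).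
  replace (2 * c * A * avg (fun t => h t * G t)) with (2 * c * avg (fun t => (h t * A) * G t)).
  - apply Rmult_le_compat_l. lra. apply avg_le.
    + apply Cts_mult; auto.
    + apply Cts_mult; auto. apply Cts_mult; auto. apply Cts_const.
    + intros t. apply Rmult_le_compat_r; auto.
  - rewrite (avg_ext _ (fun t => A * (h t * G t))) by (intros; ring).
    rewrite avg_scal. ring. apply Cts_mult; auto.
Qed.

(* [kern s z w] is (1 - |z|^2)^(s-1) / |1 - conj z w|^s. *)
Definition kap (z w : C) : R := (1 - Cmod z ^ 2) / Cmod (1 - Cconj z * w).
Definition kern (s : R) (z w : C) : R := rpow (kap z w) s / (1 - Cmod z ^ 2).

Lemma kap_den_neq z w : Cmod z < 1 -> Cmod w <= 1 -> (1 - Cconj z * w)%C <> 0%C.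
Proof.
  intros Hz Hw. apply Cmod_gt_neq. rewrite Cmod_1, Cmod_mult, Cmod_conj.
  pose proof (Cmod_ge_0 z). pose proof (Cmod_ge_0 w). nra.
Qed.
Lemma kap_den z w : Cmod z < 1 -> Cmod w <= 1 -> 0 < Cmod (1 - Cconj z * w).
Proof. intros. apply Cmod_gt_0, kap_den_neq; auto. Qed.

Lemma kap_gt0 z w : Cmod z < 1 -> Cmod w <= 1 -> 0 < kap z w.
Proof. intros Hz Hw. apply Rdiv_lt_0_compat. apply Cmod_lt1_sqr; auto. apply kap_den; auto. Qed.

Lemma one_minus_le z w : Cmod z <= 1 -> Cmod w <= 1 -> 1 - Cmod z <= Cmod (1 - Cconj z * w).
Proof.
  intros Hz Hw. pose proof (Cmod_minus_ge 1%C (Cconj z * w)%C) as H.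
  rewrite Cmod_1, Cmod_mult, Cmod_conj in H. pose proof (Cmod_ge_0 z). pose proof (Cmod_ge_0 w). nra.
Qed.

Lemma kap_le2 z w : Cmod z < 1 -> Cmod w <= 1 -> kap z w <= 2.
Proof.
  intros Hz Hw. pose proof (kap_den z w Hz Hw) as Hd. pose proof (one_minus_le z w ltac:(lra) Hw).
  pose proof (Cmod_ge_0 z). unfold kap. apply Rmult_le_reg_r with (Cmod (1 - Cconj z * w)); auto.
  unfold Rdiv. rewrite Rmult_assoc, Rinv_l by lra. nra.
Qed.

Lemma kern_ge0 s z w : Cmod z < 1 -> 0 <= kern s z w.
Proof.
  intros Hz. apply Rmult_le_pos. apply rpow_ge0. left; apply Rinv_0_lt_compat, Cmod_lt1_sqr; auto.
Qed.

Lemma Cts_kern {T : UniformSpace} (Z W : T -> C) s : 0 < s ->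
  (forall x, CCt Z x) -> (forall x, CCt W x) -> (forall x, Cmod (Z x) < 1) -> (forall x, Cmod (W x) <= 1) ->
  Cts (fun x => kern s (Z x) (W x)).
Proof.
  intros Hs HZ HW HZ1 HW1.
  assert (CmZ : Cts (fun x => 1 - Cmod (Z x) ^ 2)).
  { apply Cts_minus. apply Cts_const. apply Cts_pow. intros x; apply CCt_Cmod; auto. }
  unfold kern. apply Cts_div; auto.
  - apply Cts_rpow; auto.
    + intros x. left. apply kap_gt0; auto.
    + unfold kap. apply Cts_div; auto.
      * intros x. apply CCt_Cmod. apply CCt_minus. apply CCt_const. apply CCt_mult; auto.
        apply CCt_intro; unfold Cconj; simpl. apply CCt_fst; auto. apply ct_opp. apply CCt_snd; auto.
      * intros x. apply Rgt_not_eq. apply kap_den; auto.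
  - intros x. apply Rgt_not_eq. apply Cmod_lt1_sqr; auto.
Qed.

(** Write 1 - conj z w = (1 - conj z x) + conj z (x - w), and bound |x - w| by 3 |1 - conj w x|
    through x - w = x (1 - conj x w) - w (1 - |x|^2). *)
Lemma quasi_metric z w x : Cmod z <= 1 -> Cmod w <= 1 -> Cmod x <= 1 ->
  Cmod (1 - Cconj z * w) <= 3 * (Cmod (1 - Cconj z * x) + Cmod (1 - Cconj w * x)).
Proof.
  intros Hz Hw Hx. pose proof (Cmod_ge_0 z). pose proof (Cmod_ge_0 w). pose proof (Cmod_ge_0 x).
  assert (E : Cmod (1 - Cconj x * w) = Cmod (1 - Cconj w * x)).
  { rewrite <- Cmod_conj. f_equal. rewrite Cminus_conj, Cmult_conj, Cconj_conj.
    replace (Cconj 1) with (RtoC 1) by (apply C_eq; simpl; ring). ring. }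
  assert (HK1 : Cmod (x - w) <= 3 * Cmod (1 - Cconj w * x)).
  { assert (E2 : (x - w = x * (1 - Cconj x * w) - w * RtoC (1 - Cmod x ^ 2))%C).
    { rewrite Cmod_sqr. destruct x as [a b], w as [c d]. apply C_eq; unfold Cconj; simpl; ring. }
    rewrite E2. unfold Cminus at 1. eapply Rle_trans; [apply Cmod_triangle|].
    rewrite Cmod_opp, !Cmod_mult, Cmod_R, E.
    pose proof (one_minus_le x w Hx Hw) as Ho. rewrite E in Ho.
    rewrite Rabs_pos_eq by nra. pose proof (Cmod_ge_0 (1 - Cconj w * x)).
    assert (1 - Cmod x ^ 2 <= 2 * Cmod (1 - Cconj w * x)) by nra.
    assert (0 <= 1 - Cmod x ^ 2) by nra. nra. }
  replace (1 - Cconj z * w)%C with ((1 - Cconj z * x) + Cconj z * (x - w))%C by ring.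
  eapply Rle_trans; [apply Cmod_triangle|]. rewrite Cmod_mult, Cmod_conj.
  pose proof (Cmod_ge_0 (1 - Cconj z * x)). pose proof (Cmod_ge_0 (x - w)). nra.
Qed.

Lemma rpow_div x y s : 0 <= x -> 0 < y -> rpow (x / y) s = rpow x s / rpow y s.
Proof.
  intros Hx Hy. assert (Hy2 : 0 < rpow y s) by (apply rpow_gt0; auto).
  apply Rmult_eq_reg_r with (rpow y s); [|lra]. rewrite <- rpow_mult.
  - replace (x / y * y) with x by (field; lra). field. lra.
  - apply Rmult_le_pos; auto. left; apply Rinv_0_lt_compat; auto.
  - lra.
Qed.

(** After clearing denominators this is [quasi_metric] raised to the power s; 6 = 3 * 2, the sum of
    two distances being at most twice the larger. *)
Lemma kern_TT s z w x : 0 < s -> Cmod z < 1 -> Cmod w < 1 -> Cmod x <= 1 ->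
  kern s z x * kern s w x <= rpow 6 s * (kern s w z * kern s z x + kern s z w * kern s w x).
Proof.
  intros Hs Hz Hw Hx.
  pose proof (kap_den z x Hz Hx) as Ha. pose proof (kap_den w x Hw Hx) as Hb.
  pose proof (kap_den z w Hz ltac:(lra)) as HD. pose proof (kap_den w z Hw ltac:(lra)) as HD'.
  assert (E : Cmod (1 - Cconj w * z) = Cmod (1 - Cconj z * w)).
  { rewrite <- Cmod_conj. f_equal. rewrite Cminus_conj, Cmult_conj, Cconj_conj.
    replace (Cconj 1) with (RtoC 1) by (apply C_eq; simpl; ring). ring. }
  pose proof (quasi_metric z w x ltac:(lra) ltac:(lra) Hx) as HQ.
  pose proof (Cmod_lt1_sqr z Hz) as Pz. pose proof (Cmod_lt1_sqr w Hw) as Pw.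
  unfold kern, kap. rewrite E.
  set (a := Cmod (1 - Cconj z * x)) in *. set (b := Cmod (1 - Cconj w * x)) in *.
  set (D := Cmod (1 - Cconj z * w)) in *. set (u := 1 - Cmod z ^ 2) in *. set (v := 1 - Cmod w ^ 2) in *.
  rewrite !rpow_div by lra.
  assert (Ra : 0 < rpow a s) by (apply rpow_gt0; auto). assert (Rb : 0 < rpow b s) by (apply rpow_gt0; auto).
  assert (RD : 0 < rpow D s) by (apply rpow_gt0; auto). assert (R6 : 0 < rpow 6 s) by (apply rpow_gt0; lra).
  assert (Ru : 0 < rpow u s) by (apply rpow_gt0; auto). assert (Rv : 0 < rpow v s) by (apply rpow_gt0; auto).
  assert (K : rpow D s <= rpow 6 s * (rpow a s + rpow b s)).
  { destruct (Rle_dec a b).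
    - apply Rle_trans with (rpow (6 * b) s). apply rpow_le; lra. rewrite rpow_mult by lra. nra.
    - apply Rle_trans with (rpow (6 * a) s). apply rpow_le; lra. rewrite rpow_mult by lra. nra. }
  replace (rpow u s / rpow a s / u * (rpow v s / rpow b s / v)) with
    ((rpow u s * rpow v s / (u * v)) * (/ (rpow a s * rpow b s * rpow D s)) * rpow D s) by (field; lra).
  replace (rpow 6 s * (rpow v s / rpow D s / v * (rpow u s / rpow a s / u) + rpow u s / rpow D s / u * (rpow v s / rpow b s / v)))
    with ((rpow u s * rpow v s / (u * v)) * (/ (rpow a s * rpow b s * rpow D s)) * (rpow 6 s * (rpow a s + rpow b s))) by (field; lra).
  apply Rmult_le_compat_l; auto. apply Rmult_le_pos.
  - left. apply Rdiv_lt_0_compat; apply Rmult_lt_0_compat; auto.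
  - left. apply Rinv_0_lt_compat. repeat apply Rmult_lt_0_compat; auto.
Qed.

Lemma Cmod_circ1_sub z al : Cmod (circ 1 al - z) = Cmod (1 - Cconj z * circ 1 al).
Proof.
  assert (E : (circ 1 al - z = circ 1 al * (1 - z * Cconj (circ 1 al)))%C).
  { replace (circ 1 al * (1 - z * Cconj (circ 1 al)))%C with (circ 1 al - (circ 1 al * Cconj (circ 1 al)) * z)%C by ring.
    rewrite conj_circ1. ring. }
  rewrite E, Cmod_mult, Cmod_circ1, Rmult_1_l. rewrite <- Cmod_conj. f_equal.
  rewrite Cminus_conj, Cmult_conj, Cconj_conj.
  replace (Cconj 1) with (RtoC 1) by (apply C_eq; simpl; ring). ring.
Qed.

(** Splits off two of the exponents as a Poisson kernel, which has mean 1; the remaining power of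
    [kap] is bounded. *)
Lemma kern_Pk p z al : 0 < p -> Cmod z < 1 ->
  kern (2 + 2 * p) z (circ 1 al) = Pk z al * rpow (kap z (circ 1 al)) (2 * p).
Proof.
  intros Hp Hz. pose proof (kap_gt0 z (circ 1 al) Hz ltac:(rewrite Cmod_circ1; lra)) as Hk.
  pose proof (kap_den z (circ 1 al) Hz ltac:(rewrite Cmod_circ1; lra)) as Hd.
  pose proof (Cmod_lt1_sqr z Hz). unfold kern. rewrite rpow_plus_exp, rpow_2 by lra.
  unfold Pk. rewrite Cmod_circ1_sub. unfold kap at 1. field. lra.
Qed.

Lemma avg_kern_circ p z : 0 < p -> Cmod z < 1 -> avg (fun al => kern (2 + 2 * p) z (circ 1 al)) <= rpow 2 (2 * p).
Proof.
  intros Hp Hz.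
  apply Rle_trans with (avg (fun al => Pk z al * rpow 2 (2 * p))).
  - apply avg_le.
    + apply (Cts_kern (fun _ : R => z) (circ 1)). lra. intros; apply CCt_const. apply CC_circ.
      auto. intros; rewrite Cmod_circ1; lra.
    + apply Cts_mult. apply Pk_cts; auto. apply Cts_const.
    + intros t. rewrite kern_Pk by auto. apply Rmult_le_compat_l. apply Pk_ge0; auto.
      apply rpow_le. lra. split. left; apply kap_gt0; auto. rewrite Cmod_circ1; lra.
      apply kap_le2; auto. rewrite Cmod_circ1; lra.
  - rewrite avg_scal_r, avg_Pk by (auto; apply Pk_cts; auto). lra.
Qed.

(** The Poisson bound is applied to f times ((1 - |z|^2) / (1 - conj z w))^4, which agrees with f at
    w = z. On the circle the power p/2 of that factor is kap^(2p), which raises the exponent of the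
    kernel from 2 to 2 + 2p. *)
Lemma subharmonic_kern rho f z p : 1 < rho -> hol rho f -> Cmod z < 1 -> 0 < p ->
  rpow (Cmod (f z)) (p / 2) <= avg (fun al => kern (2 + 2 * p) z (circ 1 al) * rpow (Cmod (f (circ 1 al))) (p / 2)).
Proof.
  intros Hrho Hf Hz Hp. pose proof (Cmod_ge_0 z). pose proof (Cmod_lt1_sqr z Hz) as Pz.
  set (r2 := 2 / (1 + Cmod z)).
  assert (Hr2 : 1 < r2).
  { unfold r2. apply Rmult_lt_reg_r with (1 + Cmod z). lra. unfold Rdiv. rewrite Rmult_assoc, Rinv_l; lra. }
  assert (Hzr : Cmod z * r2 < 1).
  { unfold r2. apply Rmult_lt_reg_r with (1 + Cmod z). lra.
    replace (Cmod z * (2 / (1 + Cmod z)) * (1 + Cmod z)) with (2 * Cmod z) by (field; lra). lra. }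
  set (F := fun w => (f w * (RtoC (1 - Cmod z ^ 2) * / (1 - Cconj z * w)) ^ 4)%C).
  assert (HF : hol (Rmin rho r2) F).
  { intros w Hw. pose proof (Rmin_l rho r2). pose proof (Rmin_r rho r2). destruct (Hf w) as [l Hl]. lra.
    assert (Hn : (1 - Cconj z * w)%C <> 0%C).
    { apply Cmod_gt_neq. rewrite Cmod_1, Cmod_mult, Cmod_conj. pose proof (Cmod_ge_0 w).
      apply Rle_lt_trans with (Cmod z * r2); auto. apply Rmult_le_compat_l; lra. }
    eexists. apply Cdiff_mult. exact Hl.
    apply (Cdiff_pow (fun w => RtoC (1 - Cmod z ^ 2) * / (1 - Cconj z * w))%C). apply Cdiff_scal.
    apply (Cdiff_inv_comp (fun w => 1 - Cconj z * w)%C); auto.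
    apply Cdiff_minus. apply Cdiff_const. apply Cdiff_scal, Cdiff_id. }
  pose proof (poisson_subharmonic (Rmin rho r2) F z (p / 2) (Rmin_glb_lt _ _ _ Hrho Hr2) HF Hz ltac:(lra)) as HS.
  assert (Ez : F z = f z).
  { unfold F. assert (E : RtoC (1 - Cmod z ^ 2) = (1 - Cconj z * z)%C).
    { rewrite Cmod_sqr. destruct z as [a b]. apply C_eq; unfold Cconj; simpl; ring. }
    rewrite E. pose proof (kap_den_neq z z Hz ltac:(lra)). rewrite Cinv_r by auto. simpl. ring. }
  rewrite Ez in HS. eapply Rle_trans; [exact HS|]. right. apply avg_ext. intros al.
  assert (H1 : Cmod (circ 1 al) <= 1) by (rewrite Cmod_circ1; lra).
  pose proof (kap_gt0 z (circ 1 al) Hz H1) as Hk. pose proof (kap_den_neq z (circ 1 al) Hz H1) as Hn.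
  rewrite kern_Pk by auto. rewrite Rmult_assoc. f_equal. unfold F.
  rewrite Cmod_mult, Cmod_pow, Cmod_mult, Cmod_inv, Cmod_R, Rabs_pos_eq by (auto; lra).
  change ((1 - Cmod z ^ 2) * / Cmod (1 - Cconj z * circ 1 al)) with (kap z (circ 1 al)).
  rewrite rpow_mult by (try apply Cmod_ge_0; apply pow_le; lra). rewrite Rmult_comm. f_equal.
  replace (kap z (circ 1 al) ^ 4) with (rpow (kap z (circ 1 al)) 4).
  - rewrite rpow_rpow by lra. f_equal. field.
  - replace 4 with (2 * 2) by ring. rewrite <- rpow_rpow by lra. rewrite !rpow_2 by (try apply rpow_ge0; lra). ring.
Qed.

(* The Vinogradov-Senichkin test, for the measure carried by [Z] with density [om]. *)
Lemma carleson_kern p (om v : R -> R) (Z : R -> C) A : 0 < p -> 0 <= A ->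
  Cts om -> Cts v -> CC Z -> (forall t, 0 <= om t) -> (forall t, 0 <= v t) -> (forall t, Cmod (Z t) < 1) ->
  (forall t, 0 < om t -> avg (fun x => om x * kern (2 + 2 * p) (Z t) (Z x)) <= A) ->
  avg (fun t => om t * (avg (fun al => kern (2 + 2 * p) (Z t) (circ 1 al) * v al)) ^ 2) <=
    4 * rpow 6 (2 + 2 * p) ^ 2 * rpow 2 (2 * p) * A * avg (fun al => v al ^ 2).
Proof.
  intros Hp HA Com Cv CZ Hom Hv HZ HT. set (s := 2 + 2 * p) in *. set (c := rpow 6 s).
  assert (Hs : 0 < s) by (unfold s; lra). assert (Hc : 0 < c) by (apply rpow_gt0; lra).
  assert (H1 : forall al, Cmod (circ 1 al) <= 1) by (intros; rewrite Cmod_circ1; lra).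
  set (k := fun t al => kern s (Z t) (circ 1 al)). set (B := fun t x => kern s (Z t) (Z x)).
  assert (Ck : Cts (fun q : R * R => k (fst q) (snd q))).
  { apply (Cts_kern (fun q : R * R => Z (fst q)) (fun q : R * R => circ 1 (snd q))); auto.
    - intros q. apply (continuous_comp (V := R_UniformSpace) (W := C_UniformSpace) (fun q : R * R => fst q) Z).
      apply continuous_fst_comp, continuous_id. apply CZ.
    - intros q. apply (CCt_circ (fun _ => 1) (fun q : R * R => snd q)). apply continuous_const.
      apply continuous_snd_comp, continuous_id. }
  assert (CB : Cts (fun q : R * R => B (fst q) (snd q))).
  { apply (Cts_kern (fun q : R * R => Z (fst q)) (fun q : R * R => Z (snd q))); auto.
    - intros q. apply (continuous_comp (V := R_UniformSpace) (W := C_UniformSpace) (fun q : R * R => fst q) Z).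
      apply continuous_fst_comp, continuous_id. apply CZ.
    - intros q. apply (continuous_comp (V := R_UniformSpace) (W := C_UniformSpace) (fun q : R * R => snd q) Z).
      apply continuous_snd_comp, continuous_id. apply CZ.
    - intros; left; auto. }
  assert (Hk0 : forall t x, 0 <= k t x) by (intros; apply kern_ge0; auto).
  assert (HB0 : forall t x, 0 <= B t x) by (intros; apply kern_ge0; auto).
  set (T := fun t => avg (fun al => k t al * v al)).
  assert (Ckv : Cts (fun q : R * R => k (fst q) (snd q) * v (snd q))) by (apply Cts_mult; auto using Cts2_snd).
  assert (CT : Cts T) by (apply (Cts_avg (fun t al => k t al * v al)); auto).
  assert (HT0 : forall t, 0 <= T t).
  { intros t. apply avg_nonneg. apply (Cts2_sec1 (fun t al => k t al * v al)); auto. intros; apply Rmult_le_pos; auto. }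
  (* Duality: with [Q] the transpose of the kernel operator applied to h, X is the pairing of v with
     Q ([EX]), so X is controlled by the L^2 norm of Q. *)
  set (h := fun t => om t * T t).
  assert (Ch : Cts h) by (apply Cts_mult; auto). assert (Hh : forall t, 0 <= h t) by (intros; apply Rmult_le_pos; auto).
  set (X := avg (fun t => om t * T t ^ 2)). change (X <= 4 * c ^ 2 * rpow 2 (2 * p) * A * avg (fun al => v al ^ 2)).
  set (G := fun t => avg (fun t' => h t' * B t' t)).
  assert (CG : Cts G).
  { apply (Cts2_avg1 (fun t' t => h t' * B t' t)). apply Cts_mult; auto. apply Cts2_fst; auto. }
  assert (HG0 : forall t, 0 <= G t).
  { intros t. apply avg_nonneg. apply Cts_mult; auto. apply (Cts2_sec2 B); auto. intros; apply Rmult_le_pos; auto. }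
  set (Y := avg (fun t => h t * G t)). set (Wd := avg (fun t => om t * G t ^ 2)).
  set (Q := fun al => avg (fun t => h t * k t al)).
  assert (CQ : Cts Q).
  { apply (Cts2_avg1 (fun t al => h t * k t al)). apply Cts_mult; auto. apply Cts2_fst; auto. }
  assert (HX0 : 0 <= X) by (apply avg_nonneg; [apply Cts_mult; auto; apply Cts_pow; auto | intros; apply Rmult_le_pos; auto; apply pow2_ge_0]).
  assert (HY0 : 0 <= Y) by (apply avg_nonneg; [apply Cts_mult; auto | intros; apply Rmult_le_pos; auto]).
  assert (I1 : avg (fun al => Q al ^ 2) <= 2 * c * rpow 2 (2 * p) * Y).
  { pose proof (TT_estimate k B (fun _ => 1) h c (rpow 2 (2 * p)) Ck CB (Cts_const 1) Ch ltac:(lra) Hk0 HB0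
      ltac:(intros; lra) Hh) as HTT.
    rewrite (avg_ext (fun x => 1 * _) (fun al => Q al ^ 2)) in HTT by (intros; unfold Q; ring).
    apply HTT.
    - intros t t' x. apply kern_TT; auto.
    - intros t. apply Rmult_le_compat_l; auto. rewrite (avg_ext _ (fun al => k t al)) by (intros; ring).
      apply avg_kern_circ; auto. }
  (* The same estimate with the points Z x of the disc in place of the circle. Where om t = 0 the
     testing bound may fail, but h t = 0 there. *)
  assert (I2 : Wd <= 2 * c * A * Y).
  { apply (TT_estimate B B om h c A); auto; try lra.
    - intros t t' x. apply kern_TT; auto. left; auto.
    - intros t. unfold h. destruct (Rle_lt_or_eq_dec 0 (om t) (Hom t)) as [Ht|Ht].
      + apply Rmult_le_compat_l. apply Rmult_le_pos; auto. apply HT; auto.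
      + rewrite <- Ht. rewrite !Rmult_0_l. lra. }
  assert (Csq : Cts (fun t => sqrt (om t))) by (apply Cts_sqrt; auto).
  assert (I3 : Y ^ 2 <= X * Wd).
  { pose proof (avg_CS (fun t => sqrt (om t) * T t) (fun t => sqrt (om t) * G t) ltac:(apply Cts_mult; auto)
      ltac:(apply Cts_mult; auto)) as HCS.
    rewrite (avg_ext _ (fun t => h t * G t)) in HCS.
    rewrite (avg_ext (fun t => (sqrt (om t) * T t) ^ 2) (fun t => om t * T t ^ 2)) in HCS.
    rewrite (avg_ext (fun t => (sqrt (om t) * G t) ^ 2) (fun t => om t * G t ^ 2)) in HCS. exact HCS.
    - intros t. rewrite Rpow_mult_distr, pow2_sqrt; auto.
    - intros t. rewrite Rpow_mult_distr, pow2_sqrt; auto.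
    - intros t. unfold h. rewrite <- (sqrt_sqrt (om t)) at 3 by auto. ring. }
  (* Cauchy-Schwarz and [I2] give Y^2 <= X * 2 c A Y, and one factor Y cancels. *)
  assert (I4 : Y <= 2 * c * A * X).
  { assert (Y * Y <= (2 * c * A * X) * Y).
    { apply Rle_trans with (X * Wd). lra. apply Rle_trans with (X * (2 * c * A * Y)). apply Rmult_le_compat_l; auto. right; ring. }
    assert (0 <= 2 * c * A * X). { apply Rmult_le_pos; auto. apply Rmult_le_pos; lra. }
    destruct (Req_dec Y 0) as [->|HY]; auto. apply Rmult_le_reg_r with Y; auto. lra. }
  assert (EX : X = avg (fun al => v al * Q al)).
  { unfold X. rewrite (avg_ext _ (fun t => avg (fun al => h t * (k t al * v al)))).
    - rewrite (avg_Fubini (fun t al => h t * (k t al * v al))).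
      + apply avg_ext. intros al. unfold Q. rewrite <- avg_scal. apply avg_ext; intros; ring.
        apply Cts_mult; auto. apply (Cts2_sec2 k); auto.
      + apply Cts_mult; auto. apply Cts2_fst; auto.
    - intros t. rewrite avg_scal. fold (T t). unfold h. ring. apply (Cts2_sec1 (fun t al => k t al * v al)); auto. }
  (* Together with [I1] and [I4] the right side is a multiple of A * V * X, and one factor X
     cancels. *)
  assert (I5 : X ^ 2 <= avg (fun al => v al ^ 2) * avg (fun al => Q al ^ 2)).
  { rewrite EX at 1. apply avg_CS; auto. }
  set (V := avg (fun al => v al ^ 2)) in *.
  assert (HV0 : 0 <= V) by (apply avg_nonneg; [apply Cts_pow; auto | intros; apply pow2_ge_0]).
  assert (H2p : 0 < rpow 2 (2 * p)) by (apply rpow_gt0; lra).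
  assert (I6 : X * X <= (4 * c ^ 2 * rpow 2 (2 * p) * A * V) * X).
  { apply Rle_trans with (V * (2 * c * rpow 2 (2 * p) * Y)).
    - apply Rle_trans with (V * avg (fun al => Q al ^ 2)). lra. apply Rmult_le_compat_l; auto.
    - apply Rle_trans with (V * (2 * c * rpow 2 (2 * p) * (2 * c * A * X))).
      + apply Rmult_le_compat_l; auto. apply Rmult_le_compat_l; auto. apply Rmult_le_pos; lra.
      + right; ring. }
  destruct (Req_dec X 0) as [->|HX].
  - apply Rmult_le_pos; auto. apply Rmult_le_pos; auto. apply Rmult_le_pos. nra. lra.
  - apply Rmult_le_reg_r with X; lra.
Qed.

(** * Uniform integrability of the circle means *)

(** The absolutely summed Taylor series at radius rho is the bound, with no appeal to the maximum
    principle. *)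
Lemma hol_disc_bounded f rho : hol 1 f -> 0 <= rho < 1 ->
  exists B, 0 <= B /\ forall z, Cmod z <= rho -> Cmod (f z) <= B.
Proof.
  intros Hf Hr. pose proof (radius1_series _ rho (coef_radius1 f Hf) Hr) as HS.
  exists (Series (fun k => Cmod (coef f k) * rho ^ k)). split.
  - apply Series_ge0; auto. intros n. apply Rmult_le_pos. apply Cmod_ge_0. apply pow_le; lra.
  - intros z Hz. rewrite taylor by (auto; lra). apply Cmod_CSer_le; auto.
    intros n. rewrite Cmod_mult, Cmod_pow. apply Rmult_le_compat_l. apply Cmod_ge_0.
    apply pow_incr. split; auto. apply Cmod_ge_0.
Qed.

Lemma circ_scal c r t : circ (c * r) t = (RtoC c * circ r t)%C.
Proof. apply C_eq; unfold circ; simpl; ring. Qed.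

Lemma Cts_rpow_hol rho f r q : hol rho f -> 0 <= r < rho -> 0 < q -> Cts (fun t => rpow (Cmod (f (circ r t))) q).
Proof.
  intros Hf Hr Hq. apply Cts_rpow; auto. intros; apply Cmod_ge_0. apply CC_Cmod. apply (CC_hol rho); auto.
Qed.

(* The dilates of |g|^(p/2) form a Cauchy net in L^2, by comparison with the Poisson integral
   [u = P_rho v] : self-adjointness and the semigroup law give <v, u> = ||P_(sqrt rho) v||^2. *)
Lemma dilate_close g p r s : hol 1 g -> 0 < p -> 0 < s < r -> r < 1 ->
  exists u : R -> R, Cts u /\ (forall t, 0 <= u t <= 2 / (1 - s / r) * (1 + avg (fun t => rpow (Cmod (g (circ r t))) p))) /\
    avg (fun t => (rpow (Cmod (g (circ r t))) (p / 2) - u t) ^ 2) <=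
      2 * (avg (fun t => rpow (Cmod (g (circ r t))) p) - avg (fun t => rpow (Cmod (g (circ s t))) p)).
Proof.
  intros Hg Hp Hs Hr. set (rho := s / r).
  assert (Hrho : 0 < rho < 1).
  { unfold rho. split. apply Rdiv_lt_0_compat; lra. apply Rmult_lt_reg_r with r. lra.
    unfold Rdiv. rewrite Rmult_assoc, Rinv_l; lra. }
  set (a := sqrt rho). assert (Ha : 0 < a < 1).
  { unfold a. split. apply sqrt_lt_R0; lra. replace 1 with (sqrt 1) by apply sqrt_1. apply sqrt_lt_1_alt; lra. }
  assert (Haa : a * a = rho) by (apply sqrt_sqrt; lra).
  set (v := fun t => rpow (Cmod (g (circ r t))) (p / 2)).
  assert (Cv : Cts v) by (apply (Cts_rpow_hol 1); auto; lra).
  assert (Hv : forall t, 0 <= v t) by (intros; apply rpow_ge0).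
  assert (Ev : forall t, v t ^ 2 = rpow (Cmod (g (circ r t))) p) by (intros; apply rpow_half_sqr, Cmod_ge_0).
  set (m := fun r => avg (fun t => rpow (Cmod (g (circ r t))) p)).
  assert (Emr : avg (fun t => v t ^ 2) = m r) by (apply avg_ext; auto).
  assert (CK : forall b, 0 <= b < 1 -> Cts (fun q : R * R => Kp b (fst q - snd q))).
  { intros b Hb. apply (Cts_Kp (fun q : R * R => fst q - snd q)); auto. apply Cts_minus.
    apply (Cts2_fst (fun t => t)), Cts_id. apply (Cts2_snd (fun t => t)), Cts_id. }
  assert (CKv : forall b, 0 <= b < 1 -> Cts (fun q : R * R => Kp b (fst q - snd q) * v (snd q))).
  { intros b Hb. apply Cts_mult; auto. apply Cts2_snd; auto. }
  set (P := fun b t => avg (fun al => Kp b (t - al) * v al)).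
  assert (CP : forall b, 0 <= b < 1 -> Cts (P b)).
  { intros b Hb. apply (Cts_avg (fun t al => Kp b (t - al) * v al)); auto. }
  assert (HP0 : forall b t, 0 <= b < 1 -> 0 <= P b t).
  { intros b t Hb. apply avg_nonneg. apply (Cts2_sec1 (fun t al => Kp b (t - al) * v al)); auto.
    intros al. apply Rmult_le_pos; auto. apply Kp_ge0; auto. }
  set (w := P a).
  assert (EP : forall t, P rho t = avg (fun be => Kp a (t - be) * w be)).
  { intros t. unfold w, P.
    rewrite (avg_ext _ (fun al => avg (fun be => Kp a (t - be) * (Kp a (be - al) * v al)))).
    - rewrite (avg_Fubini (fun al be => Kp a (t - be) * (Kp a (be - al) * v al))).
      + apply avg_ext. intros be. apply avg_scal.
        apply (Cts2_sec1 (fun t al => Kp a (t - al) * v al)); apply CKv; lra.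
      + apply Cts_mult.
        * apply (Cts2_snd (fun be => Kp a (t - be))). apply (Cts2_sec1 (fun t al => Kp a (t - al))). apply CK; lra.
        * apply (Cts2_swap (fun t al => Kp a (t - al) * v al)). apply CKv; lra.
    - intros al. rewrite <- Haa, <- (Kp_semigroup a a t al) by lra.
      rewrite <- avg_scal_r. apply avg_ext; intros; ring.
      apply Cts_mult. apply (Cts2_sec1 (fun t al => Kp a (t - al))). apply CK; lra.
      apply (Cts2_sec2 (fun t al => Kp a (t - al))). apply CK; lra. }
  assert (Cw : Cts w) by (apply CP; lra).
  assert (Evu : avg (fun t => v t * P rho t) = avg (fun be => w be ^ 2)).
  { rewrite (avg_ext _ (fun t => avg (fun be => v t * (Kp a (t - be) * w be)))).
    - rewrite (avg_Fubini (fun t be => v t * (Kp a (t - be) * w be))).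
      + apply avg_ext. intros be. replace (w be ^ 2) with (w be * w be) by ring.
        change (w be * w be) with (w be * avg (fun al => Kp a (be - al) * v al)). rewrite <- avg_scal.
        * apply avg_ext. intros t. rewrite <- (Kp_even a (be - t)). replace (- (be - t)) with (t - be) by ring. ring.
        * apply (Cts2_sec1 (fun t al => Kp a (t - al) * v al)); apply CKv; lra.
      + apply Cts_mult. apply Cts2_fst; auto. apply Cts_mult. apply CK; lra. apply Cts2_snd; auto.
    - intros t. rewrite EP, avg_scal; auto. apply Cts_mult; auto.
      apply (Cts2_sec1 (fun t al => Kp a (t - al))). apply CK; lra. }
  destruct (hol_scale 1 g r ltac:(lra) Hg) as [Hgr _].
  assert (H1r : 1 < 1 / r). { apply Rmult_lt_reg_r with r. lra. unfold Rdiv. rewrite Rmult_assoc, Rinv_l; lra. }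
  assert (Hw : forall be, rpow (Cmod (g (circ (r * a) be))) (p / 2) <= w be).
  { intros be. pose proof (poisson_subharmonic (1 / r) _ (circ a be) (p / 2) H1r Hgr
      ltac:(rewrite Cmod_circ, Rabs_pos_eq; lra) ltac:(lra)) as HS. cbv beta in HS.
    rewrite <- circ_scal in HS. eapply Rle_trans; [exact HS|]. right. apply avg_ext. intros al.
    rewrite Pk_circ, <- circ_scal, Rmult_1_r. auto. }
  (* Since rho <= sqrt rho, the half step reaches a circle of radius r * a >= s, whose mean is at
     least that at s. *)
  assert (Hra : s <= r * a).
  { assert (rho <= a) by nra. replace s with (r * rho) by (unfold rho; field; lra). apply Rmult_le_compat_l; lra. }
  assert (Hra1 : r * a < 1) by nra.
  assert (L1 : m s <= avg (fun t => v t * P rho t)).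
  { rewrite Evu. apply Rle_trans with (m (r * a)).
    - apply (subharmonic_mono 1); auto. lra.
    - apply avg_le.
      + apply (Cts_rpow_hol 1); auto. nra.
      + apply Cts_pow; auto.
      + intros t. rewrite <- rpow_half_sqr by apply Cmod_ge_0. apply pow_incr. split; auto. apply rpow_ge0. }
  set (u := P rho). assert (Cu : Cts u) by (apply CP; lra).
  (* Cauchy-Schwarz against the probability density Kp, then Fubini and the mean 1 of Kp in the
     other variable. *)
  assert (L2 : avg (fun t => u t ^ 2) <= m r).
  { apply Rle_trans with (avg (fun t => avg (fun al => Kp rho (t - al) * v al ^ 2))).
    - assert (C2 : Cts (fun q : R * R => Kp rho (fst q - snd q) * v (snd q) ^ 2)).
      { apply Cts_mult. apply CK; lra. apply (Cts2_snd (fun t => v t ^ 2)). apply Cts_pow; auto. }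
      apply avg_le.
      + apply Cts_pow; auto.
      + apply (Cts_avg (fun t al => Kp rho (t - al) * v al ^ 2)); auto.
      + intros t. assert (CKt : Cts (fun al => sqrt (Kp rho (t - al)))).
        { apply Cts_sqrt. apply (Cts2_sec1 (fun t al => Kp rho (t - al))). apply CK; lra. }
        pose proof (avg_CS (fun al => sqrt (Kp rho (t - al))) (fun al => sqrt (Kp rho (t - al)) * v al) CKt
          ltac:(apply Cts_mult; auto)) as HCS.
        assert (Hsq : forall al, 0 <= Kp rho (t - al)) by (intros; apply Kp_ge0; lra).
        rewrite (avg_ext _ (fun al => Kp rho (t - al) * v al)) in HCS
          by (intros al; rewrite <- Rmult_assoc, sqrt_sqrt; auto).
        rewrite (avg_ext (fun al => sqrt (Kp rho (t - al)) ^ 2) (fun al => Kp rho (t - al))) in HCS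
          by (intros al; rewrite pow2_sqrt; auto).
        rewrite avg_Kp in HCS by lra.
        rewrite (avg_ext (fun al => (sqrt (Kp rho (t - al)) * v al) ^ 2) (fun al => Kp rho (t - al) * v al ^ 2)) in HCS
          by (intros al; rewrite Rpow_mult_distr, pow2_sqrt; auto).
        unfold u, P. lra.
    - right. rewrite (avg_Fubini (fun t al => Kp rho (t - al) * v al ^ 2)).
      + rewrite <- Emr. apply avg_ext. intros al. rewrite avg_scal_r. rewrite avg_Kp'; lra.
        apply (Cts2_sec2 (fun t al => Kp rho (t - al))). apply CK; lra.
      + apply Cts_mult. apply CK; lra. apply (Cts2_snd (fun t => v t ^ 2)). apply Cts_pow; auto. }
  exists u. split; auto. split.
  - intros t. split. apply HP0; lra.
    unfold u, P. apply Rle_trans with (avg (fun al => 2 / (1 - rho) * v al)).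
    + apply avg_le. apply (Cts2_sec1 (fun t al => Kp rho (t - al) * v al)); apply CKv; lra.
      apply Cts_mult; auto. apply Cts_const.
      intros al. apply Rmult_le_compat_r; auto. apply Kp_le; lra.
    + rewrite avg_scal by auto. fold rho. apply Rmult_le_compat_l.
      apply Rmult_le_pos. lra. left; apply Rinv_0_lt_compat; lra.
      fold (m r). rewrite <- Emr, <- (avg_const 1), <- avg_plus.
      * apply avg_le; auto. apply Cts_plus. apply Cts_const. apply Cts_pow; auto. intros al. specialize (Hv al). nra.
      * apply Cts_const.
      * apply Cts_pow; auto.
  (* In L^2 notation: ||v - u||^2 = m r - 2 <v, u> + ||u||^2, where <v, u> >= m s by [L1] and
     ||u||^2 <= m r by [L2]. *)
  - rewrite (avg_ext _ (fun t => (v t ^ 2 + (-2) * (v t * u t)) + u t ^ 2)) by (intros; fold (v t); ring).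
    fold (m r) (m s). rewrite avg_plus, avg_plus, avg_scal.
    + rewrite Emr. fold u in L1. lra.
    + apply Cts_mult; auto.
    + apply Cts_pow; auto.
    + apply Cts_mult. apply Cts_const. apply Cts_mult; auto.
    + apply Cts_plus. apply Cts_pow; auto. apply Cts_mult. apply Cts_const. apply Cts_mult; auto.
    + apply Cts_pow; auto.
Qed.

(** The means increase to a finite supremum. Once s is chosen with its mean close to it, |g|^(p/2)
    on every larger circle is close in L^2 to a function bounded by the fixed constant [U], and x^2
    <= 2 U^2 + 2 (x - u)^2. On the smaller circles g itself is bounded. *)
Lemma uniform_integrability g p M : hol 1 g -> 0 < p ->
  (forall r, 0 <= r < 1 -> avg (fun t => rpow (Cmod (g (circ r t))) p) <= M) ->
  forall eps, 0 < eps -> exists L, 0 <= L /\ forall r chi, 0 <= r < 1 -> Cts chi -> (forall t, 0 <= chi t <= 1) ->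
    avg (fun t => chi t * rpow (Cmod (g (circ r t))) p) <= L * avg chi + eps.
Proof.
  intros Hg Hp HM eps He. set (m := fun r => avg (fun t => rpow (Cmod (g (circ r t))) p)).
  destruct (completeness (fun y => exists r, 0 <= r < 1 /\ y = m r)) as [S [HS1 HS2]].
  - exists M. intros y [r [Hr ->]]. apply HM; auto.
  - exists (m 0), 0. split; auto; lra.
  (* The quarter is used up by the factor 2 of [dilate_close] and the factor 2 in x^2 <= 2 U^2 + 2
     (x - u)^2. *)
  - assert (Hs : exists s, 0 < s < 1 /\ S - eps / 4 < m s).
    { destruct (classic (exists s, 0 < s < 1 /\ S - eps / 4 < m s)) as [|Hn]; auto. exfalso.
      assert (S <= S - eps / 4); [|lra]. apply HS2. intros y [r [Hr ->]].
      destruct (Rle_lt_dec (m r) (S - eps / 4)) as [|Hlt]; auto. exfalso. apply Hn.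
      exists ((r + 1) / 2). split. lra. eapply Rlt_le_trans; [exact Hlt|].
      apply (subharmonic_mono 1); auto; lra. }
    destruct Hs as [s [Hs Hms]].
    assert (HmS : forall r, 0 <= r < 1 -> m r <= S) by (intros r Hr; apply HS1; exists r; auto).
    assert (Hm0 : 0 <= m 0) by (apply avg_nonneg; [apply (Cts_rpow_hol 1); auto; lra | intros; apply rpow_ge0]).
    assert (HS0 : 0 <= S) by (specialize (HmS 0 ltac:(lra)); lra).
    (* For r > s1 the ratio s / r stays below s / s1 < 1, which makes the bound on u independent of
       r. *)
    set (s1 := (1 + s) / 2). assert (Hs1 : s < s1 < 1) by (unfold s1; lra).
    destruct (hol_disc_bounded g s1 Hg ltac:(lra)) as [B [HB0 HB]].
    set (U := 2 / (1 - s / s1) * (1 + S)).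
    assert (Hq : 0 < s / s1 < 1).
    { split. apply Rdiv_lt_0_compat; lra. apply Rmult_lt_reg_r with s1. lra. unfold Rdiv. rewrite Rmult_assoc, Rinv_l; lra. }
    assert (HU : 0 <= U). { unfold U. apply Rmult_le_pos; [|lra]. apply Rmult_le_pos. lra. left; apply Rinv_0_lt_compat; lra. }
    exists (rpow B p + 2 * U ^ 2). pose proof (rpow_ge0 B p). split. nra.
    intros r chi Hr Cchi Hchi.
    assert (Hc0 : 0 <= avg chi) by (apply avg_nonneg; auto; intros t; apply Hchi).
    assert (Cg : Cts (fun t => rpow (Cmod (g (circ r t))) p)) by (apply (Cts_rpow_hol 1); auto).
    destruct (Rle_dec r s1) as [Hrs|Hrs].
    + apply Rle_trans with (avg (fun t => chi t * rpow B p)).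
      * apply avg_le. apply Cts_mult; auto. apply Cts_mult; auto. apply Cts_const.
        intros t. apply Rmult_le_compat_l. apply Hchi. apply rpow_le. lra. split. apply Cmod_ge_0.
        apply HB. rewrite Cmod_circ, Rabs_pos_eq; lra.
      * rewrite avg_scal_r by auto. nra.
    + destruct (dilate_close g p r s Hg Hp ltac:(lra) ltac:(lra)) as [u [Cu [Hu1 Hu2]]].
      fold (m r) in Hu1. fold (m r) (m s) in Hu2.
      assert (Cv : Cts (fun t => rpow (Cmod (g (circ r t))) (p / 2))) by (apply (Cts_rpow_hol 1); auto; lra).
      assert (HuU : forall t, 0 <= u t <= U).
      { intros t. destruct (Hu1 t) as [q1 q2]. split; auto. eapply Rle_trans; [exact q2|]. unfold U.
        pose proof (HmS r Hr).
        assert (s / r <= s / s1). { apply Rmult_le_compat_l. lra. apply Rinv_le_contravar; lra. }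
        apply Rmult_le_compat; try lra.
        - apply Rmult_le_pos. lra. left; apply Rinv_0_lt_compat; lra.
        - assert (0 <= m r). { apply avg_nonneg; auto. intros; apply rpow_ge0. } lra.
        - apply Rmult_le_compat_l. lra. apply Rinv_le_contravar; lra. }
      apply Rle_trans with (avg (fun t => 2 * U ^ 2 * chi t + 2 * (rpow (Cmod (g (circ r t))) (p / 2) - u t) ^ 2)).
      * apply avg_le. apply Cts_mult; auto.
        apply Cts_plus. apply Cts_mult; auto. apply Cts_const. apply Cts_mult. apply Cts_const. apply Cts_pow, Cts_minus; auto.
        intros t. rewrite <- rpow_half_sqr by apply Cmod_ge_0. set (x := rpow (Cmod (g (circ r t))) (p / 2)).
        destruct (Hchi t) as [c0 c1]. destruct (HuU t) as [u0 u1].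
        assert (x ^ 2 <= 2 * U ^ 2 + 2 * (x - u t) ^ 2).
        { assert (u t ^ 2 <= U ^ 2) by (apply pow_incr; lra). pose proof (pow2_ge_0 (x - 2 * u t)). nra. }
        pose proof (pow2_ge_0 (x - u t)). nra.
      * assert (Cd : Cts (fun t => (rpow (Cmod (g (circ r t))) (p / 2) - u t) ^ 2)) by (apply Cts_pow, Cts_minus; auto).
        rewrite avg_plus, !avg_scal; auto.
        -- specialize (HmS r Hr). nra.
        -- apply Cts_mult; auto. apply Cts_const.
        -- apply Cts_mult; auto. apply Cts_const.
Qed.

(** * Derivative Hardy spaces *)

Lemma Mp_avg p f r : Mp p f r = avg (fun t => rpow (Cmod (f (circ r t))) p).
Proof. reflexivity. Qed.

Lemma Mp_ge0 p f r : hol 1 f -> 0 < p -> 0 <= r < 1 -> 0 <= Mp p f r.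
Proof. intros. apply avg_nonneg. apply (Cts_rpow_hol 1); auto. intros; apply rpow_ge0. Qed.

(** The bound on the means makes the extended supremum finite, so that [real] in [Hp_norm] does not
    return its default value. Norms are handled through [Mp] from here on. *)
Lemma Hp_norm_ub p f N : hol 1 f -> 0 < p -> 0 <= N -> (forall r, 0 <= r < 1 -> Mp p f r <= rpow N p) ->
  0 <= Hp_norm p f <= N /\ forall r, 0 <= r < 1 -> Mp p f r <= rpow (Hp_norm p f) p.
Proof.
  intros Hf Hp HN H. unfold Hp_norm.
  set (E := fun y => exists r, 0 <= r < 1 /\ y = rpow (Mp p f r) (/ p)).
  destruct (Lub_Rbar_correct E) as [H1 H2].
  assert (Hip : 0 < / p) by (apply Rinv_0_lt_compat; auto).
  assert (UB : is_ub_Rbar E N).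
  { intros y [r [Hr ->]]. simpl. rewrite <- (rpow_inv_l N p) by auto. apply rpow_le. lra.
    split; auto. apply Mp_ge0; auto. }
  specialize (H2 _ UB). assert (H0 : 0 <= 0 < 1) by lra.
  pose proof (H1 _ (ex_intro _ 0 (conj H0 eq_refl))) as H3.
  destruct (Lub_Rbar E) as [L| |]; simpl in *; try tauto.
  assert (HL0 : 0 <= L) by (eapply Rle_trans; [apply rpow_ge0 | exact H3]).
  split; [lra|]. intros r Hr. rewrite <- (rpow_inv_r (Mp p f r) p) by (try apply Mp_ge0; auto).
  apply rpow_le. lra. split. apply rpow_ge0. apply (H1 _ (ex_intro _ r (conj Hr eq_refl))).
Qed.

Lemma in_Sp_iff p f : in_Sp p f <-> hol 1 f /\ exists M, forall r, 0 <= r < 1 -> Mp p (deriv f) r <= M.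
Proof.
  split.
  - intros [H1 [_ H2]]. split; auto. apply analytic_hol; auto.
  - intros [H1 H2]. split. apply analytic_hol; auto. split; auto. apply analytic_hol, hol_deriv_hol1; auto.
Qed.

Lemma in_Sp_hol p f : in_Sp p f -> hol 1 f.
Proof. intros H; apply in_Sp_iff in H; tauto. Qed.

Lemma Sp_norm_ub p f N : hol 1 f -> 0 < p -> 0 <= N -> (forall r, 0 <= r < 1 -> Mp p (deriv f) r <= rpow N p) ->
  in_Sp p f /\ Cmod (f 0%C) <= Sp_norm p f <= Cmod (f 0%C) + N.
Proof.
  intros Hf Hp HN H. destruct (Hp_norm_ub p (deriv f) N (hol_deriv_hol1 _ Hf) Hp HN H) as [H1 _].
  unfold Sp_norm. split; [|lra]. apply in_Sp_iff. split; auto. exists (rpow N p); auto.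
Qed.

Lemma Sp_norm_Mp p f : in_Sp p f -> 0 < p ->
  0 <= Sp_norm p f /\ Cmod (f 0%C) <= Sp_norm p f /\ forall r, 0 <= r < 1 -> Mp p (deriv f) r <= rpow (Sp_norm p f) p.
Proof.
  intros H Hp. apply in_Sp_iff in H. destruct H as [Hf [M HM]].
  assert (M0 : 0 <= M).
  { eapply Rle_trans; [|apply (HM 0); lra]. apply Mp_ge0; auto. apply hol_deriv_hol1; auto. lra. }
  destruct (Hp_norm_ub p (deriv f) (rpow M (/ p)) (hol_deriv_hol1 _ Hf) Hp (rpow_ge0 _ _)) as [H1 H2].
  - intros r Hr. rewrite rpow_inv_r; auto.
  - unfold Sp_norm. pose proof (Cmod_ge_0 (f 0%C)). split; [lra|]. split; [lra|].
    intros r Hr. eapply Rle_trans; [apply H2; auto|]. apply rpow_le; lra.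
Qed.

(** The factor 2 comes from estimating the coordinates separately and adding. *)
Lemma path_length (x y x' y' : R -> R) a b : a <= b ->
  (forall t, a <= t <= b -> is_derive x t (x' t)) -> (forall t, a <= t <= b -> is_derive y t (y' t)) ->
  (forall t, a <= t <= b -> continuous x' t) -> (forall t, a <= t <= b -> continuous y' t) ->
  forall g : R -> R, (forall t, a <= t <= b -> continuous g t) ->
  (forall t, a <= t <= b -> Rabs (x' t) <= g t) -> (forall t, a <= t <= b -> Rabs (y' t) <= g t) ->
  Cmod ((x b, y b) - (x a, y a)) <= 2 * RInt g a b.
Proof.
  intros Hab Hx Hy Cx Cy g Cg Gx Gy.
  assert (K : forall z z' : R -> R, (forall t, a <= t <= b -> is_derive z t (z' t)) -> (forall t, a <= t <= b -> continuous z' t) ->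
     (forall t, a <= t <= b -> Rabs (z' t) <= g t) -> Rabs (z b - z a) <= RInt g a b).
  { intros z z' Hz Cz Gz.
    assert (E : RInt z' a b = z b - z a).
    { apply is_RInt_unique. apply (is_RInt_derive z z'); rewrite Rmin_left, Rmax_right; auto. }
    rewrite <- E. eapply Rle_trans. apply abs_RInt_le; auto. apply ex_RInt_cont_on; auto.
    apply RInt_le; auto.
    - apply ex_RInt_cont_on; auto. intros t Ht. apply (continuous_comp z' Rabs); auto. apply continuous_Rabs.
    - apply ex_RInt_cont_on; auto.
    - intros t Ht. apply Gz; lra. }
  eapply Rle_trans; [apply Cmod_le_abs|]. simpl.
  pose proof (K x x' Hx Cx Gx). pose proof (K y y' Hy Cy Gy). unfold Rminus in *. lra.
Qed.

Lemma avg_shift F b : Cts F -> (forall t, F (t + 2 * PI) = F t) -> avg (fun t => F (b + t)) = avg F.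
Proof.
  intros HF Hp. unfold avg. f_equal. rewrite <- (RInt_periodic F b HF Hp).
  pose proof (RInt_comp_lin F 1 b 0 (2 * PI)) as H.
  replace (1 * 0 + b) with b in H by ring. replace (1 * (2 * PI) + b) with (b + 2 * PI) in H by ring.
  rewrite <- H by auto using Cts_ex_RInt. apply RInt_ext. intros x _.
  change (F (b + x) = 1 * F (1 * x + b)). rewrite !Rmult_1_l. f_equal; ring.
Qed.

Lemma angular_derive f r t : hol 1 f -> 0 <= r < 1 ->
  is_derive (fun t => fst (f (circ r t))) t (- snd (zderiv f (circ r t))) /\
  is_derive (fun t => snd (f (circ r t))) t (fst (zderiv f (circ r t))).
Proof.
  intros Hf Hr.
  assert (Hz : Cmod (circ r t) < 1) by (rewrite Cmod_circ, Rabs_pos_eq; lra).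
  destruct (Cdiff_polar _ _ _ _ (hol_deriv 1 f _ Hf Hz)) as [D1 D2].
  unfold zderiv. set (l := deriv f (circ r t)) in *. split; apply is_derive_Reals.
  - replace (- snd (circ r t * l)%C) with
      ((fst l * cos t - snd l * sin t) * 0 + (- r * (fst l * sin t + snd l * cos t)) * 1)
      by (unfold circ; simpl; ring).
    apply (derivable_pt_lim_comp_2d _ (fun _ => r) (fun t => t) t _ _ _ _ D1).
    apply derivable_pt_lim_const. apply derivable_pt_lim_id.
  - replace (fst (circ r t * l)%C) with
      ((fst l * sin t + snd l * cos t) * 0 + (r * (fst l * cos t - snd l * sin t)) * 1)
      by (unfold circ; simpl; ring).
    apply (derivable_pt_lim_comp_2d _ (fun _ => r) (fun t => t) t _ _ _ _ D2).
    apply derivable_pt_lim_const. apply derivable_pt_lim_id.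
Qed.

Lemma radial_derive f r t : hol 1 f -> 0 <= r < 1 ->
  is_derive (fun r => fst (f (circ r t))) r (fst (circ 1 t * deriv f (circ r t))%C) /\
  is_derive (fun r => snd (f (circ r t))) r (snd (circ 1 t * deriv f (circ r t))%C).
Proof.
  intros Hf Hr.
  assert (Hz : Cmod (circ r t) < 1) by (rewrite Cmod_circ, Rabs_pos_eq; lra).
  destruct (Cdiff_polar _ _ _ _ (hol_deriv 1 f _ Hf Hz)) as [D1 D2].
  set (l := deriv f (circ r t)) in *. split; apply is_derive_Reals.
  - replace (fst (circ 1 t * l)%C) with
      ((fst l * cos t - snd l * sin t) * 1 + (- r * (fst l * sin t + snd l * cos t)) * 0)
      by (unfold circ; simpl; ring).
    apply (derivable_pt_lim_comp_2d _ (fun r => r) (fun _ => t) r _ _ _ _ D1).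
    apply derivable_pt_lim_id. apply derivable_pt_lim_const.
  - replace (snd (circ 1 t * l)%C) with
      ((fst l * sin t + snd l * cos t) * 1 + (r * (fst l * cos t - snd l * sin t)) * 0)
      by (unfold circ; simpl; ring).
    apply (derivable_pt_lim_comp_2d _ (fun r => r) (fun _ => t) r _ _ _ _ D2).
    apply derivable_pt_lim_id. apply derivable_pt_lim_const.
Qed.

Lemma avg_le_on F G : Cts F -> Cts G -> (forall t, 0 <= t <= 2 * PI -> F t <= G t) -> avg F <= avg G.
Proof.
  intros HF HG H. unfold avg. apply Rmult_le_compat_l.
  - left; apply Rinv_0_lt_compat, PI2_pos.
  - apply RInt_le; auto using Cts_ex_RInt. left; apply PI2_pos. intros; apply H; lra.
Qed.

Lemma zderiv_hol1 f : hol 1 f -> hol 1 (zderiv f).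
Proof. apply zderiv_hol; lra. Qed.

(* Fixing the point and averaging over the circle through it turns the L^1 norm of f' into a sup bound. *)
Lemma sup_le_L1_deriv f M z : hol 1 f -> (forall r, 0 <= r < 1 -> avg (fun t => Cmod (deriv f (circ r t))) <= M) ->
  Cmod z < 1 -> Cmod (f z - f 0%C) <= 4 * PI * M.
Proof.
  intros Hf HM Hz. pose proof (Cmod_ge_0 z) as Hz0. pose proof PI_RGT_0 as HPI.
  pose proof (hol_deriv_hol1 f Hf) as Hf'.
  destruct (Req_dec (Cmod z) 0) as [E|Hzn].
  { apply Cmod_eq_0 in E. subst z. replace (f 0 - f 0)%C with (RtoC 0) by ring. rewrite Cmod_0.
    assert (0 <= M); [|apply Rmult_le_pos; lra]. eapply Rle_trans; [|apply (HM 0); lra]. apply avg_nonneg.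
    apply CC_Cmod, (CC_hol 1); auto; lra. intros; apply Cmod_ge_0. }
  set (r := Cmod z).
  assert (Hc1 : Cmod (z / RtoC r) = 1).
  { assert (Hrn : RtoC r <> 0%C) by (intros E; apply RtoC_inj in E; unfold r in E; lra).
    rewrite Cmod_div, Cmod_R, Rabs_pos_eq by (auto; unfold r; lra).
    unfold r. field. auto. }
  destruct (circle_arg _ Hc1) as [b Hb].
  assert (Ez : z = circ r b).
  { replace (circ r b) with (RtoC r * circ 1 b)%C by (rewrite <- circ_scal, Rmult_1_r; auto).
    rewrite <- Hb. field. intros E. apply RtoC_inj in E. unfold r in E; lra. }
  assert (Hr : 0 <= r < 1) by (unfold r; lra).
  set (F := fun t => f (circ r (b + t))).
  assert (CF : CC F).
  { intros t. apply CCt_comp. apply (CCt_circ (fun _ => r) (fun t => b + t)). apply continuous_const.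
    apply ct_plus. apply continuous_const. apply continuous_id. apply (hol_cont 1); auto.
    rewrite Cmod_circ, Rabs_pos_eq; lra. }
  assert (E0 : cavg F = f 0%C).
  { rewrite <- (mean_value f 1 r Hf Hr). pose proof (CC_hol 1 f r Hf Hr) as C0. apply C_eq; simpl.
    - apply (avg_shift (fun t => fst (f (circ r t)))). apply CC_fst; auto. intros; rewrite circ_periodic; auto.
    - apply (avg_shift (fun t => snd (f (circ r t)))). apply CC_snd; auto. intros; rewrite circ_periodic; auto. }
  set (g := fun t => Cmod (zderiv f (circ r (b + t)))).
  assert (CZ : CC (fun t => zderiv f (circ r (b + t)))).
  { intros t. apply CCt_comp. apply (CCt_circ (fun _ => r) (fun t => b + t)). apply continuous_const.
    apply ct_plus. apply continuous_const. apply continuous_id. apply (hol_cont 1). apply zderiv_hol1; auto.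
    rewrite Cmod_circ, Rabs_pos_eq; lra. }
  assert (Cg : Cts g) by (apply CC_Cmod; auto).
  assert (Ig : RInt g 0 (2 * PI) <= 2 * PI * M).
  { assert (Eg : RInt g 0 (2 * PI) = 2 * PI * avg g) by (unfold avg; rewrite <- Rmult_assoc, Rinv_r, Rmult_1_l; [reflexivity | lra]).
    rewrite Eg. apply Rmult_le_compat_l. lra.
    unfold g. rewrite (avg_shift (fun t => Cmod (zderiv f (circ r t)))).
    - eapply Rle_trans; [|apply (HM r Hr)]. apply avg_le.
      + apply CC_Cmod, (CC_hol 1); auto. apply zderiv_hol1; auto.
      + apply CC_Cmod, (CC_hol 1); auto.
      + intros t. unfold zderiv. rewrite Cmod_mult, Cmod_circ, Rabs_pos_eq by lra.
        pose proof (Cmod_ge_0 (deriv f (circ r t))). nra.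
    - apply CC_Cmod, (CC_hol 1); auto. apply zderiv_hol1; auto.
    - intros t. rewrite circ_periodic; auto. }
  assert (EF0 : F 0 = f z) by (unfold F; rewrite Rplus_0_r, <- Ez; auto).
  assert (K : forall t, 0 <= t <= 2 * PI -> Cmod (F t - f z) <= 4 * PI * M).
  { intros t Ht.
    assert (P : Cmod ((fst (F t), snd (F t)) - (fst (F 0), snd (F 0))) <= 2 * RInt g 0 t).
    { apply (path_length (fun t => fst (F t)) (fun t => snd (F t)) (fun t => - snd (zderiv f (circ r (b + t))))
        (fun t => fst (zderiv f (circ r (b + t))))); try lra.
      - intros s _. destruct (angular_derive f r (b + s) Hf Hr) as [D1 _].
        apply rd_eq with (1 * - snd (zderiv f (circ r (b + s)))); [|ring].
        apply (is_derive_comp (fun t => fst (f (circ r t))) (fun s => b + s)); auto.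
        apply rd_eq with (0 + 1); [|ring]. apply (rd_plus (fun _ => b) (fun s => s)). apply rd_const.
        apply (is_derive_id (K := R_AbsRing)).
      - intros s _. destruct (angular_derive f r (b + s) Hf Hr) as [_ D1].
        apply rd_eq with (1 * fst (zderiv f (circ r (b + s)))); [|ring].
        apply (is_derive_comp (fun t => snd (f (circ r t))) (fun s => b + s)); auto.
        apply rd_eq with (0 + 1); [|ring]. apply (rd_plus (fun _ => b) (fun s => s)). apply rd_const.
        apply (is_derive_id (K := R_AbsRing)).
      - intros s _. apply ct_opp. apply CCt_snd, CZ.
      - intros s _. apply CCt_fst, CZ.
      - intros s _. apply Cg.
      - intros s _. rewrite Rabs_Ropp. apply Rabs_snd_le.
      - intros s _. apply Rabs_fst_le. }
    rewrite <- !surjective_pairing, EF0 in P.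
    assert (I2 : RInt g 0 t <= RInt g 0 (2 * PI)).
    { rewrite <- (RInt_Chasles_R g 0 t (2 * PI)) by auto using Cts_ex_RInt.
      assert (0 <= RInt g t (2 * PI)). { apply RInt_ge_0. lra. apply Cts_ex_RInt; auto. intros; apply Cmod_ge_0. } lra. }
    lra. }
  rewrite Cmod_minus_sym, <- E0, <- (cavg_const (f z)), <- cavg_minus by auto using CC_const.
  assert (CD : CC (fun t => (F t - f z)%C)) by (apply CC_minus; auto using CC_const).
  eapply Rle_trans; [apply Cmod_cavg; auto|].
  rewrite <- (avg_const (4 * PI * M)). apply avg_le_on; auto using Cts_const. apply CC_Cmod; auto.
Qed.

(** Integrate |f'| along each radius and exchange the integrals. This carries smallness on a compact
    disc to all circles up to the boundary. *)
Lemma avg_radial_sub f M s R1 : hol 1 f -> (forall r, 0 <= r < 1 -> avg (fun t => Cmod (deriv f (circ r t))) <= M) ->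
  0 <= s <= R1 -> R1 < 1 ->
  avg (fun t => Cmod (f (circ R1 t))) <= avg (fun t => Cmod (f (circ s t))) + 2 * (R1 - s) * M.
Proof.
  intros Hf HM Hs HR. pose proof (hol_deriv_hol1 f Hf) as Hf'.
  (* The radius is clamped to [s, R1] so that the integrand is continuous on the whole plane, as
     [RInt_Fubini] demands. *)
  set (cl := fun x => Rmax s (Rmin x R1)).
  assert (Hcl : forall x, s <= cl x <= R1).
  { intros x. unfold cl. split. apply Rmax_l. apply Rmax_lub. lra. apply Rmin_r. }
  assert (Ecl : forall x, s <= x <= R1 -> cl x = x).
  { intros x Hx. unfold cl. rewrite Rmin_left, Rmax_right; lra. }
  assert (Ccl : Cts cl).
  { apply (Cts_ext (fun x => ((s + ((x + R1) - Rabs (x - R1)) / 2) + Rabs (s - ((x + R1) - Rabs (x - R1)) / 2)) / 2)).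
    - intros x. unfold cl, Rmax, Rmin. destruct (Rle_dec x R1); destruct (Rle_dec s _);
      unfold Rabs; repeat destruct Rcase_abs; lra.
    - assert (C1 : Cts (fun x : R => ((x + R1) - Rabs (x - R1)) / 2)).
      { apply Cts_mult; [|apply Cts_const]. apply Cts_minus. apply Cts_plus; [apply Cts_id | apply Cts_const].
        apply Cts_abs. apply Cts_minus; [apply Cts_id | apply Cts_const]. }
      apply Cts_mult; [|apply Cts_const]. apply Cts_plus.
      + apply Cts_plus; auto. apply Cts_const.
      + apply Cts_abs. apply Cts_minus; auto. apply Cts_const. }
  set (g := fun x t => Cmod (deriv f (circ (cl x) t))).
  assert (Cg : Cts (fun q : R * R => g (fst q) (snd q))).
  { intros q. apply (CCt_Cmod (fun q : R * R => deriv f (circ (cl (fst q)) (snd q)))). apply CCt_comp.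
    - apply CCt_circ. apply (Cts2_fst cl); auto. apply continuous_snd_comp, continuous_id.
    - apply (hol_cont 1); auto. destruct q as [x t]. specialize (Hcl x). simpl. rewrite Cmod_circ, Rabs_pos_eq; lra. }
  assert (Pt : forall t, Cmod (f (circ R1 t)) <= Cmod (f (circ s t)) + 2 * RInt (fun x => g x t) s R1).
  { intros t.
    assert (Cd : forall x, s <= x <= R1 -> CCt (T := R_UniformSpace) (fun x => circ 1 t * deriv f (circ x t))%C x).
    { intros x Hx. apply CCt_mult. apply CCt_const. apply CCt_comp.
      - apply (CCt_circ (fun x => x) (fun _ => t)). apply continuous_id. apply continuous_const.
      - apply (hol_cont 1); auto. rewrite Cmod_circ, Rabs_pos_eq; lra. }
    assert (P : Cmod ((fst (f (circ R1 t)), snd (f (circ R1 t))) - (fst (f (circ s t)), snd (f (circ s t)))) <= 2 * RInt (fun x => g x t) s R1).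
    { apply (path_length (fun x => fst (f (circ x t))) (fun x => snd (f (circ x t)))
        (fun x => fst (circ 1 t * deriv f (circ x t))%C) (fun x => snd (circ 1 t * deriv f (circ x t))%C)); try lra.
      - intros x Hx. exact (proj1 (radial_derive f x t Hf ltac:(lra))).
      - intros x Hx. exact (proj2 (radial_derive f x t Hf ltac:(lra))).
      - intros x Hx. apply CCt_fst, Cd; auto.
      - intros x Hx. apply CCt_snd, Cd; auto.
      - intros x Hx. apply (Cts2_sec2 g); auto.
      - intros x Hx. unfold g. rewrite Ecl by auto. eapply Rle_trans; [apply Rabs_fst_le|].
        rewrite Cmod_mult, Cmod_circ1. lra.
      - intros x Hx. unfold g. rewrite Ecl by auto. eapply Rle_trans; [apply Rabs_snd_le|].
        rewrite Cmod_mult, Cmod_circ1. lra. }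
    rewrite <- !surjective_pairing in P. pose proof (Cmod_minus_ge (f (circ R1 t)) (f (circ s t))). lra. }
  assert (CI : Cts (fun t => RInt (fun x => g x t) s R1)).
  { apply (Cts_RInt (fun t x => g x t)). lra. apply Cts2_swap; auto. }
  apply Rle_trans with (avg (fun t => Cmod (f (circ s t)) + 2 * RInt (fun x => g x t) s R1)).
  - apply avg_le; auto. apply CC_Cmod, (CC_hol 1); auto; lra.
    apply Cts_plus. apply CC_Cmod, (CC_hol 1); auto; lra. apply Cts_mult; auto. apply Cts_const.
  - rewrite avg_plus, avg_scal; auto.
    + apply Rplus_le_compat_l. rewrite Rmult_assoc. apply Rmult_le_compat_l. lra.
      unfold avg. rewrite <- (RInt_Fubini g s R1 0 (2 * PI)); auto; [|lra|left; apply PI2_pos].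
      rewrite <- RInt_scal_R by (apply Cts_RInt; auto; left; apply PI2_pos).
      apply Rle_trans with (RInt (fun _ => M) s R1).
      * apply RInt_le; [lra | | apply ex_RInt_const |].
        -- apply Cts_ex_RInt. apply Cts_mult. apply Cts_const. apply Cts_RInt; auto. left; apply PI2_pos.
        -- intros x Hx. unfold g. rewrite Ecl by lra. apply (HM x). lra.
      * rewrite RInt_const. right. reflexivity.
    + apply CC_Cmod, (CC_hol 1); auto; lra.
    + apply Cts_mult; auto. apply Cts_const.
Qed.

(** * Carleson embedding and Littlewood subordination *)

Lemma Cts_rpow_comp (f : C -> C) (Z : R -> C) q : 0 < q -> hol 1 f -> CC Z -> (forall t, Cmod (Z t) < 1) ->
  Cts (fun t => rpow (Cmod (f (Z t))) q).
Proof.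
  intros Hq Hf HZ HZ1. apply Cts_rpow; auto. intros; apply Cmod_ge_0.
  apply CC_Cmod. intros t. apply CCt_comp. apply HZ. apply (hol_cont 1); auto.
Qed.

(** The Poisson estimates require analyticity past the closed disc. They are applied to the dilates
    f (lam z), and lam -> 1 is a plain continuity argument because Z stays in the open disc. *)
Lemma dilation_limit (f : C -> C) (Z : R -> C) (om : R -> R) q K : 0 < q -> hol 1 f -> CC Z -> (forall t, Cmod (Z t) < 1) ->
  Cts om -> (forall lam, 0 < lam < 1 -> avg (fun t => om t * rpow (Cmod (f (RtoC lam * Z t)%C)) q) <= K) ->
  avg (fun t => om t * rpow (Cmod (f (Z t))) q) <= K.
Proof.
  intros Hq Hf HZ HZ1 Com H.
  assert (Hl : forall (e : R) t, Cmod (RtoC (1 - Rmin (Rabs e) 1) * Z t)%C < 1).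
  { intros e t. rewrite Cmod_mult, Cmod_R. pose proof (Rmin_l (Rabs e) 1). pose proof (Rmin_r (Rabs e) 1).
    assert (0 <= Rmin (Rabs e) 1) by (apply Rmin_glb; [apply Rabs_pos | lra]).
    rewrite Rabs_pos_eq by lra. specialize (HZ1 t). pose proof (Cmod_ge_0 (Z t)). nra. }
  (* The dilation factor is 1 - min(|e|, 1), continuous in e on the whole line, with e = 0 as the
     limit case. *)
  set (F := fun e t => om t * rpow (Cmod (f (RtoC (1 - Rmin (Rabs e) 1) * Z t)%C)) q).
  assert (Clam : continuous (fun e : R => 1 - Rmin (Rabs e) 1) 0 /\ forall e : R, continuous (fun e : R => 1 - Rmin (Rabs e) 1) e).
  { assert (K0 : forall e : R, continuous (fun e : R => 1 - Rmin (Rabs e) 1) e).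
    { apply (Cts_ext (fun e : R => 1 - ((Rabs e + 1) - Rabs (Rabs e - 1)) / 2)).
      - intros e. unfold Rmin. destruct (Rle_dec (Rabs e) 1); unfold Rabs at 2; destruct Rcase_abs; lra.
      - apply Cts_minus. apply Cts_const. apply Cts_mult; [|apply Cts_const].
        assert (Cts (fun e : R => Rabs e)) by (apply Cts_abs, Cts_id).
        apply Cts_minus. apply Cts_plus; auto using Cts_const. apply Cts_abs, Cts_minus; auto using Cts_const. }
    split; auto. }
  assert (CF : Cts (fun p : R * R => F (fst p) (snd p))).
  { unfold F. apply Cts_mult. apply Cts2_snd; auto. apply Cts_rpow; auto. intros; apply Cmod_ge_0.
    intros p. apply (CCt_Cmod (fun p : R * R => f (RtoC (1 - Rmin (Rabs (fst p)) 1) * Z (snd p))%C)). apply CCt_comp.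
    - apply CCt_mult.
      + apply CCt_intro; simpl. apply (Cts2_fst (fun e => 1 - Rmin (Rabs e) 1)). intros e; apply Clam. apply continuous_const.
      + apply (continuous_comp (V := R_UniformSpace) (W := C_UniformSpace) (fun q : R * R => snd q) Z).
        apply continuous_snd_comp, continuous_id. apply HZ.
    - apply (hol_cont 1); auto. }
  pose proof (le_of_right_limit (fun e => avg (F e)) (fun _ => K) (Cts_avg F CF 0) (continuous_const _ _)) as HL.
  cbv beta in HL. replace (avg (fun t => om t * rpow (Cmod (f (Z t))) q)) with (avg (F 0)).
  - apply HL. intros e He He1. unfold F. rewrite Rabs_pos_eq, Rmin_left by lra. apply H. lra.
  - apply avg_ext. intros t. unfold F. rewrite Rabs_R0, Rmin_left, Rminus_0_r by lra.
    replace (1 * Z t)%C with (Z t) by ring. auto.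
Qed.

(** [subharmonic_kern] majorizes |f|^(p/2) at Z t by a kernel integral over the circle, and
    [carleson_kern] bounds the square of that integral. *)
Lemma carleson_embedding p (om : R -> R) (Z : R -> C) A f M : 0 < p -> 0 <= A -> 0 <= M ->
  Cts om -> CC Z -> (forall t, 0 <= om t) -> (forall t, Cmod (Z t) < 1) ->
  (forall t, 0 < om t -> avg (fun x => om x * kern (2 + 2 * p) (Z t) (Z x)) <= A) ->
  hol 1 f -> (forall r, 0 <= r < 1 -> Mp p f r <= M) ->
  avg (fun t => om t * rpow (Cmod (f (Z t))) p) <= 4 * rpow 6 (2 + 2 * p) ^ 2 * rpow 2 (2 * p) * A * M.
Proof.
  intros Hp HA HM0 Com CZ Hom HZ HT Hf HM. apply dilation_limit; auto.
  intros lam Hlam. destruct (hol_scale 1 f lam ltac:(lra) Hf) as [Hfl _].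
  assert (H1l : 1 < 1 / lam). { apply Rmult_lt_reg_r with lam. lra. unfold Rdiv. rewrite Rmult_assoc, Rinv_l; lra. }
  set (v := fun al => rpow (Cmod (f (RtoC lam * circ 1 al)%C)) (p / 2)).
  assert (Ev : forall al, v al = rpow (Cmod (f (circ lam al))) (p / 2)).
  { intros al. unfold v. rewrite <- circ_scal, Rmult_1_r. auto. }
  assert (Cv : Cts v). { eapply Cts_ext. intros al; symmetry; apply Ev. apply (Cts_rpow_hol 1); auto; lra. }
  assert (Hv : forall t, 0 <= v t) by (intros; apply rpow_ge0).
  assert (CT : Cts (fun t => avg (fun al => kern (2 + 2 * p) (Z t) (circ 1 al) * v al))).
  { apply (Cts_avg (fun t al => kern (2 + 2 * p) (Z t) (circ 1 al) * v al)). apply Cts_mult; [|apply Cts2_snd; auto].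
    apply (Cts_kern (fun q : R * R => Z (fst q)) (fun q : R * R => circ 1 (snd q))). lra.
    - intros q. apply (continuous_comp (V := R_UniformSpace) (W := C_UniformSpace) (fun q : R * R => fst q) Z).
      apply continuous_fst_comp, continuous_id. apply CZ.
    - intros q. apply (CCt_circ (fun _ => 1) (fun q : R * R => snd q)). apply continuous_const.
      apply continuous_snd_comp, continuous_id.
    - auto.
    - intros q. rewrite Cmod_circ1; lra. }
  assert (CfZ : Cts (fun t => rpow (Cmod (f (RtoC lam * Z t)%C)) p)).
  { apply (Cts_rpow_comp f (fun t => RtoC lam * Z t)%C); auto.
    - apply CC_mult; auto. apply CC_const.
    - intros t. rewrite Cmod_mult, Cmod_R, Rabs_pos_eq by lra. specialize (HZ t). pose proof (Cmod_ge_0 (Z t)). nra. }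
  apply Rle_trans with (avg (fun t => om t * (avg (fun al => kern (2 + 2 * p) (Z t) (circ 1 al) * v al)) ^ 2)).
  - apply avg_le.
    + apply Cts_mult; auto.
    + apply Cts_mult; auto. apply Cts_pow; auto.
    + intros t. apply Rmult_le_compat_l; auto. rewrite <- rpow_half_sqr by apply Cmod_ge_0.
      apply pow_incr. split. apply rpow_ge0.
      apply (subharmonic_kern (1 / lam) (fun z => f (RtoC lam * z)%C) (Z t) p H1l Hfl (HZ t) Hp).
  - eapply Rle_trans. apply (carleson_kern p om v Z A); auto.
    apply Rmult_le_compat_l.
    + apply Rmult_le_pos; auto. apply Rmult_le_pos; [|apply rpow_ge0]. pose proof (pow2_ge_0 (rpow 6 (2 + 2 * p))). lra.
    + eapply Rle_trans; [|apply (HM lam); lra]. right. apply avg_ext. intros al. rewrite Ev. apply rpow_half_sqr, Cmod_ge_0.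
Qed.

Definition selfmap (vphi : C -> C) : Prop := hol 1 vphi /\ forall z, Cmod z < 1 -> Cmod (vphi z) < 1.

Lemma CC_selfmap vphi r : selfmap vphi -> 0 <= r < 1 -> CC (fun t => vphi (circ r t)).
Proof. intros [H _] Hr. apply (CC_hol 1); auto. Qed.

Lemma selfmap_circ vphi r t : selfmap vphi -> 0 <= r < 1 -> Cmod (vphi (circ r t)) < 1.
Proof. intros [_ H] Hr. apply H. rewrite Cmod_circ, Rabs_pos_eq; lra. Qed.

(** Littlewood's subordination principle: majorize |f| by a Poisson integral, exchange the averages,
    and use [avg_Pk_comp], which leaves the Poisson kernel at vphi 0. *)
Lemma littlewood vphi f M r : selfmap vphi -> hol 1 f -> 0 <= r < 1 ->
  (forall r, 0 <= r < 1 -> avg (fun t => Cmod (f (circ r t))) <= M) ->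
  avg (fun t => Cmod (f (vphi (circ r t)))) <= 2 / (1 - Cmod (vphi 0%C)) * M.
Proof.
  intros Hv Hf Hr HM. set (Z := fun t => vphi (circ r t)).
  pose proof (CC_selfmap vphi r Hv Hr) as CZ. fold Z in CZ.
  assert (HZ : forall t, Cmod (Z t) < 1) by (intros; apply selfmap_circ; auto).
  assert (Hv0 : Cmod (vphi 0%C) < 1) by (apply Hv; rewrite Cmod_0; lra).
  set (K := 2 / (1 - Cmod (vphi 0%C))).
  assert (E : forall x, rpow (Cmod x) 1 = Cmod x) by (intros; apply rpow_exp1, Cmod_ge_0).
  rewrite (avg_ext _ (fun t => 1 * rpow (Cmod (f (Z t))) 1)) by (intros; rewrite E; fold (Z t); ring).
  apply dilation_limit; auto using Cts_const; [lra|].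
  intros lam Hlam. destruct (hol_scale 1 f lam ltac:(lra) Hf) as [Hfl _].
  assert (H1l : 1 < 1 / lam). { apply Rmult_lt_reg_r with lam. lra. unfold Rdiv. rewrite Rmult_assoc, Rinv_l; lra. }
  set (v := fun al => Cmod (f (RtoC lam * circ 1 al)%C)).
  assert (Ev : forall al, v al = Cmod (f (circ lam al))).
  { intros al. unfold v. rewrite <- circ_scal, Rmult_1_r. auto. }
  assert (Cv : Cts v). { eapply Cts_ext. intros al; symmetry; apply Ev. apply CC_Cmod, (CC_hol 1); auto; lra. }
  assert (CP : Cts (fun q : R * R => Pk (Z (fst q)) (snd q))).
  { assert (CZ1 : forall q : R * R, CCt (T := prod_UniformSpace R_UniformSpace R_UniformSpace) (fun q : R * R => Z (fst q)) q).
    { intros q. apply (continuous_comp (V := R_UniformSpace) (W := C_UniformSpace) (fun q : R * R => fst q) Z).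
      apply continuous_fst_comp, continuous_id. apply CZ. }
    unfold Pk. apply Cts_div.
    - apply Cts_minus. apply Cts_const. apply Cts_pow. intros q. apply CCt_Cmod; auto.
    - apply Cts_pow. intros q. apply (CCt_Cmod (fun q : R * R => (circ 1 (snd q) - Z (fst q))%C)). apply CCt_minus; auto.
      apply (CCt_circ (fun _ => 1) (fun q : R * R => snd q)). apply continuous_const. apply continuous_snd_comp, continuous_id.
    - intros q. apply Rgt_not_eq. apply Pk_den; auto. }
  assert (CPv : Cts (fun q : R * R => Pk (Z (fst q)) (snd q) * v (snd q))) by (apply Cts_mult; auto; apply Cts2_snd; auto).
  apply Rle_trans with (avg (fun t => avg (fun al => Pk (Z t) al * v al))).
  - apply avg_le.
    + apply Cts_mult. apply Cts_const. apply (Cts_rpow_comp f (fun t => RtoC lam * Z t)%C); auto; try lra.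
      * apply CC_mult; auto. apply CC_const.
      * intros t. rewrite Cmod_mult, Cmod_R, Rabs_pos_eq by lra. specialize (HZ t). pose proof (Cmod_ge_0 (Z t)). nra.
    + apply (Cts_avg (fun t al => Pk (Z t) al * v al)); auto.
    + intros t. rewrite Rmult_1_l.
      eapply Rle_trans. apply (poisson_subharmonic (1 / lam) (fun z => f (RtoC lam * z)%C) (Z t) 1 H1l Hfl (HZ t)); lra.
      right. apply avg_ext. intros al. rewrite E. auto.
  - rewrite (avg_Fubini (fun t al => Pk (Z t) al * v al)); auto.
    apply Rle_trans with (avg (fun al => K * v al)).
    + apply avg_le. apply (Cts2_avg1 (fun t al => Pk (Z t) al * v al)); auto. apply Cts_mult; auto. apply Cts_const.
      intros al. rewrite avg_scal_r by (apply (Cts2_sec2 (fun t al => Pk (Z t) al)); auto).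
      apply Rmult_le_compat_r. apply Cmod_ge_0. unfold Z. rewrite avg_Pk_comp; try apply Hv; auto.
      apply Pk_le; auto.
    + rewrite avg_scal by auto. apply Rmult_le_compat_l.
      * apply Rmult_le_pos. lra. left; apply Rinv_0_lt_compat; lra.
      * rewrite (avg_ext _ _ Ev). apply HM; lra.
Qed.

(** * Montel's theorem *)

Definition sinc (s : nat -> nat) : Prop := forall n, (s n < s (S n))%nat.

Lemma sinc_lt s n m : sinc s -> (n < m)%nat -> (s n < s m)%nat.
Proof. intros H Hnm. induction Hnm. apply H. specialize (H m). lia. Qed.
Lemma sinc_ge s n : sinc s -> (n <= s n)%nat.
Proof. intros H. induction n. lia. specialize (H n). lia. Qed.
Lemma sinc_comp s t : sinc s -> sinc t -> sinc (fun n => s (t n)).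
Proof. intros Hs Ht n. apply sinc_lt; auto. Qed.

Lemma bounded_subseq (y : nat -> R) B : (forall n, Rabs (y n) <= B) ->
  exists t l, sinc t /\ is_lim_seq (fun n => y (t n)) (Finite l).
Proof.
  intros HB.
  destruct (Bolzano_Weierstrass y (fun x => - B <= x <= B)) as [l Hl].
  - apply compact_P3.
  - intros n. apply Rabs_le_between; auto.
  - assert (Hn : forall N n, exists m, (N <= m)%nat /\ Rabs (y m - l) < / INR (S n)).
    { intros N n. assert (Hp : 0 < / INR (S n)) by (apply Rinv_0_lt_compat, lt_0_INR; lia).
      destruct (Hl (fun x => Rabs (x - l) < / INR (S n)) N) as [m [Hm1 Hm2]].
      - exists (mkposreal _ Hp). intros x Hx. exact Hx.
      - exists m; auto. }
    destruct (dependent_choice (T := nat) (fun _ _ => True)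
      (fun n m m' => (m < m')%nat /\ Rabs (y m' - l) < / INR (S n)) O I) as [s [_ [_ Hs]]].
    { intros n m _. destruct (Hn (S m) n) as [m' [H1 H2]]. exists m'. split; auto. }
    exists (fun n => s (S n)), l. split.
    + intros n. apply Hs.
    + apply is_lim_seq_spec. intros eps. destruct (archimed_cor1 eps (cond_pos eps)) as [N [HN1 HN2]].
      exists N. intros n Hn'. destruct (Hs n) as [_ H]. eapply Rlt_trans; [exact H|].
      eapply Rle_lt_trans; [|exact HN1]. apply Rinv_le_contravar. apply lt_0_INR; lia. apply le_INR; lia.
Qed.

(** Cantor's diagonal: [sg (S k)] is a subsequence of [sg k] along which the k-th coordinate
    converges. *)
Lemma diagonal_subseq (x : nat -> nat -> R) (B : nat -> R) : (forall n k, Rabs (x n k) <= B k) ->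
  exists s l, sinc s /\ forall k, is_lim_seq (fun n => x (s n) k) (Finite (l k)).
Proof.
  intros HB.
  destruct (dependent_choice (T := nat -> nat) (fun _ s => sinc s)
    (fun k s s' => exists t l, sinc t /\ (forall n, s' n = s (t n)) /\ is_lim_seq (fun n => x (s' n) k) (Finite l))
    (fun n => n)) as [sg [_ [Hinc Hstep]]].
  - intros n. lia.
  - intros k s Hs. destruct (bounded_subseq (fun n => x (s n) k) (B k)) as [t [l [Ht Hl]]]; auto.
    exists (fun n => s (t n)). split. apply sinc_comp; auto. exists t, l. auto.
  - assert (Hsub : forall k j, exists t, sinc t /\ forall n, sg (k + j)%nat n = sg k (t n)).
    { intros k j. induction j.
      - exists (fun n => n). split. intros n; lia. rewrite Nat.add_0_r. auto.
      - destruct IHj as [t [Ht E]]. destruct (Hstep (k + j)%nat) as [t' [_ [Ht' [E' _]]]].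
        exists (fun n => t (t' n)). split. apply sinc_comp; auto.
        intros n. replace (k + S j)%nat with (S (k + j)) by lia. rewrite E', E. auto. }
    assert (Hl : forall k, exists l, is_lim_seq (fun n => x (sg (S k) n) k) (Finite l)).
    { intros k. destruct (Hstep k) as [t [l [_ [_ H]]]]. exists l; auto. }
    set (l := fun k => proj1_sig (constructive_indefinite_description _ (Hl k))).
    assert (Hll : forall k, is_lim_seq (fun n => x (sg (S k) n) k) (Finite (l k))).
    { intros k. unfold l. destruct (constructive_indefinite_description _ (Hl k)); auto. }
    exists (fun n => sg n n), l. split.
    (* The diagonal increases strictly, because sg (S n) (S n) = sg n (t (S n)) with t (S n) > n. *)
    + intros n. destruct (Hstep n) as [t [_ [Ht [E _]]]]. rewrite E.
      apply sinc_lt; auto. pose proof (sinc_ge t (S n) Ht). lia.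
    + intros k. apply is_lim_seq_spec. intros eps. pose proof (Hll k) as HL. apply is_lim_seq_spec in HL.
      destruct (HL eps) as [N HN]. exists (Nat.max N (S k)). intros n Hn.
      destruct (Hsub (S k) (n - S k)%nat) as [t [Ht E]]. replace (S k + (n - S k))%nat with n in E by lia.
      rewrite E. apply HN. pose proof (sinc_ge t n Ht). lia.
Qed.

Lemma Series_geom_tail a q K M : (forall k, 0 <= a k) -> 0 <= q < 1 -> 0 <= M -> (forall k, a k <= M * q ^ k) ->
  ex_series a /\ Series a <= Rsumb a K + M * q ^ K / (1 - q).
Proof.
  intros Ha Hq HM H.
  assert (Hex : ex_series a).
  { apply ex_series_le_R with (fun k => M * q ^ k). intros; split; auto. apply ex_series_scal_R, ex_series_geom.
    rewrite Rabs_pos_eq; lra. }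
  split; auto.
  assert (Hj : forall j, Rsumb a (K + j) <= Rsumb a K + M * (q ^ K - q ^ (K + j)) / (1 - q)).
  { induction j.
    - rewrite Nat.add_0_r. unfold Rminus. rewrite Rplus_opp_r, Rmult_0_r. unfold Rdiv. lra.
    - replace (K + S j)%nat with (S (K + j)) by lia. simpl Rsumb. specialize (H (K + j)%nat).
      apply Rle_trans with (Rsumb a K + M * (q ^ K - q ^ (K + j)) / (1 - q) + M * q ^ (K + j)); [lra|].
      right. simpl. field. lra. }
  assert (Hqk : forall j, 0 <= q ^ j) by (intros; apply pow_le; lra).
  apply Series_le_bound; auto. intros n.
  apply Rle_trans with (Rsumb a (K + n)).
  - apply Rsumb_mono; auto. lia.
  - eapply Rle_trans; [apply Hj|]. apply Rplus_le_compat_l. unfold Rdiv. apply Rmult_le_compat_r.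
    left; apply Rinv_0_lt_compat; lra. apply Rmult_le_compat_l; auto. specialize (Hqk (K + n)%nat). lra.
Qed.

Lemma Rsumb_small (c : nat -> nat -> R) K : (forall k, is_lim_seq (fun n => c n k) 0) ->
  is_lim_seq (fun n => Rsumb (c n) K) 0.
Proof.
  intros H. induction K.
  - apply is_lim_seq_const.
  - simpl. replace (Finite 0) with (Finite (0 + 0)) by (f_equal; ring).
    apply (is_lim_seq_plus' (fun n => Rsumb (c n) K) (fun n => c n K)); auto.
Qed.

(** One coefficient sum at the larger radius s + d controls both the series and its derivative, the
    latter at the price of 1/d. *)
Lemma PS_PSd_bound c s d z : radius1 c -> 0 <= s -> 0 < d -> s + d < 1 -> Cmod z <= s ->
  Cmod (PS c z) <= Series (fun k => Cmod (c k) * (s + d) ^ k) /\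
  Cmod (PS (PSd c) z) <= Series (fun k => Cmod (c k) * (s + d) ^ k) / d.
Proof.
  intros Hc Hs Hd Hsd Hz.
  pose proof (radius1_series c (s + d) Hc ltac:(lra)) as HS.
  assert (Hpos : forall k, 0 <= Cmod (c k) * (s + d) ^ k).
  { intros k. apply Rmult_le_pos. apply Cmod_ge_0. apply pow_le; lra. }
  split.
  - apply Cmod_CSer_le; auto. intros n. rewrite Cmod_mult, Cmod_pow. apply Rmult_le_compat_l. apply Cmod_ge_0.
    apply pow_incr. split. apply Cmod_ge_0. lra.
  - assert (HS1 : ex_series (fun k => / d * (Cmod (c (S k)) * (s + d) ^ S k))).
    { apply ex_series_scal_R. apply (ex_series_incr_1 (fun k => Cmod (c k) * (s + d) ^ k)). auto. }
    eapply Rle_trans.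
    + apply (Cmod_CSer_le _ (fun k => / d * (Cmod (c (S k)) * (s + d) ^ S k))); auto.
      intros k. unfold PSd. rewrite !Cmod_mult, Cmod_R, Cmod_pow, Rabs_pos_eq by apply pos_INR.
      pose proof (INR_pow_le s d (S k) Hs Hd) as HI. replace (S k - 1)%nat with k in HI by lia.
      pose proof (Cmod_ge_0 (c (S k))).
      assert (Cmod z ^ k <= s ^ k) by (apply pow_incr; split; [apply Cmod_ge_0 | lra]).
      apply Rle_trans with (Cmod (c (S k)) * (INR (S k) * s ^ k)).
      * rewrite (Rmult_comm (INR (S k))), Rmult_assoc. apply Rmult_le_compat_l; auto. apply Rmult_le_compat_l; auto. apply pos_INR.
      * rewrite (Rmult_comm (/ d)), Rmult_assoc. apply Rmult_le_compat_l; auto.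
    + rewrite Series_scal_l. unfold Rdiv. rewrite Rmult_comm. apply Rmult_le_compat_r.
      left; apply Rinv_0_lt_compat; auto.
      rewrite (Series_incr_1 (fun k => Cmod (c k) * (s + d) ^ k)) by auto.
      specialize (Hpos O). lra.
Qed.

(** Proved on Taylor coefficients: they are bounded, so a diagonal subsequence converges
    coefficientwise, and Cauchy's estimates give a uniform geometric tail. Convergence of the
    derivatives comes from the same coefficient sum. *)
Lemma montel (f : nat -> C -> C) B : (forall n, hol 1 (f n)) -> (forall n z, Cmod z < 1 -> Cmod (f n z) <= B) ->
  exists s g, sinc s /\ hol 1 g /\ forall rho eps, 0 <= rho < 1 -> 0 < eps -> exists N, forall n, (N <= n)%nat ->
    forall z, Cmod z <= rho -> Cmod (f (s n) z - g z) <= eps /\ Cmod (deriv (f (s n)) z - deriv g z) <= eps.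
Proof.
  intros Hf HB.
  assert (B0 : 0 <= B).
  { eapply Rle_trans; [apply Cmod_ge_0 | apply (HB O 0%C)]. rewrite Cmod_0; lra. }
  assert (HC : forall n k r, 0 < r < 1 -> Cmod (coef (f n) k) * r ^ k <= B).
  { intros n k r Hr. apply coef_bound; auto. intros t. apply HB. rewrite Cmod_circ, Rabs_pos_eq; lra. }
  assert (HC2 : forall n k, Cmod (coef (f n) k) <= B * 2 ^ k).
  { intros n k. pose proof (HC n k (/ 2) ltac:(lra)) as H. rewrite pow_inv in H.
    apply Rmult_le_reg_r with (/ 2 ^ k). apply Rinv_0_lt_compat, pow_lt; lra.
    rewrite Rmult_assoc, Rinv_r by (apply pow_nonzero; lra). lra. }
  destruct (diagonal_subseq (fun n k => fst (coef (f n) k)) (fun k => B * 2 ^ k)) as [s1 [l1 [Hs1 Hl1]]].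
  { intros n k. eapply Rle_trans; [apply Rabs_fst_le | apply HC2]. }
  destruct (diagonal_subseq (fun n k => snd (coef (f (s1 n)) k)) (fun k => B * 2 ^ k)) as [s2 [l2 [Hs2 Hl2]]].
  { intros n k. eapply Rle_trans; [apply Rabs_snd_le | apply HC2]. }
  set (s := fun n => s1 (s2 n)). set (a := fun k => (l1 k, l2 k) : C).
  assert (Hlim : forall k, is_lim_seq (fun n => Cmod (coef (f (s n)) k - a k)) 0).
  { intros k. apply (is_lim_seq_le_le (fun _ => 0) _ (fun n => Rabs (fst (coef (f (s n)) k) - l1 k) + Rabs (snd (coef (f (s n)) k) - l2 k))).
    - intros n. split. apply Cmod_ge_0. apply (Cmod_le_abs (coef (f (s n)) k - a k)%C).
    - apply is_lim_seq_const.
    - replace (Finite 0) with (Finite (0 + 0)) by (f_equal; ring). apply is_lim_seq_plus'.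
      + apply (proj1 (is_lim_seq_abs_0 (fun n => fst (coef (f (s n)) k) - l1 k))). replace (Finite 0) with (Finite (l1 k - l1 k)) by (f_equal; ring).
        apply is_lim_seq_minus'; [|apply is_lim_seq_const].
        apply (is_lim_seq_subseq (fun n => fst (coef (f (s1 n)) k)) (l1 k) s2); auto.
        apply eventually_subseq. auto.
      + apply (proj1 (is_lim_seq_abs_0 (fun n => snd (coef (f (s n)) k) - l2 k))). replace (Finite 0) with (Finite (l2 k - l2 k)) by (f_equal; ring).
        apply is_lim_seq_minus'; [|apply is_lim_seq_const]. apply Hl2. }
  assert (Ha : forall k r, 0 < r < 1 -> Cmod (a k) * r ^ k <= B).
  { intros k r Hr. apply Rle_plus_epsilon. intros e He.
    assert (Hrk : 0 < r ^ k <= 1). { split. apply pow_lt; lra. rewrite <- (pow1 k). apply pow_incr; lra. }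
    pose proof (Hlim k) as H. apply is_lim_seq_spec in H. destruct (H (mkposreal _ He)) as [N HN].
    specialize (HN N (le_n N)). simpl in HN. rewrite Rminus_0_r, Rabs_pos_eq in HN by apply Cmod_ge_0.
    pose proof (HC (s N) k r Hr). pose proof (Cmod_minus_ge (a k) (coef (f (s N)) k)). rewrite Cmod_minus_sym in HN.
    pose proof (Cmod_ge_0 (coef (f (s N)) k)). nra. }
  assert (Ra : radius1 a) by (intros r Hr; exists B; auto).
  exists s, (PS a). split; [|split].
  - exact (sinc_comp s1 s2 Hs1 Hs2).
  - exact (PS_hol a Ra).
  - intros rho eps Hrho Heps.
    (* Three radii rho < s' < s'' < 1: the step to s' pays for the derivative, the step to s'' for
       the geometric decay with ratio q = s' / s''. *)
    set (d := (1 - rho) / 3). assert (Hd : 0 < d < 1) by (unfold d; lra).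
    set (s' := rho + d). set (s'' := rho + 2 * d). assert (Hss : 0 < s' < s'' /\ s'' < 1) by (unfold s', s'', d; lra).
    set (q := s' / s''). assert (Hq : 0 <= q < 1).
    { unfold q. split. apply Rmult_le_pos; [lra | left; apply Rinv_0_lt_compat; lra].
      apply Rmult_lt_reg_r with s''. lra. unfold Rdiv. rewrite Rmult_assoc, Rinv_l; lra. }
    set (c := fun n k => (coef (f (s n)) k - a k)%C).
    assert (Hc : forall n k r, 0 < r < 1 -> Cmod (c n k) * r ^ k <= 2 * B).
    { intros n k r Hr. pose proof (HC (s n) k r Hr). pose proof (Ha k r Hr).
      assert (Cmod (c n k) <= Cmod (coef (f (s n)) k) + Cmod (a k)).
      { unfold c, Cminus. eapply Rle_trans; [apply Cmod_triangle|]. rewrite Cmod_opp. lra. }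
      pose proof (pow_lt r k ltac:(lra)). nra. }
    assert (Rc : forall n, radius1 (c n)) by (intros n r Hr; exists (2 * B); auto).
    assert (Hq2 : forall n k, Cmod (c n k) * s' ^ k <= 2 * B * q ^ k).
    { intros n k. replace (s' ^ k) with (s'' ^ k * q ^ k) by (rewrite <- Rpow_mult_distr; f_equal; unfold q; field; lra).
      rewrite <- Rmult_assoc. apply Rmult_le_compat_r. apply pow_le; lra. apply Hc; lra. }
    (* One half for the head and one for the tail; the factor d compensates the 1/d of the
       derivative bound. *)
    set (e := eps * d / 2). assert (He : 0 < e) by (unfold e; nra).
    destruct (pow_lt_1_zero q) with (y := e * (1 - q) / (2 * B + 1)) as [K HK].
    { rewrite Rabs_pos_eq; lra. } { apply Rdiv_lt_0_compat; [apply Rmult_lt_0_compat|]; lra. }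
    specialize (HK K (le_n K)). rewrite Rabs_pos_eq in HK by (apply pow_le; lra).
    assert (Htail : 2 * B * q ^ K / (1 - q) <= e).
    { apply Rmult_le_reg_r with (1 - q). lra. unfold Rdiv. rewrite Rmult_assoc, Rinv_l, Rmult_1_r by lra.
      pose proof (pow_le q K (proj1 Hq)).
      apply Rle_trans with ((2 * B + 1) * q ^ K). nra.
      apply Rle_trans with ((2 * B + 1) * (e * (1 - q) / (2 * B + 1))). apply Rmult_le_compat_l; lra.
      right; field; lra. }
    assert (HRs : is_lim_seq (fun n => Rsumb (fun k => Cmod (c n k) * s' ^ k) K) 0).
    { apply (Rsumb_small (fun n k => Cmod (c n k) * s' ^ k)). intros k.
      replace (Finite 0) with (Finite (0 * s' ^ k)) by (f_equal; ring).
      apply is_lim_seq_mult'; [apply Hlim | apply is_lim_seq_const]. }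
    apply is_lim_seq_spec in HRs. destruct (HRs (mkposreal _ He)) as [N HN]. simpl in HN.
    exists N. intros n Hn z Hz. specialize (HN n Hn). rewrite Rminus_0_r in HN. apply Rabs_def2 in HN.
    assert (Hpos : forall k, 0 <= Cmod (c n k) * s' ^ k).
    { intros k. apply Rmult_le_pos. apply Cmod_ge_0. apply pow_le; lra. }
    destruct (Series_geom_tail _ q K (2 * B) Hpos Hq ltac:(lra) (Hq2 n)) as [_ HSer].
    destruct (PS_PSd_bound (c n) rho d z (Rc n) ltac:(lra) ltac:(lra) ltac:(unfold d; lra) Hz) as [P1 P2].
    fold s' in P1, P2.
    assert (HS2 : Series (fun k => Cmod (c n k) * s' ^ k) <= eps * d) by (unfold e in *; lra).
    assert (Hz1 : Cmod z < 1) by lra.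
    pose proof (coef_radius1 _ (Hf (s n))) as Rf.
    split.
    + replace (f (s n) z - PS a z)%C with (PS (c n) z). nra.
      rewrite (taylor (f (s n)) z) by auto. unfold PS. rewrite <- CSer_minus by (apply radius1_absC; auto).
      apply CSer_ext. intros k. unfold c. ring.
    + replace (deriv (f (s n)) z - deriv (PS a) z)%C with (PS (PSd (c n)) z).
      * eapply Rle_trans; [exact P2|]. apply Rmult_le_reg_r with d. lra. unfold Rdiv. rewrite Rmult_assoc, Rinv_l; lra.
      * rewrite (deriv_taylor (f (s n)) z) by auto. rewrite (Cdiff_deriv _ _ _ (PS_diff a z Ra Hz1)).
        unfold PS. rewrite <- CSer_minus by (apply radius1_absC; auto; apply radius1_PSd; auto).
        apply CSer_ext. intros k. unfold PSd, c. ring.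
Qed.

Lemma Cts_Rmax {T : UniformSpace} (F G : T -> R) : Cts F -> Cts G -> Cts (fun x => Rmax (F x) (G x)).
Proof.
  intros HF HG. apply (Cts_ext (fun x => (F x + G x + Rabs (F x - G x)) / 2)).
  - intros x. unfold Rmax. destruct (Rle_dec (F x) (G x)); unfold Rabs; destruct Rcase_abs; lra.
  - apply Cts_mult; [|apply Cts_const]. apply Cts_plus. apply Cts_plus; auto. apply Cts_abs, Cts_minus; auto.
Qed.

Lemma Cts_Rmin {T : UniformSpace} (F G : T -> R) : Cts F -> Cts G -> Cts (fun x => Rmin (F x) (G x)).
Proof.
  intros HF HG. apply (Cts_ext (fun x => (F x + G x - Rabs (F x - G x)) / 2)).
  - intros x. unfold Rmin. destruct (Rle_dec (F x) (G x)); unfold Rabs; destruct Rcase_abs; lra.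
  - apply Cts_mult; [|apply Cts_const]. apply Cts_minus. apply Cts_plus; auto. apply Cts_abs, Cts_minus; auto.
Qed.

(** Takes the place of Fatou's lemma: max(|F| - e, 0)^p <= |G|^p pointwise, and the left side
    depends continuously on e. *)
Lemma Mp_limit p (F : C -> C) r M : 0 < p -> CC (fun t => F (circ r t)) ->
  (forall e, 0 < e -> exists G : R -> C, CC G /\ (forall t, Cmod (G t - F (circ r t)) <= e) /\
     avg (fun t => rpow (Cmod (G t)) p) <= M) ->
  Mp p F r <= M.
Proof.
  intros Hp CF H. pose proof (CC_Cmod _ CF) as Cm.
  set (Phi := fun e t => rpow (Rmax (Cmod (F (circ r t)) - Rabs e) 0) p).
  assert (CP : Cts (fun q : R * R => Phi (fst q) (snd q))).
  { apply Cts_rpow; auto. intros; apply Rmax_r. apply Cts_Rmax; [|apply Cts_const].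
    apply Cts_minus. apply (Cts2_snd (fun t => Cmod (F (circ r t)))); auto.
    apply (Cts2_fst (fun e => Rabs e)). apply Cts_abs, Cts_id. }
  pose proof (le_of_right_limit (fun e => avg (Phi e)) (fun _ => M) (Cts_avg Phi CP 0) (continuous_const _ _)) as HL.
  cbv beta in HL. rewrite Mp_avg. replace (avg (fun t => rpow (Cmod (F (circ r t))) p)) with (avg (Phi 0)).
  - apply HL. intros e He _. destruct (H e He) as [G [CG [HG1 HG2]]].
    eapply Rle_trans; [|exact HG2]. apply avg_le.
    + apply (Cts2_sec1 Phi); auto.
    + apply Cts_rpow; auto. intros; apply Cmod_ge_0. apply CC_Cmod; auto.
    + intros t. apply rpow_le. lra. split. apply Rmax_r. apply Rmax_lub; [|apply Cmod_ge_0].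
      rewrite Rabs_pos_eq by lra. specialize (HG1 t). pose proof (Cmod_minus_ge (F (circ r t)) (G t)).
      rewrite Cmod_minus_sym in HG1. lra.
  - apply avg_ext. intros t. unfold Phi. rewrite Rabs_R0, Rminus_0_r, Rmax_left by apply Cmod_ge_0. auto.
Qed.

(** * Compactness from vanishing kernel integrals *)

Definition ramp (a b x : R) : R := Rmax 0 (Rmin 1 ((x - a) / (b - a))).

Lemma ramp_range a b x : 0 <= ramp a b x <= 1.
Proof.
  unfold ramp. split. apply Rmax_l. apply Rmax_lub. lra. apply Rmin_l.
Qed.
Lemma ramp_lo a b x : a < b -> x <= a -> ramp a b x = 0.
Proof.
  intros Hab Hx. unfold ramp. apply Rmax_left. eapply Rle_trans; [apply Rmin_r|].
  unfold Rdiv. assert (0 < / (b - a)) by (apply Rinv_0_lt_compat; lra). nra.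
Qed.
Lemma ramp_hi a b x : a < b -> b <= x -> ramp a b x = 1.
Proof.
  intros Hab Hx. unfold ramp. rewrite Rmin_left. apply Rmax_right; lra.
  apply Rmult_le_reg_r with (b - a). lra. unfold Rdiv. rewrite Rmult_assoc, Rinv_l; lra.
Qed.
Lemma Cts_ramp {T : UniformSpace} (F : T -> R) a b : Cts F -> Cts (fun x => ramp a b (F x)).
Proof.
  intros HF. unfold ramp. apply Cts_Rmax. apply Cts_const. apply Cts_Rmin. apply Cts_const.
  apply Cts_mult; [|apply Cts_const]. apply Cts_minus; auto using Cts_const.
Qed.

Lemma avg_Cmod_le_Mp p f r : 1 <= p -> hol 1 f -> 0 <= r < 1 -> avg (fun t => Cmod (f (circ r t))) <= 1 + Mp p f r.
Proof.
  intros Hp Hf Hr. rewrite Mp_avg.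
  assert (C1 : Cts (fun t => rpow (Cmod (f (circ r t))) p)) by (apply (Cts_rpow_hol 1); auto; lra).
  rewrite <- (avg_const 1), <- avg_plus by auto using Cts_const. apply avg_le.
  - apply CC_Cmod, (CC_hol 1); auto.
  - apply Cts_plus; auto using Cts_const.
  - intros t. apply le_1_rpow; auto. apply Cmod_ge_0.
Qed.

(* The multiplier part phi' f(vphi) of (W f)' never contributes to non-compactness. *)
Lemma multiplier_small p g vphi M B D : 1 <= p -> hol 1 g -> (forall r, 0 <= r < 1 -> Mp p g r <= M) -> selfmap vphi ->
  0 < B -> 0 <= D -> forall eps, 0 < eps -> exists del s, 0 < del /\ 0 <= s < 1 /\
  forall d, hol 1 d -> (forall z, Cmod z < 1 -> Cmod (d z) <= B) -> (forall r, 0 <= r < 1 -> Mp p (deriv d) r <= D) ->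
    (forall z, Cmod z <= s -> Cmod (d z) <= del) -> forall r, 0 <= r < 1 ->
    avg (fun t => rpow (Cmod (g (circ r t))) p * rpow (Cmod (d (vphi (circ r t)))) p) <= eps.
Proof.
  intros Hp Hg HM Hv HB HD eps He.
  assert (Bp : 0 < rpow B p) by (apply rpow_gt0; auto).
  destruct (uniform_integrability g p M Hg ltac:(lra) HM (eps / (2 * rpow B p))) as [L [HL0 HL]].
  { apply Rdiv_lt_0_compat; lra. }
  assert (Hv0 : Cmod (vphi 0%C) < 1) by (apply Hv; rewrite Cmod_0; lra).
  set (K := 2 / (1 - Cmod (vphi 0%C))).
  assert (HK : 0 < K) by (apply Rdiv_lt_0_compat; lra).
  set (Q := rpow B p * L * K / B).
  assert (HQ : 0 <= Q).
  { unfold Q. apply Rmult_le_pos; [|left; apply Rinv_0_lt_compat; auto]. apply Rmult_le_pos; [|lra]. apply Rmult_le_pos; lra. }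
  set (kp := eps / (4 * (Q + 1))).
  assert (Hkp : 0 < kp) by (apply Rdiv_lt_0_compat; lra).
  (* So close to 1 that the L^1 means of d grow by at most kp between radius s and the boundary, by
     [avg_radial_sub]. *)
  set (s := Rmax 0 (1 - kp / (2 * (1 + D)))).
  assert (Hks : 0 < kp / (2 * (1 + D))) by (apply Rdiv_lt_0_compat; lra).
  assert (Hs : 0 <= s < 1 /\ 2 * (1 - s) * (1 + D) <= kp).
  { split. split. apply Rmax_l. apply Rmax_lub_lt; lra.
    assert (1 - s <= kp / (2 * (1 + D))).
    { pose proof (Rmax_r 0 (1 - kp / (2 * (1 + D)))). fold s in H. lra. }
    apply Rle_trans with (2 * (kp / (2 * (1 + D))) * (1 + D)).
    - apply Rmult_le_compat_r; lra.
    - right; field; lra. }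
  exists kp, s. split; auto. split; [tauto|]. destruct Hs as [Hs Hs2].
  intros d Hd HdB HdD Hdel r Hr. pose proof (hol_deriv_hol1 d Hd) as Hd'.
  set (Z := fun t => vphi (circ r t)).
  pose proof (CC_selfmap vphi r Hv Hr) as CZ. fold Z in CZ.
  assert (HZ : forall t, Cmod (Z t) < 1) by (intros; apply selfmap_circ; auto).
  assert (HM1 : forall r, 0 <= r < 1 -> avg (fun t => Cmod (deriv d (circ r t))) <= 1 + D).
  { intros r' Hr'. eapply Rle_trans. apply (avg_Cmod_le_Mp p); auto. specialize (HdD r' Hr'). lra. }
  assert (Hsmall : forall r, 0 <= r < 1 -> avg (fun t => Cmod (d (circ r t))) <= 2 * kp).
  { assert (Hsm : forall r, 0 <= r <= s -> avg (fun t => Cmod (d (circ r t))) <= kp).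
    { intros r' Hr'. apply avg_le_const. apply CC_Cmod, (CC_hol 1); auto; lra.
      intros t. apply Hdel. rewrite Cmod_circ, Rabs_pos_eq; lra. }
    intros r' Hr'. destruct (Rle_dec r' s). specialize (Hsm r'); lra.
    eapply Rle_trans. apply (avg_radial_sub d (1 + D) s r'); auto; lra.
    specialize (Hsm s ltac:(lra)).
    assert (2 * (r' - s) * (1 + D) <= 2 * (1 - s) * (1 + D)) by (apply Rmult_le_compat_r; lra). lra. }
  pose proof (littlewood vphi d (2 * kp) r Hv Hd Hr Hsmall) as HLw. fold K in HLw.
  change (avg (fun t => Cmod (d (Z t))) <= K * (2 * kp)) in HLw.
  (* The second factor of the integrand, scaled into [0, 1], serves as the density in
     [uniform_integrability]. Its mean is small because p >= 1 gives chi <= |d| / B at Z t and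
     [littlewood] bounds the mean of |d| there. *)
  set (chi := fun t => rpow (Cmod (d (Z t)) / B) p).
  assert (Hq : forall t, 0 <= Cmod (d (Z t)) / B <= 1).
  { intros t. split. apply Rmult_le_pos. apply Cmod_ge_0. left; apply Rinv_0_lt_compat; auto.
    apply Rmult_le_reg_r with B; auto. unfold Rdiv. rewrite Rmult_assoc, Rinv_l, Rmult_1_r, Rmult_1_l by lra. apply HdB; auto. }
  assert (CdZ : Cts (fun t => Cmod (d (Z t)))).
  { apply CC_Cmod. intros t. apply CCt_comp. apply CZ. apply (hol_cont 1); auto. }
  assert (Cchi : Cts chi).
  { apply Cts_rpow. lra. intros t. apply Hq. apply Cts_mult; auto. apply Cts_const. }
  assert (Hchi : forall t, 0 <= chi t <= 1).
  { intros t. split. apply rpow_ge0. apply rpow_le1; auto. lra. }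
  specialize (HL r chi Hr Cchi Hchi).
  assert (Hac : avg chi <= K * (2 * kp) / B).
  { apply Rle_trans with (avg (fun t => Cmod (d (Z t)) * / B)).
    - apply avg_le; auto. apply Cts_mult; auto. apply Cts_const.
      intros t. unfold chi. rewrite <- (rpow_exp1 (Cmod (d (Z t)) * / B)) by apply Hq.
      apply rpow_anti_exp; [apply Hq | lra].
    - rewrite (avg_scal_r (/ B) (fun t => Cmod (d (Z t)))) by auto. apply Rmult_le_compat_r; auto. left; apply Rinv_0_lt_compat; auto. }
  assert (E : avg (fun t => rpow (Cmod (g (circ r t))) p * rpow (Cmod (d (vphi (circ r t)))) p) =
     rpow B p * avg (fun t => chi t * rpow (Cmod (g (circ r t))) p)).
  { rewrite <- avg_scal. apply avg_ext. intros t. fold (Z t). unfold chi.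
    rewrite rpow_div by (auto; apply Cmod_ge_0). field. lra.
    apply Cts_mult; auto. apply (Cts_rpow_hol 1); auto; lra. }
  rewrite E.
  apply Rle_trans with (rpow B p * (L * (K * (2 * kp) / B) + eps / (2 * rpow B p))).
  - apply Rmult_le_compat_l. lra. eapply Rle_trans; [exact HL|]. apply Rplus_le_compat_r. apply Rmult_le_compat_l; auto.
  - replace (rpow B p * (L * (K * (2 * kp) / B) + eps / (2 * rpow B p))) with (2 * (Q * kp) + eps / 2) by (unfold Q; field; lra).
    assert (Q * kp <= eps / 4).
    { unfold kp. apply Rmult_le_reg_r with (4 * (Q + 1)). lra.
      replace (Q * (eps / (4 * (Q + 1))) * (4 * (Q + 1))) with (Q * eps) by (field; lra). nra. }
    lra.
Qed.

(** The vanishing Carleson condition for the pull-back measures, uniform over the circles. By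
    [Cmod_tg_kern] the integrand is |u|^p |f_a'|^p with f_a' evaluated at vphi. *)
Definition vanishing p (u vphi : C -> C) : Prop :=
  forall eps, 0 < eps -> exists eta, 0 <= eta < 1 /\ forall a, eta < Cmod a < 1 -> forall r, 0 <= r < 1 ->
    avg (fun t => rpow (Cmod (u (circ r t))) p * kern (2 * p) a (vphi (circ r t))) <= eps.

(** Since kap <= 2, the kernel tested by the Carleson embedding is dominated by the kernel of the
    test functions. *)
Lemma kern_exp_le p z w : 0 < p -> Cmod z < 1 -> Cmod w <= 1 -> kern (2 + 2 * p) z w <= 4 * kern (2 * p) z w.
Proof.
  intros Hp Hz Hw. pose proof (kap_gt0 z w Hz Hw) as Hk. pose proof (kap_le2 z w Hz Hw) as Hk2.
  pose proof (Cmod_lt1_sqr z Hz). unfold kern. rewrite rpow_plus_exp, rpow_2 by lra.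
  pose proof (rpow_ge0 (kap z w) (2 * p)). unfold Rdiv. rewrite <- !Rmult_assoc.
  apply Rmult_le_compat_r. left; apply Rinv_0_lt_compat; auto. assert (kap z w ^ 2 <= 4) by nra. apply Rmult_le_compat_r; auto.
Qed.

(** Cut according to |vphi|. Near the boundary the weight |u|^p chi has a small Carleson constant,
    since the test is needed only at points with chi > 0, that is |vphi| > eta. On the rest d is
    uniformly small. *)
Lemma composition_small p u vphi M D : 1 <= p -> hol 1 u -> (forall r, 0 <= r < 1 -> Mp p u r <= M) -> selfmap vphi ->
  vanishing p u vphi -> 0 <= D -> forall eps, 0 < eps -> exists del s, 0 < del /\ 0 <= s < 1 /\
  forall d, hol 1 d -> (forall r, 0 <= r < 1 -> Mp p d r <= D) ->
    (forall z, Cmod z <= s -> Cmod (d z) <= del) -> forall r, 0 <= r < 1 ->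
    avg (fun t => rpow (Cmod (u (circ r t))) p * rpow (Cmod (d (vphi (circ r t)))) p) <= eps.
Proof.
  intros Hp Hu HM Hv HV HD eps He.
  assert (M0 : 0 <= M) by (eapply Rle_trans; [apply (Mp_ge0 p u 0) | apply HM]; auto; lra).
  set (Cst := 4 * rpow 6 (2 + 2 * p) ^ 2 * rpow 2 (2 * p)).
  assert (HC : 0 < Cst).
  { unfold Cst. assert (0 < rpow 6 (2 + 2 * p)) by (apply rpow_gt0; lra). assert (0 < rpow 2 (2 * p)) by (apply rpow_gt0; lra).
    apply Rmult_lt_0_compat; auto. nra. }
  set (e2 := eps / (2 * (Cst * 4 * (D + 1)))).
  assert (HCD : 0 < Cst * 4 * (D + 1)) by (apply Rmult_lt_0_compat; lra).
  assert (He2 : 0 < e2) by (apply Rdiv_lt_0_compat; lra).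
  destruct (HV e2 He2) as [eta [Heta HVe]].
  set (s := (1 + eta) / 2). assert (Hs : eta < s < 1) by (unfold s; lra).
  set (del := rpow (eps / (2 * (M + 1))) (/ p)).
  assert (Hq : 0 < eps / (2 * (M + 1))) by (apply Rdiv_lt_0_compat; lra).
  exists del, s. split; [apply rpow_gt0; auto|]. split; [lra|].
  intros d Hd HdD Hdel r Hr.
  set (Z := fun t => vphi (circ r t)).
  pose proof (CC_selfmap vphi r Hv Hr) as CZ. fold Z in CZ.
  assert (HZ : forall t, Cmod (Z t) < 1) by (intros; apply selfmap_circ; auto).
  set (U := fun t => rpow (Cmod (u (circ r t))) p).
  assert (CU : Cts U) by (apply (Cts_rpow_hol 1); auto; lra).
  assert (HU : forall t, 0 <= U t) by (intros; apply rpow_ge0).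
  set (chi := fun t => ramp eta s (Cmod (Z t))).
  assert (Cchi : Cts chi) by (apply Cts_ramp, CC_Cmod; auto).
  assert (Hchi : forall t, 0 <= chi t <= 1) by (intros; apply ramp_range).
  set (Dt := fun t => rpow (Cmod (d (Z t))) p).
  assert (CD : Cts Dt) by (apply (Cts_rpow_comp d Z); auto; lra).
  assert (HDt : forall t, 0 <= Dt t) by (intros; apply rpow_ge0).
  change (avg (fun t => U t * Dt t) <= eps).
  rewrite (avg_ext _ (fun t => (U t * chi t) * Dt t + (U t * (1 - chi t)) * Dt t)) by (intros; ring).
  assert (C1 : Cts (fun t => U t * chi t)) by (apply Cts_mult; auto).
  assert (C2 : Cts (fun t => U t * (1 - chi t))) by (apply Cts_mult; auto; apply Cts_minus; auto using Cts_const).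
  rewrite avg_plus by (apply Cts_mult; auto).
  assert (I1 : avg (fun t => (U t * chi t) * Dt t) <= Cst * (4 * e2) * D).
  { apply (carleson_embedding p (fun t => U t * chi t) Z (4 * e2) d D); auto; try lra.
    - intros t. apply Rmult_le_pos; auto. apply Hchi.
    - intros t Ht.
      assert (HZt : eta < Cmod (Z t)).
      { destruct (Rle_lt_dec (Cmod (Z t)) eta) as [Hl|]; auto. exfalso. unfold chi in Ht.
        rewrite ramp_lo in Ht by lra. lra. }
      assert (CK : forall q, 0 < q -> Cts (fun x => kern q (Z t) (Z x))).
      { intros q Hq0. apply (Cts_kern (fun _ : R => Z t) Z); auto. intros; apply CCt_const. intros; left; auto. }
      apply Rle_trans with (avg (fun x => 4 * (U x * kern (2 * p) (Z t) (Z x)))).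
      + apply avg_le.
        * apply Cts_mult; auto. apply CK; lra.
        * apply Cts_mult. apply Cts_const. apply Cts_mult; auto. apply CK; lra.
        * intros x. pose proof (kern_exp_le p (Z t) (Z x) ltac:(lra) (HZ t) ltac:(left; auto)) as Hk.
          pose proof (kern_ge0 (2 + 2 * p) (Z t) (Z x) (HZ t)). specialize (Hchi x). specialize (HU x).
          apply Rle_trans with (U x * kern (2 + 2 * p) (Z t) (Z x)).
          -- apply Rmult_le_compat_r; auto. nra.
          -- nra.
      + rewrite avg_scal by (apply Cts_mult; auto; apply CK; lra). apply Rmult_le_compat_l. lra.
        apply (HVe (Z t)); auto. }
  assert (I2 : avg (fun t => (U t * (1 - chi t)) * Dt t) <= eps / 2).
  { apply Rle_trans with (avg (fun t => U t * (eps / (2 * (M + 1))))).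
    - apply avg_le. apply Cts_mult; auto. apply Cts_mult; auto. apply Cts_const.
      intros t. rewrite Rmult_assoc. apply Rmult_le_compat_l; auto. specialize (Hchi t).
      destruct (Rle_dec s (Cmod (Z t))) as [Hst|Hst].
      + unfold chi. rewrite ramp_hi by lra. lra.
      + assert (Dt t <= eps / (2 * (M + 1))).
        { unfold Dt. rewrite <- (rpow_inv_r (eps / (2 * (M + 1))) p) by lra. apply rpow_le. lra.
          split. apply Cmod_ge_0. apply Hdel. lra. }
        specialize (HDt t). nra.
    - rewrite avg_scal_r by auto. specialize (HM r Hr). rewrite Mp_avg in HM. fold U in HM.
      apply Rle_trans with ((M + 1) * (eps / (2 * (M + 1)))). apply Rmult_le_compat_r; lra. right; field; lra. }
  assert (I3 : Cst * (4 * e2) * D <= eps / 2).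
  { apply Rle_trans with (Cst * 4 * (D + 1) * e2).
    - replace (Cst * (4 * e2) * D) with (Cst * 4 * D * e2) by ring. apply Rmult_le_compat_r; [lra|]. nra.
    - right. unfold e2. field. lra. }
  lra.
Qed.

Lemma W_diff phi vphi f z : hol 1 phi -> selfmap vphi -> hol 1 f -> Cmod z < 1 ->
  Cdiff (W phi vphi f) z (deriv phi z * f (vphi z) + phi z * deriv vphi z * deriv f (vphi z))%C.
Proof.
  intros Hphi [Hv Hs] Hf Hz.
  pose proof (Cdiff_comp f vphi z _ _ (hol_deriv 1 vphi z Hv Hz) (hol_deriv 1 f (vphi z) Hf (Hs z Hz))) as H1.
  pose proof (Cdiff_mult phi (fun w => f (vphi w)) z _ _ (hol_deriv 1 phi z Hphi Hz) H1) as H2.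
  replace (deriv phi z * f (vphi z) + phi z * deriv vphi z * deriv f (vphi z))%C with
    (deriv phi z * f (vphi z) + phi z * (deriv f (vphi z) * deriv vphi z))%C by ring. exact H2.
Qed.

Lemma W_hol phi vphi f : hol 1 phi -> selfmap vphi -> hol 1 f -> hol 1 (W phi vphi f).
Proof. intros Hp Hv Hf z Hz. eexists. apply W_diff; auto. Qed.

Lemma W_Mp p phi vphi f e1 e2 r : 0 < p -> hol 1 phi -> selfmap vphi -> hol 1 f -> 0 <= r < 1 ->
  avg (fun t => rpow (Cmod (deriv phi (circ r t))) p * rpow (Cmod (f (vphi (circ r t)))) p) <= e1 ->
  avg (fun t => rpow (Cmod (phi (circ r t) * deriv vphi (circ r t))%C) p * rpow (Cmod (deriv f (vphi (circ r t)))) p) <= e2 ->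
  Mp p (deriv (W phi vphi f)) r <= rpow 2 p * (e1 + e2).
Proof.
  intros Hp Hphi Hv Hf Hr H1 H2. rewrite Mp_avg.
  set (Z := fun t => vphi (circ r t)).
  pose proof (CC_selfmap vphi r Hv Hr) as CZ. fold Z in CZ.
  assert (HZ : forall t, Cmod (Z t) < 1) by (intros; apply selfmap_circ; auto).
  assert (C1 : Cts (fun t => rpow (Cmod (deriv phi (circ r t))) p * rpow (Cmod (f (vphi (circ r t)))) p)).
  { apply Cts_mult. apply (Cts_rpow_hol 1); auto. apply hol_deriv_hol1; auto. apply (Cts_rpow_comp f Z); auto. }
  assert (C2 : Cts (fun t => rpow (Cmod (phi (circ r t) * deriv vphi (circ r t))%C) p * rpow (Cmod (deriv f (vphi (circ r t)))) p)).
  { apply Cts_mult.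
    - apply Cts_rpow; auto. intros; apply Cmod_ge_0. apply CC_Cmod. apply CC_mult; apply (CC_hol 1); auto.
      apply hol_deriv_hol1, Hv.
    - apply (Cts_rpow_comp (deriv f) Z); auto. apply hol_deriv_hol1; auto. }
  eapply Rle_trans.
  - apply (avg_le _ (fun t => rpow 2 p * (rpow (Cmod (deriv phi (circ r t))) p * rpow (Cmod (f (vphi (circ r t)))) p
      + rpow (Cmod (phi (circ r t) * deriv vphi (circ r t))%C) p * rpow (Cmod (deriv f (vphi (circ r t)))) p))).
    + apply (Cts_rpow_hol 1); auto. apply hol_deriv_hol1, W_hol; auto.
    + apply Cts_mult. apply Cts_const. apply Cts_plus; auto.
    + intros t. rewrite (Cdiff_deriv _ _ _ (W_diff phi vphi f (circ r t) Hphi Hv Hf ltac:(rewrite Cmod_circ, Rabs_pos_eq; lra))).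
      rewrite <- !rpow_mult, <- !Cmod_mult by apply Cmod_ge_0.
      eapply Rle_trans; [|apply rpow_add_le; try apply Cmod_ge_0; lra].
      apply rpow_le. lra. split. apply Cmod_ge_0. apply Cmod_triangle.
  - rewrite avg_scal by (apply Cts_plus; auto). rewrite avg_plus by auto.
    apply Rmult_le_compat_l. apply rpow_ge0. lra.
Qed.

Lemma Cdiff_sub_deriv f g z : hol 1 f -> hol 1 g -> Cmod z < 1 -> deriv (fun z => f z - g z)%C z = (deriv f z - deriv g z)%C.
Proof. intros Hf Hg Hz. apply Cdiff_deriv. apply Cdiff_minus; apply (hol_deriv 1); auto. Qed.

Lemma hol_minus f g : hol 1 f -> hol 1 g -> hol 1 (fun z => f z - g z)%C.
Proof. intros Hf Hg z Hz. eexists. apply Cdiff_minus; apply (hol_deriv 1); auto. Qed.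

Lemma Mp_sub p f g r M N : 0 < p -> hol 1 f -> hol 1 g -> 0 <= r < 1 -> Mp p (deriv f) r <= M -> Mp p (deriv g) r <= N ->
  Mp p (deriv (fun z => f z - g z)%C) r <= rpow 2 p * (M + N).
Proof.
  intros Hp Hf Hg Hr HM HN. pose proof (hol_deriv_hol1 f Hf). pose proof (hol_deriv_hol1 g Hg).
  assert (C1 : Cts (fun t => rpow (Cmod (deriv f (circ r t))) p)) by (apply (Cts_rpow_hol 1); auto).
  assert (C2 : Cts (fun t => rpow (Cmod (deriv g (circ r t))) p)) by (apply (Cts_rpow_hol 1); auto).
  rewrite Mp_avg. eapply Rle_trans.
  - apply (avg_le _ (fun t => rpow 2 p * (rpow (Cmod (deriv f (circ r t))) p + rpow (Cmod (deriv g (circ r t))) p))).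
    + apply (Cts_rpow_hol 1); auto. apply hol_deriv_hol1, hol_minus; auto.
    + apply Cts_mult. apply Cts_const. apply Cts_plus; auto.
    + intros t. rewrite Cdiff_sub_deriv; auto. 2:{ rewrite Cmod_circ, Rabs_pos_eq; lra. }
      eapply Rle_trans; [|apply rpow_add_le; try apply Cmod_ge_0; lra].
      apply rpow_le. lra. split. apply Cmod_ge_0. unfold Cminus. eapply Rle_trans; [apply Cmod_triangle|]. rewrite Cmod_opp. lra.
  - rewrite avg_scal by (apply Cts_plus; auto). rewrite avg_plus by auto.
    apply Rmult_le_compat_l. apply rpow_ge0. rewrite Mp_avg in HM, HN. lra.
Qed.

(** The bound is not homogeneous, because the L^1 mean is estimated by x <= 1 + x^p; it serves to
    bound balls of S^p uniformly. *)
Lemma Sp_sup p f z : 1 <= p -> in_Sp p f -> Cmod z < 1 -> Cmod (f z) <= Sp_norm p f + 4 * PI * (1 + rpow (Sp_norm p f) p).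
Proof.
  intros Hp Hf Hz. destruct (Sp_norm_Mp p f Hf ltac:(lra)) as [H0 [H1 H2]]. pose proof (in_Sp_hol p f Hf) as Hh.
  pose proof (sup_le_L1_deriv f (1 + rpow (Sp_norm p f) p) z Hh) as H.
  pose proof (Cmod_minus_ge (f z) (f 0%C)).
  assert (Cmod (f z - f 0%C) <= 4 * PI * (1 + rpow (Sp_norm p f) p)); [|lra].
  apply H; auto. intros r Hr. eapply Rle_trans. apply (avg_Cmod_le_Mp p); auto. apply hol_deriv_hol1; auto.
  specialize (H2 r Hr). lra.
Qed.

Lemma Sp_norm_ext p f g : hol 1 f -> (forall z, Cmod z < 1 -> f z = g z) -> Sp_norm p f = Sp_norm p g.
Proof.
  intros Hf E. unfold Sp_norm, Hp_norm. rewrite E by (rewrite Cmod_0; lra). f_equal. f_equal.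
  apply Lub_Rbar_eqset. intros y. split; intros [r [Hr ->]]; exists r; split; auto; f_equal; rewrite !Mp_avg;
  apply avg_ext; intros t; do 2 f_equal;
  [symmetry|]; apply (deriv_ext 1); auto; rewrite Cmod_circ, Rabs_pos_eq; lra.
Qed.

(** Montel gives a limit g, which lies in S^p by [Mp_limit]. The differences [d n] are bounded in
    S^p and in sup norm and tend to 0 locally uniformly with their derivatives, so
    [multiplier_small] and [composition_small] dispose of the two terms of (W (d n))'. *)
Lemma compact_of_vanishing p phi vphi : 1 <= p -> hol 1 phi -> selfmap vphi ->
  bounded_on_Sp p (W phi vphi) -> in_Sp p phi ->
  (exists M, forall r, 0 <= r < 1 -> Mp p (fun z => phi z * deriv vphi z)%C r <= M) ->
  vanishing p (fun z => phi z * deriv vphi z)%C vphi -> compact_on_Sp p (W phi vphi).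
Proof.
  intros Hp Hphi Hv [Hbd _] HphiS [Mu HMu] HV f Hf [B HB].
  assert (p0 : 0 < p) by lra.
  assert (HB0 : 0 <= B). { eapply Rle_trans; [apply (Sp_norm_Mp p (f O)) | apply HB]; auto. }
  assert (Hh : forall n, hol 1 (f n)) by (intros; apply (in_Sp_hol p); auto).
  set (B1 := B + 4 * PI * (1 + rpow B p) + 1).
  pose proof PI_RGT_0 as HPI. pose proof (rpow_ge0 B p) as HBp.
  assert (HBsup : forall n z, Cmod z < 1 -> Cmod (f n z) <= B1).
  { intros n z Hz. eapply Rle_trans. apply (Sp_sup p); auto. unfold B1.
    destruct (Sp_norm_Mp p (f n) (Hf n) p0) as [q0 _]. specialize (HB n).
    assert (rpow (Sp_norm p (f n)) p <= rpow B p) by (apply rpow_le; lra). nra. }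
  assert (HMp : forall n r, 0 <= r < 1 -> Mp p (deriv (f n)) r <= rpow B p).
  { intros n r Hr. destruct (Sp_norm_Mp p (f n) (Hf n) p0) as [q0 [_ q1]]. eapply Rle_trans; [apply q1; auto|].
    apply rpow_le. lra. split; auto. }
  destruct (montel f B1 Hh HBsup) as [s [g [Hs [Hg HL]]]].
  assert (HgM : forall r, 0 <= r < 1 -> Mp p (deriv g) r <= rpow B p).
  { intros r Hr. apply Mp_limit; auto.
    - apply (CC_hol 1); auto. apply hol_deriv_hol1; auto.
    - intros e He. destruct (HL r e Hr He) as [N HN]. exists (fun t => deriv (f (s N)) (circ r t)). split; [|split].
      + apply (CC_hol 1); auto. apply hol_deriv_hol1; auto.
      + intros t. apply (HN N (le_n N)). rewrite Cmod_circ, Rabs_pos_eq; lra.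
      + exact (HMp (s N) r Hr). }
  assert (HgS : in_Sp p g) by (apply in_Sp_iff; split; auto; exists (rpow B p); auto).
  assert (HgB : forall z, Cmod z < 1 -> Cmod (g z) <= B1 + 1).
  { intros z Hz. destruct (HL (Cmod z) 1) as [N HN]; try lra. split; auto. apply Cmod_ge_0.
    destruct (HN N (le_n N) z (Rle_refl _)) as [H _]. specialize (HBsup (s N) z Hz).
    pose proof (Cmod_minus_ge (g z) (f (s N) z)). rewrite Cmod_minus_sym in H. lra. }
  exists s, (W phi vphi g). split; [exact Hs|]. split; [apply Hbd; auto|].
  set (d := fun n z => (f (s n) z - g z)%C).
  assert (Hd : forall n, hol 1 (d n)) by (intros; apply hol_minus; auto).
  assert (HdB : forall n z, Cmod z < 1 -> Cmod (d n z) <= 2 * B1 + 1).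
  { intros n z Hz. unfold d, Cminus. eapply Rle_trans; [apply Cmod_triangle|]. rewrite Cmod_opp.
    specialize (HBsup (s n) z Hz). specialize (HgB z Hz). lra. }
  set (D := rpow 2 p * (rpow B p + rpow B p)).
  assert (HD : 0 <= D) by (apply Rmult_le_pos; [apply rpow_ge0 | lra]).
  assert (HdD : forall n r, 0 <= r < 1 -> Mp p (deriv (d n)) r <= D).
  { intros n r Hr. apply Mp_sub; auto. }
  assert (HB1 : 0 < 2 * B1 + 1) by (unfold B1; nra).
  assert (Hu : hol 1 (fun z => phi z * deriv vphi z)%C).
  { intros z Hz. destruct (hol_deriv_hol1 vphi (proj1 Hv) z Hz) as [l Hl]. eexists. apply Cdiff_mult; [apply (hol_deriv 1); auto | exact Hl]. }
  assert (E : forall n, Sp_norm p (fun z => W phi vphi (f (s n)) z - W phi vphi g z)%C = Sp_norm p (W phi vphi (d n))).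
  { intros n. symmetry. apply Sp_norm_ext. apply W_hol; auto. intros z Hz. unfold W, d. ring. }
  apply (is_lim_seq_ext (fun n => Sp_norm p (W phi vphi (d n)))). { intros; symmetry; apply E. }
  apply is_lim_seq_spec. intros eps. pose proof (cond_pos eps) as He.
  set (e1 := rpow (eps / 4) p / (2 * rpow 2 p)).
  assert (H2p : 0 < rpow 2 p) by (apply rpow_gt0; lra).
  assert (He1 : 0 < e1). { apply Rdiv_lt_0_compat; [apply rpow_gt0|]; lra. }
  destruct (multiplier_small p (deriv phi) vphi (rpow (Sp_norm p phi) p) (2 * B1 + 1) D Hp (hol_deriv_hol1 _ Hphi)
    (proj2 (proj2 (Sp_norm_Mp p phi HphiS p0))) Hv HB1 HD e1 He1) as [del1 [s1 [Hdel1 [Hs1 K1]]]].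
  destruct (composition_small p _ vphi Mu D Hp Hu HMu Hv HV HD e1 He1) as [del2 [s2 [Hdel2 [Hs2 K2]]]].
  assert (Hv0 : Cmod (vphi 0%C) < 1) by (apply Hv; rewrite Cmod_0; lra).
  destruct (HL s1 del1 Hs1 Hdel1) as [N1 HN1]. destruct (HL s2 del2 Hs2 Hdel2) as [N2 HN2].
  pose proof (Cmod_ge_0 (phi 0%C)) as Hp0.
  destruct (HL (Cmod (vphi 0%C)) (eps / (4 * (Cmod (phi 0%C) + 1)))) as [N3 HN3].
  { split; auto. apply Cmod_ge_0. } { apply Rdiv_lt_0_compat; lra. }
  exists (Nat.max N1 (Nat.max N2 N3)). intros n Hn.
  assert (HMW : forall r, 0 <= r < 1 -> Mp p (deriv (W phi vphi (d n))) r <= rpow (eps / 4) p).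
  { intros r Hr. replace (rpow (eps / 4) p) with (rpow 2 p * (e1 + e1)) by (unfold e1; field; lra).
    apply W_Mp; auto.
    - apply K1; auto. intros z Hz. apply (HN1 n ltac:(lia) z Hz).
    - apply (K2 (deriv (d n))); auto. apply hol_deriv_hol1; auto. intros z Hz. unfold d.
      rewrite Cdiff_sub_deriv by (auto; lra). apply (HN2 n ltac:(lia) z Hz). }
  destruct (Sp_norm_ub p (W phi vphi (d n)) (eps / 4) (W_hol _ _ _ Hphi Hv (Hd n)) p0 ltac:(lra) HMW) as [_ [Hn0 Hn1]].
  pose proof (Cmod_ge_0 (W phi vphi (d n) 0%C)).
  assert (HW0 : Cmod (W phi vphi (d n) 0%C) <= eps / 4).
  { unfold W. rewrite Cmod_mult. destruct (HN3 n ltac:(lia) (vphi 0%C) (Rle_refl _)) as [q _].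
    change (Cmod (phi 0%C) * Cmod (f (s n) (vphi 0%C) - g (vphi 0%C)) <= eps / 4).
    apply Rle_trans with ((Cmod (phi 0%C) + 1) * (eps / (4 * (Cmod (phi 0%C) + 1)))).
    - apply Rmult_le_compat; try apply Cmod_ge_0; lra.
    - right; field; lra. }
  rewrite Rminus_0_r, Rabs_pos_eq; lra.
Qed.

(** * Test functions *)

(** Since (2 - 1/p) p = 2p - 1, this constant makes |tg|^p equal to the kernel with s = 2p. The
    factor z in [ta] makes its derivative a pure square and its value at 0 zero, so the S^p norm
    sees the derivative only. *)
Definition cst p (a : C) : R := rpow (1 - Cmod a ^ 2) (2 - / p).
Definition ta p (a z : C) : C := (RtoC (cst p a) * (z * / (1 - Cconj a * z)))%C.
Definition tg p (a z : C) : C := (RtoC (cst p a) * / ((1 - Cconj a * z) * (1 - Cconj a * z)))%C.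

Lemma cst_ge0 p a : 0 <= cst p a.
Proof. apply rpow_ge0. Qed.

Lemma cst_le p a : 1 <= p -> Cmod a < 1 -> cst p a <= 1 - Cmod a ^ 2.
Proof.
  intros Hp Ha. pose proof (Cmod_lt1_sqr a Ha) as H. pose proof (pow2_ge_0 (Cmod a)).
  unfold cst. rewrite <- (rpow_exp1 (1 - Cmod a ^ 2)) at 2 by lra. apply rpow_anti_exp; [lra|].
  assert (/ p <= 1). { rewrite <- Rinv_1. apply Rinv_le_contravar; lra. } lra.
Qed.

Lemma ta_diff p a z : Cmod a < 1 -> Cmod z < 1 -> Cdiff (ta p a) z (tg p a z).
Proof.
  intros Ha Hz. pose proof (kap_den_neq a z Ha ltac:(lra)) as Hn.
  unfold tg. replace (/ ((1 - Cconj a * z) * (1 - Cconj a * z)))%C with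
    (1 * / (1 - Cconj a * z) + z * (- / ((1 - Cconj a * z) * (1 - Cconj a * z)) * (0 - Cconj a * 1)))%C by (field; auto).
  apply (Cdiff_scal (RtoC (cst p a)) (fun z => z * / (1 - Cconj a * z))%C).
  apply (Cdiff_mult (fun z => z) (fun z => / (1 - Cconj a * z))%C). apply Cdiff_id.
  apply (Cdiff_inv_comp (fun z => 1 - Cconj a * z)%C); auto.
  apply Cdiff_minus. apply Cdiff_const. apply Cdiff_scal, Cdiff_id.
Qed.

Lemma ta_hol p a : Cmod a < 1 -> hol 1 (ta p a).
Proof. intros Ha z Hz. eexists. apply ta_diff; auto. Qed.

Lemma ta_deriv p a z : Cmod a < 1 -> Cmod z < 1 -> deriv (ta p a) z = tg p a z.
Proof. intros. apply Cdiff_deriv, ta_diff; auto. Qed.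

Lemma Cmod_ta_le p a z m : Cmod a < 1 -> Cmod z <= 1 -> 0 < m <= Cmod (1 - Cconj a * z) -> Cmod (ta p a z) <= cst p a / m.
Proof.
  intros Ha Hz Hm. pose proof (kap_den_neq a z Ha Hz) as Hn. pose proof (cst_ge0 p a).
  unfold ta. rewrite !Cmod_mult, Cmod_inv, Cmod_R, Rabs_pos_eq by auto. apply Rmult_le_compat_l; auto.
  assert (/ Cmod (1 - Cconj a * z) <= / m) by (apply Rinv_le_contravar; lra).
  assert (0 < / Cmod (1 - Cconj a * z)) by (apply Rinv_0_lt_compat; lra). pose proof (Cmod_ge_0 z). nra.
Qed.

Lemma Cmod_tg_le p a z m : Cmod a < 1 -> Cmod z <= 1 -> 0 < m <= Cmod (1 - Cconj a * z) -> Cmod (tg p a z) <= cst p a / m ^ 2.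
Proof.
  intros Ha Hz Hm. pose proof (kap_den_neq a z Ha Hz) as Hn. pose proof (cst_ge0 p a).
  unfold tg. rewrite Cmod_mult, Cmod_inv, Cmod_mult, Cmod_R, Rabs_pos_eq by (auto; apply Cmult_neq_0; auto).
  apply Rmult_le_compat_l; auto. apply Rinv_le_contravar. apply pow_lt; lra.
  simpl. rewrite Rmult_1_r. apply Rmult_le_compat; lra.
Qed.

Lemma Cmod_ta_le2 p a z : 1 <= p -> Cmod a < 1 -> Cmod z < 1 -> Cmod (ta p a z) <= 2.
Proof.
  intros Hp Ha Hz. pose proof (Cmod_ge_0 a).
  eapply Rle_trans. apply (Cmod_ta_le p a z (1 - Cmod a)); auto; [lra|]. split; [lra|]. apply one_minus_le; lra.
  pose proof (cst_le p a Hp Ha). apply Rmult_le_reg_r with (1 - Cmod a). lra.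
  unfold Rdiv. rewrite Rmult_assoc, Rinv_l by lra. nra.
Qed.

Lemma Cmod_tg_kern p a z : 1 <= p -> Cmod a < 1 -> Cmod z <= 1 -> rpow (Cmod (tg p a z)) p = kern (2 * p) a z.
Proof.
  intros Hp Ha Hz. pose proof (kap_den_neq a z Ha Hz) as Hn. pose proof (kap_den a z Ha Hz) as Hd.
  pose proof (Cmod_lt1_sqr a Ha) as Hu.
  unfold tg, kern, kap. rewrite Cmod_mult, Cmod_inv, Cmod_mult, Cmod_R, Rabs_pos_eq by (auto using cst_ge0; apply Cmult_neq_0; auto).
  rewrite rpow_div by lra. unfold cst. set (v := 1 - Cmod a ^ 2) in *. set (D := Cmod (1 - Cconj a * z)) in *.
  assert (Hv : 0 < rpow v (2 * p)) by (apply rpow_gt0; auto).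
  rewrite rpow_mult by (try apply rpow_ge0; left; apply Rinv_0_lt_compat; nra).
  rewrite rpow_rpow by lra.
  replace ((2 - / p) * p) with (2 * p - 1) by (field; lra).
  assert (E1 : rpow v (2 * p - 1) * v = rpow v (2 * p)).
  { rewrite <- (rpow_exp1 v) at 2 by lra. rewrite <- rpow_plus_exp by lra. f_equal; ring. }
  assert (E2 : rpow (/ (D * D)) p * rpow D (2 * p) = 1).
  { rewrite <- (rpow_rpow D 2 p), rpow_2 by lra. rewrite <- rpow_mult.
    - replace (/ (D * D) * D ^ 2) with 1 by (field; lra). apply rpow_1.
    - left; apply Rinv_0_lt_compat; nra.
    - apply pow2_ge_0. }
  assert (HD : 0 < rpow D (2 * p)) by (apply rpow_gt0; auto).
  rewrite <- E1. replace (rpow (/ (D * D)) p) with (/ rpow D (2 * p)).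
  - field. lra.
  - apply Rmult_eq_reg_r with (rpow D (2 * p)); [|lra]. rewrite E2. field. lra.
Qed.

(** Replacing the numerator 1 - |a|^2 by the larger 1 - |a z|^2 gives a positive harmonic function
    of z, whose means along vphi are its value at vphi 0. *)
Lemma kern2_cayley a z : Cmod a < 1 -> Cmod z < 1 ->
  kern 2 a z <= fst ((1 + Cconj a * z) * / (1 - Cconj a * z))%C.
Proof.
  intros Ha Hz. pose proof (kap_den_neq a z Ha ltac:(lra)) as Hn. pose proof (kap_den a z Ha ltac:(lra)) as Hd.
  pose proof (Cmod_lt1_sqr a Ha) as Hu.
  rewrite fst_cayley by auto. unfold kern. rewrite rpow_2 by (left; apply kap_gt0; lra). unfold kap.
  replace (((1 - Cmod a ^ 2) / Cmod (1 - Cconj a * z)) ^ 2 / (1 - Cmod a ^ 2)) with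
    ((1 - Cmod a ^ 2) / Cmod (1 - Cconj a * z) ^ 2) by (field; lra).
  apply Rmult_le_compat_r. left; apply Rinv_0_lt_compat, pow_lt; auto.
  rewrite Cmod_mult, Cmod_conj, Rpow_mult_distr. pose proof (Cmod_lt1_sqr z Hz).
  pose proof (pow2_ge_0 (Cmod a)). pose proof (pow2_ge_0 (Cmod z)). nra.
Qed.

Lemma Cts_kern_comp s a (Z : R -> C) : 0 < s -> Cmod a < 1 -> CC Z -> (forall t, Cmod (Z t) < 1) -> Cts (fun t => kern s a (Z t)).
Proof.
  intros Hs Ha CZ HZ. apply (Cts_kern (fun _ : R => a) Z); auto. intros; apply CCt_const. intros; left; auto.
Qed.

Lemma avg_kern2 vphi a r : selfmap vphi -> Cmod a < 1 -> 0 <= r < 1 ->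
  avg (fun t => kern 2 a (vphi (circ r t))) <= 2 / (1 - Cmod (vphi 0%C)).
Proof.
  intros Hv Ha Hr. pose proof Hv as [Hv1 Hv2].
  pose proof (CC_selfmap vphi r Hv Hr) as CZ.
  assert (HZ : forall t, Cmod (vphi (circ r t)) < 1) by (intros; apply selfmap_circ; auto).
  assert (Hh : hol 1 (fun z => (1 + Cconj a * vphi z) * / (1 - Cconj a * vphi z))%C).
  { intros z Hz. destruct (Hv1 z Hz) as [l Hl].
    destruct (cayley_hol (Cconj a) 1) with (z := vphi z) as [m Hm].
    - rewrite Cmod_conj; lra.
    - apply Hv2; auto.
    - eexists. apply (Cdiff_comp _ vphi z _ _ Hl Hm). }
  pose proof (mean_value _ 1 r Hh Hr) as HM. apply (f_equal fst) in HM. simpl fst in HM at 1.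
  assert (H0 : Cmod (vphi 0%C) < 1) by (apply Hv2; rewrite Cmod_0; lra).
  apply Rle_trans with (fst ((1 + Cconj a * vphi 0%C) * / (1 - Cconj a * vphi 0%C))%C).
  - rewrite <- HM. apply avg_le.
    + apply Cts_kern_comp; auto; lra.
    + apply (CC_fst (fun t => (1 + Cconj a * vphi (circ r t)) * / (1 - Cconj a * vphi (circ r t)))%C).
      apply (CC_hol 1 (fun z => (1 + Cconj a * vphi z) * / (1 - Cconj a * vphi z))%C); auto.
    + intros t. apply kern2_cayley; auto.
  - pose proof (kap_den_neq a _ Ha ltac:(left; exact H0)) as Hn.
    eapply Rle_trans; [apply fst_le_Cmod|]. rewrite Cmod_mult, Cmod_inv by auto.
    pose proof (Cmod_ge_0 (vphi 0%C)). pose proof (Cmod_ge_0 a).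
    apply Rmult_le_compat.
    + apply Cmod_ge_0.
    + left; apply Rinv_0_lt_compat, Cmod_gt_0; auto.
    + eapply Rle_trans; [apply Cmod_triangle|]. rewrite Cmod_1, Cmod_mult, Cmod_conj. nra.
    + apply Rinv_le_contravar. lra. pose proof (Cmod_minus_ge 1%C (Cconj a * vphi 0%C)%C) as HG.
      rewrite Cmod_1, Cmod_mult, Cmod_conj in HG. nra.
Qed.

Lemma kern_2p_le p z w : 1 <= p -> Cmod z < 1 -> Cmod w <= 1 -> kern (2 * p) z w <= rpow 2 (2 * p - 2) * kern 2 z w.
Proof.
  intros Hp Hz Hw. pose proof (kap_gt0 z w Hz Hw) as Hk. pose proof (kap_le2 z w Hz Hw) as Hk2.
  pose proof (Cmod_lt1_sqr z Hz). unfold kern. replace (2 * p) with ((2 * p - 2) + 2) at 1 by ring.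
  rewrite rpow_plus_exp by lra. unfold Rdiv. rewrite <- Rmult_assoc.
  apply Rmult_le_compat_r. left; apply Rinv_0_lt_compat; auto.
  apply Rmult_le_compat_r. apply rpow_ge0. apply rpow_le; lra.
Qed.

Lemma selfmap_id : selfmap (fun z => z).
Proof. split; auto. intros z _. eexists. apply Cdiff_id. Qed.

Lemma tg_Mp p a r : 1 <= p -> Cmod a < 1 -> 0 <= r < 1 -> Mp p (tg p a) r <= rpow 2 (2 * p).
Proof.
  intros Hp Ha Hr. rewrite Mp_avg.
  assert (Hc : forall t, Cmod (circ r t) < 1) by (intros; rewrite Cmod_circ, Rabs_pos_eq; lra).
  rewrite (avg_ext _ (fun t => kern (2 * p) a (circ r t))) by (intros; apply Cmod_tg_kern; auto; left; auto).
  assert (C2 : Cts (fun t => kern 2 a (circ r t))) by (apply Cts_kern_comp; auto; [lra | apply CC_circ]).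
  apply Rle_trans with (avg (fun t => rpow 2 (2 * p - 2) * kern 2 a (circ r t))).
  - apply avg_le. apply Cts_kern_comp; auto; [lra | apply CC_circ]. apply Cts_mult; auto. apply Cts_const.
    intros t. apply kern_2p_le; auto. left; auto.
  - rewrite avg_scal by auto. pose proof (avg_kern2 (fun z => z) a r selfmap_id Ha Hr) as H.
    cbv beta in H. rewrite Cmod_0 in H. replace (2 / (1 - 0)) with 2 in H by field.
    replace (2 * p) with ((2 * p - 2) + 1 + 1) at 2 by ring. rewrite !rpow_plus_exp, !rpow_exp1 by lra.
    pose proof (rpow_ge0 2 (2 * p - 2)). nra.
Qed.

Lemma ta_Mp p a r : 1 <= p -> Cmod a < 1 -> 0 <= r < 1 -> Mp p (deriv (ta p a)) r <= rpow 2 (2 * p).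
Proof.
  intros Hp Ha Hr. eapply Rle_trans; [|apply (tg_Mp p a r); auto]. right. rewrite !Mp_avg. apply avg_ext. intros t.
  rewrite ta_deriv; auto. rewrite Cmod_circ, Rabs_pos_eq; lra.
Qed.

Lemma ta_0 p a : ta p a 0%C = 0%C.
Proof. unfold ta. ring. Qed.

Lemma ta_Sp p a : 1 <= p -> Cmod a < 1 -> in_Sp p (ta p a).
Proof.
  intros Hp Ha. apply in_Sp_iff. split. apply ta_hol; auto. exists (rpow 2 (2 * p)). intros; apply ta_Mp; auto.
Qed.

(** * Cut-offs at a boundary point *)

Definition near (zeta : C) (del : R) (z : C) : R := 1 - ramp del (2 * del) (Cmod (z - zeta)).

Lemma near_range zeta del z : 0 <= near zeta del z <= 1.
Proof. unfold near. pose proof (ramp_range del (2 * del) (Cmod (z - zeta))). lra. Qed.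

Lemma ramp_scale del x : 0 < del -> ramp del (2 * del) x = Rmax 0 (Rmin 1 (x / del - 1)).
Proof. intros H. unfold ramp. do 2 f_equal. field. lra. Qed.

Lemma near_mono zeta d1 d2 z : 0 < d1 <= d2 -> near zeta d1 z <= near zeta d2 z.
Proof.
  intros H. unfold near. rewrite !ramp_scale by lra. set (x := Cmod (z - zeta)).
  assert (Hx : 0 <= x) by apply Cmod_ge_0.
  assert (x / d2 <= x / d1) by (apply Rmult_le_compat_l; auto; apply Rinv_le_contravar; lra).
  assert (Rmin 1 (x / d2 - 1) <= Rmin 1 (x / d1 - 1)).
  { apply Rmin_glb. apply Rmin_l. eapply Rle_trans; [apply Rmin_r|]. lra. }
  assert (Rmax 0 (Rmin 1 (x / d2 - 1)) <= Rmax 0 (Rmin 1 (x / d1 - 1))).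
  { apply Rmax_lub. apply Rmax_l. eapply Rle_trans; [eassumption | apply Rmax_r]. }
  lra.
Qed.

Lemma Cts_near zeta del (Z : R -> C) : CC Z -> Cts (fun t => near zeta del (Z t)).
Proof.
  intros CZ. apply Cts_minus. apply Cts_const. apply Cts_ramp. apply (CC_Cmod (fun t => Z t - zeta)%C).
  apply CC_minus; auto. apply CC_const.
Qed.

Lemma unit_dual zeta z : Cmod zeta = 1 -> Cmod (1 - Cconj zeta * z) = Cmod (z - zeta).
Proof.
  intros H. destruct (circle_arg _ H) as [b ->]. rewrite <- (Cmod_minus_sym (circ 1 b)).
  assert (E : (circ 1 b - z = circ 1 b * (1 - Cconj (circ 1 b) * z))%C).
  { replace (circ 1 b * (1 - Cconj (circ 1 b) * z))%C with (circ 1 b - (circ 1 b * Cconj (circ 1 b)) * z)%C by ring.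
    rewrite conj_circ1. ring. }
  rewrite E, Cmod_mult, Cmod_circ1. ring.
Qed.

(** The cut-off is dominated by 9 del times the kernel with s = 2 at a = (1 - del) zeta: where it
    does not vanish, |1 - conj a z| <= 3 del while 1 - |a|^2 >= del. *)
Lemma near_small zeta vphi del r : Cmod zeta = 1 -> selfmap vphi -> 0 < del < 1 -> 0 <= r < 1 ->
  avg (fun t => near zeta del (vphi (circ r t))) <= 9 * del * (2 / (1 - Cmod (vphi 0%C))).
Proof.
  intros Hz Hv Hd Hr. set (Z := fun t => vphi (circ r t)).
  pose proof (CC_selfmap vphi r Hv Hr) as CZ. fold Z in CZ.
  assert (HZ : forall t, Cmod (Z t) < 1) by (intros; apply selfmap_circ; auto).
  set (a := (RtoC (1 - del) * zeta)%C).
  assert (Ha : Cmod a = 1 - del) by (unfold a; rewrite Cmod_mult, Cmod_R, Hz, Rabs_pos_eq; lra).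
  assert (Ha1 : Cmod a < 1) by lra.
  assert (CK : Cts (fun t => kern 2 a (Z t))) by (apply Cts_kern_comp; auto; lra).
  apply Rle_trans with (avg (fun t => 9 * del * kern 2 a (Z t))).
  - apply avg_le. apply Cts_near; auto. apply Cts_mult; auto. apply Cts_const.
    intros t. fold (Z t). pose proof (kern_ge0 2 a (Z t) Ha1) as Hk0.
    destruct (Rle_dec (2 * del) (Cmod (Z t - zeta))) as [Hf|Hf].
    + unfold near. rewrite ramp_hi by lra. nra.
    + apply Rle_trans with 1; [apply near_range|].
      pose proof (kap_den a (Z t) Ha1 ltac:(left; auto)) as HD.
      assert (HD3 : Cmod (1 - Cconj a * Z t) <= 3 * del).
      { assert (E : (1 - Cconj a * Z t = (1 - Cconj zeta * Z t) + RtoC del * (Cconj zeta * Z t))%C).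
        { unfold a. rewrite Cmult_conj. replace (Cconj (RtoC (1 - del))) with (RtoC (1 - del)) by (apply C_eq; simpl; ring).
          rewrite RtoC_minus. ring. }
        rewrite E. eapply Rle_trans; [apply Cmod_triangle|]. rewrite unit_dual by auto.
        rewrite !Cmod_mult, Cmod_R, Cmod_conj, Hz, Rabs_pos_eq by lra. specialize (HZ t). pose proof (Cmod_ge_0 (Z t)). nra. }
      unfold kern. rewrite rpow_2 by (left; apply kap_gt0; auto; left; auto). unfold kap.
      pose proof (Cmod_lt1_sqr a Ha1) as Hu. set (D := Cmod (1 - Cconj a * Z t)) in *.
      replace (((1 - Cmod a ^ 2) / D) ^ 2 / (1 - Cmod a ^ 2)) with ((1 - Cmod a ^ 2) / D ^ 2) by (field; lra).
      assert (del <= 1 - Cmod a ^ 2) by (rewrite Ha; nra).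
      apply Rmult_le_reg_r with (D ^ 2). apply pow_lt; auto.
      replace (9 * del * ((1 - Cmod a ^ 2) / D ^ 2) * D ^ 2) with (9 * del * (1 - Cmod a ^ 2)) by (field; lra).
      assert (D ^ 2 <= (3 * del) ^ 2) by (apply pow_incr; lra). nra.
  - rewrite avg_scal by auto. apply Rmult_le_compat_l. lra. apply avg_kern2; auto.
Qed.

(** For a fixed h, [near_small] makes the set small and uniform integrability makes its mass small,
    on all circles at once. *)
Lemma near_hump_small p zeta vphi h M : 0 < p -> Cmod zeta = 1 -> selfmap vphi -> hol 1 h ->
  (forall r, 0 <= r < 1 -> Mp p h r <= M) -> forall eps, 0 < eps -> exists d0, 0 < d0 /\ forall del, 0 < del <= d0 ->
  forall r, 0 <= r < 1 -> avg (fun t => near zeta del (vphi (circ r t)) * rpow (Cmod (h (circ r t))) p) <= eps.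
Proof.
  intros Hp Hz Hv Hh HM eps He.
  destruct (uniform_integrability h p M Hh Hp HM (eps / 2)) as [L [HL0 HL]]; [lra|].
  assert (Hv0 : Cmod (vphi 0%C) < 1) by (apply Hv; rewrite Cmod_0; lra).
  set (K := 9 * (2 / (1 - Cmod (vphi 0%C)))).
  assert (HK : 0 < K) by (apply Rmult_lt_0_compat; [lra | apply Rdiv_lt_0_compat; lra]).
  assert (HLK : 0 < 2 * (L * K + 1)) by (pose proof (Rmult_le_pos L K HL0 ltac:(lra)); lra).
  exists (Rmin (/ 2) (eps / (2 * (L * K + 1)))). split.
  { apply Rmin_pos. lra. apply Rdiv_lt_0_compat; lra. }
  intros del Hdel r Hr. pose proof (Rmin_l (/ 2) (eps / (2 * (L * K + 1)))). pose proof (Rmin_r (/ 2) (eps / (2 * (L * K + 1)))).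
  set (chi := fun t => near zeta del (vphi (circ r t))).
  assert (Cchi : Cts chi) by (apply (Cts_near zeta del (fun t => vphi (circ r t))); apply CC_selfmap; auto).
  eapply Rle_trans. apply (HL r chi Hr Cchi). intros t; apply near_range.
  pose proof (near_small zeta vphi del r Hz Hv ltac:(lra) Hr) as HN. fold chi in HN.
  assert (L * avg chi <= L * (K * del)) by (apply Rmult_le_compat_l; auto; unfold K; lra).
  assert (L * (K * del) <= eps / 2).
  { apply Rle_trans with ((L * K + 1) * (eps / (2 * (L * K + 1)))).
    - rewrite <- Rmult_assoc. apply Rmult_le_compat; try lra. apply Rmult_le_pos; lra.
    - right; field; lra. }
  lra.
Qed.

(** Where |vphi - zeta| > del and |a - zeta| <= del/2, the denominator |1 - conj a vphi| is at least
    del/2, so f_a and f_a' at vphi are bounded by multiples of [cst p a]. *)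
Lemma off_hump_small p zeta phi vphi M : 1 <= p -> Cmod zeta = 1 -> hol 1 phi -> selfmap vphi ->
  (forall r, 0 <= r < 1 -> Mp p (deriv phi) r <= M) ->
  (forall r, 0 <= r < 1 -> Mp p (fun z => phi z * deriv vphi z)%C r <= M) ->
  forall del eps, 0 < del < 1 -> 0 < eps -> exists c0, 0 < c0 /\ forall a, Cmod a < 1 -> Cmod (a - zeta) <= del / 2 -> cst p a <= c0 ->
  forall r, 0 <= r < 1 -> avg (fun t => (1 - near zeta del (vphi (circ r t))) * rpow (Cmod (deriv (W phi vphi (ta p a)) (circ r t))) p) <= eps.
Proof.
  intros Hp Hz Hphi Hv HM1 HM2 del eps Hdel He. assert (p0 : 0 < p) by lra.
  assert (Hu : hol 1 (fun z => phi z * deriv vphi z)%C).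
  { intros z Hzz. destruct (hol_deriv_hol1 vphi (proj1 Hv) z Hzz) as [l Hl]. eexists. apply Cdiff_mult; [apply (hol_deriv 1); auto | exact Hl]. }
  assert (M0 : 0 <= M) by (eapply Rle_trans; [apply (Mp_ge0 p (deriv phi) 0) | apply HM1]; try apply hol_deriv_hol1; auto; lra).
  assert (H2p : 0 < rpow 2 p) by (apply rpow_gt0; lra).
  set (e := eps / (2 * rpow 2 p * (M + 1))).
  assert (Hden : 0 < 2 * rpow 2 p * (M + 1)) by (apply Rmult_lt_0_compat; lra).
  assert (He' : 0 < e) by (apply Rdiv_lt_0_compat; auto).
  set (m := del / 2). assert (Hm : 0 < m < 1) by (unfold m; lra).
  exists (rpow e (/ p) * m ^ 2). split.
  { apply Rmult_lt_0_compat. apply rpow_gt0; auto. apply pow_lt; lra. }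
  intros a Ha Haz Hca r Hr.
  set (Z := fun t => vphi (circ r t)).
  pose proof (CC_selfmap vphi r Hv Hr) as CZ. fold Z in CZ.
  assert (HZ : forall t, Cmod (Z t) < 1) by (intros; apply selfmap_circ; auto).
  pose proof (ta_hol p a Ha) as Hta.
  assert (Cch : Cts (fun t => 1 - near zeta del (Z t))) by (apply Cts_minus; [apply Cts_const | apply Cts_near; auto]).
  assert (C1 : Cts (fun t => rpow (Cmod (deriv phi (circ r t))) p)) by (apply (Cts_rpow_hol 1); auto; apply hol_deriv_hol1; auto).
  assert (C2 : Cts (fun t => rpow (Cmod (phi (circ r t) * deriv vphi (circ r t))%C) p)).
  { apply (Cts_rpow_hol 1 (fun z => phi z * deriv vphi z)%C); auto. }
  apply Rle_trans with (avg (fun t => rpow 2 p * e * (rpow (Cmod (deriv phi (circ r t))) p + rpow (Cmod (phi (circ r t) * deriv vphi (circ r t))%C) p))).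
  - apply avg_le.
    + apply Cts_mult; auto. apply (Cts_rpow_hol 1); auto. apply hol_deriv_hol1, W_hol; auto.
    + apply Cts_mult. apply Cts_const. apply Cts_plus; auto.
    + intros t. fold (Z t).
      assert (P1 := rpow_ge0 (Cmod (deriv phi (circ r t))) p).
      assert (P2 := rpow_ge0 (Cmod (phi (circ r t) * deriv vphi (circ r t))%C) p).
      destruct (Rle_dec (Cmod (Z t - zeta)) del) as [Hn|Hn].
      { unfold near. rewrite ramp_lo by lra. replace (1 - (1 - 0)) with 0 by ring. rewrite Rmult_0_l.
        apply Rmult_le_pos; [|lra]. apply Rmult_le_pos; lra. }
      assert (Hcirc : Cmod (circ r t) < 1) by (rewrite Cmod_circ, Rabs_pos_eq; lra).
      assert (HD : m <= Cmod (1 - Cconj a * Z t)).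
      { assert (E : (1 - Cconj a * Z t = (1 - Cconj zeta * Z t) - Cconj (a - zeta) * Z t)%C) by (rewrite Cminus_conj; ring).
        pose proof (Cmod_minus_ge (1 - Cconj zeta * Z t)%C (Cconj (a - zeta) * Z t)%C) as HG. rewrite <- E in HG.
        rewrite unit_dual, Cmod_mult, Cmod_conj in HG by auto.
        specialize (HZ t). pose proof (Cmod_ge_0 (a - zeta)).
        assert (Cmod (a - zeta) * Cmod (Z t) <= Cmod (a - zeta)) by (rewrite <- (Rmult_1_r (Cmod (a - zeta))) at 2; apply Rmult_le_compat_l; lra). unfold m in *. lra. }
      assert (Q1 : Cmod (ta p a (Z t)) <= rpow e (/ p)).
      { eapply Rle_trans. apply (Cmod_ta_le p a (Z t) m); auto. left; auto. split; [lra | exact HD].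
        apply Rmult_le_reg_r with m. lra. unfold Rdiv. rewrite Rmult_assoc, Rinv_l, Rmult_1_r by lra.
        eapply Rle_trans; [exact Hca|]. assert (0 < rpow e (/ p)) by (apply rpow_gt0; auto). apply Rmult_le_compat_l; [lra|]. nra. }
      assert (Q2 : Cmod (tg p a (Z t)) <= rpow e (/ p)).
      { eapply Rle_trans. apply (Cmod_tg_le p a (Z t) m); auto. left; auto. split; [lra | exact HD].
        apply Rmult_le_reg_r with (m ^ 2). apply pow_lt; lra. unfold Rdiv. rewrite Rmult_assoc, Rinv_l, Rmult_1_r; auto.
        apply pow_nonzero; lra. }
      assert (QE : rpow (rpow e (/ p)) p = e) by (apply rpow_inv_r; lra).
      rewrite (Cdiff_deriv _ _ _ (W_diff phi vphi (ta p a) (circ r t) Hphi Hv Hta Hcirc)). fold (Z t).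
      rewrite ta_deriv by auto.
      apply Rle_trans with (rpow (Cmod (deriv phi (circ r t) * ta p a (Z t)) + Cmod (phi (circ r t) * deriv vphi (circ r t) * tg p a (Z t))%C) p).
      * rewrite <- (Rmult_1_l (rpow (Cmod (deriv phi (circ r t) * ta p a (Z t)) + _) p)).
        apply Rmult_le_compat; try lra.
        -- pose proof (near_range zeta del (Z t)). lra.
        -- apply rpow_ge0.
        -- pose proof (near_range zeta del (Z t)). lra.
        -- apply rpow_le. lra. split. apply Cmod_ge_0. apply Cmod_triangle.
      * eapply Rle_trans. apply rpow_add_le; try apply Cmod_ge_0; lra.
        rewrite Rmult_assoc. apply Rmult_le_compat_l. lra.
        rewrite (Cmod_mult (deriv phi (circ r t))), (Cmod_mult (phi (circ r t) * deriv vphi (circ r t))%C).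
        rewrite !(rpow_mult _ _ p) by apply Cmod_ge_0.
        assert (rpow (Cmod (ta p a (Z t))) p <= e) by (rewrite <- QE; apply rpow_le; [lra | split; [apply Cmod_ge_0 | auto]]).
        assert (rpow (Cmod (tg p a (Z t))) p <= e) by (rewrite <- QE; apply rpow_le; [lra | split; [apply Cmod_ge_0 | auto]]).
        nra.
  - rewrite avg_scal by (apply Cts_plus; auto). rewrite avg_plus by auto.
    specialize (HM1 r Hr). specialize (HM2 r Hr). rewrite Mp_avg in HM1, HM2.
    apply Rle_trans with (rpow 2 p * e * (2 * (M + 1))).
    + apply Rmult_le_compat_l. apply Rmult_le_pos; lra. lra.
    + right. unfold e. field. lra.
Qed.

(** * Gliding humps *)

Lemma Cts_Rsumb (F : nat -> R -> R) n : (forall k, Cts (F k)) -> Cts (fun t => Rsumb (fun k => F k t) n).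
Proof. intros H. induction n; simpl. apply Cts_const. apply Cts_plus; auto. Qed.

Lemma Cts_rpow_Cmod p (Z : R -> C) : 1 <= p -> CC Z -> Cts (fun t => rpow (Cmod (Z t)) p).
Proof. intros Hp H. apply (Cts_rpow (fun t : R => Cmod (Z t))). lra. intros; apply Cmod_ge_0. apply CC_Cmod; auto. Qed.

Lemma avg_Rsumb (F : nat -> R -> R) n : (forall k, Cts (F k)) ->
  avg (fun t => Rsumb (fun k => F k t) n) = Rsumb (fun k => avg (F k)) n.
Proof.
  intros H. induction n; simpl. apply avg_const. rewrite avg_plus, IHn; auto. apply Cts_Rsumb; auto.
Qed.

Lemma CC_Csumb (F : nat -> R -> C) n : (forall k, CC (F k)) -> CC (fun t => Csumb (fun k => F k t) n).
Proof. intros H. induction n; simpl. apply CC_const. apply CC_plus; auto. Qed.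

Lemma Rsumb_telescope (X : nat -> R) n : Rsumb (fun k => X k - X (S k)) n = X O - X n.
Proof. induction n; simpl. ring. rewrite IHn. ring. Qed.

Lemma rpow_2_ge2 p : 1 <= p -> 2 <= rpow 2 p.
Proof. intros H. rewrite <- (rpow_exp1 2) at 1 by lra. apply rpow_mono_exp; lra. Qed.

(** Peeling off the first term repeatedly costs one more factor 2^p for each later term. *)
Lemma rpow_Csumb_le p (z : nat -> C) n : 1 <= p ->
  rpow (Cmod (Csumb z n)) p <= Rsumb (fun k => rpow 2 p ^ S k * rpow (Cmod (z k)) p) n.
Proof.
  intros Hp. pose proof (rpow_2_ge2 p Hp) as H2. revert z. induction n; intros z.
  - simpl. rewrite Cmod_0, rpow_0. lra.
  - rewrite Csumb_shift. eapply Rle_trans.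
    { apply rpow_le. lra. split. apply Cmod_ge_0. apply Cmod_triangle. }
    eapply Rle_trans. { apply rpow_add_le; try apply Cmod_ge_0. lra. }
    assert (E : forall b m, Rsumb b (S m) = b O + Rsumb (fun k => b (S k)) m).
    { intros b m. induction m; simpl in *; lra. }
    rewrite E, pow_1, Rmult_plus_distr_l. apply Rplus_le_compat_l.
    eapply Rle_trans. { apply Rmult_le_compat_l. lra. apply IHn. }
    rewrite <- Rsumb_scal. right. apply Rsumb_ext. intros k _. simpl. ring.
Qed.

Definition off (k : nat) (b : nat -> R) (j : nat) : R := if Nat.eqb j k then 0 else b j.

Lemma Csumb_split (z : nat -> C) k n :
  Csumb z n = (Csumb (fun j => if Nat.eqb j k then 0%C else z j) n + (if Nat.ltb k n then z k else 0%C))%C.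
Proof.
  induction n; simpl.
  - ring.
  - rewrite IHn. destruct (Nat.eqb_spec n k) as [->|Hk].
    + rewrite Nat.ltb_irrefl. replace (k <? S k)%nat with true by (symmetry; apply Nat.ltb_lt; lia). ring.
    + destruct (Nat.ltb_spec k n) as [Hl|Hl].
      * replace (k <? S n)%nat with true by (symmetry; apply Nat.ltb_lt; lia). ring.
      * replace (k <? S n)%nat with false by (symmetry; apply Nat.ltb_ge; lia). ring.
Qed.

Lemma rpow_off_le p z k n : 1 <= p ->
  rpow (Cmod (Csumb (fun j => if Nat.eqb j k then 0%C else z j) n)) p <=
  Rsumb (off k (fun j => rpow 2 p ^ S j * rpow (Cmod (z j)) p)) n.
Proof.
  intros Hp. eapply Rle_trans. apply rpow_Csumb_le; auto. right. apply Rsumb_ext. intros j _. unfold off.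
  destruct (Nat.eqb j k); auto. rewrite Cmod_0, rpow_0. ring.
Qed.

(** The k-th term is isolated before the others are split, so that only the off-diagonal terms pay
    the growing powers of 2^p. *)
Lemma rpow_sum_up p z k n : 1 <= p ->
  rpow (Cmod (Csumb z n)) p <= rpow 2 p * (rpow (Cmod (z k)) p + Rsumb (off k (fun j => rpow 2 p ^ S j * rpow (Cmod (z j)) p)) n).
Proof.
  intros Hp. pose proof (rpow_2_ge2 p Hp) as H2. pose proof (rpow_off_le p z k n Hp) as H1. rewrite (Csumb_split z k n).
  set (w := Csumb (fun j => if Nat.eqb j k then 0%C else z j) n) in *.
  set (v := if Nat.ltb k n then z k else 0%C).
  assert (Hv : rpow (Cmod v) p <= rpow (Cmod (z k)) p).
  { unfold v. destruct (Nat.ltb k n). lra. rewrite Cmod_0, rpow_0. apply rpow_ge0. }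
  eapply Rle_trans. { apply rpow_le. lra. split. apply Cmod_ge_0. apply Cmod_triangle. }
  eapply Rle_trans. { apply rpow_add_le; try apply Cmod_ge_0. lra. }
  apply Rmult_le_compat_l; lra.
Qed.

Lemma rpow_sum_low p z k n : 1 <= p -> (k < n)%nat ->
  rpow (Cmod (z k)) p <= rpow 2 p * (rpow (Cmod (Csumb z n)) p + Rsumb (off k (fun j => rpow 2 p ^ S j * rpow (Cmod (z j)) p)) n).
Proof.
  intros Hp Hk. pose proof (rpow_2_ge2 p Hp) as H2. pose proof (rpow_off_le p z k n Hp) as H1. pose proof (Csumb_split z k n) as E.
  replace (Nat.ltb k n) with true in E by (symmetry; apply Nat.ltb_lt; auto).
  set (w := Csumb (fun j => if Nat.eqb j k then 0%C else z j) n) in *.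
  replace (z k) with (Csumb z n + - w)%C by (rewrite E; ring).
  eapply Rle_trans. { apply rpow_le. lra. split. apply Cmod_ge_0. apply Cmod_triangle. }
  eapply Rle_trans. { apply rpow_add_le; try apply Cmod_ge_0. lra. }
  rewrite Cmod_opp. apply Rmult_le_compat_l; lra.
Qed.

(* Off-diagonal decay beating the factor [rpow 2 p ^ S k] lost in [rpow_Csumb_le]. *)
Definition mu p := / (4 * rpow 2 p).

Lemma mu_range p : 1 <= p -> 0 < mu p <= / 8.
Proof.
  intros Hp. pose proof (rpow_2_ge2 p Hp). unfold mu. split. apply Rinv_0_lt_compat; lra. apply Rinv_le_contravar; lra.
Qed.

Lemma mu_pow_le p n : 1 <= p -> 0 < mu p ^ n <= 1.
Proof.
  intros Hp. pose proof (mu_range p Hp). split. apply pow_lt; lra.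
  rewrite <- (pow1 n). apply pow_incr; lra.
Qed.

Lemma theta_mu_pow p n : 1 <= p -> rpow 2 p ^ n * mu p ^ n <= 1.
Proof.
  intros Hp. pose proof (rpow_2_ge2 p Hp). rewrite <- Rpow_mult_distr.
  replace (rpow 2 p * mu p) with (/ 4) by (unfold mu; field; lra). rewrite <- (pow1 n). apply pow_incr; lra.
Qed.

Lemma Rsumb_mu p n : 1 <= p -> Rsumb (fun k => mu p ^ k) n <= 2.
Proof.
  intros Hp. pose proof (mu_range p Hp).
  assert (E : Rsumb (fun k => mu p ^ k) n * (1 - mu p) = 1 - mu p ^ n).
  { induction n; simpl. ring. rewrite Rmult_plus_distr_r, IHn. ring. }
  pose proof (mu_pow_le p n Hp). assert (0 <= Rsumb (fun k => mu p ^ k) n). { apply Rsumb_ge0. intros; apply pow_le; lra. }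
  nra.
Qed.

(** The differences X k - X (S k) are the cells of a telescoping partition, and h k lives
    essentially in cell k. The exponent 2k is what [gliding_off] turns into j + k: mu^j absorbs the
    power of 2^p lost at the j-th term, and mu^k makes the cells summable. *)
Definition gliding p (h : nat -> R -> C) (X : nat -> R -> R) eps : Prop :=
  (forall k, CC (h k)) /\ (forall k, Cts (X k)) /\ (forall t, X O t = 1) /\ (forall k t, 0 <= X (S k) t <= X k t) /\
  (forall k, avg (fun t => (1 - X k t) * rpow (Cmod (h k t)) p) <= eps * mu p ^ (2 * k)) /\
  (forall j k, (j < k)%nat -> avg (fun t => X k t * rpow (Cmod (h j t)) p) <= eps * mu p ^ (2 * k)).

Lemma gliding_X p h X eps k t : gliding p h X eps -> 0 <= X k t <= 1.
Proof.
  intros (_ & _ & X0 & HX & _). induction k. rewrite X0; lra. specialize (HX k t). lra.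
Qed.

Lemma gliding_anti p h X eps j k t : gliding p h X eps -> (j <= k)%nat -> X k t <= X j t.
Proof.
  intros (_ & _ & _ & HX & _) Hjk. induction Hjk. lra. specialize (HX m t). lra.
Qed.

Lemma gliding_Cts p h X eps k : 1 <= p -> gliding p h X eps -> Cts (fun t => rpow (Cmod (h k t)) p).
Proof. intros Hp (H & _). apply Cts_rpow_Cmod; auto. Qed.

(** For j < k the cell lies below X k, where h j is small. For j > k it lies below 1 - X (S k) <= 1
    - X j, again where h j is small. *)
Lemma gliding_off p h X eps k j : 1 <= p -> 0 <= eps -> gliding p h X eps -> j <> k ->
  avg (fun t => (X k t - X (S k) t) * rpow (Cmod (h j t)) p) <= eps * mu p ^ (j + k).
Proof.
  intros Hp He HG Hjk. pose proof (mu_range p Hp) as Hmu. pose proof HG as (Ch & CX & X0 & HX & Hoff & Hon).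
  pose proof (gliding_Cts p h X eps j Hp HG) as Cj.
  assert (anti : forall a b, (b <= a)%nat -> mu p ^ a <= mu p ^ b).
  { intros a b Hab. replace a with (b + (a - b))%nat by lia. rewrite pow_add.
    pose proof (mu_pow_le p b Hp). pose proof (mu_pow_le p (a - b) Hp). nra. }
  destruct (Nat.lt_ge_cases j k) as [Hl|Hl].
  - eapply Rle_trans; [|eapply Rle_trans; [apply (Hon j k Hl)|]].
    + apply avg_le. apply Cts_mult; auto. apply Cts_minus; auto. apply Cts_mult; auto.
      intros t. apply Rmult_le_compat_r. apply rpow_ge0. specialize (HX k t). lra.
    + apply Rmult_le_compat_l; auto. apply anti. lia.
  - eapply Rle_trans; [|eapply Rle_trans; [apply (Hoff j)|]].
    + apply avg_le. apply Cts_mult; auto. apply Cts_minus; auto. apply Cts_mult; auto. apply Cts_minus; auto. apply Cts_const.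
      intros t. apply Rmult_le_compat_r. apply rpow_ge0.
      pose proof (gliding_X p h X eps k t HG). pose proof (gliding_anti p h X eps (S k) j t HG ltac:(lia)). lra.
    + apply Rmult_le_compat_l; auto. apply anti. lia.
Qed.

Definition offsum p (h : nat -> R -> C) (x : nat -> C) k n (t : R) : R :=
  Rsumb (off k (fun j => rpow 2 p ^ S j * rpow (Cmod (x j * h j t)%C) p)) n.

Lemma Cts_offsum p h x k n : 1 <= p -> (forall k, CC (h k)) -> Cts (offsum p h x k n).
Proof.
  intros Hp H. unfold offsum, off. apply (Cts_Rsumb (fun j t => if Nat.eqb j k then 0 else rpow 2 p ^ S j * rpow (Cmod (x j * h j t)%C) p)).
  intros j. destruct (Nat.eqb j k). apply Cts_const. apply Cts_mult. apply Cts_const. apply (Cts_rpow_Cmod p (fun t => x j * h j t)%C); auto. apply CC_mult; auto. apply CC_const.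
Qed.

(** The powers of 2^p are cancelled by mu^j through [theta_mu_pow]; one factor 2^p and the summable
    mu^k remain. *)
Lemma avg_offsum p h X eps x k n : 1 <= p -> 0 <= eps -> gliding p h X eps ->
  avg (fun t => (X k t - X (S k) t) * offsum p h x k n t) <= rpow 2 p * eps * Rsumb (fun j => rpow (Cmod (x j)) p) n * mu p ^ k.
Proof.
  intros Hp He HG. pose proof HG as (Ch & CX & _). pose proof (rpow_2_ge2 p Hp) as H2.
  assert (Cps : Cts (fun t => X k t - X (S k) t)) by (apply Cts_minus; auto).
  set (F := fun j t => if Nat.eqb j k then 0 else (rpow 2 p ^ S j * rpow (Cmod (x j)) p) * ((X k t - X (S k) t) * rpow (Cmod (h j t)) p)).
  assert (CF : forall j, Cts (F j)).
  { intros j. unfold F. destruct (Nat.eqb j k). apply Cts_const. apply Cts_mult. apply Cts_const. apply Cts_mult; auto.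
    apply (gliding_Cts p h X eps); auto. }
  rewrite (avg_ext _ (fun t => Rsumb (fun j => F j t) n)).
  - rewrite avg_Rsumb by auto. replace (rpow 2 p * eps * Rsumb (fun j => rpow (Cmod (x j)) p) n * mu p ^ k) with
      ((rpow 2 p * eps * mu p ^ k) * Rsumb (fun j => rpow (Cmod (x j)) p) n) by ring.
    rewrite <- Rsumb_scal. apply Rsumb_le. intros j _. pose proof (rpow_ge0 (Cmod (x j)) p) as Hx.
    pose proof (mu_pow_le p k Hp) as Hmk. assert (Hte : 0 <= rpow 2 p * eps) by (apply Rmult_le_pos; lra). unfold F.
    destruct (Nat.eqb_spec j k) as [E|E].
    + rewrite avg_const. repeat apply Rmult_le_pos; lra.
    + rewrite avg_scal by (apply Cts_mult; auto; apply (gliding_Cts p h X eps); auto).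
      pose proof (gliding_off p h X eps k j Hp He HG E) as HO. rewrite pow_add in HO.
      pose proof (theta_mu_pow p j Hp) as HT. pose proof (pow_lt (rpow 2 p) j ltac:(lra)) as Hpj.
      eapply Rle_trans. { apply Rmult_le_compat_l; [|exact HO]. simpl. repeat apply Rmult_le_pos; lra. }
      replace (rpow 2 p ^ S j * rpow (Cmod (x j)) p * (eps * (mu p ^ j * mu p ^ k))) with
        ((rpow 2 p * eps * mu p ^ k * rpow (Cmod (x j)) p) * (rpow 2 p ^ j * mu p ^ j)) by (simpl; ring).
      rewrite <- (Rmult_1_r (rpow 2 p * eps * mu p ^ k * rpow (Cmod (x j)) p)) at 2.
      apply Rmult_le_compat_l; auto. repeat apply Rmult_le_pos; lra.
  - intros t. unfold offsum. rewrite <- Rsumb_scal. apply Rsumb_ext. intros j _. unfold off, F.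
    destruct (Nat.eqb j k). ring. rewrite Cmod_mult, rpow_mult by apply Cmod_ge_0. ring.
Qed.

Lemma sum_avg_offsum p h X eps x n m : 1 <= p -> 0 <= eps -> gliding p h X eps ->
  Rsumb (fun k => avg (fun t => (X k t - X (S k) t) * offsum p h x k n t)) m <= 2 * rpow 2 p * eps * Rsumb (fun j => rpow (Cmod (x j)) p) n.
Proof.
  intros Hp He HG. pose proof (rpow_2_ge2 p Hp). set (Sx := Rsumb (fun j => rpow (Cmod (x j)) p) n).
  assert (0 <= Sx) by (apply Rsumb_ge0; intros; apply rpow_ge0).
  apply Rle_trans with (Rsumb (fun k => (rpow 2 p * eps * Sx) * mu p ^ k) m).
  - apply Rsumb_le. intros k _. apply avg_offsum; auto.
  - rewrite Rsumb_scal. pose proof (Rsumb_mu p m Hp).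
    assert (0 <= rpow 2 p * eps * Sx) by (repeat apply Rmult_le_pos; lra).
    replace (2 * rpow 2 p * eps * Sx) with (rpow 2 p * eps * Sx * 2) by ring. apply Rmult_le_compat_l; auto.
Qed.

(** Split 1 into the first n cells and X n. In cell k only the k-th term counts, up to the
    off-diagonal sum; on X n all n humps are early ones and small. The 3 is 2 from the cells plus 1
    from X n. *)
Lemma gliding_upper p h X eps G x n : 1 <= p -> 0 <= eps -> gliding p h X eps ->
  (forall k, avg (fun t => rpow (Cmod (h k t)) p) <= G) ->
  avg (fun t => rpow (Cmod (Csumb (fun j => x j * h j t)%C n)) p) <=
    (rpow 2 p * G + 3 * rpow 2 p ^ 2 * eps) * Rsumb (fun j => rpow (Cmod (x j)) p) n.
Proof.
  intros Hp He HG Hh. pose proof HG as (Ch & CX & X0 & HX & Hoff & Hon). pose proof (rpow_2_ge2 p Hp) as H2.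
  set (F := fun t => rpow (Cmod (Csumb (fun j => x j * h j t)%C n)) p).
  set (th := rpow 2 p) in *. set (Sx := Rsumb (fun j => rpow (Cmod (x j)) p) n).
  assert (CF : Cts F).
  { apply (Cts_rpow_Cmod p (fun t => Csumb (fun j => x j * h j t)%C n)); auto.
    apply (CC_Csumb (fun j t => x j * h j t)%C). intros; apply CC_mult; auto. apply CC_const. }
  assert (Chk : forall k, Cts (fun t => rpow (Cmod (h k t)) p)) by (intros; apply (gliding_Cts p h X eps); auto).
  assert (Cps : forall k, Cts (fun t => X k t - X (S k) t)) by (intros; apply Cts_minus; auto).
  set (A := fun k t => th * ((X k t - X (S k) t) * rpow (Cmod (x k * h k t)%C) p) + th * ((X k t - X (S k) t) * offsum p h x k n t)).
  assert (CA1 : forall k, Cts (fun t => (X k t - X (S k) t) * rpow (Cmod (x k * h k t)%C) p)).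
  { intros k. apply Cts_mult; auto. apply (Cts_rpow_Cmod p (fun t => x k * h k t)%C); auto. apply CC_mult; auto. apply CC_const. }
  assert (CA2 : forall k, Cts (fun t => (X k t - X (S k) t) * offsum p h x k n t)).
  { intros k. apply Cts_mult; auto. apply Cts_offsum; auto. }
  assert (CA : forall k, Cts (A k)) by (intros k; apply Cts_plus; apply Cts_mult; auto; apply Cts_const).
  set (B := fun j t => (th ^ S j * rpow (Cmod (x j)) p) * (X n t * rpow (Cmod (h j t)) p)).
  assert (CB : forall j, Cts (B j)) by (intros j; apply Cts_mult; [apply Cts_const | apply Cts_mult; auto]).
  apply Rle_trans with (avg (fun t => Rsumb (fun k => A k t) n + Rsumb (fun j => B j t) n)).
  - apply avg_le; auto. apply Cts_plus; apply Cts_Rsumb; auto. intros t.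
    replace (F t) with (Rsumb (fun k => F t * (X k t - X (S k) t)) n + F t * X n t).
    2: { rewrite Rsumb_scal, (Rsumb_telescope (fun k => X k t)), X0. ring. }
    apply Rplus_le_compat.
    + apply Rsumb_le. intros k _. unfold A. rewrite <- Rmult_plus_distr_l, <- Rmult_plus_distr_l, (Rmult_comm (X k t - X (S k) t)), <- Rmult_assoc.
      apply Rmult_le_compat_r. specialize (HX k t); lra. apply (rpow_sum_up p (fun j => x j * h j t)%C k n Hp).
    + rewrite Rmult_comm. pose proof (gliding_X p h X eps n t HG) as [Xn _].
      eapply Rle_trans. { apply Rmult_le_compat_l. exact Xn. apply rpow_Csumb_le; auto. }
      rewrite <- Rsumb_scal. right. apply Rsumb_ext. intros j _. unfold B. rewrite Cmod_mult, rpow_mult by apply Cmod_ge_0.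
      fold th. ring.
  - rewrite avg_plus, !avg_Rsumb by (auto; apply Cts_Rsumb; auto).
    assert (SB : Rsumb (fun j => avg (B j)) n <= th * eps * Sx).
    { unfold Sx. rewrite <- Rsumb_scal. apply Rsumb_le. intros j Hj. unfold B. rewrite avg_scal by (apply Cts_mult; auto).
      pose proof (Hon j n Hj) as HO. pose proof (rpow_ge0 (Cmod (x j)) p) as Hx.
      assert (Hmn : mu p ^ (2 * n) <= mu p ^ j).
      { replace (2 * n)%nat with (j + (2 * n - j))%nat by lia. rewrite pow_add.
        pose proof (mu_pow_le p j Hp). pose proof (mu_pow_le p (2 * n - j) Hp). nra. }
      pose proof (theta_mu_pow p j Hp) as HT. fold th in HT. pose proof (pow_lt th j ltac:(lra)) as Hpj.
      eapply Rle_trans. { apply Rmult_le_compat_l; [|eapply Rle_trans; [exact HO | apply Rmult_le_compat_l; [exact He | exact Hmn]]].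
        simpl. repeat apply Rmult_le_pos; lra. }
      replace (th ^ S j * rpow (Cmod (x j)) p * (eps * mu p ^ j)) with ((th * eps * rpow (Cmod (x j)) p) * (th ^ j * mu p ^ j)) by (simpl; ring).
      rewrite <- (Rmult_1_r (th * eps * rpow (Cmod (x j)) p)) at 2.
      apply Rmult_le_compat_l; auto. repeat apply Rmult_le_pos; lra. }
    assert (SA : Rsumb (fun k => avg (A k)) n <= th * G * Sx + th * (2 * th * eps * Sx)).
    { apply Rle_trans with (Rsumb (fun k => th * G * rpow (Cmod (x k)) p + th * avg (fun t => (X k t - X (S k) t) * offsum p h x k n t)) n).
      - apply Rsumb_le. intros k _. unfold A. rewrite avg_plus, !avg_scal by (auto; apply Cts_mult; auto; apply Cts_const).
        apply Rplus_le_compat_r. rewrite Rmult_assoc. apply Rmult_le_compat_l. lra.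
        pose proof (rpow_ge0 (Cmod (x k)) p) as Hx.
        apply Rle_trans with (avg (fun t => rpow (Cmod (x k)) p * rpow (Cmod (h k t)) p)).
        + apply avg_le; auto. apply Cts_mult; auto. apply Cts_const. intros t.
          rewrite Cmod_mult, rpow_mult by apply Cmod_ge_0. pose proof (gliding_X p h X eps k t HG). specialize (HX k t).
          pose proof (rpow_ge0 (Cmod (h k t)) p). assert (0 <= rpow (Cmod (x k)) p * rpow (Cmod (h k t)) p) by (apply Rmult_le_pos; auto). nra.
        + rewrite avg_scal, Rmult_comm by auto. apply Rmult_le_compat_r; auto.
      - rewrite Rsumb_plus, !Rsumb_scal. apply Rplus_le_compat_l. apply Rmult_le_compat_l. lra. apply sum_avg_offsum; auto. }
    assert (S0 : 0 <= Sx) by (apply Rsumb_ge0; intros; apply rpow_ge0).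
    assert (th * eps * Sx <= th * eps * Sx * th).
    { assert (0 <= th * eps * Sx) by (repeat apply Rmult_le_pos; lra).
      rewrite <- (Rmult_1_r (th * eps * Sx)) at 1. apply Rmult_le_compat_l; lra. }
    simpl. lra.
Qed.

(** In cell k the hump h k keeps mass c - 2 eps, and the sum differs from its k-th term by the
    off-diagonal part. Only the first K humps are assumed to have mass c: on a given circle that is
    all that can be arranged. *)
Lemma gliding_lower p h X eps c x K n : 1 <= p -> 0 <= eps -> gliding p h X eps -> (K <= n)%nat ->
  (forall k, (k < K)%nat -> c <= avg (fun t => rpow (Cmod (h k t)) p)) ->
  (c - 2 * eps) * Rsumb (fun j => rpow (Cmod (x j)) p) K <=
    rpow 2 p * avg (fun t => rpow (Cmod (Csumb (fun j => x j * h j t)%C n)) p)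
    + 2 * rpow 2 p ^ 2 * eps * Rsumb (fun j => rpow (Cmod (x j)) p) n.
Proof.
  intros Hp He HG HKn Hh. pose proof HG as (Ch & CX & X0 & HX & Hoff & Hon). pose proof (rpow_2_ge2 p Hp) as H2.
  set (F := fun t => rpow (Cmod (Csumb (fun j => x j * h j t)%C n)) p).
  set (th := rpow 2 p) in *. set (Sx := Rsumb (fun j => rpow (Cmod (x j)) p) n).
  assert (CF : Cts F).
  { apply (Cts_rpow_Cmod p (fun t => Csumb (fun j => x j * h j t)%C n)); auto.
    apply (CC_Csumb (fun j t => x j * h j t)%C). intros; apply CC_mult; auto. apply CC_const. }
  assert (Chk : forall k, Cts (fun t => rpow (Cmod (h k t)) p)) by (intros; apply (gliding_Cts p h X eps); auto).
  assert (Cps : forall k, Cts (fun t => X k t - X (S k) t)) by (intros; apply Cts_minus; auto).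
  assert (CA2 : forall k, Cts (fun t => (X k t - X (S k) t) * offsum p h x k n t)).
  { intros k. apply Cts_mult; auto. apply Cts_offsum; auto. }
  assert (CPF : forall k, Cts (fun t => F t * (X k t - X (S k) t))) by (intros; apply Cts_mult; auto).
  assert (Step : forall k, (k < K)%nat -> (c - 2 * eps) * rpow (Cmod (x k)) p <=
     th * (avg (fun t => F t * (X k t - X (S k) t)) + avg (fun t => (X k t - X (S k) t) * offsum p h x k n t))).
  { intros k Hk. pose proof (rpow_ge0 (Cmod (x k)) p) as Hx.
    assert (Hd : c - 2 * eps <= avg (fun t => (X k t - X (S k) t) * rpow (Cmod (h k t)) p)).
    { rewrite (avg_ext _ (fun t => (rpow (Cmod (h k t)) p - (1 - X k t) * rpow (Cmod (h k t)) p) - X (S k) t * rpow (Cmod (h k t)) p)) by (intros; ring).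
      assert (Cts (fun t => (1 - X k t) * rpow (Cmod (h k t)) p)) by (apply Cts_mult; auto; apply Cts_minus; auto; apply Cts_const).
      rewrite !avg_minus by (auto; try (apply Cts_minus; auto); apply Cts_mult; auto).
      specialize (Hh k Hk). specialize (Hoff k). pose proof (Hon k (S k) ltac:(lia)) as Hon'.
      pose proof (mu_pow_le p (2 * k) Hp). pose proof (mu_pow_le p (2 * S k) Hp).
      assert (eps * mu p ^ (2 * k) <= eps) by (rewrite <- (Rmult_1_r eps) at 2; apply Rmult_le_compat_l; lra).
      assert (eps * mu p ^ (2 * S k) <= eps) by (rewrite <- (Rmult_1_r eps) at 2; apply Rmult_le_compat_l; lra).
      lra. }
    rewrite <- avg_plus by auto. rewrite <- avg_scal by (apply Cts_plus; auto).
    apply Rle_trans with (avg (fun t => rpow (Cmod (x k)) p * ((X k t - X (S k) t) * rpow (Cmod (h k t)) p))).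
    - rewrite avg_scal by (apply Cts_mult; auto). rewrite Rmult_comm. apply Rmult_le_compat_l; auto.
    - apply avg_le. apply Cts_mult. apply Cts_const. apply Cts_mult; auto. apply Cts_mult. apply Cts_const. apply Cts_plus; auto.
      intros t. replace (rpow (Cmod (x k)) p * ((X k t - X (S k) t) * rpow (Cmod (h k t)) p)) with
        ((X k t - X (S k) t) * (rpow (Cmod (x k)) p * rpow (Cmod (h k t)) p)) by ring.
      rewrite <- rpow_mult, <- Cmod_mult by apply Cmod_ge_0.
      replace (th * (F t * (X k t - X (S k) t) + (X k t - X (S k) t) * offsum p h x k n t)) with
        ((X k t - X (S k) t) * (th * (F t + offsum p h x k n t))) by ring.
      apply Rmult_le_compat_l. specialize (HX k t); lra. apply (rpow_sum_low p (fun j => x j * h j t)%C k n Hp). lia. }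
  rewrite <- Rsumb_scal. eapply Rle_trans. apply Rsumb_le. exact Step.
  rewrite Rsumb_scal, Rsumb_plus, Rmult_plus_distr_l. apply Rplus_le_compat.
  - apply Rmult_le_compat_l. lra. rewrite <- avg_Rsumb by auto. apply avg_le; auto. apply Cts_Rsumb; auto.
    intros t. rewrite Rsumb_scal, (Rsumb_telescope (fun k => X k t)), X0. pose proof (gliding_X p h X eps K t HG).
    assert (0 <= F t) by apply rpow_ge0. nra.
  - pose proof (sum_avg_offsum p h X eps x n K Hp He HG) as HS. fold th Sx in HS.
    replace (2 * th ^ 2 * eps * Sx) with (th * (2 * th * eps * Sx)) by ring. apply Rmult_le_compat_l; lra.
Qed.

(** * Selection of the test points *)

(** (W f_a)' differs from u f_a'(vphi) by phi' f_a(vphi). For small [cst p a] the function f_a is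
    small on a compact disc, so [multiplier_small] makes the difference cost at most half of e0. *)
Lemma test_lower p phi vphi M e0 : 1 <= p -> hol 1 phi -> selfmap vphi ->
  (forall r, 0 <= r < 1 -> Mp p (deriv phi) r <= M) -> 0 < e0 ->
  exists c0, 0 < c0 /\ forall a r, Cmod a < 1 -> cst p a <= c0 -> 0 <= r < 1 ->
    e0 <= avg (fun t => rpow (Cmod (phi (circ r t) * deriv vphi (circ r t))%C) p * kern (2 * p) a (vphi (circ r t))) ->
    e0 / (2 * rpow 2 p) <= avg (fun t => rpow (Cmod (deriv (W phi vphi (ta p a)) (circ r t))) p).
Proof.
  intros Hp Hphi Hv HM He. pose proof (rpow_2_ge2 p Hp) as H2. set (th := rpow 2 p) in *. assert (p0 : 0 < p) by lra.
  destruct (multiplier_small p (deriv phi) vphi M 2 (rpow 2 (2 * p)) Hp (hol_deriv_hol1 phi Hphi) HM Hv ltac:(lra) (rpow_ge0 _ _)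
    (e0 / (2 * th))) as (del & s & Hdel & Hs & HS). { apply Rdiv_lt_0_compat; lra. }
  exists (del * (1 - s)). split. { apply Rmult_lt_0_compat; lra. }
  intros a r Ha Hca Hr H0.
  specialize (HS (ta p a) (ta_hol p a Ha) (fun z Hz => Cmod_ta_le2 p a z Hp Ha Hz) (fun r Hr => ta_Mp p a r Hp Ha Hr)).
  assert (Hsm : forall z, Cmod z <= s -> Cmod (ta p a z) <= del).
  { intros z Hz. eapply Rle_trans. apply (Cmod_ta_le p a z (1 - s)); auto. lra. split. lra.
    pose proof (Cmod_minus_ge 1%C (Cconj a * z)%C) as HG. rewrite Cmod_1, Cmod_mult, Cmod_conj in HG.
    pose proof (Cmod_ge_0 a). pose proof (Cmod_ge_0 z). nra.
    apply Rmult_le_reg_r with (1 - s). lra. unfold Rdiv. rewrite Rmult_assoc, Rinv_l; lra. }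
  specialize (HS Hsm r Hr).
  set (Z := fun t => vphi (circ r t)).
  assert (HZ : forall t, Cmod (Z t) < 1) by (intros; apply selfmap_circ; auto).
  assert (Hcirc : forall t, Cmod (circ r t) < 1) by (intros; rewrite Cmod_circ, Rabs_pos_eq; lra).
  pose proof (CC_selfmap vphi r Hv Hr) as CZ. fold Z in CZ.
  pose proof (ta_hol p a Ha) as Hta. pose proof (W_hol phi vphi _ Hphi Hv Hta) as HW.
  assert (Hu : hol 1 (fun z => phi z * deriv vphi z)%C).
  { intros z Hzz. destruct (hol_deriv_hol1 vphi (proj1 Hv) z Hzz) as [l Hl]. eexists. apply Cdiff_mult; [apply (hol_deriv 1); auto | exact Hl]. }
  assert (C1 : Cts (fun t => rpow (Cmod (deriv (W phi vphi (ta p a)) (circ r t))) p)).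
  { apply (Cts_rpow_hol 1); auto. apply hol_deriv_hol1; auto. }
  assert (C2 : Cts (fun t => rpow (Cmod (deriv phi (circ r t))) p * rpow (Cmod (ta p a (vphi (circ r t)))) p)).
  { apply Cts_mult. apply (Cts_rpow_hol 1); auto. apply hol_deriv_hol1; auto. apply (Cts_rpow_comp (ta p a) Z p); auto. }
  assert (C3 : Cts (fun t => rpow (Cmod (phi (circ r t) * deriv vphi (circ r t))%C) p * kern (2 * p) a (vphi (circ r t)))).
  { apply Cts_mult. apply (Cts_rpow_hol 1 (fun z => phi z * deriv vphi z)%C); auto.
    apply (Cts_kern_comp (2 * p) a Z); auto. lra. }
  assert (Hle : e0 <= th * (avg (fun t => rpow (Cmod (deriv (W phi vphi (ta p a)) (circ r t))) p) + e0 / (2 * th))).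
  { eapply Rle_trans. exact H0. eapply Rle_trans; [|apply Rmult_le_compat_l; [lra | apply Rplus_le_compat_l; exact HS]].
    rewrite <- avg_plus, <- avg_scal by (auto; apply Cts_plus; auto).
    apply avg_le; auto. apply Cts_mult. apply Cts_const. apply Cts_plus; auto.
    intros t. fold (Z t). rewrite <- (Cmod_tg_kern p a (Z t)) by (auto; left; auto).
    rewrite <- !rpow_mult, <- !Cmod_mult by apply Cmod_ge_0.
    rewrite (Cdiff_deriv _ _ _ (W_diff phi vphi (ta p a) (circ r t) Hphi Hv Hta (Hcirc t))). fold (Z t).
    rewrite ta_deriv by auto.
    set (A := (deriv phi (circ r t) * ta p a (Z t))%C). set (B := (phi (circ r t) * deriv vphi (circ r t) * tg p a (Z t))%C).
    replace B with ((A + B) + - A)%C at 1 by ring.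
    eapply Rle_trans. { apply rpow_le. lra. split. apply Cmod_ge_0. apply Cmod_triangle. }
    eapply Rle_trans. { apply rpow_add_le; try apply Cmod_ge_0. lra. }
    rewrite Cmod_opp. fold th. lra. }
  apply Rmult_le_reg_l with th. lra. replace (th * (e0 / (2 * th))) with (e0 / 2) in * by (field; lra).
  rewrite Rmult_plus_distr_l in Hle. replace (th * (e0 / (2 * th))) with (e0 / 2) in * by (field; lra). lra.
Qed.

(** Points with |a| > 1 - 1/(n + 1) violating the condition exist for every n; extracting
    subsequences for the two coordinates gives the limit zeta. *)
Lemma not_vanishing_sequence p u vphi : ~ vanishing p u vphi ->
  exists e0 zeta a rr, 0 < e0 /\ Cmod zeta = 1 /\
  (forall n : nat, Cmod (a n) < 1 /\ 0 <= rr n < 1 /\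
    e0 <= avg (fun t => rpow (Cmod (u (circ (rr n) t))) p * kern (2 * p) (a n) (vphi (circ (rr n) t)))) /\
  forall e, 0 < e -> exists N, forall n, (N <= n)%nat -> Cmod (a n - zeta) <= e.
Proof.
  intros HV. apply not_all_ex_not in HV as [e0 HV]. apply imply_to_and in HV as [He HV].
  assert (H : forall n : nat, exists q : C * R, (1 - / (INR n + 1) < Cmod (fst q) < 1) /\ 0 <= snd q < 1 /\
    e0 <= avg (fun t => rpow (Cmod (u (circ (snd q) t))) p * kern (2 * p) (fst q) (vphi (circ (snd q) t)))).
  { intros n. apply NNPP. intros HN. apply HV. pose proof (pos_INR n).
    assert (0 < / (INR n + 1) <= 1).
    { split. apply Rinv_0_lt_compat; lra. rewrite <- Rinv_1. apply Rinv_le_contravar; lra. }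
    exists (1 - / (INR n + 1)). split. lra. intros a Ha r Hr.
    destruct (Rle_lt_dec e0 (avg (fun t => rpow (Cmod (u (circ r t))) p * kern (2 * p) a (vphi (circ r t))))) as [Hl|Hl]; [|lra].
    exfalso. apply HN. exists (a, r). simpl. auto. }
  assert (H' : exists q : nat -> C * R, forall n, (1 - / (INR n + 1) < Cmod (fst (q n)) < 1) /\ 0 <= snd (q n) < 1 /\
    e0 <= avg (fun t => rpow (Cmod (u (circ (snd (q n)) t))) p * kern (2 * p) (fst (q n)) (vphi (circ (snd (q n)) t)))).
  { exists (fun n => proj1_sig (constructive_indefinite_description _ (H n))). intros n.
    exact (proj2_sig (constructive_indefinite_description _ (H n))). }
  destruct H' as [q Hq]. clear H.
  destruct (bounded_subseq (fun n => fst (fst (q n))) 1) as (t1 & l1 & Ht1 & L1).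
  { intros n. destruct (Hq n) as [[_ Hn] _]. pose proof (Rabs_fst_le (fst (q n))). lra. }
  destruct (bounded_subseq (fun n => snd (fst (q (t1 n)))) 1) as (t2 & l2 & Ht2 & L2).
  { intros n. destruct (Hq (t1 n)) as [[_ Hn] _]. pose proof (Rabs_snd_le (fst (q (t1 n)))). lra. }
  pose proof (sinc_comp t1 t2 Ht1 Ht2) as Ht. set (tt := fun n => t1 (t2 n)) in *.
  set (zeta := (l1, l2) : C).
  assert (Hc : forall e, 0 < e -> exists N, forall n, (N <= n)%nat -> Cmod (fst (q (tt n)) - zeta) <= e).
  { intros e Hee. apply is_lim_seq_spec in L1. apply is_lim_seq_spec in L2.
    assert (e20 : 0 < e / 2) by lra.
    destruct (L1 (mkposreal _ e20)) as [N1 HN1]. destruct (L2 (mkposreal _ e20)) as [N2 HN2].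
    exists (max N1 N2). intros n Hn. eapply Rle_trans; [apply Cmod_le_abs|].
    pose proof (sinc_ge t2 n Ht2) as Hg. specialize (HN1 (t2 n) ltac:(lia)). specialize (HN2 n ltac:(lia)). simpl in HN1, HN2.
    unfold tt, zeta. simpl. unfold Rminus in HN1, HN2. lra. }
  exists e0, zeta, (fun n => fst (q (tt n))), (fun n => snd (q (tt n))). split; [auto|]. split; [|split; [|exact Hc]].
  - apply Rle_antisym; apply le_epsilon; intros e Hee.
    + destruct (Hc e Hee) as [N HN]. specialize (HN N (le_n _)). destruct (Hq (tt N)) as [[_ H1] _].
      pose proof (Cmod_minus_ge zeta (zeta - fst (q (tt N)))%C) as HG. rewrite Cmod_minus_sym in HN.
      replace (zeta - (zeta - fst (q (tt N))))%C with (fst (q (tt N))) in HG by ring. lra.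
    + destruct (Hc (e / 2)) as [N HN]. lra.
      destruct (archimed_cor1 (e / 2)) as (K & HK & HK0). lra.
      set (n := max N K). specialize (HN n ltac:(lia)). destruct (Hq (tt n)) as [[H1 _] _].
      assert (/ (INR (tt n) + 1) <= / INR K).
      { apply Rinv_le_contravar. apply lt_0_INR; auto. pose proof (sinc_ge tt n Ht).
        assert (INR K <= INR (tt n)) by (apply le_INR; lia). lra. }
      pose proof (Cmod_minus_ge (fst (q (tt n))) (fst (q (tt n)) - zeta)%C) as HG.
      replace (fst (q (tt n)) - (fst (q (tt n)) - zeta))%C with zeta in HG by ring. lra.
  - intros n. destruct (Hq (tt n)) as ([_ H1] & H2 & H3). auto.
Qed.

(** The gliding hump scheme in the abstract: A d n x says that hump n has mass at most x off the
    d-neighbourhood, B d n x that it has mass at most x inside. The two choices alternate: first d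
    small for the humps already present, then n large for that d. *)
Lemma hump_selection (A B : R -> nat -> R -> Prop) (e : nat -> R) :
  (forall k, 0 < e k) ->
  (forall d1 d2 n x, 0 < d1 <= d2 -> B d2 n x -> B d1 n x) ->
  (forall d x, 0 < d < 1 -> 0 < x -> exists N, forall n, (N <= n)%nat -> A d n x) ->
  (forall n x, 0 < x -> exists d, 0 < d /\ B d n x) ->
  exists (nn : nat -> nat) (dd : nat -> R), (forall k, 0 < dd k < 1) /\ (forall k, dd (S k) <= dd k) /\
    (forall k, A (dd k) (nn k) (e k)) /\ (forall j k, (j < k)%nat -> B (dd k) (nn j) (e k)).
Proof.
  intros He Bm HA HB.
  (* One d for all indices up to n, which includes every hump selected earlier. *)
  assert (HB' : forall n x, 0 < x -> exists d, 0 < d /\ forall m, (m <= n)%nat -> B d m x).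
  { intros n x Hx. induction n.
    - destruct (HB O x Hx) as (d & Hd & H). exists d. split; auto. intros m Hm. replace m with O by lia. auto.
    - destruct IHn as (d1 & Hd1 & H1). destruct (HB (S n) x Hx) as (d2 & Hd2 & H2). exists (Rmin d1 d2).
      assert (Hm0 : 0 < Rmin d1 d2) by (apply Rmin_pos; auto). split; auto. intros m Hm.
      destruct (Nat.eq_dec m (S n)) as [->|Hne].
      + apply Bm with d2; auto. split; auto. apply Rmin_r.
      + apply Bm with d1; auto. split; auto. apply Rmin_l. apply H1; lia. }
  destruct (HA (/ 2) (e O) ltac:(lra) (He O)) as [N0 HN0].
  destruct (dependent_choice (fun k (q : nat * R) => 0 < snd q < 1 /\ A (snd q) (fst q) (e k))
    (fun k (q q' : nat * R) => (fst q < fst q')%nat /\ snd q' <= snd q /\ forall m, (m <= fst q)%nat -> B (snd q') m (e (S k)))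
    (N0, / 2)) as (s & _ & HP & HQ).
  - simpl. split. lra. apply HN0; lia.
  - intros k [n d] [Hd _]. simpl in *. destruct (HB' n (e (S k)) (He _)) as (d1 & Hd1 & H1).
    assert (Hm0 : 0 < Rmin d1 d) by (apply Rmin_pos; lra). pose proof (Rmin_l d1 d). pose proof (Rmin_r d1 d).
    destruct (HA (Rmin d1 d) (e (S k)) ltac:(lra) (He _)) as [N HN].
    exists (max N (S n), Rmin d1 d). simpl. repeat split; try lra; try lia. apply HN; lia.
    intros m Hm. apply Bm with d1; auto.
  - exists (fun k => fst (s k)), (fun k => snd (s k)). split; [|split; [|split]].
    + intros k. apply HP.
    + intros k. apply HQ.
    + intros k. apply HP.
    + assert (Hs : sinc (fun k => fst (s k))) by (intros k; apply HQ).
      intros j k Hjk. destruct k as [|k]. lia. apply HQ.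
      destruct (Nat.eq_dec j k) as [->|Hne]. lia. pose proof (sinc_lt _ j k Hs ltac:(lia)). simpl in *. lia.
Qed.

(** The constant 1 at index 0 makes the cells start as a partition of unity. *)
Definition cutoff (zeta : C) (dd : nat -> R) (Z : R -> C) (k : nat) (t : R) : R :=
  match k with O => 1 | _ => near zeta (dd k) (Z t) end.

Lemma gliding_cutoff p zeta dd (Z : R -> C) (h : nat -> R -> C) eps : 1 <= p -> 0 <= eps -> CC Z -> (forall k, CC (h k)) ->
  (forall k, 0 < dd k < 1) -> (forall k, dd (S k) <= dd k) ->
  (forall k, avg (fun t => (1 - near zeta (dd k) (Z t)) * rpow (Cmod (h k t)) p) <= eps * mu p ^ (2 * k)) ->
  (forall j k, (j < k)%nat -> avg (fun t => near zeta (dd k) (Z t) * rpow (Cmod (h j t)) p) <= eps * mu p ^ (2 * k)) ->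
  gliding p h (cutoff zeta dd Z) eps.
Proof.
  intros Hp He CZ Ch Hdd Hmon HA HB. split; [auto|]. split; [|split; [|split; [|split]]].
  - intros [|k]. apply Cts_const. apply (Cts_near zeta (dd (S k)) Z); auto.
  - reflexivity.
  - intros [|k] t. apply near_range. split. apply near_range.
    apply (near_mono zeta (dd (S (S k))) (dd (S k)) (Z t)). split. apply Hdd. auto.
  - intros [|k].
    + rewrite (avg_ext _ (fun _ => 0)) by (intros; simpl; ring). rewrite avg_const. simpl. lra.
    + apply (HA (S k)).
  - intros j [|k] Hjk. lia. apply (HB j (S k) Hjk).
Qed.

(** One sequence of points must glide both before and after applying W. The system before W is the
    special case phi = 1, vphi = id of the system after it, so both are selected simultaneously by
    the same lemmas. *)
Lemma test_sequence p phi vphi M : 1 <= p -> hol 1 phi -> selfmap vphi ->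
  (forall r, 0 <= r < 1 -> Mp p (deriv phi) r <= M) ->
  (forall r, 0 <= r < 1 -> Mp p (fun z => phi z * deriv vphi z)%C r <= M) ->
  (forall a, Cmod a < 1 -> in_Sp p (W phi vphi (ta p a))) ->
  ~ vanishing p (fun z => phi z * deriv vphi z)%C vphi ->
  exists b c eps, 0 < c /\ 0 < eps <= 1 /\ 8 * rpow 2 p ^ 2 * eps <= c /\
    (forall k : nat, Cmod (b k) < 1 /\ cst p (b k) <= (/ 2) ^ k) /\
    (forall r, 0 <= r < 1 -> exists X, gliding p (fun k t => deriv (W phi vphi (ta p (b k))) (circ r t)) X eps) /\
    (forall r, 0 <= r < 1 -> exists X, gliding p (fun k t => tg p (b k) (circ r t)) X eps) /\
    (forall k, exists rk, 0 <= rk < 1 /\ forall r, rk <= r < 1 ->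
       c <= avg (fun t => rpow (Cmod (deriv (W phi vphi (ta p (b k))) (circ r t))) p)).
Proof.
  intros Hp Hphi Hv HM1 HM2 HW HV. pose proof (rpow_2_ge2 p Hp) as H2. set (th := rpow 2 p) in *.
  destruct (not_vanishing_sequence _ _ _ HV) as (e0 & zeta & a & rr & He0 & Hz & Ha & Hlim).
  destruct (test_lower p phi vphi M e0 Hp Hphi Hv HM1 He0) as (c0 & Hc0 & HL).
  set (c := e0 / (2 * rpow 2 p)). assert (Hc : 0 < c) by (apply Rdiv_lt_0_compat; unfold th in *; lra).
  assert (Hth2 : 0 < 8 * th ^ 2) by (pose proof (pow_lt th 2 ltac:(lra)); lra).
  (* Small enough for both error terms of [gliding_lower] to be absorbed by c in [W_embed_lower]. *)
  set (eps := Rmin 1 (c / (8 * th ^ 2))).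
  assert (Heps : 0 < eps <= 1). { split. apply Rmin_pos. lra. apply Rdiv_lt_0_compat; auto. apply Rmin_l. }
  assert (Hec : 8 * th ^ 2 * eps <= c).
  { apply Rle_trans with (8 * th ^ 2 * (c / (8 * th ^ 2))). apply Rmult_le_compat_l. lra. apply Rmin_r. right; field; lra. }
  assert (Hcst : forall e, 0 < e -> exists N, forall n, (N <= n)%nat -> cst p (a n) <= e).
  { intros e He. destruct (Hlim (e / 2)) as [N HN]. lra. exists N. intros n Hn. specialize (HN n Hn).
    destruct (Ha n) as [H1 _]. eapply Rle_trans. apply cst_le; auto.
    pose proof (Cmod_minus_ge zeta (zeta - a n)%C) as HG. rewrite (Cmod_minus_sym zeta (a n)), Hz in HG.
    replace (zeta - (zeta - a n))%C with (a n) in HG by ring. pose proof (Cmod_ge_0 (a n)).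
    replace (1 - Cmod (a n) ^ 2) with ((1 - Cmod (a n)) * (1 + Cmod (a n))) by ring. nra. }
  set (offA := fun (ph vp : C -> C) d n x => forall r, 0 <= r < 1 ->
    avg (fun t => (1 - near zeta d (vp (circ r t))) * rpow (Cmod (deriv (W ph vp (ta p (a n))) (circ r t))) p) <= x).
  (* Quantifying over all d' <= d makes the property pass to smaller d, as [hump_selection]
     requires. *)
  set (onB := fun (ph vp : C -> C) d n x => forall d', 0 < d' <= d -> forall r, 0 <= r < 1 ->
    avg (fun t => near zeta d' (vp (circ r t)) * rpow (Cmod (deriv (W ph vp (ta p (a n))) (circ r t))) p) <= x).
  assert (offA_ev : forall ph vp N, hol 1 ph -> selfmap vp -> (forall r, 0 <= r < 1 -> Mp p (deriv ph) r <= N) ->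
    (forall r, 0 <= r < 1 -> Mp p (fun z => ph z * deriv vp z)%C r <= N) ->
    forall d x, 0 < d < 1 -> 0 < x -> exists K, forall n, (K <= n)%nat -> offA ph vp d n x).
  { intros ph vp N Hph Hvp HN1 HN2 d x Hd Hx.
    destruct (off_hump_small p zeta ph vp N Hp Hz Hph Hvp HN1 HN2 d x Hd Hx) as (c1 & Hc1 & HO).
    destruct (Hcst c1 Hc1) as [K1 HK1]. destruct (Hlim (d / 2)) as [K2 HK2]. lra. exists (max K1 K2). intros n Hn r Hr.
    apply HO; auto. apply Ha. apply HK2; lia. apply HK1; lia. }
  assert (onB_ev : forall ph vp, hol 1 ph -> selfmap vp -> (forall a, Cmod a < 1 -> in_Sp p (W ph vp (ta p a))) ->
    forall n x, 0 < x -> exists d, 0 < d /\ onB ph vp d n x).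
  { intros ph vp Hph Hvp HS n x Hx. destruct (Ha n) as [Han _]. destruct (proj1 (in_Sp_iff _ _) (HS _ Han)) as [HWh [N HN]].
    destruct (near_hump_small p zeta vp (deriv (W ph vp (ta p (a n)))) N ltac:(lra) Hz Hvp (hol_deriv_hol1 _ HWh) HN x Hx) as (d0 & Hd0 & HB).
    exists d0. split; auto. }
  set (one := (fun _ => 1%C) : C -> C). set (idC := (fun z => z) : C -> C).
  assert (Ho1 : hol 1 one) by (intros z _; eexists; apply Cdiff_const).
  assert (Hone : forall z, deriv one z = 0%C) by (intros z; apply Cdiff_deriv, Cdiff_const).
  assert (Hidd : forall z, deriv idC z = 1%C) by (intros z; apply Cdiff_deriv, Cdiff_id).
  assert (Wd : forall n z, Cmod z < 1 -> deriv (W one idC (ta p (a n))) z = tg p (a n) z).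
  { intros n z Hzz. destruct (Ha n) as [Han _].
    rewrite (Cdiff_deriv _ _ _ (W_diff one idC (ta p (a n)) z Ho1 selfmap_id (ta_hol p _ Han) Hzz)).
    rewrite Hone, Hidd. unfold idC, one. rewrite ta_deriv by auto. ring. }
  assert (HWid : forall b, Cmod b < 1 -> in_Sp p (W one idC (ta p b))).
  { intros b Hb. apply in_Sp_iff. split. apply W_hol; auto. apply selfmap_id. apply ta_hol; auto.
    exists (rpow 2 (2 * p)). intros r Hr. eapply Rle_trans; [|apply (tg_Mp p b r); auto]. right. rewrite !Mp_avg. apply avg_ext. intros t.
    assert (Hcirc : Cmod (circ r t) < 1) by (rewrite Cmod_circ, Rabs_pos_eq; lra).
    rewrite (Cdiff_deriv _ _ _ (W_diff one idC (ta p b) _ Ho1 selfmap_id (ta_hol p _ Hb) Hcirc)).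
    rewrite Hone, Hidd. unfold idC, one. rewrite ta_deriv by auto. do 2 f_equal. ring. }
  destruct (hump_selection
    (* The bound of [cst] by x gives the decay 2^(-k) that makes the embedding series converge; the
       bound by c0 makes [test_lower] applicable. *)
    (fun d n x => (offA phi vphi d n x /\ offA one idC d n x) /\ cst p (a n) <= x /\ cst p (a n) <= c0)
    (fun d n x => onB phi vphi d n x /\ onB one idC d n x) (fun k => eps * mu p ^ (2 * k))) as (nn & dd & Hdd & Hmon & HA & HB).
  - intros k. apply Rmult_lt_0_compat. lra. apply mu_pow_le; auto.
  - intros d1 d2 n x Hd [B1 B2]. split; intros d' Hd'; [apply B1 | apply B2]; lra.
  - intros d x Hd Hx. destruct (offA_ev phi vphi M Hphi Hv HM1 HM2 d x Hd Hx) as [N1 HN1].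
    destruct (offA_ev one idC 1 Ho1 selfmap_id) with (d := d) (x := x) as [N2 HN2]; auto.
    { intros r Hr. rewrite Mp_avg, (avg_ext _ (fun _ => 0)). rewrite avg_const. lra.
      intros t. rewrite Hone, Cmod_0. try apply rpow_0. }
    { intros r Hr. rewrite Mp_avg, (avg_ext _ (fun _ => 1)). rewrite avg_const. lra.
      intros t. rewrite Hidd. unfold one. rewrite Cmult_1_l, Cmod_1. try apply rpow_1. }
    destruct (Hcst x Hx) as [N3 HN3]. destruct (Hcst c0 Hc0) as [N4 HN4].
    exists (max (max N1 N2) (max N3 N4)). intros n Hn. repeat split; [apply HN1 | apply HN2 | apply HN3 | apply HN4]; lia.
  - intros n x Hx. destruct (onB_ev phi vphi Hphi Hv HW n x Hx) as (d1 & Hd1 & B1).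
    destruct (onB_ev one idC Ho1 selfmap_id HWid n x Hx) as (d2 & Hd2 & B2). exists (Rmin d1 d2).
    pose proof (Rmin_l d1 d2). pose proof (Rmin_r d1 d2). split. apply Rmin_pos; auto.
    split; intros d' Hd'; [apply B1 | apply B2]; lra.
  - exists (fun k => a (nn k)), c, eps. split; [auto|]. split; [auto|]. split; [auto|].
    assert (Hcirc : forall r t, 0 <= r < 1 -> Cmod (circ r t) < 1) by (intros; rewrite Cmod_circ, Rabs_pos_eq; lra).
    split; [|split; [|split]].
    + intros k. split. apply Ha. destruct (HA k) as (_ & HA2 & _). eapply Rle_trans. exact HA2.
      pose proof (mu_range p Hp) as Hmu. apply Rle_trans with (mu p ^ (2 * k)).
      * pose proof (mu_pow_le p (2 * k) Hp). nra.
      * rewrite pow_mult. apply pow_incr. split. apply pow2_ge_0. nra.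
    + intros r Hr. exists (cutoff zeta dd (fun t => vphi (circ r t))). apply gliding_cutoff; auto. lra.
      * apply CC_selfmap; auto.
      * intros k. apply (CC_hol 1); auto. apply hol_deriv_hol1, W_hol; auto. apply ta_hol, Ha.
      * intros k. destruct (HA k) as [[A1 _] _]. exact (A1 r Hr).
      * intros j k Hjk. destruct (HB j k Hjk) as [B1 _]. specialize (Hdd k). exact (B1 (dd k) ltac:(lra) r Hr).
    + intros r Hr. exists (cutoff zeta dd (fun t => circ r t)). apply gliding_cutoff; auto. lra.
      * apply CC_circ.
      * intros k. apply (CC_hol 1); auto. apply hol_ext with (deriv (ta p (a (nn k)))).
        intros z Hzz. apply ta_deriv; auto. apply Ha. apply hol_deriv_hol1, ta_hol, Ha.
      * intros k. destruct (HA k) as [[_ A2] _]. rewrite (avg_ext _ (fun t => (1 - near zeta (dd k) (circ r t)) * rpow (Cmod (deriv (W one idC (ta p (a (nn k)))) (circ r t))) p)).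
        exact (A2 r Hr). intros t. rewrite Wd; auto.
      * intros j k Hjk. destruct (HB j k Hjk) as [_ B2]. specialize (Hdd k).
        rewrite (avg_ext _ (fun t => near zeta (dd k) (circ r t) * rpow (Cmod (deriv (W one idC (ta p (a (nn j)))) (circ r t))) p)).
        exact (B2 (dd k) ltac:(lra) r Hr). intros t. rewrite Wd; auto.
    (* Non-vanishing supplies one radius per point; monotonicity of the means extends the lower
       bound to all larger radii. *)
    + intros k. destruct (Ha (nn k)) as (H3 & H4 & H5). destruct (HA k) as (_ & _ & HA3). exists (rr (nn k)). split; auto.
      intros r Hr. eapply Rle_trans. apply (HL (a (nn k)) (rr (nn k))); auto.
      apply (subharmonic_mono 1); try lra. apply hol_deriv_hol1, W_hol; auto. apply ta_hol; auto.
Qed.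

(** * The embedding of l^p *)

Lemma Cmod_geom_absC (a : nat -> C) q M : 0 <= q < 1 -> 0 <= M -> (forall k, Cmod (a k) <= M * q ^ k) -> absC a.
Proof.
  intros Hq HM H. apply (Series_geom_tail (fun k => Cmod (a k)) q O M); auto. intros; apply Cmod_ge_0.
Qed.

Lemma CSer_geom_tail (a : nat -> C) q M L : 0 <= q < 1 -> 0 <= M -> (forall k, Cmod (a k) <= M * q ^ k) ->
  Cmod (Csumb a L - CSer a) <= M * q ^ L / (1 - q).
Proof.
  intros Hq HM H. pose proof (Cmod_geom_absC a q M Hq HM H) as Ha. apply le_epsilon. intros e He.
  destruct (CSer_lim a Ha e He) as [N HN].
  assert (Hn : forall n, Cmod (Csumb a L - Csumb a (L + n)) <= M * (q ^ L - q ^ (L + n)) / (1 - q)).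
  { induction n.
    - rewrite Nat.add_0_r. replace (Csumb a L - Csumb a L)%C with (RtoC 0) by ring. rewrite Cmod_0. right. field. lra.
    - replace (L + S n)%nat with (S (L + n)) by lia. simpl Csumb.
      replace (Csumb a L - (Csumb a (L + n) + a (L + n)%nat))%C with ((Csumb a L - Csumb a (L + n)) + - a (L + n)%nat)%C by ring.
      eapply Rle_trans; [apply Cmod_triangle|]. rewrite Cmod_opp. specialize (H (L + n)%nat).
      replace (M * (q ^ L - q ^ S (L + n)) / (1 - q)) with (M * (q ^ L - q ^ (L + n)) / (1 - q) + M * q ^ (L + n)) by (simpl; field; lra).
      lra. }
  specialize (HN (L + N)%nat ltac:(lia)). specialize (Hn N).
  replace (Csumb a L - CSer a)%C with ((Csumb a L - Csumb a (L + N)) + (Csumb a (L + N) - CSer a))%C by ring.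
  eapply Rle_trans; [apply Cmod_triangle|].
  assert (M * (q ^ L - q ^ (L + N)) / (1 - q) <= M * q ^ L / (1 - q)).
  { apply Rmult_le_compat_r. left; apply Rinv_0_lt_compat; lra. apply Rmult_le_compat_l; auto.
    assert (0 <= q ^ (L + N)) by (apply pow_le; lra). lra. }
  lra.
Qed.

Lemma geom_small q M e : 0 <= q < 1 -> 0 <= M -> 0 < e -> exists N, forall n, (N <= n)%nat -> M * q ^ n / (1 - q) <= e.
Proof.
  intros Hq HM He. destruct (pow_lt_1_zero q) with (y := e * (1 - q) / (M + 1)) as [N HN].
  - rewrite Rabs_pos_eq; lra.
  - apply Rdiv_lt_0_compat. nra. lra.
  - exists N. intros n Hn. specialize (HN n Hn). rewrite Rabs_pos_eq in HN by (apply pow_le; lra).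
    apply Rmult_le_reg_r with (1 - q). lra. unfold Rdiv at 1. rewrite Rmult_assoc, Rinv_l, Rmult_1_r by lra.
    assert (0 <= q ^ n) by (apply pow_le; lra).
    apply Rle_trans with ((M + 1) * (e * (1 - q) / (M + 1))); [nra|]. right. field. lra.
Qed.

Definition embed p (b x : nat -> C) : C -> C := fun z => CSer (fun k => x k * ta p (b k) z)%C.

(** The decay of [cst] makes the series in [embed] converge geometrically on compact discs for every
    bounded x, before any hump estimate. *)
Definition test_points p (b : nat -> C) : Prop := forall k, Cmod (b k) < 1 /\ cst p (b k) <= (/ 2) ^ k.

Lemma den_ge a z m : Cmod a < 1 -> Cmod z <= 1 - m -> m <= Cmod (1 - Cconj a * z).
Proof.
  intros Ha Hz. pose proof (Cmod_minus_ge 1%C (Cconj a * z)%C) as HG. rewrite Cmod_1, Cmod_mult, Cmod_conj in HG.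
  pose proof (Cmod_ge_0 a). pose proof (Cmod_ge_0 z). nra.
Qed.

Lemma x_ta_le p b x B m k z : test_points p b -> (forall k, Cmod (x k) <= B) -> 0 < m -> Cmod z <= 1 - m ->
  Cmod (x k * ta p (b k) z)%C <= B / m * (/ 2) ^ k.
Proof.
  intros Hb Hx Hm Hz. destruct (Hb k) as [H1 H2]. rewrite Cmod_mult.
  replace (B / m * (/ 2) ^ k) with (B * ((/ 2) ^ k / m)) by (field; lra).
  apply Rmult_le_compat; try apply Cmod_ge_0; auto. eapply Rle_trans.
  apply (Cmod_ta_le p (b k) z m); auto. lra. split; auto. apply den_ge; auto.
  apply Rmult_le_compat_r; auto. left; apply Rinv_0_lt_compat; auto.
Qed.

Lemma x_tg_le p b x B m k z : test_points p b -> (forall k, Cmod (x k) <= B) -> 0 < m -> Cmod z <= 1 - m ->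
  Cmod (x k * tg p (b k) z)%C <= B / m ^ 2 * (/ 2) ^ k.
Proof.
  intros Hb Hx Hm Hz. destruct (Hb k) as [H1 H2]. rewrite Cmod_mult.
  replace (B / m ^ 2 * (/ 2) ^ k) with (B * ((/ 2) ^ k / m ^ 2)) by (field; lra).
  apply Rmult_le_compat; try apply Cmod_ge_0; auto. eapply Rle_trans.
  apply (Cmod_tg_le p (b k) z m); auto. lra. split; auto. apply den_ge; auto.
  apply Rmult_le_compat_r; auto. left; apply Rinv_0_lt_compat, pow_lt; auto.
Qed.

Lemma absC_x_ta p b x B z : test_points p b -> (forall k, Cmod (x k) <= B) -> Cmod z < 1 -> absC (fun k => x k * ta p (b k) z)%C.
Proof.
  intros Hb Hx Hz. assert (B0 : 0 <= B) by (eapply Rle_trans; [apply Cmod_ge_0 | apply (Hx O)]).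
  apply (Cmod_geom_absC _ (/ 2) (B / (1 - Cmod z))). lra. apply Rmult_le_pos; auto. left; apply Rinv_0_lt_compat; lra.
  intros k. apply x_ta_le; auto; lra.
Qed.

Lemma absC_x_tg p b x B z : test_points p b -> (forall k, Cmod (x k) <= B) -> Cmod z < 1 -> absC (fun k => x k * tg p (b k) z)%C.
Proof.
  intros Hb Hx Hz. assert (B0 : 0 <= B) by (eapply Rle_trans; [apply Cmod_ge_0 | apply (Hx O)]).
  apply (Cmod_geom_absC _ (/ 2) (B / (1 - Cmod z) ^ 2)). lra. apply Rmult_le_pos; auto. left; apply Rinv_0_lt_compat, pow_lt; lra.
  intros k. apply x_tg_le; auto; lra.
Qed.

Lemma embed_diff p b x B z : test_points p b -> (forall k, Cmod (x k) <= B) -> Cmod z < 1 ->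
  Cdiff (embed p b x) z (CSer (fun k => x k * tg p (b k) z)%C).
Proof.
  intros Hb Hx Hz. assert (B0 : 0 <= B) by (eapply Rle_trans; [apply Cmod_ge_0 | apply (Hx O)]).
  set (d := (1 - Cmod z) / 2). assert (Hd : 0 < d) by (unfold d; lra).
  assert (Hw : forall w, Cmod (w - z) < d -> Cmod w <= 1 - d).
  { intros w Hw. replace w with ((w - z) + z)%C by ring. eapply Rle_trans; [apply Cmod_triangle|]. unfold d in *. lra. }
  apply (Cdiff_CSer (fun k w => x k * ta p (b k) w)%C (fun k => x k * tg p (b k) z)%C (fun k => B / d ^ 3 * (/ 2) ^ k) z d); auto.
  - apply ex_series_scal_R. apply ex_series_geom. rewrite Rabs_pos_eq; lra.
  - apply (absC_x_tg p b x B); auto.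
  - intros w Hwd. apply (absC_x_ta p b x B); auto. specialize (Hw w Hwd). lra.
  - intros k w Hwd. destruct (Hb k) as [H1 H2]. specialize (Hw w Hwd).
    assert (Hzd : Cmod z <= 1 - d) by (unfold d; lra).
    pose proof (den_ge (b k) w d H1 Hw) as Dw. pose proof (den_ge (b k) z d H1 Hzd) as Dz.
    pose proof (kap_den_neq (b k) w H1 ltac:(lra)) as Nw.
    pose proof (kap_den_neq (b k) z H1 ltac:(lra)) as Nz.
    (* The exact second-order remainder of [ta], as required by [Cdiff_CSer]. *)
    replace (x k * ta p (b k) w - x k * ta p (b k) z - (w - z) * (x k * tg p (b k) z))%C with
      (x k * (RtoC (cst p (b k)) * (((w - z) * (w - z)) * (Cconj (b k) * / ((1 - Cconj (b k) * w) * ((1 - Cconj (b k) * z) * (1 - Cconj (b k) * z)))))))%C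
      by (unfold ta, tg; field; auto).
    rewrite !Cmod_mult, Cmod_inv, !Cmod_mult, Cmod_conj, Cmod_R, Rabs_pos_eq by (auto using cst_ge0; repeat apply Cmult_neq_0; auto).
    set (Aw := Cmod (1 - Cconj (b k) * w)) in *. set (Az := Cmod (1 - Cconj (b k) * z)) in *.
    assert (HI : / (Aw * (Az * Az)) <= / d ^ 3).
    { apply Rinv_le_contravar. apply pow_lt; auto. replace (d ^ 3) with (d * (d * d)) by ring.
      assert (d * d <= Az * Az) by (apply Rmult_le_compat; lra). apply Rmult_le_compat; try lra. nra. }
    assert (HI0 : 0 < / (Aw * (Az * Az))). { apply Rinv_0_lt_compat. assert (0 < Az * Az) by nra. apply Rmult_lt_0_compat; lra. }
    pose proof (Cmod_ge_0 (b k)). pose proof (Cmod_ge_0 (w - z)). pose proof (cst_ge0 p (b k)). pose proof (Cmod_ge_0 (x k)). specialize (Hx k).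
    replace (B / d ^ 3 * (/ 2) ^ k * Cmod (w - z) ^ 2) with (B * ((/ 2) ^ k * ((Cmod (w - z) * Cmod (w - z)) * (1 * / d ^ 3)))) by (field; lra).
    assert (0 <= Cmod (w - z) * Cmod (w - z)) by nra.
    apply Rmult_le_compat; auto. repeat apply Rmult_le_pos; lra.
    apply Rmult_le_compat; auto. repeat apply Rmult_le_pos; lra.
    apply Rmult_le_compat_l; auto. apply Rmult_le_compat; lra.
Qed.

Lemma embed_hol p b x B : test_points p b -> (forall k, Cmod (x k) <= B) -> hol 1 (embed p b x).
Proof. intros Hb Hx z Hz. eexists. apply (embed_diff p b x B); auto. Qed.

Lemma embed_0 p b x : embed p b x 0%C = 0%C.
Proof.
  unfold embed. rewrite (CSer_ext _ (fun k => 0 * 0)%C) by (intros; rewrite ta_0; ring).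
  rewrite (CSer_scal 0%C (fun _ => 0%C)). ring. apply (Cmod_geom_absC _ 0 0); try lra. intros; rewrite Cmod_0; lra.
Qed.

Lemma embed_linear p b a x y Bx By z : test_points p b -> (forall k, Cmod (x k) <= Bx) -> (forall k, Cmod (y k) <= By) ->
  Cmod z < 1 -> embed p b (fun k => a * x k + y k)%C z = (a * embed p b x z + embed p b y z)%C.
Proof.
  intros Hb Hx Hy Hz. unfold embed. pose proof (absC_x_ta p b x Bx z Hb Hx Hz) as A1. pose proof (absC_x_ta p b y By z Hb Hy Hz) as A2.
  rewrite <- CSer_scal, <- CSer_plus; auto. apply CSer_ext. intros; ring. apply absC_scal; auto.
Qed.

Lemma lp_bounded p x : 1 <= p -> in_lp p x -> forall k, Cmod (x k) <= 1 + Series (fun n => rpow (Cmod (x n)) p).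
Proof.
  intros Hp Hx k. eapply Rle_trans. apply (le_1_rpow _ p Hp). apply Cmod_ge_0. apply Rplus_le_compat_l.
  pose proof (Rsumb_le_Series (fun n => rpow (Cmod (x n)) p) (S k) ltac:(intros; apply rpow_ge0) Hx) as H. simpl in H.
  assert (0 <= Rsumb (fun n => rpow (Cmod (x n)) p) k) by (apply Rsumb_ge0; intros; apply rpow_ge0). lra.
Qed.

Lemma W_embed_deriv p phi vphi b x B z : hol 1 phi -> selfmap vphi -> test_points p b -> (forall k, Cmod (x k) <= B) -> Cmod z < 1 ->
  deriv (W phi vphi (embed p b x)) z = CSer (fun k => x k * deriv (W phi vphi (ta p (b k))) z)%C.
Proof.
  intros Hphi Hv Hb Hx Hz. assert (Hvz : Cmod (vphi z) < 1) by (apply Hv; auto).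
  pose proof (absC_x_ta p b x B _ Hb Hx Hvz) as A1. pose proof (absC_x_tg p b x B _ Hb Hx Hvz) as A2.
  rewrite (Cdiff_deriv _ _ _ (W_diff phi vphi _ z Hphi Hv (embed_hol p b x B Hb Hx) Hz)).
  rewrite (Cdiff_deriv _ _ _ (embed_diff p b x B _ Hb Hx Hvz)). unfold embed.
  rewrite <- !CSer_scal, <- CSer_plus by (auto; apply absC_scal; auto). apply CSer_ext. intros k. destruct (Hb k) as [H1 _].
  rewrite (Cdiff_deriv _ _ _ (W_diff phi vphi _ z Hphi Hv (ta_hol p (b k) H1) Hz)). rewrite ta_deriv by auto. ring.
Qed.

(** On a fixed circle the derivatives of the partial sums converge uniformly, so [gliding_upper]
    passes to the limit by [Mp_limit]. *)
Lemma embed_Sp p b eps x : 1 <= p -> test_points p b -> 0 <= eps <= 1 ->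
  (forall r, 0 <= r < 1 -> exists X, gliding p (fun k t => tg p (b k) (circ r t)) X eps) -> in_lp p x ->
  in_Sp p (embed p b x) /\
  Sp_norm p (embed p b x) <= rpow (rpow 2 p * rpow 2 (2 * p) + 3 * rpow 2 p ^ 2 * eps) (/ p) * lp_norm p x.
Proof.
  intros Hp Hb He HG Hlp. pose proof (lp_bounded p x Hp Hlp) as Hx. pose proof (rpow_2_ge2 p Hp) as H2.
  set (Sx := Series (fun n => rpow (Cmod (x n)) p)) in *. set (C2 := rpow 2 p * rpow 2 (2 * p) + 3 * rpow 2 p ^ 2 * eps).
  assert (S0 : 0 <= Sx) by (apply Series_ge0; auto; intros; apply rpow_ge0).
  assert (C20 : 0 <= C2).
  { unfold C2. pose proof (rpow_ge0 2 (2 * p)). pose proof (pow_le (rpow 2 p) 2 ltac:(lra)).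
    apply Rplus_le_le_0_compat; repeat apply Rmult_le_pos; lra. }
  pose proof (embed_hol p b x _ Hb Hx) as HE.
  assert (HN : 0 <= rpow C2 (/ p) * lp_norm p x) by (apply Rmult_le_pos; apply rpow_ge0).
  destruct (Sp_norm_ub p (embed p b x) (rpow C2 (/ p) * lp_norm p x)) as [HS [_ HS2]]; auto; [lra | |].
  - intros r Hr. unfold lp_norm. fold Sx. rewrite rpow_mult, !rpow_inv_r by (try apply rpow_ge0; lra).
    assert (Hcirc : forall t, Cmod (circ r t) = r) by (intros; rewrite Cmod_circ, Rabs_pos_eq; lra).
    apply Mp_limit. lra. apply (CC_hol 1); auto. apply hol_deriv_hol1; auto. intros e Hee.
    assert (Hm : 0 < 1 - r) by lra. assert (B0 : 0 <= (1 + Sx) / (1 - r) ^ 2).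
    { apply Rmult_le_pos. lra. left; apply Rinv_0_lt_compat, pow_lt; lra. }
    destruct (geom_small (/ 2) _ e ltac:(lra) B0 Hee) as [L HL]. specialize (HL L (le_n _)).
    destruct (HG r Hr) as [X HX].
    exists (fun t => Csumb (fun k => x k * tg p (b k) (circ r t))%C L). split; [|split].
    + apply (CC_Csumb (fun k t => x k * tg p (b k) (circ r t))%C). intros k. apply CC_mult. apply CC_const. apply HX.
    + intros t. rewrite (Cdiff_deriv _ _ _ (embed_diff p b x _ (circ r t) Hb Hx ltac:(rewrite Hcirc; lra))).
      eapply Rle_trans; [|exact HL]. apply CSer_geom_tail; auto. lra. intros k.
      apply x_tg_le; auto. rewrite Hcirc. lra.
    + eapply Rle_trans. apply (gliding_upper p _ X eps (rpow 2 (2 * p)) x L Hp ltac:(lra) HX).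
      * intros k. rewrite <- (Mp_avg p (tg p (b k))). apply tg_Mp; auto. apply Hb.
      * apply Rmult_le_compat_l; auto. apply Rsumb_le_Series; auto. intros; apply rpow_ge0.
  - split; auto. rewrite embed_0, Cmod_0 in HS2. lra.
Qed.

(** For each K take a circle beyond the radii of the first K humps and a partial sum of length L >=
    K that approximates (W (embed x))' there. [gliding_lower] bounds the first K coefficients; then
    K -> infinity. *)
Lemma W_embed_lower p phi vphi b c eps x : 1 <= p -> hol 1 phi -> selfmap vphi -> test_points p b ->
  0 < c -> 0 < eps -> 8 * rpow 2 p ^ 2 * eps <= c ->
  (forall r, 0 <= r < 1 -> exists X, gliding p (fun k t => deriv (W phi vphi (ta p (b k))) (circ r t)) X eps) ->
  (forall k, exists rk, 0 <= rk < 1 /\ forall r, rk <= r < 1 ->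
       c <= avg (fun t => rpow (Cmod (deriv (W phi vphi (ta p (b k))) (circ r t))) p)) ->
  in_lp p x -> in_Sp p (W phi vphi (embed p b x)) ->
  lp_norm p x <= rpow (2 * rpow 2 p ^ 2 / c) (/ p) * Sp_norm p (W phi vphi (embed p b x)).
Proof.
  intros Hp Hphi Hv Hb Hc He Hec HG Hlow Hlp HW. pose proof (lp_bounded p x Hp Hlp) as Hx. pose proof (rpow_2_ge2 p Hp) as H2.
  set (Sx := Series (fun n => rpow (Cmod (x n)) p)) in *. set (th := rpow 2 p) in *.
  assert (S0 : 0 <= Sx) by (apply Series_ge0; auto; intros; apply rpow_ge0).
  destruct (Sp_norm_Mp p _ HW ltac:(lra)) as (N0 & _ & HN). set (N := Sp_norm p (W phi vphi (embed p b x))) in *.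
  assert (Hsum : forall K, (c - 2 * eps) * Rsumb (fun j => rpow (Cmod (x j)) p) K <= th ^ 2 * rpow N p + 2 * th ^ 2 * eps * Sx).
  { intros K.
    (* The radii [rk] may approach 1 as k grows, so only finitely many humps are handled on one
       circle. *)
    assert (HR : exists R0, 0 <= R0 < 1 /\ forall k, (k < K)%nat -> forall r, R0 <= r < 1 ->
       c <= avg (fun t => rpow (Cmod (deriv (W phi vphi (ta p (b k))) (circ r t))) p)).
    { induction K. exists 0. split. lra. intros; lia. destruct IHK as (R1 & HR1 & H1). destruct (Hlow K) as (R2 & HR2 & H3).
      exists (Rmax R1 R2). pose proof (Rmax_l R1 R2). pose proof (Rmax_r R1 R2). split.
      split. lra. apply Rmax_lub_lt; lra. intros k Hk r Hr. destruct (Nat.eq_dec k K) as [->|Hne].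
      apply H3. lra. apply H1. lia. lra. }
    destruct HR as (r & Hr & Hcr). destruct (HG r Hr) as [X HX].
    apply le_epsilon. intros e Hee. set (e1 := rpow (e / th ^ 2) (/ p)).
    assert (Ht2 : 0 < th ^ 2) by (apply pow_lt; lra).
    assert (Hee1 : 0 < e / th ^ 2) by (apply Rdiv_lt_0_compat; auto).
    assert (E1 : 0 < e1) by (apply rpow_gt0; auto). assert (E2 : rpow e1 p = e / th ^ 2) by (apply rpow_inv_r; lra).
    assert (Hcirc : forall t, Cmod (circ r t) < 1) by (intros; rewrite Cmod_circ, Rabs_pos_eq; lra).
    (* The largest value of |vphi| on the circle keeps its image at distance m > 0 from the
       boundary, which gives a geometric tail uniform in t. *)
    destruct (circle_max vphi r (proj1 Hv) Hr) as [t0 Ht0].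
    assert (Hs : Cmod (vphi (circ r t0)) < 1) by (apply selfmap_circ; auto).
    set (m := 1 - Cmod (vphi (circ r t0))). assert (Hm : 0 < m) by (unfold m; lra).
    destruct (Cmod_hol_bounded (deriv phi) r (hol_deriv_hol1 _ Hphi) Hr) as (B1 & HB1 & Q1).
    destruct (Cmod_hol_bounded phi r Hphi Hr) as (B2 & HB2 & Q2).
    destruct (Cmod_hol_bounded (deriv vphi) r (hol_deriv_hol1 _ (proj1 Hv)) Hr) as (B3 & HB3 & Q3).
    set (Bt := B1 * ((1 + Sx) / m) + B2 * B3 * ((1 + Sx) / m ^ 2)).
    assert (D1 : 0 <= (1 + Sx) / m) by (apply Rmult_le_pos; [lra | left; apply Rinv_0_lt_compat; auto]).
    assert (D2 : 0 <= (1 + Sx) / m ^ 2) by (apply Rmult_le_pos; [lra | left; apply Rinv_0_lt_compat, pow_lt; auto]).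
    assert (Bt0 : 0 <= Bt) by (apply Rplus_le_le_0_compat; apply Rmult_le_pos; auto; apply Rmult_le_pos; auto).
    assert (Hterm : forall t k, Cmod (x k * deriv (W phi vphi (ta p (b k))) (circ r t))%C <= Bt * (/ 2) ^ k).
    { intros t k. destruct (Hb k) as [Hbk _].
      rewrite (Cdiff_deriv _ _ _ (W_diff phi vphi _ _ Hphi Hv (ta_hol p (b k) Hbk) (Hcirc t))). set (z := circ r t).
      assert (Hvz : Cmod (vphi z) <= 1 - m) by (unfold m; specialize (Ht0 t); fold z in Ht0; lra).
      rewrite ta_deriv by (auto; lra).
      replace (x k * (deriv phi z * ta p (b k) (vphi z) + phi z * deriv vphi z * tg p (b k) (vphi z)))%C with
        (deriv phi z * (x k * ta p (b k) (vphi z)) + phi z * deriv vphi z * (x k * tg p (b k) (vphi z)))%C by ring.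
      eapply Rle_trans; [apply Cmod_triangle|]. unfold Bt. rewrite Rmult_plus_distr_r, !(Rmult_assoc _ _ ((/ 2) ^ k)).
      rewrite (Cmod_mult (deriv phi z)), (Cmod_mult (phi z * deriv vphi z)), (Cmod_mult (phi z)).
      pose proof (x_ta_le p b x _ m k (vphi z) Hb Hx Hm Hvz) as T1. pose proof (x_tg_le p b x _ m k (vphi z) Hb Hx Hm Hvz) as T2.
      apply Rplus_le_compat; apply Rmult_le_compat; auto; try apply Cmod_ge_0; try apply Q1.
      apply Rmult_le_pos; apply Cmod_ge_0.
      apply Rmult_le_compat; try apply Cmod_ge_0; [apply Q2 | apply Q3]. }
    destruct (geom_small (/ 2) Bt e1 ltac:(lra) Bt0 E1) as [L0 HL0]. set (L := max L0 K). specialize (HL0 L ltac:(unfold L; lia)).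
    set (F := deriv (W phi vphi (embed p b x))) in *.
    assert (CF : Cts (fun t => rpow (Cmod (F (circ r t))) p)).
    { apply (Cts_rpow_hol 1); auto; [|lra]. apply hol_deriv_hol1, (in_Sp_hol p); auto. }
    pose proof HX as (Ch & _).
    assert (Fn : avg (fun t => rpow (Cmod (Csumb (fun k => x k * deriv (W phi vphi (ta p (b k))) (circ r t))%C L)) p) <=
      th * (rpow N p + e / th ^ 2)).
    { specialize (HN r Hr). rewrite Mp_avg in HN.
      apply Rle_trans with (avg (fun t => th * (rpow (Cmod (F (circ r t))) p + e / th ^ 2))).
      - apply avg_le.
        + apply (Cts_rpow_Cmod p (fun t => Csumb (fun k => x k * deriv (W phi vphi (ta p (b k))) (circ r t))%C L)); auto.
          apply (CC_Csumb (fun k t => x k * deriv (W phi vphi (ta p (b k))) (circ r t))%C). intros k. apply CC_mult; auto. apply CC_const.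
        + apply Cts_mult. apply Cts_const. apply Cts_plus; auto. apply Cts_const.
        + intros t. rewrite <- E2. unfold th.
          eapply Rle_trans; [|apply rpow_add_le; try apply Cmod_ge_0; lra].
          apply rpow_le. lra. split. apply Cmod_ge_0. unfold F.
          rewrite (W_embed_deriv p phi vphi b x _ (circ r t) Hphi Hv Hb Hx (Hcirc t)).
          pose proof (CSer_geom_tail _ (/ 2) Bt L ltac:(lra) Bt0 (Hterm t)) as HT. cbv beta in HT.
          set (P := Csumb (fun k => x k * deriv (W phi vphi (ta p (b k))) (circ r t))%C L) in *.
          set (Q := CSer (fun k => x k * deriv (W phi vphi (ta p (b k))) (circ r t))%C) in *.
          replace P with (Q + (P - Q))%C at 1 by ring. eapply Rle_trans; [apply Cmod_triangle|]. lra.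
      - rewrite avg_scal, avg_plus, avg_const by (auto; try apply Cts_const; apply Cts_plus; auto; apply Cts_const).
        apply Rmult_le_compat_l; lra. }
    eapply Rle_trans. apply (gliding_lower p _ X eps c x K L Hp ltac:(lra) HX ltac:(unfold L; lia)).
    intros k Hk. apply Hcr; auto. lra. fold th.
    apply Rle_trans with (th * (th * (rpow N p + e / th ^ 2)) + 2 * th ^ 2 * eps * Sx).
    - apply Rplus_le_compat. apply Rmult_le_compat_l. lra. exact Fn.
      apply Rmult_le_compat_l. repeat apply Rmult_le_pos; lra. apply Rsumb_le_Series; auto. intros; apply rpow_ge0.
    - right. field. lra. }
  (* Both error terms are at most (c/4) Sx and are absorbed on the left, which leaves (c/2) Sx. *)
  assert (Ht4 : 4 <= th ^ 2) by nra.
  assert (He4 : 2 * eps <= c / 4) by nra.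
  assert (Hfin : Sx <= (th ^ 2 * rpow N p + 2 * th ^ 2 * eps * Sx) / (c - 2 * eps)).
  { apply Series_le_bound; auto. intros K. apply Rmult_le_reg_l with (c - 2 * eps). lra.
    eapply Rle_trans. apply Hsum. right. field. lra. }
  assert (Hfin2 : (c - 2 * eps) * Sx <= th ^ 2 * rpow N p + 2 * th ^ 2 * eps * Sx).
  { apply Rle_trans with ((c - 2 * eps) * ((th ^ 2 * rpow N p + 2 * th ^ 2 * eps * Sx) / (c - 2 * eps))).
    apply Rmult_le_compat_l; lra. right. field. lra. }
  assert (Hs1 : 2 * th ^ 2 * eps * Sx <= c / 4 * Sx) by (apply Rmult_le_compat_r; lra).
  assert (Hs2 : 2 * eps * Sx <= c / 4 * Sx) by (apply Rmult_le_compat_r; lra).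
  assert (Hmain : Sx <= 2 * th ^ 2 / c * rpow N p).
  { apply Rmult_le_reg_l with (c / 2). lra. replace (c / 2 * (2 * th ^ 2 / c * rpow N p)) with (th ^ 2 * rpow N p) by (field; lra). lra. }
  unfold lp_norm. fold Sx. rewrite <- (rpow_inv_l N p) at 1 by lra.
  assert (0 <= 2 * th ^ 2 / c) by (left; apply Rdiv_lt_0_compat; lra).
  rewrite <- rpow_mult by (auto; apply rpow_ge0). apply rpow_le. left; apply Rinv_0_lt_compat; lra. lra.
Qed.

(** * Proof of the theorem *)

Lemma in_Sp_ext p f g : (forall z, Cmod z < 1 -> f z = g z) -> in_Sp p f -> in_Sp p g.
Proof.
  intros E H. apply in_Sp_iff in H as [H [M HM]]. apply in_Sp_iff. split. apply (hol_ext 1 f g); auto.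
  exists M. intros r Hr. eapply Rle_trans; [|apply (HM r Hr)]. right. rewrite !Mp_avg. apply avg_ext. intros t.
  rewrite (deriv_ext 1 f g); auto. rewrite Cmod_circ, Rabs_pos_eq; lra.
Qed.

(** A triangle inequality up to the constant 5 = 4 + 1: with V the sum of the two norms, 2^p (V^p +
    V^p) <= (4 V)^p bounds the derivative part, and the values at 0 add one more V. *)
Lemma Sp_lin p a f g : 1 <= p -> in_Sp p f -> in_Sp p g ->
  in_Sp p (fun z => a * f z + g z)%C /\ Sp_norm p (fun z => a * f z + g z)%C <= 5 * (Cmod a * Sp_norm p f + Sp_norm p g).
Proof.
  intros Hp Hf Hg. pose proof (in_Sp_hol _ _ Hf) as hf. pose proof (in_Sp_hol _ _ Hg) as hg. pose proof (rpow_2_ge2 p Hp) as H2.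
  destruct (Sp_norm_Mp p f Hf ltac:(lra)) as (F0 & F1 & FM). destruct (Sp_norm_Mp p g Hg ltac:(lra)) as (G0 & G1 & GM).
  set (NF := Sp_norm p f) in *. set (NG := Sp_norm p g) in *. pose proof (Cmod_ge_0 a) as Ha.
  assert (D : forall z, Cmod z < 1 -> Cdiff (fun z => a * f z + g z)%C z (a * deriv f z + deriv g z)%C).
  { intros z Hz. apply Cdiff_plus. apply Cdiff_scal. apply (hol_deriv 1); auto. apply (hol_deriv 1); auto. }
  assert (aF0 : 0 <= Cmod a * NF) by (apply Rmult_le_pos; auto). set (V := Cmod a * NF + NG).
  destruct (Sp_norm_ub p (fun z => a * f z + g z)%C (4 * V)) as [HS [_ HN]]; try lra.
  - intros z Hz. eexists. apply D; auto.
  - unfold V; lra.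
  - intros r Hr. rewrite Mp_avg.
    assert (Hcirc : forall t, Cmod (circ r t) < 1) by (intros; rewrite Cmod_circ, Rabs_pos_eq; lra).
    specialize (FM r Hr). specialize (GM r Hr). rewrite Mp_avg in FM, GM.
    assert (C1 : Cts (fun t => rpow (Cmod (deriv f (circ r t))) p)) by (apply (Cts_rpow_hol 1); auto; [apply hol_deriv_hol1; auto | lra]).
    assert (C2 : Cts (fun t => rpow (Cmod (deriv g (circ r t))) p)) by (apply (Cts_rpow_hol 1); auto; [apply hol_deriv_hol1; auto | lra]).
    apply Rle_trans with (avg (fun t => rpow 2 p * (rpow (Cmod a) p * rpow (Cmod (deriv f (circ r t))) p + rpow (Cmod (deriv g (circ r t))) p))).
    + apply avg_le.
      * apply (Cts_rpow_hol 1); auto; [|lra]. apply hol_deriv_hol1. intros z Hz. eexists. apply D; auto.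
      * apply Cts_mult. apply Cts_const. apply Cts_plus; auto. apply Cts_mult; auto. apply Cts_const.
      * intros t. rewrite (Cdiff_deriv _ _ _ (D _ (Hcirc t))). rewrite <- rpow_mult, <- Cmod_mult by apply Cmod_ge_0.
        eapply Rle_trans; [|apply rpow_add_le; try apply Cmod_ge_0; lra].
        apply rpow_le. lra. split. apply Cmod_ge_0. apply Cmod_triangle.
    + rewrite avg_scal, avg_plus, avg_scal by (auto; try (apply Cts_plus; auto); apply Cts_mult; auto; apply Cts_const).
      replace (4 * V) with (2 * (2 * V)) by ring. rewrite (rpow_mult 2) by (unfold V; lra). apply Rmult_le_compat_l. lra.
      rewrite (rpow_mult 2) by (unfold V; lra).
      assert (rpow (Cmod a) p * avg (fun t => rpow (Cmod (deriv f (circ r t))) p) <= rpow V p).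
      { apply Rle_trans with (rpow (Cmod a * NF) p). rewrite rpow_mult by auto. apply Rmult_le_compat_l; auto. apply rpow_ge0.
        apply rpow_le. lra. unfold V; lra. }
      assert (rpow NG p <= rpow V p) by (apply rpow_le; unfold V; lra).
      pose proof (rpow_ge0 V p). nra.
  - split; auto. eapply Rle_trans. exact HN. unfold V.
    assert (Cmod (a * f 0%C + g 0%C) <= Cmod a * NF + NG).
    { eapply Rle_trans; [apply Cmod_triangle|]. rewrite Cmod_mult. assert (Cmod a * Cmod (f 0%C) <= Cmod a * NF) by (apply Rmult_le_compat_l; auto). lra. }
    lra.
Qed.

Lemma Sp_sub p f g : 1 <= p -> in_Sp p f -> in_Sp p g ->
  in_Sp p (fun z => f z - g z)%C /\ Sp_norm p (fun z => f z - g z)%C <= 5 * (Sp_norm p f + Sp_norm p g).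
Proof.
  intros Hp Hf Hg. destruct (Sp_lin p (RtoC (-1)) g f Hp Hg Hf) as [H1 H2].
  assert (E : forall z, Cmod z < 1 -> (RtoC (-1) * g z + f z)%C = (f z - g z)%C).
  { intros z _. apply C_eq; simpl; ring. }
  rewrite (Sp_norm_ext p _ _ (in_Sp_hol _ _ H1) E) in H2. split. exact (in_Sp_ext p _ _ E H1).
  rewrite Cmod_R, Rabs_left in H2 by lra. lra.
Qed.

Lemma in_lp_lin p a x y : 1 <= p -> in_lp p x -> in_lp p y -> in_lp p (fun n => a * x n + y n)%C.
Proof.
  intros Hp Hx Hy. unfold in_lp in *.
  apply (ex_series_le_R _ (fun n => rpow 2 p * rpow (Cmod a) p * rpow (Cmod (x n)) p + rpow 2 p * rpow (Cmod (y n)) p)).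
  - intros n. split. apply rpow_ge0. rewrite Rmult_assoc, <- Rmult_plus_distr_l, <- rpow_mult, <- Cmod_mult by apply Cmod_ge_0.
    eapply Rle_trans; [|apply rpow_add_le; try apply Cmod_ge_0; lra].
    apply rpow_le. lra. split. apply Cmod_ge_0. apply Cmod_triangle.
  - apply (ex_series_plus (V := R_NormedModule)); apply ex_series_scal_R; auto.
Qed.

Definition unit_seq (n k : nat) : C := if Nat.eqb k n then RtoC 1 else RtoC 0.

Lemma unit_seq_lp p n : in_lp p (unit_seq n).
Proof.
  apply (ex_series_bounded _ 1). intros; apply rpow_ge0.
  assert (H : forall m, Rsumb (fun k => rpow (Cmod (unit_seq n k)) p) m = if Nat.ltb n m then 1 else 0).
  { induction m. auto. simpl Rsumb. rewrite IHm. unfold unit_seq. destruct (Nat.eqb_spec m n) as [->|Hne].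
    - rewrite Nat.ltb_irrefl. replace (n <? S n)%nat with true by (symmetry; apply Nat.ltb_lt; lia). rewrite Cmod_1, rpow_1. ring.
    - rewrite Cmod_0, rpow_0. destruct (Nat.ltb_spec n m).
      + replace (n <? S m)%nat with true by (symmetry; apply Nat.ltb_lt; lia). ring.
      + replace (n <? S m)%nat with false by (symmetry; apply Nat.ltb_ge; lia). ring. }
  intros m. rewrite H. destruct (Nat.ltb n m); lra.
Qed.

(** Keeps the indices up to and including n, to match [sum_n] in the linear independence clause. *)
Definition trunc (a : nat -> C) (n k : nat) : C := if Nat.leb k n then a k else RtoC 0.

Lemma zero_lp p : in_lp p (fun _ => RtoC 0).
Proof.
  apply (ex_series_bounded _ 0). intros; apply rpow_ge0. rewrite Cmod_0, rpow_0. intros m. induction m; simpl; lra.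
Qed.

Lemma trunc_0 a : trunc a 0 = (fun k => a O * unit_seq 0 k + RtoC 0)%C.
Proof.
  apply functional_extensionality. intros [|k]; unfold trunc, unit_seq; simpl; ring.
Qed.

Lemma trunc_S a n : trunc a (S n) = (fun k => a (S n) * unit_seq (S n) k + trunc a n k)%C.
Proof.
  apply functional_extensionality. intros k. unfold trunc, unit_seq. destruct (Nat.eqb_spec k (S n)) as [->|Hne].
  - rewrite Nat.leb_refl. replace (S n <=? n)%nat with false by (symmetry; apply Nat.leb_gt; lia). ring.
  - destruct (Nat.leb_spec k n).
    + replace (k <=? S n)%nat with true by (symmetry; apply Nat.leb_le; lia). ring.
    + replace (k <=? S n)%nat with false by (symmetry; apply Nat.leb_gt; lia). ring.
Qed.

Lemma trunc_lp p a n : 1 <= p -> in_lp p (trunc a n).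
Proof.
  intros Hp. induction n.
  - rewrite trunc_0. apply (in_lp_lin p (a O) (unit_seq 0) (fun _ => RtoC 0)); auto. apply unit_seq_lp. apply zero_lp.
  - rewrite trunc_S. apply in_lp_lin; auto. apply unit_seq_lp.
Qed.

Lemma lp_norm_eq0 p x : 1 <= p -> in_lp p x -> lp_norm p x <= 0 -> forall k, x k = RtoC 0.
Proof.
  intros Hp Hx H k. apply Cmod_eq_0. apply Rle_antisym; [|apply Cmod_ge_0].
  pose proof (Rsumb_le_Series (fun n => rpow (Cmod (x n)) p) (S k) ltac:(intros; apply rpow_ge0) Hx) as Hs. simpl in Hs.
  assert (0 <= Rsumb (fun n => rpow (Cmod (x n)) p) k) by (apply Rsumb_ge0; intros; apply rpow_ge0).
  apply Rnot_lt_le. intros Hk. pose proof (rpow_gt0 (Cmod (x k)) p Hk) as H1.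
  pose proof (rpow_gt0 (Series (fun n => rpow (Cmod (x n)) p)) (/ p) ltac:(lra)) as H3. unfold lp_norm in H. lra.
Qed.

(** The lower bound for W on the range of the embedding is stable under approximation, so W is
    bounded below on the closure of that range, which is an infinite-dimensional closed subspace. *)
Lemma fixes_lp_not_strictly_singular p phi vphi : 1 <= p -> bounded_on_Sp p (W phi vphi) -> fixes_lp_copy p (W phi vphi) ->
  ~ strictly_singular_on_Sp p (W phi vphi).
Proof.
  intros Hp [HT [K HK]] (E & c1 & c2 & d & Hc1 & Hd & HE & Hlin & Hn & Hlow) HSS.
  assert (E0 : forall z, Cmod z < 1 -> E (fun _ => RtoC 0) z = 0%C).
  { intros z Hz. pose proof (Hlin (RtoC (-1)) (fun _ => RtoC 0) (fun _ => RtoC 0) (zero_lp p) (zero_lp p) z Hz) as H. cbv beta in H.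
    replace (fun n : nat => (RtoC (-1) * RtoC 0 + RtoC 0)%C) with (fun _ : nat => RtoC 0) in H by (apply functional_extensionality; intros; ring).
    rewrite H. apply C_eq; simpl; ring. }
  assert (N0 : lp_norm p (fun _ => RtoC 0) = 0).
  { unfold lp_norm. rewrite (Series_ext _ (fun _ => 0 * 0)). rewrite Series_scal_l, Rmult_0_l. apply rpow_0.
    intros; rewrite Cmod_0, rpow_0; ring. }
  assert (Z0 : in_Sp p (fun _ => 0%C)).
  { apply (in_Sp_ext p (E (fun _ => RtoC 0))). intros z Hz. apply E0; auto. apply HE, zero_lp. }
  assert (ZN : Sp_norm p (fun _ => 0%C) <= 0).
  { rewrite <- (Sp_norm_ext p (E (fun _ => RtoC 0)) (fun _ => 0%C)). destruct (Hn _ (zero_lp p)) as [_ H]. rewrite N0 in H. lra.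
    apply (in_Sp_hol p), HE, zero_lp. intros z Hz. apply E0; auto. }
  (* The closure instead of the range: closedness is then immediate, and membership does not depend
     on values outside the disc, where E need not be linear. *)
  set (MM := fun f => in_Sp p f /\ forall e, 0 < e -> exists x, in_lp p x /\ Sp_norm p (fun z => f z - E x z)%C <= e).
  assert (ME : forall x, in_lp p x -> MM (E x)).
  { intros x Hx. split. apply HE; auto. intros e He. exists x. split; auto.
    rewrite (Sp_norm_ext p (fun z => E x z - E x z)%C (fun _ => 0%C)). lra.
    apply hol_minus; apply (in_Sp_hol p), HE; auto. intros; ring. }
  apply (HSS MM).
  - split; [|split; [|split; [|split]]].
    + intros f [H _]; auto.
    + split; auto. intros e He. exists (fun _ => RtoC 0). split. apply zero_lp.
      rewrite (Sp_norm_ext p _ (fun _ => 0%C)). lra. apply (hol_minus (fun _ => 0%C)); apply (in_Sp_hol p); auto. apply HE, zero_lp.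
      intros z Hz. rewrite E0 by auto. ring.
    + intros a f g [Hf Af] [Hg Ag]. split. apply (Sp_lin p a f g); auto. intros e He. pose proof (Cmod_ge_0 a) as Ha.
      destruct (Af (e / (10 * (Cmod a + 1)))) as (x & Hx & Dx). { apply Rdiv_lt_0_compat; lra. }
      destruct (Ag (e / 10)) as (y & Hy & Dy). lra.
      exists (fun n => a * x n + y n)%C. split. apply in_lp_lin; auto.
      destruct (Sp_sub p f (E x) Hp Hf (HE _ Hx)) as [S1 _]. destruct (Sp_sub p g (E y) Hp Hg (HE _ Hy)) as [S2 _].
      destruct (Sp_lin p a _ _ Hp S1 S2) as [S3 S4].
      rewrite <- (Sp_norm_ext p (fun z => a * (f z - E x z) + (g z - E y z))%C).
      * eapply Rle_trans. exact S4.
        assert (Cmod a * Sp_norm p (fun z => f z - E x z)%C <= e / 10).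
        { apply Rle_trans with ((Cmod a + 1) * (e / (10 * (Cmod a + 1)))).
          - apply Rmult_le_compat; try lra. apply (Sp_norm_Mp p _ S1). lra.
          - right. field. lra. }
        lra.
      * apply (in_Sp_hol p); auto.
      * intros z Hz. rewrite Hlin by auto. ring.
    + intros g h Hg Hh Hl. split; auto. intros e He. apply is_lim_seq_spec in Hl.
      assert (e20 : 0 < e / 10) by lra. destruct (Hl (mkposreal _ e20)) as [n Hn']. specialize (Hn' n (le_n _)). simpl in Hn'.
      rewrite Rminus_0_r in Hn'. apply Rabs_def2 in Hn'. destruct (Hg n) as [Sg Ag].
      destruct (Ag (e / 10) e20) as (x & Hx & Dx). exists x. split; auto.
      destruct (Sp_sub p _ _ Hp Sg Hh) as [S1 _]. destruct (Sp_sub p _ _ Hp Sg (HE _ Hx)) as [S2 _].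
      destruct (Sp_sub p _ _ Hp S2 S1) as [S3 S4].
      rewrite <- (Sp_norm_ext p (fun z => (g n z - E x z) - (g n z - h z))%C).
      * lra.
      * apply (in_Sp_hol p); auto.
      * intros; ring.
    (* A vanishing combination is the image of a truncated sequence; its norm is 0, so the lower
       bound c1 forces the coefficients to vanish. *)
    + exists (fun n => E (unit_seq n)). split. intros n; apply ME, unit_seq_lp.
      intros n a Ha. assert (Hs : forall z, Cmod z < 1 -> E (trunc a n) z = @sum_n C_AbelianMonoid (fun i => (a i * E (unit_seq i) z)%C) n).
      { intros z Hz. clear Ha. induction n.
        - rewrite sum_O, trunc_0. rewrite (Hlin (a O) (unit_seq 0) (fun _ => RtoC 0)); auto. rewrite E0 by auto. ring.
          apply unit_seq_lp. apply zero_lp.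
        - rewrite sum_Sn, trunc_S. rewrite (Hlin (a (S n)) (unit_seq (S n)) (trunc a n)); auto.
          rewrite IHn. apply Cplus_comm. apply unit_seq_lp. apply trunc_lp; auto. }
      pose proof (trunc_lp p a n Hp) as Htr. destruct (Hn _ Htr) as [Hl _].
      assert (Hz0 : Sp_norm p (E (trunc a n)) <= 0).
      { rewrite (Sp_norm_ext p _ (fun _ => 0%C)). exact ZN. apply (in_Sp_hol p), HE; auto.
        intros z Hz. rewrite Hs by auto. apply Ha. exact Hz. }
      assert (Hl0 : lp_norm p (trunc a n) <= 0).
      { apply Rmult_le_reg_l with c1; auto. lra. }
      intros i Hi. pose proof (lp_norm_eq0 p _ Hp Htr Hl0 i) as Hi0. unfold trunc in Hi0.
      replace (i <=? n)%nat with true in Hi0 by (symmetry; apply Nat.leb_le; auto). exact Hi0.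
  (* The signs of c2 and K are unknown, so both are enlarged. The 25 is 5 * 5, from two uses of the
     weak triangle inequality. *)
  - set (c3 := Rmax c2 1). assert (Hc3 : 1 <= c3) by apply Rmax_r. pose proof (Rmax_l c2 1) as Hc23. fold c3 in Hc23.
    set (K1 := Rmax K 0). assert (HK1 : 0 <= K1) by apply Rmax_r. pose proof (Rmax_l K 0) as HKK. fold K1 in HKK.
    exists (d / (25 * c3)). split. apply Rdiv_lt_0_compat; lra. intros f [Sf Af].
    assert (Hmain : Sp_norm p f <= 25 * c3 / d * Sp_norm p (W phi vphi f)).
    (* D is the total coefficient with which the approximation error g = f - E x enters the final
       estimate. *)
    { apply le_epsilon. intros e He. set (D := 25 * c3 * K1 / d + 5).
      assert (HD : 5 <= D). { unfold D. assert (0 <= 25 * c3 * K1 / d). { apply Rmult_le_pos. apply Rmult_le_pos; lra. left; apply Rinv_0_lt_compat; auto. } lra. }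
      destruct (Af (e / D)) as (x & Hx & Dx). apply Rdiv_lt_0_compat; lra.
      pose proof (HE x Hx) as SE. destruct (Sp_sub p _ _ Hp Sf SE) as [Sg _].
      set (g := fun z => (f z - E x z)%C) in *.
      destruct (Sp_lin p (RtoC 1) (E x) g Hp SE Sg) as [_ B1]. rewrite Cmod_1, Rmult_1_l in B1.
      rewrite (Sp_norm_ext p _ f) in B1.
      2: { intros z Hz. destruct (in_Sp_hol _ _ SE z Hz) as [l1 L1]. destruct (in_Sp_hol _ _ Sg z Hz) as [l2 L2]. eexists. apply Cdiff_plus. apply Cdiff_scal; exact L1. exact L2. }
      2: { intros z Hz. unfold g. ring. }
      destruct (Sp_sub p _ _ Hp (HT _ Sf) (HT _ Sg)) as [SW B2].
      rewrite (Sp_norm_ext p _ (W phi vphi (E x)) (in_Sp_hol _ _ SW)) in B2 by (intros z Hz; unfold W, g; ring).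
      specialize (Hlow x Hx). destruct (Hn x Hx) as [_ Hup]. pose proof (HK g Sg) as HKg.
      assert (Hg0 : 0 <= Sp_norm p g) by (apply (Sp_norm_Mp p g Sg); lra).
      assert (Hl0 : 0 <= lp_norm p x) by apply rpow_ge0.
      assert (HKg1 : K * Sp_norm p g <= K1 * Sp_norm p g) by (apply Rmult_le_compat_r; auto).
      assert (Hup1 : c2 * lp_norm p x <= c3 * lp_norm p x) by (apply Rmult_le_compat_r; auto).
      assert (Hl1 : lp_norm p x <= 5 * (Sp_norm p (W phi vphi f) + K1 * Sp_norm p g) / d).
      { apply Rmult_le_reg_l with d; auto. replace (d * (5 * (Sp_norm p (W phi vphi f) + K1 * Sp_norm p g) / d)) with (5 * (Sp_norm p (W phi vphi f) + K1 * Sp_norm p g)) by (field; lra). lra. }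
      apply (Rmult_le_compat_l c3) in Hl1; [|lra].
      assert (HDg : D * Sp_norm p g <= e).
      { apply Rle_trans with (D * (e / D)). apply Rmult_le_compat_l; lra. right; field; lra. }
      assert (Heq : 5 * (c3 * (5 * (Sp_norm p (W phi vphi f) + K1 * Sp_norm p g) / d)) + 5 * Sp_norm p g =
        25 * c3 / d * Sp_norm p (W phi vphi f) + D * Sp_norm p g) by (unfold D; field; lra).
      lra. }
    apply Rmult_le_reg_l with (25 * c3 / d). apply Rdiv_lt_0_compat; lra.
    replace (25 * c3 / d * (d / (25 * c3) * Sp_norm p f)) with (Sp_norm p f) by (field; lra). exact Hmain.
Qed.

Lemma one_Sp p : 1 <= p -> in_Sp p (fun _ => RtoC 1).
Proof.
  intros Hp. apply in_Sp_iff. split. intros z _. eexists. apply (Cdiff_const (RtoC 1)).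
  exists 0. intros r Hr. rewrite Mp_avg, (avg_ext _ (fun _ => 0)). rewrite avg_const. lra.
  intros t. rewrite (Cdiff_deriv _ _ _ (Cdiff_const (RtoC 1) (circ r t))), Cmod_0, rpow_0. reflexivity.
Qed.

Lemma id_Sp p : 1 <= p -> in_Sp p (fun z => z).
Proof.
  intros Hp. apply in_Sp_iff. split. apply selfmap_id.
  exists 1. intros r Hr. rewrite Mp_avg, (avg_ext _ (fun _ => 1)). rewrite avg_const. lra.
  intros t. rewrite (Cdiff_deriv _ _ _ (Cdiff_id (circ r t))), Cmod_1, rpow_1. reflexivity.
Qed.

(** Test W on the constant 1, which yields phi, and on the identity, whose image has derivative phi'
    vphi + phi vphi'; subtract the first term, using |vphi| < 1. *)
Lemma W_symbol p phi vphi : 1 <= p -> hol 1 phi -> selfmap vphi -> bounded_on_Sp p (W phi vphi) ->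
  in_Sp p phi /\ exists M, forall r, 0 <= r < 1 -> Mp p (fun z => phi z * deriv vphi z)%C r <= M.
Proof.
  intros Hp Hphi Hv [HW _]. pose proof (rpow_2_ge2 p Hp) as H2.
  assert (Sphi : in_Sp p phi).
  { apply (in_Sp_ext p (W phi vphi (fun _ => RtoC 1))). intros; unfold W; ring. apply HW, one_Sp; auto. }
  split; auto. pose proof (HW _ (id_Sp p Hp)) as Sid. apply in_Sp_iff in Sid as [H1 [M1 HM1]].
  apply in_Sp_iff in Sphi as [_ [M2 HM2]]. exists (rpow 2 p * (M1 + M2)). intros r Hr. rewrite Mp_avg.
  specialize (HM1 r Hr). specialize (HM2 r Hr). rewrite Mp_avg in HM1, HM2.
  assert (Hcirc : forall t, Cmod (circ r t) < 1) by (intros; rewrite Cmod_circ, Rabs_pos_eq; lra).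
  assert (C1 : Cts (fun t => rpow (Cmod (deriv (W phi vphi (fun z => z)) (circ r t))) p)) by (apply (Cts_rpow_hol 1); auto; [apply hol_deriv_hol1; auto | lra]).
  assert (C2 : Cts (fun t => rpow (Cmod (deriv phi (circ r t))) p)) by (apply (Cts_rpow_hol 1); auto; [apply hol_deriv_hol1; auto | lra]).
  apply Rle_trans with (avg (fun t => rpow 2 p * (rpow (Cmod (deriv (W phi vphi (fun z => z)) (circ r t))) p + rpow (Cmod (deriv phi (circ r t))) p))).
  - apply avg_le.
    + apply (Cts_rpow_hol 1 (fun z => phi z * deriv vphi z)%C); auto; [|lra].
      intros z Hz. destruct (hol_deriv_hol1 vphi (proj1 Hv) z Hz) as [l Hl]. eexists. apply Cdiff_mult; [apply (hol_deriv 1); auto | exact Hl].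
    + apply Cts_mult. apply Cts_const. apply Cts_plus; auto.
    + intros t. rewrite (Cdiff_deriv _ _ _ (W_diff phi vphi (fun z => z) _ Hphi Hv (proj1 selfmap_id) (Hcirc t))).
      rewrite (Cdiff_deriv _ _ _ (Cdiff_id (vphi (circ r t)))). set (z := circ r t).
      eapply Rle_trans; [|apply rpow_add_le; try apply Cmod_ge_0; lra].
      apply rpow_le. lra. split. apply Cmod_ge_0.
      replace (phi z * deriv vphi z)%C with ((deriv phi z * vphi z + phi z * deriv vphi z * 1) + - (deriv phi z * vphi z))%C at 1 by ring.
      eapply Rle_trans; [apply Cmod_triangle|]. apply Rplus_le_compat_l. rewrite Cmod_opp, Cmod_mult.
      pose proof (proj2 Hv z (Hcirc t)). pose proof (Cmod_ge_0 (deriv phi z)). nra.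
  - rewrite avg_scal, avg_plus by (auto; apply Cts_plus; auto). apply Rmult_le_compat_l; lra.
Qed.

(** The lower bound for the embedding itself needs no separate hump estimate: it follows from the
    lower bound for W on the range and the boundedness of W. *)
Lemma fixes_lp p phi vphi : 1 <= p -> hol 1 phi -> selfmap vphi ->
  bounded_on_Sp p (W phi vphi) -> ~ compact_on_Sp p (W phi vphi) -> fixes_lp_copy p (W phi vphi).
Proof.
  intros Hp Hphi Hv HB HC. destruct (W_symbol p phi vphi Hp Hphi Hv HB) as [Sphi [M1 HM1]].
  assert (HV : ~ vanishing p (fun z => phi z * deriv vphi z)%C vphi).
  { intros HV. apply HC. apply compact_of_vanishing; auto. exists M1; auto. }
  destruct (proj1 (in_Sp_iff _ _) Sphi) as [_ [M2 HM2]]. destruct HB as [HT [K HK]].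
  destruct (test_sequence p phi vphi (Rmax M1 M2) Hp Hphi Hv) as (b & c & eps & Hc & He & Hec & Hb & G1 & G2 & Hlow); auto.
  { intros r Hr. eapply Rle_trans; [apply HM2; auto | apply Rmax_r]. }
  { intros r Hr. eapply Rle_trans; [apply HM1; auto | apply Rmax_l]. }
  { intros a Ha. apply HT, ta_Sp; auto. }
  set (C2 := rpow (rpow 2 p * rpow 2 (2 * p) + 3 * rpow 2 p ^ 2 * eps) (/ p)).
  pose proof (rpow_2_ge2 p Hp) as H2.
  set (D := rpow (2 * rpow 2 p ^ 2 / c) (/ p)).
  assert (HD : 0 < D). { apply rpow_gt0. apply Rdiv_lt_0_compat; auto. apply Rmult_lt_0_compat. lra. apply pow_lt; lra. }
  assert (HE : forall x, in_lp p x -> in_Sp p (embed p b x) /\ Sp_norm p (embed p b x) <= C2 * lp_norm p x).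
  { intros x Hx. apply embed_Sp; auto. lra. }
  assert (HL : forall x, in_lp p x -> lp_norm p x <= D * Sp_norm p (W phi vphi (embed p b x))).
  { intros x Hx. apply (W_embed_lower p phi vphi b c eps x); auto. lra. apply HT, HE; auto. }
  set (K1 := Rmax K 1). assert (HK1 : 1 <= K1) by apply Rmax_r. pose proof (Rmax_l K 1) as HKK. fold K1 in HKK.
  assert (HL' : forall x, in_lp p x -> / D * lp_norm p x <= Sp_norm p (W phi vphi (embed p b x))).
  { intros x Hx. apply Rmult_le_reg_l with D; auto. rewrite <- Rmult_assoc, Rinv_r, Rmult_1_l by lra. auto. }
  exists (embed p b), (/ (D * K1)), C2, (/ D).
  split. { apply Rinv_0_lt_compat, Rmult_lt_0_compat; lra. }
  split. { apply Rinv_0_lt_compat; auto. }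
  split. { intros x Hx; apply HE; auto. }
  split. { intros a x y Hx Hy z Hz. apply (embed_linear p b a x y _ _ z Hb (lp_bounded p x Hp Hx) (lp_bounded p y Hp Hy) Hz). }
  split; auto. intros x Hx. destruct (HE x Hx) as [SE Hup]. split; auto.
  specialize (HL' x Hx). pose proof (HK _ SE) as HKx.
  assert (K * Sp_norm p (embed p b x) <= K1 * Sp_norm p (embed p b x)).
  { apply Rmult_le_compat_r; auto. apply (Sp_norm_Mp p _ SE). lra. }
  apply Rmult_le_reg_l with K1. lra. replace (K1 * (/ (D * K1) * lp_norm p x)) with (/ D * lp_norm p x) by (field; lra). lra.
Qed.

Theorem theorem1 (p : R) (phi vphi : C -> C) :
  1 <= p ->
  analytic_on_D phi ->
  analytic_selfmap vphi ->
  bounded_on_Sp p (W phi vphi) ->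
  ~ compact_on_Sp p (W phi vphi) ->
  fixes_lp_copy p (W phi vphi) /\ ~ strictly_singular_on_Sp p (W phi vphi).
Proof.
  intros Hp Hphi [Hv1 Hv2] HB HC. apply analytic_hol in Hphi. apply analytic_hol in Hv1.
  assert (HF : fixes_lp_copy p (W phi vphi)) by (apply fixes_lp; auto; split; auto).
  split; auto. apply fixes_lp_not_strictly_singular; auto.
Qed.
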